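(* Let $x:M^m\to \mathbb S^{m+p}$ be an umbilic-free immersed submanifold which is Blaschke parallel (its Blaschke tensor $A$ is parallel with respect to the Levi-Civita connection of its Möbius metric $g$) and whose Möbius form $C$ vanishes identically. If $x$ has (exactly) three distinct Blaschke eigenvalues, then $x$ must be Möbius equivalent to one of the following four kinds of immersions: (1) a non-minimal and umbilic-free pseudo-parallel immersion $\tilde x:M^m\to \mathbb S^{m+p}$ with parallel mean curvature and constant scalar curvature, which has three distinct principal curvatures in the direction of the mean curvature vector; (2) the image $\sigma\circ\bar x$ under $\sigma$ of a non-minimal and umbilic-free pseudo-parallel immersion $\bar x:M^m\to \mathbb R^{m+p}$ with parallel mean curvature and constant scalar curvature, which has three distinct principal curvatures in the direction of the mean curvature vector; (3) the image $\tau\circ\bar x$ under $\tau$ of a non-minimal and umbilic-free pseudo-parallel immersion $\bar x:M^m\to \mathbb H^{m+p}$ with parallel mean curvature and constant scalar curvature, which has three distinct principal curvatures in the direction of the mean curvature vector; (4) a submanifold ${\rm LS}(\mathfrak m,\mathfrak p,\mathfrak r,\mu)$ for some multiple parameters $\mathfrak m,\mathfrak p,\mathfrak r,\mu$ satisfying $m_3r_2^2\neq m_2r_3^2$.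
   Context: **Spaces and maps.** $\mathbb S^n(r)\subset\mathbb R^{n+1}$ is the standard sphere of radius $r$, $\mathbb S^n=\mathbb S^n(1)$. $\mathbb R^N_1=\mathbb R\times\mathbb R^{N-1}$ carries $\langle y,y'\rangle_1=-y_0y_0'+y_1\cdot y_1'$. For $c<0$, $\mathbb H^n(c)=\{y=(y_0,y_1)\in\mathbb R^{n+1}_1:\langle y,y\rangle_1=1/c,\ y_0>0\}$, $\mathbb H^n=\mathbb H^n(-1)$. The conformal diffeomorphisms $\sigma:\mathbb R^n\to\mathbb S^n\setminus\{(-1,0)\}$ and $\tau:\mathbb H^n\to\mathbb S^n_+$ (open hemisphere with positive first coordinate) are $\sigma(u)=\left(\frac{1-|u|^2}{1+|u|^2},\frac{2u}{1+|u|^2}\right)$, $\tau(y)=\left(\frac1{y_0},\frac{y_1}{y_0}\right)$. **Möbius invariants.** Let $x:M^m\to\mathbb S^{m+p}$ be an umbilic-free immersion (the traceless part of its second fundamental form $h$ vanishes nowhere), $H=\frac1m{\rm tr}\,h$. Put $\rho=\left(\frac m{m-1}(|h|^2-m|H|^2)\right)^{1/2}$, $Y=\rho(1,x):M\to\mathbb R^{m+p+2}_1$. The Möbius metric is $g=\langle dY,dY\rangle_1=\rho^2dx\cdot dx$. With $\Delta$ the Laplacian of $g$, put $N=-\frac1m\Delta Y-\frac1{2m^2}\langle\Delta Y,\Delta Y\rangle_1Y$. The Möbius normal bundle $V$ is the orthogonal complement of $\mathbb RY\oplus\mathbb RN\oplus Y_*(TM)$ in $M\times\mathbb R^{m+p+2}_1$.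 For a local $g$-orthonormal frame $\{E_i\}_{1\le i\le m}$ with dual $\{\omega^i\}$, $Y_i=Y_*(E_i)$, and a local orthonormal frame $\{E_\alpha\}_{m+1\le\alpha\le m+p}$ of $V$, the Blaschke tensor $A=\sum A_{ij}\omega^i\omega^j$, the Möbius second fundamental form $B=\sum B^\alpha_{ij}\omega^i\omega^jE_\alpha$ and the Möbius form $C=\sum C^\alpha_i\omega^iE_\alpha$ are defined by $dN=\sum A_{ij}\omega^jY_i+\sum C^\alpha_i\omega^iE_\alpha$, $\ dY_i=-\sum A_{ij}\omega^jY-\omega^iN+\sum\omega_i^jY_j+\sum B^\alpha_{ij}\omega^jE_\alpha$, where $\omega_i^j$ are the Levi-Civita connection forms of $g$. The Blaschke eigenvalues are the eigenvalues of $A$ with respect to $g$. Two submanifolds of $\mathbb S^{m+p}$ are Möbius equivalent if they differ by a Möbius (conformal) transformation of $\mathbb S^{m+p}$; equivalently, their vectors $Y,\tilde Y$ satisfy $\tilde Y=T(Y)$ for some Lorentz transformation $T$ of $\mathbb R^{m+p+2}_1$ preserving the positive light cone. **Pseudo-parallel.** A submanifold of a Riemannian manifold is pseudo-parallel if the inner product of its second fundamental form with its mean curvature vector is a parallel symmetric 2-tensor. Parallel mean curvature means the mean curvature vector is parallel in the normal bundle. **The submanifolds ${\rm LS}(\mathfrak m,\mathfrak p,\mathfrak r,\mu)$.** Let $\mathfrak m=(m_1,m_2,m_3)$, $\mathfrak p=(p_1,p_2,p_3)$, $\mathfrak r=(r_1,r_2,r_3)$, $\mu=(\mu_1,\mu_2,\mu_3)$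 with integers $m_a\ge1$, $p_a\ge0$ and reals $r_a>0$, $r_1^2=r_2^2+r_3^2$, $\mu_a\ge0$, $\mu_1+\mu_2+\mu_3=1$. Put $m=m_1+m_2+m_3$, $p=p_1+p_2+p_3+1$. Let $\lambda_1,\lambda_2,\lambda_3$ be the unique solution of $(m+m_1)\lambda_1+m_2\lambda_2+m_3\lambda_3=-\frac{m_1}{r_1^2}$, $\ m_1\lambda_1+(m+m_2)\lambda_2+m_3\lambda_3=\frac{m_2}{r_2^2}$, $\ m_1\lambda_1+m_2\lambda_2+(m+m_3)\lambda_3=\frac{m_3}{r_3^2}$, and let $B^0_1,B^0_2,B^0_3$ be the real numbers (unique up to a common sign) with $m_1B^0_1+m_2B^0_2+m_3B^0_3=0$ and $B^0_aB^0_b=-(\lambda_a+\lambda_b)$ for $a\ne b$. Put $K=m_1(B^0_1)^2+m_2(B^0_2)^2+m_3(B^0_3)^2-\frac{m-1}m$. Let $\tilde y=(\tilde y_0,\tilde y_1):M_1\to\mathbb H^{m_1+p_1}(-1/r_1^2)\subset\mathbb R^{m_1+p_1+1}_1$, $\tilde y_2:M_2\to\mathbb S^{m_2+p_2}(r_2)\subset\mathbb R^{m_2+p_2+1}$, $\tilde y_3:M_3\to\mathbb S^{m_3+p_3}(r_3)\subset\mathbb R^{m_3+p_3+1}$ be minimal immersions of manifolds of dimensions $m_1,m_2,m_3$ with constant scalar curvatures $\tilde S_1=-\frac{m_1(m_1-1)}{r_1^2}+\mu_1K$, $\tilde S_2=\frac{m_2(m_2-1)}{r_2^2}+\mu_2K$,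 $\tilde S_3=\frac{m_3(m_3-1)}{r_3^2}+\mu_3K$, respectively (scalar curvature = trace of Ricci). Then ${\rm LS}(\mathfrak m,\mathfrak p,\mathfrak r,\mu)$ denotes the immersed submanifold $\tilde x=\left(\frac{\tilde y_1}{\tilde y_0},\frac{\tilde y_2}{\tilde y_0},\frac{\tilde y_3}{\tilde y_0}\right):M_1\times M_2\times M_3\to\mathbb S^{m+p}$.
   Formalization: In case (4) the product decomposition of M is only required near each point, with one Möbius transformation and one set of parameters for all of x; globally the claim fails, e.g. for an LS immersion restricted to an open ball that is not a product. *)

(* Defs.v *)
From mathcomp Require Import all_boot all_order all_algebra.
From mathcomp Require Import all_classical all_reals all_analysis.

Set Implicit Arguments.
Unset Strict Implicit.
Unset Printing Implicit Defensive.

Import Order.TTheory GRing.Theory Num.Theory.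
Import numFieldNormedType.Exports.

Local Open Scope classical_set_scope.
Local Open Scope ring_scope.

Section LinearAlgebra.
Variable R : realType.

Definition dot n (u v : 'rV[R]_n) : R := \sum_(i < n) u 0 i * v 0 i.

(* The Lorentz product of R^(1+n)_1; coordinate 0 is the timelike one. *)
Definition lorentz n (u v : 'rV[R]_(1 + n)) : R :=
  - (u 0 0 * v 0 0) + dot (rsubmx u) (rsubmx v).

(* Matrices act on row vectors from the right. *)
Definition lorentz_transformation n (T : 'M[R]_(1 + n)) : Prop :=
  (forall u v : 'rV_(1 + n), lorentz (u *m T) (v *m T) = lorentz u v) /\
  (forall u : 'rV_(1 + n),
     lorentz u u = 0 -> 0 < u 0 0 -> 0 < (u *m T) 0 0).

(* A point y of the unit sphere of R^n spans the light ray of (1, y); T acts on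
   the sphere through its action on light rays. *)
Definition light n (y : 'rV[R]_n) : 'rV[R]_(1 + n) := row_mx 1%:M y.

Definition mobius n (T : 'M[R]_(1 + n)) (y : 'rV[R]_n) : 'rV[R]_n :=
  ((light y *m T) 0 0)^-1 *: rsubmx (light y *m T).

Definition mobius_equivalent (M : Type) n (x x' : M -> 'rV[R]_n) : Prop :=
  exists2 T : 'M[R]_(1 + n), lorentz_transformation T &
    forall q, x' q = mobius T (x q).

Definition sigma n (u : 'rV[R]_n) : 'rV[R]_(1 + n) :=
  (1 + dot u u)^-1 *: row_mx (1 - dot u u)%:M (2 *: u).

Definition tau n (y : 'rV[R]_(1 + n)) : 'rV[R]_(1 + n) :=
  (y 0 0)^-1 *: row_mx 1%:M (rsubmx y).

(* Matrix of the endomorphism that the symmetric bilinear form P corresponds to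
   with respect to the inner product G. *)
Definition endo m (G P : 'M[R]_m) : 'M[R]_m := P *m invmx G.

Definition three_distinct_eigenvalues m (S : 'M[R]_m) : Prop :=
  exists2 s : 3.-tuple R, uniq s & forall t, eigenvalue S t = (t \in s).

End LinearAlgebra.

(* The model space forms.  For sf_curv != 0 the space is a quadric
   <y, y> = 1 / sf_curv of the ambient (pseudo-)Euclidean space; for
   sf_curv = 0 it is the whole Euclidean space. *)
Record space_form (R : realType) (N : nat) := SpaceForm {
  sf_form : 'rV[R]_N -> 'rV[R]_N -> R;
  sf_curv : R;
  sf_pts : set 'rV[R]_N }.

Section Models.
Variable R : realType.

Definition sphere n (r : R) : space_form R n.+1 :=
  SpaceForm (@dot R n.+1) (r ^- 2) [set y | dot y y = r ^+ 2].

Definition euclidean n : space_form R n := SpaceForm (@dot R n) 0 setT.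

Definition hyperbolic n (c : R) : space_form R (1 + n) :=
  SpaceForm (@lorentz R n) c
    [set y : 'rV_(1 + n) | lorentz y y = c^-1 /\ 0 < y 0 0].

End Models.

Section Calculus.
Variables (R : realType) (m : nat).

Definition pd (V : normedModType R) (i : 'I_m) (f : 'rV[R]_m -> V)
    (u : 'rV[R]_m) : V :=
  'D_(delta_mx 0 i) f u.

Fixpoint Ck (k : nat) (U : set 'rV[R]_m) (V : normedModType R)
    (f : 'rV[R]_m -> V) : Prop :=
  (forall u, U u -> {for u, continuous f}) /\
  (if k is k'.+1 then
     (forall u i, U u -> derivable f u (delta_mx 0 i)) /\
     (forall i, Ck k' U (pd i f))
   else True).

Definition smooth_on (U : set 'rV[R]_m) (V : normedModType R)
    (f : 'rV[R]_m -> V) : Prop :=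
  forall k, Ck k U f.

End Calculus.

Section Manifolds.
Variable R : realType.

Record chart (M : topologicalType) (m : nat) := Chart {
  cdom : set M;
  cmap : M -> 'rV[R]_m;
  cinv : 'rV[R]_m -> M }.

Definition cimg (M : topologicalType) m (c : chart M m) : set 'rV[R]_m :=
  cmap c @` cdom c.

Definition is_chart (M : topologicalType) m (c : chart M m) : Prop :=
  [/\ open (cdom c), open (cimg c),
      forall q, cdom c q -> cinv c (cmap c q) = q,
      forall q, cdom c q -> {for q, continuous (cmap c)} &
      forall u, cimg c u -> {for u, continuous (cinv c)}].

(* Smoothness on W of a map between manifolds; W is meant to be open. *)
Definition smooth_map (M M' : topologicalType) m m' (A : set (chart M m))
    (A' : set (chart M' m')) (W : set M) (F : M -> M') : Prop :=
  (forall q, W q -> {for q, continuous F}) /\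
  (forall c c', A c -> A' c' ->
     smooth_on (cmap c @` (cdom c `&` W `&` F @^-1` cdom c'))
       (cmap c' \o F \o cinv c)).

(* A is a smooth atlas of dimension m making M a manifold; manifolds are
   nonempty, connected, Hausdorff and second countable. *)
Definition is_manifold (M : topologicalType) m (A : set (chart M m)) : Prop :=
  [/\ hausdorff_space M, @second_countable M,
      connected [set: M] & [set: M] !=set0] /\
  [/\ forall c, A c -> is_chart c,
      forall q, exists2 c, A c & cdom c q &
      forall c c', A c -> A c' ->
        smooth_on (cmap c @` (cdom c `&` cdom c')) (cmap c' \o cinv c)].

Definition prod_chart (M1 M2 : topologicalType) m1 m2
    (c1 : chart M1 m1) (c2 : chart M2 m2) : chart (M1 * M2)%type (m1 + m2) :=
  Chart (cdom c1 `*` cdom c2)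
    (fun q => row_mx (cmap c1 q.1) (cmap c2 q.2))
    (fun u => (cinv c1 (lsubmx u), cinv c2 (rsubmx u))).

Definition prod_atlas (M1 M2 : topologicalType) m1 m2
    (A1 : set (chart M1 m1)) (A2 : set (chart M2 m2)) :
    set (chart (M1 * M2)%type (m1 + m2)) :=
  [set c | exists c1 c2, [/\ A1 c1, A2 c2 & c = prod_chart c1 c2]].

(* F is a diffeomorphism of M onto an open subset of M'. *)
Definition open_embedding (M M' : topologicalType) m m' (A : set (chart M m))
    (A' : set (chart M' m')) (F : M -> M') : Prop :=
  open (range F) /\
  exists G : M' -> M,
    [/\ cancel F G, smooth_map A A' setT F & smooth_map A' A (range F) G].

End Manifolds.

Section IntrinsicGeometry.
Variables (R : realType) (m : nat).
Implicit Types (G P : 'rV[R]_m -> 'M[R]_m) (u : 'rV[R]_m).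

(* christoffel G k i j u is Gamma^k_ij for the metric G = (G_ij). *)
Definition christoffel G (k i j : 'I_m) u : R :=
  2^-1 * \sum_l (invmx (G u)) k l *
    (pd i (fun v => G v j l) u + pd j (fun v => G v i l) u
     - pd l (fun v => G v i j) u).

(* (nabla_k P)_ij for a covariant 2-tensor P. *)
Definition cov_deriv G P (k i j : 'I_m) u : R :=
  pd k (fun v => P v i j) u
  - \sum_l christoffel G l k i u * P u l j
  - \sum_l christoffel G l k j u * P u i l.

(* The curvature component R^l_kij, in the convention
   R(d_i, d_j) d_k = sum_l R^l_kij d_l. *)
Definition curvature G (l k i j : 'I_m) u : R :=
  pd i (christoffel G l j k) u - pd j (christoffel G l i k) u
  + \sum_s (christoffel G l i s u * christoffel G s j k u
            - christoffel G l j s u * christoffel G s i k u).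

Definition ricci G (j k : 'I_m) u : R := \sum_i curvature G i k i j u.

Definition scalar_curvature G u : R :=
  \sum_j \sum_k (invmx (G u)) j k * ricci G j k u.

Definition laplacian N G (f : 'rV[R]_m -> 'rV[R]_N) u : 'rV[R]_N :=
  \sum_i \sum_j (invmx (G u)) i j *:
    (pd i (pd j f) u - \sum_k christoffel G k i j u *: pd k f u).

End IntrinsicGeometry.

(* Here f is a local parametrisation u |-> f u of a submanifold. *)
Section LocalImmersions.
Variables (R : realType) (m N : nat).
Implicit Types (f : 'rV[R]_m -> 'rV[R]_N) (u : 'rV[R]_m).

Definition induced_metric (b : 'rV[R]_N -> 'rV[R]_N -> R) f u : 'M[R]_m :=
  \matrix_(i, j) b (pd i f u) (pd j f u).

Variable Q : space_form R N.
Local Notation b := (sf_form Q).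
Local Notation G f := (induced_metric b f).

(* Orthogonal projection of the ambient space onto T_(f u) Q. *)
Definition space_proj f u (v : 'rV[R]_N) : 'rV[R]_N :=
  v - (sf_curv Q * b v (f u)) *: f u.

(* Orthogonal projection onto the normal space of the submanifold in Q. *)
Definition normal_proj f u (v : 'rV[R]_N) : 'rV[R]_N :=
  space_proj f u v
  - \sum_i \sum_j ((invmx (G f u)) i j * b v (pd i f u)) *: pd j f u.

(* The flat derivative of d_j f along d_i, projected onto T Q, is the
   Levi-Civita derivative in Q; its normal part is h(d_i, d_j). *)
Definition sff f (i j : 'I_m) u : 'rV[R]_N :=
  normal_proj f u (pd i (pd j f) u).

Definition mean_curvature f u : 'rV[R]_N :=
  m%:R^-1 *: \sum_i \sum_j (invmx (G f u)) i j *: sff f i j u.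

Definition sff_sqnorm f u : R :=
  \sum_i \sum_j \sum_k \sum_l
    (invmx (G f u)) i k * (invmx (G f u)) j l * b (sff f i j u) (sff f k l u).

(* <h, xi> for a normal vector xi. *)
Definition sff_along f (xi : 'rV[R]_N) u : 'M[R]_m :=
  \matrix_(i, j) b (sff f i j u) xi.

Definition unit_mean_curvature f u : 'rV[R]_N :=
  (Num.sqrt (b (mean_curvature f u) (mean_curvature f u)))^-1
    *: mean_curvature f u.

End LocalImmersions.

(* Moebius invariants of f, parametrising a submanifold of the unit sphere. *)
Section LocalMobius.
Variables (R : realType) (m n : nat).
Implicit Types (f : 'rV[R]_m -> 'rV[R]_n.+1) (u : 'rV[R]_m).

Definition rho f u : R :=
  let Q := sphere n 1 in let H := mean_curvature Q f u in
  Num.sqrt (m%:R / (m%:R - 1) *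
    (sff_sqnorm Q f u - m%:R * dot H H)).

Definition mobius_position f u : 'rV[R]_(1 + n.+1) :=
  rho f u *: light (f u).

Definition mobius_metric f : 'rV[R]_m -> 'M[R]_m :=
  induced_metric (@lorentz R n.+1) (mobius_position f).

Definition mobius_N f u : 'rV[R]_(1 + n.+1) :=
  let L := laplacian (mobius_metric f) (mobius_position f) u in
  - (m%:R^-1 *: L)
  - ((2 * m%:R ^+ 2)^-1 * lorentz L L) *: mobius_position f u.

(* The components A_ij and C(d_i) of
   dN = sum A_ij omega^j Y_i + sum C^alpha_i omega^i E_alpha
   in a coordinate frame; A is read off by pairing with Y_*, since
   V is orthogonal to Y_*(TM). *)
Definition blaschke_tensor f u : 'M[R]_m :=
  \matrix_(i, j) lorentz (pd i (mobius_N f) u) (pd j (mobius_position f) u).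

Definition mobius_form f (i : 'I_m) u : 'rV[R]_(1 + n.+1) :=
  pd i (mobius_N f) u
  - \sum_j \sum_k (blaschke_tensor f u i j * (invmx (mobius_metric f u)) j k)
      *: pd k (mobius_position f) u.

End LocalMobius.

(* Submanifolds x : M -> Q, through the local parametrisations x \o cinv c. *)
Section Submanifolds.
Variables (R : realType) (m N : nat) (M : topologicalType).
Variables (A : set (chart R M m)) (Q : space_form R N) (x : M -> 'rV[R]_N).

Definition at_charts (P : ('rV[R]_m -> 'rV[R]_N) -> 'rV[R]_m -> Prop) : Prop :=
  forall c, A c -> forall u, cimg c u -> P (x \o cinv c) u.

Definition immersion : Prop :=
  [/\ forall q, sf_pts Q (x q),
      forall c, A c -> smooth_on (cimg c) (x \o cinv c) &
      at_charts (fun f u => row_free (\matrix_(i < m) pd i f u))].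

Definition minimal : Prop := at_charts (fun f u => mean_curvature Q f u = 0).

Definition umbilic_free : Prop :=
  at_charts (fun f u => exists i j,
    sff Q f i j u <> induced_metric (sf_form Q) f u i j *: mean_curvature Q f u).

Definition pseudo_parallel : Prop :=
  at_charts (fun f u => forall k i j,
    cov_deriv (induced_metric (sf_form Q) f)
      (fun v => sff_along Q f (mean_curvature Q f v) v) k i j u = 0).

Definition parallel_mean_curvature : Prop :=
  at_charts (fun f u => forall k,
    normal_proj Q f u (pd k (mean_curvature Q f) u) = 0).

Definition scalar_curvature_eq (s : R) : Prop :=
  at_charts (fun f u => scalar_curvature (induced_metric (sf_form Q) f) u = s).

Definition three_principal_curvatures_along_H : Prop :=
  at_charts (fun f u => three_distinct_eigenvalues
    (endo (induced_metric (sf_form Q) f u)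
          (sff_along Q f (unit_mean_curvature Q f u) u))).

Definition special_pseudo_parallel : Prop :=
  [/\ immersion, ~ minimal, umbilic_free & pseudo_parallel] /\
  [/\ parallel_mean_curvature, exists s, scalar_curvature_eq s &
      three_principal_curvatures_along_H].

End Submanifolds.

Section MobiusSubmanifolds.
Variables (R : realType) (m n : nat) (M : topologicalType).
Variables (A : set (chart R M m)) (x : M -> 'rV[R]_n.+1).

Definition blaschke_parallel : Prop :=
  at_charts A x (fun f u => forall k i j,
    cov_deriv (mobius_metric f) (blaschke_tensor f) k i j u = 0).

Definition mobius_form_vanishes : Prop :=
  at_charts A x (fun f u => forall i, mobius_form f i u = 0).

Definition three_blaschke_eigenvalues : Prop :=
  at_charts A x (fun f u => three_distinct_eigenvalues
    (endo (mobius_metric f u) (blaschke_tensor f u))).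

End MobiusSubmanifolds.

Section LS.
Variable R : realType.

(* K is the constant attached to the multiple parameters m_a, r_a. *)
Definition LS_constant (m1 m2 m3 : nat) (r1 r2 r3 K : R) : Prop :=
  let m : R := (m1 + m2 + m3)%:R in
  exists l1 l2 l3 B1 B2 B3 : R,
    [/\ (m + m1%:R) * l1 + m2%:R * l2 + m3%:R * l3 = - (m1%:R / r1 ^+ 2),
        m1%:R * l1 + (m + m2%:R) * l2 + m3%:R * l3 = m2%:R / r2 ^+ 2 &
        m1%:R * l1 + m2%:R * l2 + (m + m3%:R) * l3 = m3%:R / r3 ^+ 2] /\
    [/\ m1%:R * B1 + m2%:R * B2 + m3%:R * B3 = 0,
        B1 * B2 = - (l1 + l2), B1 * B3 = - (l1 + l3), B2 * B3 = - (l2 + l3) &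
        K = m1%:R * B1 ^+ 2 + m2%:R * B2 ^+ 2 + m3%:R * B3 ^+ 2
            - (m - 1) / m].

Definition LS_parameters (m1 m2 m3 : nat) (r1 r2 r3 mu1 mu2 mu3 : R) : Prop :=
  [/\ (0 < m1)%N, (0 < m2)%N & (0 < m3)%N] /\
  [/\ 0 < r1, 0 < r2, 0 < r3 & r1 ^+ 2 = r2 ^+ 2 + r3 ^+ 2] /\
  [/\ 0 <= mu1, 0 <= mu2, 0 <= mu3 & mu1 + mu2 + mu3 = 1].

Definition minimal_csc m N (Q : space_form R N) (M : topologicalType)
    (A : set (chart R M m)) (y : M -> 'rV[R]_N) (s : R) : Prop :=
  [/\ is_manifold A, immersion A Q y, minimal A Q y &
      scalar_curvature_eq A Q y s].

(* y1, y2, y3 are factors from which LS(m, p, r, mu) is built. *)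
Definition LS_factors (m1 m2 m3 p1 p2 p3 : nat) (r1 r2 r3 mu1 mu2 mu3 : R)
    (M1 M2 M3 : topologicalType) (A1 : set (chart R M1 m1))
    (A2 : set (chart R M2 m2)) (A3 : set (chart R M3 m3))
    (y1 : M1 -> 'rV[R]_(1 + (m1 + p1))) (y2 : M2 -> 'rV[R]_(m2 + p2).+1)
    (y3 : M3 -> 'rV[R]_(m3 + p3).+1) : Prop :=
  exists2 K : R, LS_constant m1 m2 m3 r1 r2 r3 K &
  [/\ minimal_csc (hyperbolic (m1 + p1) (- r1 ^- 2)) A1 y1
        (- (m1%:R * (m1%:R - 1) / r1 ^+ 2) + mu1 * K),
      minimal_csc (sphere (m2 + p2) r2) A2 y2
        (m2%:R * (m2%:R - 1) / r2 ^+ 2 + mu2 * K) &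
      minimal_csc (sphere (m3 + p3) r3) A3 y3
        (m3%:R * (m3%:R - 1) / r3 ^+ 2 + mu3 * K)].

(* The dimension of the codomain is the n of e, so that it can be made
   syntactically that of the sphere under consideration. *)
Definition LS_map (n1 n2 n3 n : nat) (e : (n1 + n2 + n3)%N = n)
    (M1 M2 M3 : Type) (y1 : M1 -> 'rV[R]_(1 + n1)) (y2 : M2 -> 'rV[R]_n2)
    (y3 : M3 -> 'rV[R]_n3) (z : M1 * M2 * M3) : 'rV[R]_n :=
  castmx (erefl, e)
    ((y1 z.1.1 0 0)^-1 *:
       row_mx (row_mx (rsubmx (y1 z.1.1)) (y2 z.1.2)) (y3 z.2)).

(* x is Moebius equivalent to LS(m, p, r, mu): one Moebius transformation T
   carries x onto it, the product decomposition M1 x M2 x M3 being that of a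
   neighbourhood W = range F of each point of M.  A decomposition of the whole
   of M cannot be required: restricting x to a non-product open set keeps all
   its Moebius invariants. *)
Definition mobius_equivalent_to_LS (m n : nat) (M : topologicalType)
    (A : set (chart R M m)) (x : M -> 'rV[R]_n)
    (m1 m2 m3 p1 p2 p3 : nat) (r1 r2 r3 mu1 mu2 mu3 : R) : Prop :=
  exists e : ((m1 + p1) + (m2 + p2).+1 + (m3 + p3).+1)%N = n,
  exists2 T : 'M[R]_(1 + n), lorentz_transformation T &
  forall q : M,
  exists (M1 M2 M3 : topologicalType) (A1 : set (chart R M1 m1))
    (A2 : set (chart R M2 m2)) (A3 : set (chart R M3 m3))
    (y1 : M1 -> 'rV[R]_(1 + (m1 + p1))) (y2 : M2 -> 'rV[R]_(m2 + p2).+1)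
    (y3 : M3 -> 'rV[R]_(m3 + p3).+1) (F : M1 * M2 * M3 -> M),
    [/\ LS_factors r1 r2 r3 mu1 mu2 mu3 A1 A2 A3 y1 y2 y3,
        open_embedding (prod_atlas (prod_atlas A1 A2) A3) A F,
        range F q &
        forall z, LS_map e y1 y2 y3 z = mobius T (x (F z))].

End LS.

(* Main.v *)
(* The proof is carried out in the Lorentz space of the position vector Y.
   Since C = 0, the Gauss-Weingarten equations give dN = A dY, and since A is
   parallel its eigenvalues l_a are constants.  For a parallel endomorphism P
   commuting with the second derivatives of Y, the P-trace of Hess Y has
   differential determined by P alone; applied to the spectral projections P_a
   (of rank m_a) of A, this produces vectors v_a with <v_a, Y> = 1,
   dv_a = k_a P_a dY, <v_a, v_b> = k_a delta_ab and k_a = (m l_a + tr A) / m_a.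
   If some k_a vanishes, v_a is constant; if sum 1/k_a <> 0, the vector
   Y - sum v_a/k_a is a nonzero constant.  Either way there is a constant c with
   <c, Y> = 1, and projecting along c exhibits x as the image of a submanifold
   of a space form, the sign of <c, c> selecting the sphere, R^n or H^n.
   Otherwise Y = sum v_a/k_a, where the factors y_a = v_a/k_a depend on the a-th
   block of suitable local coordinates only, are minimal in quadrics of
   curvature k_a, and have constant scalar curvature because the partial norms of
   Hess Y are constant.  The y_a of distant points are still orthogonal: <v_a, c>
   is an eigenfunction of the Laplacian, so unique continuation (by a Carleman
   estimate, with integrals replaced by limits of Riemann sums) propagates the
   local orthogonality.  Hence one Lorentz transformation splits the ambient
   space into the three spans, which gives LS(m, p, r, mu). *)
Require Import Defs.
From mathcomp Require Import all_boot all_order all_algebra.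
From mathcomp Require Import all_classical all_reals all_analysis.
From HB Require Import structures.
From mathcomp Require Import complex.
From mathcomp Require Import ring lra zify.

Set Implicit Arguments.
Unset Strict Implicit.
Unset Printing Implicit Defensive.

Import Order.TTheory GRing.Theory Num.Theory.
Import numFieldNormedType.Exports.

Local Open Scope classical_set_scope.
Local Open Scope ring_scope.

(* The [v_a] exist because of a cancellation: when the P-trace of Hess Y is differentiated,
   commuting derivatives produces two curvature traces, and they agree since a parallel endomorphism
   commutes with the curvature. The [v_a] are mutually orthogonal, and a Lorentz space has no two
   orthogonal timelike vectors; so when the inverses of the [k_a] add up to zero exactly one [k_a]
   is negative. That vanishing sum is $r_1^2=r_2^2+r_3^2$, and $m_3r_2^2\neq m_2r_3^2$ expresses
   that two eigenvalues differ. The weights $\mu_a$ measure the norm of Hess Y in a block. A vector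
   orthogonal to the null vector Y is never timelike, which bounds that norm below by $m_ak_a$; this
   is why $\mu_a\ge 0$ can be arranged. Each partial norm depends on its own block of coordinates
   only, while the total is fixed by the normalisation of Y; hence each is constant. The product
   coordinates are local and the data merely smooth, so a single Lorentz transformation for all of M
   has to be won by continuation along M, and the continuation principle must hold for smooth
   coefficients. *)
Tactic Notation "eqbig" ident(i) := apply: eq_bigr => i _.
Local Notation Coo := smooth_on.

(** * Smooth functions on open sets of R^m: closure properties and differentiation rules *)

Lemma derive_lineE (R : numFieldType) (V W : normedModType R) (f : V -> W) x v :
  'D_v f x = 'D_1 (fun h : R => f (h *: v + x)) 0.
rewrite /derive; set g1 := fun h => h^-1 *: _; set g2 := fun h => h^-1 *: _.
suff -> : g1 = g2 by [].
by rewrite funeqE /g1 /g2 => h /=; rewrite addr0 scale0r add0r [_%:A]mulr1.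
Qed.

Section SmoothClosure.
Variables (R : realType) (m : nat) (U : set 'rV[R]_m).
Hypothesis oU : open U.

Lemma open_near (W : Type) (f g : 'rV[R]_m -> W) u : U u ->
  (forall v, U v -> f v = g v) -> {near nbhs u, f =1 g}.
by move=> Uu fg; near=> v; apply: fg; near: v; exact: open_nbhs_nbhs.
Unshelve. all: by end_near. Qed.

Section Normed.
Variable V : normedModType R.
Implicit Types f g : 'rV[R]_m -> V.

Lemma pd_ext f g i u : (forall v, U v -> f v = g v) -> U u ->
  pd i f u = pd i g u.
by move=> fg Uu; apply: near_eq_derive; exact: open_near. Qed.

(** Functions are total and smoothness is a condition at the points of [U]; since [U] is open,
    equality on [U] is equality near each of its points. Later computations replace functions freely
    on this ground. *)
Lemma Ck_ext k f g : (forall v, U v -> f v = g v) -> Ck k U f -> Ck k U g.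
have cf f' g' : (forall v, U v -> f' v = g' v) ->
    (forall u, U u -> {for u, continuous f'}) ->
    forall u, U u -> {for u, continuous g'}.
  move=> fg fc u Uu; have fgn := open_near Uu fg.
  move: (fc u Uu); rewrite /prop_for /continuous_at (fg _ Uu) => fcu.
  by apply: cvg_trans fcu; exact: (@near_eq_cvg _ _ (nbhs u) _ f' g' fgn).
elim: k f g => [|k IH] f g fg /= [fc].
  by move=> _; split=> //; exact: cf fg fc.
move=> [df dkf]; split; first exact: cf fg fc.
split=> [u i Uu|i].
  by apply: near_eq_derivable (df u i Uu); exact: (open_near Uu fg).
by apply: IH (dkf i) => v Uv; exact: (pd_ext i fg Uv).
Qed.

Lemma sm_ext f g : (forall v, U v -> f v = g v) ->
  Coo U f -> Coo U g.
by move=> fg sf k; apply: Ck_ext fg _. Qed.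

Lemma sm_cont f u : Coo U f -> U u -> {for u, continuous f}.
by move=> /(_ 0%N) [+ _]; apply. Qed.

Lemma sm_der f u i : Coo U f -> U u ->
  derivable f u (delta_mx 0 i).
by move=> /(_ 1%N) [_ [+ _]] Uu; apply. Qed.

Lemma sm_pd f i : Coo U f -> Coo U (pd i f).
by move=> sf k; have [_ [_ ]] := sf k.+1; apply. Qed.

Lemma sm_cst (c : V) : Coo U (fun=> c).
move=> k; elim: k c => [|k IH] c /=; (split; first by move=> u _; exact: cst_continuous).
  by [].
split=> [u i Uu|i]; first exact: derivable_cst.
apply: (@Ck_ext _ (fun=> 0)) (IH 0) => v Uv.
by rewrite /pd (_ : (fun=> c) = cst c)// derive_cst.
Qed.

Lemma pd_cst (c : V) i (u : 'rV[R]_m) : pd i (fun=> c) u = 0.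
by rewrite /pd (_ : (fun=> c) = cst c)// derive_cst. Qed.

Lemma pdD f g i u : U u -> Coo U f -> Coo U g ->
  pd i (fun v => f v + g v) u = pd i f u + pd i g u.
move=> Uu sf sg; rewrite /pd (_ : (fun v => f v + g v) = f + g)//.
by rewrite deriveD//; exact: sm_der.
Qed.

Lemma pdN f i u : U u -> Coo U f ->
  pd i (fun v => - f v) u = - pd i f u.
move=> Uu sf; rewrite /pd (_ : (fun v => - f v) = - f)//.
by rewrite deriveN//; exact: sm_der.
Qed.

Lemma CkD k f g : Ck k U f -> Ck k U g -> Ck k U (fun v => f v + g v).
elim: k f g => [|k IH] f g /= [fc fk] [gc gk].
  by split=> // u Uu; apply: continuousD; [exact: fc|exact: gc].
case: fk gk => [fd fk] [gd gk]; split; first by move=> u Uu; apply: continuousD; [exact: fc|exact: gc].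
split=> [u i Uu|i]; first by apply: derivableD; [exact: fd|exact: gd].
apply: (Ck_ext _ (IH _ _ (fk i) (gk i))) => v Uv.
by rewrite /pd (_ : (fun v => f v + g v) = f + g)// deriveD//; [exact: fd|exact: gd].
Qed.

Lemma smoothD f g : Coo U f -> Coo U g ->
  Coo U (fun v => f v + g v).
by move=> sf sg k; apply: CkD. Qed.

Lemma CkN k f : Ck k U f -> Ck k U (fun v => - f v).
elim: k f => [|k IH] f /= [fc fk].
  by split=> // u Uu; apply: continuousN; exact: fc.
case: fk => [fd fk]; split; first by move=> u Uu; apply: continuousN; exact: fc.
split=> [u i Uu|i]; first by apply: derivableN; exact: fd.
apply: (Ck_ext _ (IH _ (fk i))) => v Uv.
by rewrite /pd (_ : (fun v => - f v) = - f)// deriveN//; exact: fd.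
Qed.

Lemma smoothN f : Coo U f -> Coo U (fun v => - f v).
by move=> sf k; apply: CkN. Qed.

Lemma smoothB f g : Coo U f -> Coo U g ->
  Coo U (fun v => f v - g v).
by move=> sf sg; apply: smoothD => //; apply: smoothN. Qed.

Lemma pdB f g i u : U u -> Coo U f -> Coo U g ->
  pd i (fun v => f v - g v) u = pd i f u - pd i g u.
by move=> Uu sf sg; rewrite pdD//; [rewrite pdN|exact: smoothN].
Qed.

Lemma sm_sum (I : Type) (r : seq I) (P : pred I) (F : I -> 'rV[R]_m -> V) :
  (forall i, Coo U (F i)) ->
  Coo U (fun v => \sum_(i <- r | P i) F i v).
move=> sF; elim: r => [|a r IH].
  by apply: (sm_ext _ (@sm_cst 0)) => v _; rewrite big_nil.
case Pa: (P a); last by apply: (sm_ext _ IH) => v _; rewrite big_cons Pa.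
apply: (sm_ext _ (smoothD (sF a) IH)) => v _; by rewrite big_cons Pa.
Qed.

Lemma pd_sum (I : Type) (r : seq I) (P : pred I) (F : I -> 'rV[R]_m -> V) j u :
  U u -> (forall i, Coo U (F i)) ->
  pd j (fun v => \sum_(i <- r | P i) F i v) u = \sum_(i <- r | P i) pd j (F i) u.
move=> Uu sF; elim: r => [|a r IH].
  rewrite big_nil; transitivity (pd j (fun _ : 'rV[R]_m => 0 : V) u); last exact: pd_cst.
  by apply: pd_ext Uu => v _; rewrite big_nil.
rewrite big_cons; case Pa: (P a).
  rewrite -IH -pdD//; last exact: sm_sum.
  by apply: pd_ext Uu => v _; rewrite big_cons Pa.
by rewrite -IH; apply: pd_ext Uu => v _; rewrite big_cons Pa.
Qed.

End Normed.

Section Scalar.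
Implicit Types f g : 'rV[R]_m -> R.

Lemma pdM f g i u : U u -> Coo U f -> Coo U g ->
  pd i (fun v => f v * g v) u = pd i f u * g u + f u * pd i g u.
move=> Uu sf sg; rewrite /pd (_ : (fun v => f v * g v) = f * g)//.
rewrite deriveM; try exact: sm_der.
by rewrite addrC; congr (_ + _); rewrite -[LHS]mulrC.
Qed.

Lemma CkW k (V : normedModType R) (f : 'rV[R]_m -> V) : Ck k.+1 U f -> Ck k U f.
by elim: k f => [|k IH] f /= [fc [fd fk]]; split=> //; split=> // i; apply: IH; apply: fk.
Qed.

Lemma CkM k f g : Ck k U f -> Ck k U g -> Ck k U (fun v => f v * g v).
elim: k f g => [|k IH] f g.
  by move=> /= [fc fk] [gc gk]; split=> // u Uu; apply: continuousM; [exact: fc|exact: gc].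
move=> Hf Hg; have [/= fc [fd fk]] := Hf; have [/= gc [gd gk]] := Hg; split.
  by move=> u Uu; apply: continuousM; [exact: fc|exact: gc].
split=> [u i Uu|i]; first by apply: derivableM; [exact: fd|exact: gd].
apply: (Ck_ext _ (CkD (IH _ _ (fk i) (CkW Hg)) (IH _ _ (CkW Hf) (gk i)))) => v Uv.
rewrite /pd (_ : (fun v => f v * g v) = f * g)// deriveM; [|exact: fd|exact: gd].
by rewrite addrC; congr (_ + _); rewrite -[RHS]mulrC.
Qed.

Lemma smoothM f g : Coo U f -> Coo U g ->
  Coo U (fun v => f v * g v).
by move=> sf sg k; apply: CkM. Qed.

Lemma pdV f i u : U u -> Coo U f -> f u != 0 ->
  pd i (fun v => (f v)^-1) u = - (f u) ^- 2 * pd i f u.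
by move=> Uu sf fu; rewrite /pd deriveV//; exact: sm_der. Qed.

Lemma smoothV f : Coo U f -> (forall u, U u -> f u != 0) ->
  Coo U (fun v => (f v)^-1).
move=> sf f0 k; elim: k => [|k IH] /=.
  by split=> // u Uu; apply: continuousV; [exact: f0|exact: sm_cont].
split; first by move=> u Uu; apply: continuousV; [exact: f0|exact: sm_cont].
split=> [u i Uu|i]; first by apply: (@derivableV _ _ f); [exact: f0|exact: sm_der].
apply: (Ck_ext _ (CkN (CkM (CkM IH IH) (sm_pd i sf k)))) => v Uv.
by rewrite pdV// ?f0// mulNr expr2 invfM.
Qed.

Lemma is_pd_comp1 (g : R -> R) (d : R) f i u : Coo U f -> U u ->
  is_derive (f u) 1 g d ->
  is_derive u (delta_mx 0 i) (fun v => g (f v)) (d * pd i f u).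
move=> sf Uu dg.
set v : 'rV[R]_m := delta_mx 0 i.
pose h t := f (t *: v + u).
have dh : derivable h 0 1.
  by apply: (iffLR (derivable1P _ _ _)); exact: sm_der.
have hd : is_derive (0 : R) 1 (fun t : R => g (h t)) ((d * pd i f u) : R^o).
  have h0 : h 0 = f u by rewrite /h scale0r add0r.
  have dd : 'D_1 h 0 = pd i f u by rewrite /pd [RHS]derive_lineE.
  have H1 : is_derive (0 : R) 1 h (pd i f u) by apply: DeriveDef.
  have H2 : is_derive (h 0) 1 g d by rewrite h0.
  rewrite -[fun t => _]/(g \o h); exact: (is_derive1_comp H2 H1).
have [hd1 hd2] := hd.
split; first by apply/derivable1P.
by rewrite [LHS]derive_lineE -hd2.
Qed.

(** The induction on the order treats all members of the family at once, because the derivative of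
    one member is a combination of two others. The exponential and the family [expbump] are closed
    in this sense. *)
Lemma sm_comp1 (G : nat -> R -> R) f :
  (forall n, exists (a b : R) (n1 n2 : nat), forall x : R,
     is_derive x 1 (G n) (a * G n1 x + b * G n2 x)) ->
  Coo U f -> forall n, Coo U (fun v => G n (f v)).
move=> dG sf.
have cG n u : U u -> {for u, continuous (fun v => G n (f v))}.
  have [a [b [n1 [n2 dGn]]]] := dG n.
  move=> Uu; apply: (@continuous_comp _ _ _ f (G n)).
    exact: sm_cont.
  by apply/differentiable_continuous/derivable1_diffP; case: (dGn (f u)).
move=> n k; elim: k n => [|k IH] n; first by split=> // u; exact: cG.
split; first by move=> u; exact: cG.
have [a [b [n1 [n2 dGn]]]] := dG n.
split=> [u i Uu|i]; first by case: (is_pd_comp1 i sf Uu (dGn (f u))).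
have H c l : Ck k U (fun v => c * G l (f v)).
  by apply: CkM; [exact: sm_cst|exact: IH].
have H2 := CkM (CkD (H a n1) (H b n2)) (sm_pd i sf k).
apply: (Ck_ext _ H2) => v Uv; rewrite [RHS]/pd.
by have [_ ->] := is_pd_comp1 i sf Uv (dGn (f v)).
Qed.

Lemma sm_expR f : Coo U f -> Coo U (fun v => expR (f v)).
move=> sf; apply: (@sm_comp1 (fun=> expR) f _ sf 0%N) => n.
exists 1, 0, 0%N, 0%N => x; rewrite mul1r mul0r addr0; exact: is_derive_expR.
Qed.

Lemma pd_expR f i u : Coo U f -> U u ->
  pd i (fun v => expR (f v)) u = expR (f u) * pd i f u.
by move=> sf Uu; have [_] := is_pd_comp1 i sf Uu (is_derive_expR (f u)).
Qed.

Lemma sm_sqrt f : Coo U f -> (forall u, U u -> 0 < f u) ->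
  Coo U (fun v => Num.sqrt (f v)).
move=> sf f0.
have cs u : U u -> {for u, continuous (fun v => Num.sqrt (f v))}.
  move=> Uu; apply: (@continuous_comp _ _ _ f Num.sqrt); first exact: sm_cont.
  exact: sqrt_continuous.
elim => [|k IH] /=; first by split=> // u Uu; exact: cs.
split; first by move=> u Uu; exact: cs.
split=> [u i Uu|i]; first by case: (is_pd_comp1 i sf Uu (is_derive1_sqrt (f0 _ Uu))).
(* The derivative $1/(2\sqrt f)$ is written $\sqrt f/(2f)$, so that the induction hypothesis on the
   root itself applies. *)
have H : Ck k U (fun v => Num.sqrt (f v) * (2 * f v)^-1 * pd i f v).
  apply: CkM; last exact: (sm_pd i sf k).
  apply: CkM => //; apply: smoothV.
    by apply: smoothM => //; exact: sm_cst.
  by move=> u Uu; rewrite mulf_neq0// ?pnatr_eq0// gt_eqF// f0.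
apply: (Ck_ext _ H) => v Uv; rewrite [RHS]/pd; have [_ ->] := is_pd_comp1 i sf Uv (is_derive1_sqrt (f0 _ Uv)).
congr (_ * _); have s0 : 0 < Num.sqrt (f v) by rewrite sqrtr_gt0 f0.
rewrite -{2}(sqr_sqrtr (ltW (f0 _ Uv))); field.
by rewrite gt_eqF.
Qed.

Lemma smoothX f n : Coo U f -> Coo U (fun v => f v ^+ n).
move=> sf; elim: n => [|n IH].
  by apply: (sm_ext _ (@sm_cst _ (1 : R))) => v _; rewrite expr0.
by apply: (sm_ext _ (smoothM sf IH)) => v _; rewrite exprS.
Qed.

Lemma sm_prod (I : Type) (r : seq I) (P : pred I) (F : I -> 'rV[R]_m -> R) :
  (forall i, Coo U (F i)) ->
  Coo U (fun v => \prod_(i <- r | P i) F i v).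
move=> sF; elim: r => [|a r IH].
  by apply: (sm_ext _ (@sm_cst _ (1 : R))) => v _; rewrite big_nil.
case Pa: (P a); last by apply: (sm_ext _ IH) => v _; rewrite big_cons Pa.
apply: (sm_ext _ (smoothM (sF a) IH)) => v _; by rewrite big_cons Pa.
Qed.

End Scalar.
End SmoothClosure.

Arguments pd_ext {R m U} oU {V f g i u}.
Arguments pdD {R m U V f g i u}.
Arguments pdN {R m U V f i u}.
Arguments pdB {R m U} oU {V f g i u}.
Arguments pdM {R m U f g i u}.
Arguments pd_expR {R m U f i u}.
Arguments pdV {R m U f i u}.
Arguments pd_sum {R m U} oU {V I r P F j u}.

(** * The mean value theorem along lines *)

Section Lines.
Variables (R : realType) (V W : normedModType R).

Lemma line_is_derive (f : V -> W) (v z : V) (s : R) :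
  derivable f (s *: v + z) v ->
  is_derive s 1 (fun t : R => f (t *: v + z)) ('D_v f (s *: v + z)).
move=> df.
have E : (fun h : R => h^-1 *: (f ((h *: 1 + s) *: v + z) - f (s *: v + z))) =
         (fun h : R => h^-1 *: (f (h *: v + (s *: v + z)) - f (s *: v + z))).
  by apply/funext => h; rewrite [h *: 1]mulr1 scalerDl addrA.
by split; [rewrite /derivable /= E|rewrite /derive /= E].
Qed.

End Lines.

Section ValueRV.
Variable R : realType.

(* The step [c] may have any sign. *)
Lemma MVT_line (V : normedModType R) (f : V -> R) (v z : V) (c : R) :
  (forall t : R, t \in `[0, 1] -> derivable f ((t * c) *: v + z) v) ->
  exists2 t : R, t \in `[0, 1] & f (c *: v + z) - f z = c * 'D_v f ((t * c) *: v + z).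
move=> df.
pose h (t : R) := f ((t * c) *: v + z).
have hd (t : R) : t \in `[0, 1] -> is_derive t 1 h (c * 'D_v f ((t * c) *: v + z)).
  move=> t01; rewrite [c * _]mulrC; have H1 := line_is_derive (df t t01).
  have H2 : is_derive t 1 (fun t : R => t * c) c.
    have -> : (fun t : R => t * c) = c *: (@id R) by apply/funext => x; rewrite mulrC.
    by apply: is_derive_eq; rewrite [c *: _]mulr1.
  exact: (@is_derive1_comp R (fun t => f (t *: v + z)) (fun t => t * c) t _ _ H1 H2).
have hc : {within `[0, 1], continuous h}.
  by apply: derivable_within_continuous => t t01; case: (hd t t01).
have ho (t : R) : t \in `]0, 1[ -> is_derive t 1 h (c * 'D_v f ((t * c) *: v + z)).
  by move=> t01; apply: hd; apply: subset_itv_oo_cc.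
have [t t01] := MVT_segment ler01 ho hc.
rewrite subr0 mulr1 {1 2}/h mul1r mul0r scale0r add0r => E.
by exists t.
Qed.

End ValueRV.

(** * Smooth matrix-valued maps and strict differentiability *)

Section Matrices.
Variables (R : realType) (m : nat).

Lemma mx_norm_le p q (A : 'M[R]_(p, q)) (e : R) : 0 <= e ->
  (forall i j, `|A i j| <= e) -> `|A| <= e.
move=> e0 H; rewrite [leLHS]/Num.Def.normr/= mx_normrE.
by rewrite (bigmax_le _ e0)// => -[i j] _ /=.
Qed.

Lemma mx_norm_lt p q (A : 'M[R]_(p, q)) (e : R) : 0 < e ->
  (forall i j, `|A i j| < e) -> `|A| < e.
move=> e0 H; rewrite [ltLHS]/Num.Def.normr/= mx_normrE.
by rewrite (bigmax_lt _ e0)// => -[i j] _ /=.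
Qed.

Lemma mx_norm_ge p q (A : 'M[R]_(p, q)) i j : `|A i j| <= `|A|.
rewrite [leRHS]/Num.Def.normr/= mx_normrE.
by rewrite (le_trans _ (le_bigmax _ _ (i, j))).
Qed.

Lemma mx_continuousP (T : topologicalType) p q (F : T -> 'M[R]_(p, q)) u :
  {for u, continuous F} <-> forall i j, {for u, continuous (fun v => F v i j)}.
split=> [cF i j|cF].
  by apply: (@continuous_comp _ _ _ F (fun A : 'M[R]_(p, q) => A i j)) => //;
    exact: coord_continuous.
apply/cvgrPdist_lt => e e0; near=> v.
apply: mx_norm_lt => // i j; rewrite !mxE; move: i j; near: v.
apply: filter_forall => i; apply: filter_forall => j.
exact: ((cvgrPdist_lt _ _).1 (cF i j)).
Unshelve. all: by end_near. Qed.

Variable U : set 'rV[R]_m.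
Hypothesis oU : open U.

Lemma Ck_mxP k p q (F : 'rV[R]_m -> 'M[R]_(p, q)) :
  Ck k U F <-> forall i j, Ck k U (fun v => F v i j).
have dE l (G : 'rV[R]_m -> 'M[R]_(p, q)) u i j :
    derivable G u (delta_mx 0 l) -> pd l G u i j = pd l (fun v => G v i j) u.
  by move=> dG; rewrite /pd derive_mx// mxE.
elim: k F => [|k IH] F; split=> /=.
- move=> [cF _] i j; split=> // u Uu; move: i j; apply/mx_continuousP; exact: cF.
- move=> cF; split=> // u Uu; apply/mx_continuousP => i j; exact: (cF i j).1.
- move=> [cF [dF kF]] i j; split; [|split].
  + by move=> u Uu; move: i j; apply/mx_continuousP; exact: cF.
  + by move=> u l Uu; move: i j; apply/derivable_mxP; exact: dF.
  + move=> l; have /IH/(_ i j) := kF l.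
    by apply: Ck_ext => // v Uv; rewrite dE//; exact: dF.
- move=> H; have dF u l : U u -> derivable F u (delta_mx 0 l).
    by move=> Uu; apply/derivable_mxP => i j; exact: ((H i j).2.1).
  split; [|split] => //.
  + by move=> u Uu; apply/mx_continuousP => i j; exact: (H i j).1.
  + move=> l; apply/IH => i j.
    apply: Ck_ext ((H i j).2.2 l) => // v Uv.
    by rewrite dE//; exact: dF.
Qed.

Lemma sm_mxP p q (F : 'rV[R]_m -> 'M[R]_(p, q)) :
  Coo U F <-> forall i j, Coo U (fun v => F v i j).
split=> [sF i j k|sF k]; first by have /Ck_mxP := sF k; apply.
by apply/Ck_mxP => i j; exact: sF.
Qed.

Lemma sm_coord p q (F : 'rV[R]_m -> 'M[R]_(p, q)) i j :
  Coo U F -> Coo U (fun v => F v i j).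
by move/sm_mxP. Qed.

Lemma pd_mxE p q (F : 'rV[R]_m -> 'M[R]_(p, q)) l u i j :
  U u -> Coo U F -> pd l F u i j = pd l (fun v => F v i j) u.
by move=> Uu sF; rewrite /pd derive_mx ?mxE//; exact: sm_der. Qed.
Arguments pd_mxE {p q F l u i j}.

Lemma sm_mulmx p q r (F : 'rV[R]_m -> 'M[R]_(p, q)) (G : 'rV[R]_m -> 'M[R]_(q, r)) :
  Coo U F -> Coo U G -> Coo U (fun v => F v *m G v).
move=> sF sG; apply/sm_mxP => i j.
have H : Coo U (fun v => \sum_k F v i k * G v k j).
  by apply: sm_sum => // k; apply: smoothM => //; exact: sm_coord.
by apply: (sm_ext oU _ H) => v _; rewrite mxE.
Qed.

Lemma pd_mulmx p q r (F : 'rV[R]_m -> 'M[R]_(p, q)) (G : 'rV[R]_m -> 'M[R]_(q, r)) l u :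
  U u -> Coo U F -> Coo U G ->
  pd l (fun v => F v *m G v) u = pd l F u *m G u + F u *m pd l G u.
move=> Uu sF sG; apply/matrixP => i j.
rewrite (pd_mxE Uu)//; last exact: sm_mulmx.
rewrite !mxE -big_split /= (@pd_ext _ _ _ oU _ _
    (fun v => \sum_k F v i k * G v k j))//; last by move=> v _; rewrite mxE.
rewrite (pd_sum oU Uu)//; last by move=> k; apply: smoothM => //; exact: sm_coord.
eqbig k; rewrite (pdM Uu)//; try exact: sm_coord.
by rewrite -!(pd_mxE Uu).
Qed.
Arguments pd_mulmx {p q r F G l u}.

Lemma sm_scale p q (a : 'rV[R]_m -> R) (F : 'rV[R]_m -> 'M[R]_(p, q)) :
  Coo U a -> Coo U F -> Coo U (fun v => a v *: F v).
move=> sa sF; apply/sm_mxP => i j.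
apply: (sm_ext oU _ (smoothM oU sa (sm_coord i j sF))) => v _.
by rewrite mxE.
Qed.

Lemma pd_scale p q (a : 'rV[R]_m -> R) (F : 'rV[R]_m -> 'M[R]_(p, q)) l u :
  U u -> Coo U a -> Coo U F ->
  pd l (fun v => a v *: F v) u = pd l a u *: F u + a u *: pd l F u.
move=> Uu sa sF; apply/matrixP => i j; rewrite (pd_mxE Uu)//; last exact: sm_scale.
rewrite !mxE (@pd_ext _ _ _ oU _ _ (fun v => a v * F v i j))//; last first.
  by move=> v _; rewrite mxE.
by rewrite (pdM Uu)// ?(pd_mxE Uu sF)//; exact: sm_coord.
Qed.
Arguments pd_scale {p q a F l u}.

Lemma sm_tr p q (F : 'rV[R]_m -> 'M[R]_(p, q)) :
  Coo U F -> Coo U (fun v => (F v)^T).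
move=> sF; apply/sm_mxP => i j.
by apply: (sm_ext oU _ (sm_coord j i sF)) => v _; rewrite mxE.
Qed.

Lemma pd_tr p q (F : 'rV[R]_m -> 'M[R]_(p, q)) l u :
  U u -> Coo U F -> pd l (fun v => (F v)^T) u = (pd l F u)^T.
move=> Uu sF; apply/matrixP => i j; rewrite (pd_mxE Uu)//; last exact: sm_tr.
rewrite mxE (pd_mxE Uu)//; apply: (pd_ext oU _ Uu) => v _; exact: mxE.
Qed.
Arguments pd_tr {p q F l u}.

Lemma sm_det n (F : 'rV[R]_m -> 'M[R]_n) :
  Coo U F -> Coo U (fun v => \det (F v)).
move=> sF; rewrite /determinant; apply: sm_sum => // s.
apply: smoothM => //; first exact: sm_cst.
by apply: sm_prod => // i; exact: sm_coord.
Qed.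

Lemma sm_invmx n (F : 'rV[R]_m -> 'M[R]_n) :
  Coo U F -> (forall v, U v -> F v \in unitmx) ->
  Coo U (fun v => invmx (F v)).
move=> sF uF; apply/sm_mxP => i j.
have H : Coo U (fun v => (\det (F v))^-1 * cofactor (F v) j i).
  apply: smoothM => //.
    apply: smoothV => //; first exact: sm_det.
    by move=> v /uF; rewrite unitmxE unitfE.
  apply: smoothM => //; first exact: sm_cst.
  apply: sm_det; apply/sm_mxP => a b.
  have := sm_coord (lift j a) (lift i b) sF.
  by apply: sm_ext => // v _; rewrite !mxE.
by apply: (sm_ext oU _ H) => v Uv; rewrite /invmx uF// !mxE.
Qed.

Lemma pd_invmx n (F : 'rV[R]_m -> 'M[R]_n) l u :
  U u -> Coo U F -> (forall v, U v -> F v \in unitmx) ->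
  pd l (fun v => invmx (F v)) u = - (invmx (F u) *m pd l F u *m invmx (F u)).
move=> Uu sF uF; have sI := sm_invmx sF uF.
have : pd l (fun v => invmx (F v) *m F v) u = 0.
  rewrite (@pd_ext _ _ _ oU _ _ (fun=> 1%:M))// ?pd_cst// => v Uv.
  by rewrite mulVmx// uF.
rewrite (pd_mulmx Uu)// => /eqP; rewrite addr_eq0 => /eqP E.
by rewrite -[LHS]mulmx1 -(mulmxV (uF _ Uu)) mulmxA E mulNmx.
Qed.
Arguments pd_invmx {n F l u}.

(** The difference is telescoped along a staircase from [x] to [y] that changes one coordinate at a
    time, with the mean value theorem on each step. Both end points vary, which is what the symmetry
    of second derivatives and the inverse function theorem require. *)
Lemma C1_strict (f : 'rV[R]_m -> R) u e : U u -> Coo U f -> 0 < e ->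
  exists2 d, 0 < d & (ball u d `<=` U) /\
   forall x y, ball u d x -> ball u d y ->
   `|f y - f x - \sum_j (y 0 j - x 0 j) * pd j f u| <= e * `|y - x|.
move=> Uu sf e0.
(* Division by [m.+1] rather than [m] covers [m = 0]. *)
pose e' := e / m.+1%:R; have e'0 : 0 < e' by rewrite divr_gt0.
have : \forall v \near u, U v /\ forall j, `|pd j f u - pd j f v| < e'.
  near=> v; split; first by near: v; exact: open_nbhs_nbhs.
  near: v; apply: filter_forall => j.
  have /cvgrPdist_lt := sm_cont (sm_pd j sf) Uu; exact.
move=> /nbhs_ballP[d /= d0 dP]; exists d => //; split; first by move=> x /dP[].
move=> x y bx by_.
pose z (k : nat) : 'rV[R]_m := \row_j if (j < k)%N then y 0 j else x 0 j.
have z0 : z 0%N = x by apply/rowP => j; rewrite mxE.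
have zm : z m = y by apply/rowP => j; rewrite mxE ltn_ord.
have zS (k : 'I_m) : z k.+1 = (y 0 k - x 0 k) *: delta_mx 0 k + z k.
  apply/rowP => j; rewrite !mxE eqxx /= ltnS leq_eqVlt -val_eqE.
  case: eqP => [/val_inj ->|_] /=; first by rewrite ltnn mulr1 subrK.
  by rewrite mulr0 add0r.
have bz (k : 'I_m) (t : R) : t \in `[0, 1] ->
    ball u d ((t * (y 0 k - x 0 k)) *: delta_mx 0 k + z k).
  rewrite in_itv /= => /andP[t0 t1]; move: bx by_; rewrite -!ball_normE /= => bx by_.
  apply: mx_norm_lt => // i j; rewrite !ord1 !mxE eqxx /=.
  have xj := le_lt_trans (mx_norm_ge (u - x) 0 j) bx.
  have yj := le_lt_trans (mx_norm_ge (u - y) 0 j) by_.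
  rewrite !mxE in xj yj.
  case: eqP => [jk|_]; last by case: ifP => _; rewrite mulr0 add0r.
  rewrite jk ltnn mulr1 in xj yj *.
  move: xj yj; rewrite !ltr_norml => /andP[? ?] /andP[? ?].
  have [xy|/ltW xy] := leP (x 0 k) (y 0 k).
    have p1 : 0 <= t * (y 0 k - x 0 k) by rewrite mulr_ge0// subr_ge0.
    have p2 : 0 <= (1 - t) * (y 0 k - x 0 k) by rewrite mulr_ge0// subr_ge0.
    by apply/andP; split; lra.
  have p1 : 0 <= t * (x 0 k - y 0 k) by rewrite mulr_ge0// subr_ge0.
  have p2 : 0 <= (1 - t) * (x 0 k - y 0 k) by rewrite mulr_ge0// subr_ge0.
  by apply/andP; split; lra.
have -> : f y - f x = \sum_(k < m) (f (z k.+1) - f (z k)).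
  by rewrite -(big_mkord xpredT (fun k => f (z k.+1) - f (z k))) telescope_sumr// z0 zm.
rewrite -sumrB (le_trans (ler_norm_sum _ _ _))//.
apply: (@le_trans _ _ (\sum_(k < m) e' * `|y - x|)).
  apply: ler_sum => k _; rewrite zS.
  have [t t01 ->] : exists2 t : R, t \in `[0, 1] &
      f ((y 0 k - x 0 k) *: delta_mx 0 k + z k) - f (z k) =
      (y 0 k - x 0 k) * pd k f ((t * (y 0 k - x 0 k)) *: delta_mx 0 k + z k).
    by apply: MVT_line => t t01; apply: (sm_der sf); case: (dP _ (bz k t t01)).
  rewrite -mulrBr normrM mulrC ler_pM//.
    by rewrite distrC ltW//; case: (dP _ (bz k t t01)).
  by have := mx_norm_ge (y - x) 0 k; rewrite !mxE.
rewrite sumr_const card_ord -mulr_natl mulrA ler_wpM2r//.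
rewrite /e' mulrCA mulr_natl ger_pMr// -mulr_natl.
rewrite -ler_pdivlMr ?invr_gt0// mul1r invrK// ler_nat.
Unshelve. all: by end_near. Qed.
End Matrices.

Arguments pd_mxE {R m U p q F l u i j}.
Arguments pd_mulmx {R m U} oU {p q r F G l u}.
Arguments pd_scale {R m U} oU {p q a F l u}.
Arguments pd_tr {R m U} oU {p q F l u}.
Arguments pd_invmx {R m U} oU {n F l u}.

(** * Differentials as linear maps and the chain rule *)

Section Gradient.
Variables (R : realType) (m p q : nat).
Variables (F : 'rV[R]_m -> 'M[R]_(p, q)) (u : 'rV[R]_m).

Definition gradient (h : 'rV[R]_m) : 'M[R]_(p, q) :=
  \sum_j h 0 j *: pd j F u.

Fact gradient_is_linear : linear gradient.
move=> a h k; rewrite /gradient scaler_sumr -big_split /=.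
by eqbig j; rewrite !mxE scalerDl scalerA.
Qed.

HB.instance Definition _ := GRing.isLinear.Build R 'rV[R]_m 'M[R]_(p, q) _
  gradient gradient_is_linear.

Lemma gradient_le h : `|gradient h| <= (\sum_j `|pd j F u|) * `|h|.
rewrite /gradient (le_trans (ler_norm_sum _ _ _))// mulr_suml ler_sum// => j _.
by rewrite normrZ mulrC ler_wpM2l// mx_norm_ge.
Qed.

Lemma gradient_continuous : continuous gradient.
apply/linear_bounded_continuous/linear_boundedP.
exists (\sum_j `|pd j F u|); split; first by rewrite ger0_real// sumr_ge0.
by move=> r ltr x; rewrite (le_trans (gradient_le x))// ler_wpM2r// ltW.
Qed.

End Gradient.

Lemma is_diff_approx (R : realType) (V W : normedModType R) (f : V -> W)
    (L : {linear V -> W}) (u : V) : continuous L ->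
  (forall e : R, 0 < e ->
     \forall h \near 0, `|f (h + u) - f u - L h| <= e * `|h|) ->
  is_diff u f L.
move=> cL H.
have E : f \o shift u = cst (f u) + L +o_ 0 id.
  apply/eqaddoP => e e0; near=> h; rewrite !fctE /= opprD addrA.
  by near: h; exact: H.
have dE : 'd f u = L :> (_ -> _) by exact: (diff_unique cL E).
by split=> //; apply/diff_locallyP; rewrite dE; split.
Unshelve. all: by end_near. Qed.

Section Strict.
Variables (R : realType) (m : nat) (U : set 'rV[R]_m).
Hypothesis oU : open U.

Lemma C1_strict_mx p q (F : 'rV[R]_m -> 'M[R]_(p, q)) u e :
  U u -> Coo U F -> 0 < e ->
  exists2 d, 0 < d & (ball u d `<=` U) /\
   forall x y, ball u d x -> ball u d y ->
   `|F y - F x - gradient F u (y - x)| <= e * `|y - x|.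
move=> Uu sF e0.
have : \forall d \near 0^'+, ball u d `<=` U /\ forall i j, forall x y, ball u d x -> ball u d y ->
   `|F y i j - F x i j - \sum_l (y 0 l - x 0 l) * pd l F u i j| <= e * `|y - x|.
  have /nbhs_ballP[r /= r0 rP] := open_nbhs_nbhs (conj oU Uu).
  have N1 : \forall d \near 0^'+, ball u d `<=` U.
    near=> d; apply: subset_trans rP; apply: le_ball; apply: ltW.
    by near: d; exact: nbhs_right_lt.
  have N2 : \forall d \near 0^'+, forall i j, forall x y, ball u d x -> ball u d y ->
   `|F y i j - F x i j - \sum_l (y 0 l - x 0 l) * pd l F u i j| <= e * `|y - x|; last exact: filterI.
  apply: filter_forall => i; apply: filter_forall => j.
  have [d d0 [_ dP]] := C1_strict oU Uu (sm_coord oU i j sF) e0.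
  near=> d'; move=> x y bx by_.
  have le : ball u d' `<=` ball u d.
    by apply: le_ball; rewrite ltW//; near: d'; exact: nbhs_right_lt.
  have := dP x y (le _ bx) (le _ by_).
  by under eq_bigr do rewrite -(pd_mxE Uu sF).
move=> H.
have [d [d0 [dU dP]]] : exists d, 0 < d /\ (ball u d `<=` U /\ forall i j, forall x y, ball u d x -> ball u d y ->
   `|F y i j - F x i j - \sum_l (y 0 l - x 0 l) * pd l F u i j| <= e * `|y - x|).
  have : \forall d \near 0^'+, (0 : R) < d by exact: nbhs_right_gt.
  by move=> /(filterI H)/filter_ex[d [? ?]]; exists d.
exists d => //; split=> // x y bx by_; apply: mx_norm_le => [|i j].
  by rewrite mulr_ge0// ltW.
rewrite !mxE summxE (le_trans _ (dP i j x y bx by_))// le_eqVlt; apply/orP; left.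
by apply/eqP; congr (`|_ - _|); eqbig l; rewrite !mxE.
Unshelve. all: by end_near. Qed.

Lemma sm_is_diff p q (F : 'rV[R]_m -> 'M[R]_(p, q)) u :
  U u -> Coo U F -> is_diff u F (gradient F u).
move=> Uu sF.
apply: is_diff_approx; first exact: gradient_continuous.
move=> e e0; have [d d0 [_ dP]] := C1_strict_mx Uu sF e0.
near=> h; have := dP u (h + u); rewrite addrK; apply; first exact: ballxx.
rewrite -ball_normE /= opprD addrCA subrr addr0 normrN.
near: h; apply/nbhs_ballP; exists d => //= x; rewrite -ball_normE /=.
by rewrite sub0r normrN.
Unshelve. all: by end_near. Qed.

End Strict.

Section Chain.
Variables (R : realType) (m n : nat).
Variables (U : set 'rV[R]_m) (U' : set 'rV[R]_n).
Hypotheses (oU : open U) (oU' : open U').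
Variable phi : 'rV[R]_n -> 'rV[R]_m.
Hypothesis sphi : Coo U' phi.
Hypothesis phiU : forall u, U' u -> U (phi u).

Lemma is_pd_comp p q (F : 'rV[R]_m -> 'M[R]_(p, q)) i u :
  U' u -> Coo U F ->
  is_derive u (delta_mx 0 i) (F \o phi) (gradient F (phi u) (pd i phi u)).
move=> Uu sF.
have d1 := sm_is_diff oU' Uu sphi.
have d2 := sm_is_diff oU (phiU Uu) sF.
have d3 := is_diff_comp d1 d2.
have ex : differentiable (F \o phi) u by case: d3.
split; first exact: diff_derivable.
rewrite deriveE// (diff_val (is_diff_def := d3)) /=; congr gradient.
rewrite /gradient (bigD1 i)//= mxE !eqxx scale1r big1 ?addr0// => j ji.
by rewrite mxE eqxx /= (negPf ji) scale0r.
Qed.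

Lemma pd_comp p q (F : 'rV[R]_m -> 'M[R]_(p, q)) i u :
  U' u -> Coo U F ->
  pd i (F \o phi) u = \sum_j pd i phi u 0 j *: pd j F (phi u).
by move=> Uu sF; have [_] := is_pd_comp i Uu sF. Qed.

Lemma sm_comp p q (F : 'rV[R]_m -> 'M[R]_(p, q)) :
  Coo U F -> Coo U' (F \o phi).
have cF p' q' (G : 'rV[R]_m -> 'M[R]_(p', q')) u : Coo U G -> U' u ->
    {for u, continuous (G \o phi)}.
  move=> sG Uu; apply: continuous_comp; first exact: sm_cont.
  by apply: (sm_cont sG); exact: phiU.
move=> sF k; elim: k p q F sF => [|k IH] p q F sF.
  by split=> [u Uu|]; [exact: cF|exact: I].
split=> [u Uu|]; first exact: cF.
split=> [u i Uu|i]; first by case: (is_pd_comp i Uu sF).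
have H : Ck k U' (fun u => \sum_j pd i phi u 0 j *: pd j F (phi u)).
  apply/(Ck_mxP oU') => a b.
  have sC (l : seq 'I_m) : Ck k U' (fun u => \sum_(j <- l) pd i phi u 0 j * pd j F (phi u) a b).
    elim: l => [|j l IHl].
      by apply: (Ck_ext oU' _ (@sm_cst _ _ _ _ _ (0 : R) k)) => // v _; rewrite big_nil.
    have H1 : Ck k U' (fun u => pd i phi u 0 j).
      by move: k {IH IHl}; apply: sm_coord => //; exact: sm_pd.
    have H2 : Ck k U' (fun u => pd j F (phi u) a b).
      by have /(Ck_mxP oU') := IH _ _ _ (sm_pd j sF); apply.
    apply: (Ck_ext oU' _ (CkD oU' (CkM oU' H1 H2) IHl)) => v _.
    by rewrite big_cons.
  apply: (Ck_ext oU' _ (sC (index_enum 'I_m))) => v _.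
  by rewrite summxE; eqbig j; rewrite mxE.
by apply: (Ck_ext oU' _ H) => v Uv; rewrite pd_comp.
Qed.

End Chain.

(** * Symmetry of second derivatives *)

Section Schwarz.
Variables (R : realType) (m : nat) (U : set 'rV[R]_m).
Hypothesis oU : open U.

(* The second difference of [f] over a square of side [t], divided by [t ^ 2],
   tends to either mixed derivative. *)
Lemma pdC (f : 'rV[R]_m -> R) i j u : U u -> Coo U f ->
  pd i (pd j f) u = pd j (pd i f) u.
move=> Uu sf.
pose D (a b : 'I_m) (t : R) := f (t *: delta_mx 0 a + (t *: delta_mx 0 b + u))
  - f (t *: delta_mx 0 a + u) - f (t *: delta_mx 0 b + u) + f u.
have DC a b t : D a b t = D b a t by rewrite /D addrCA; ring.
have key a b e : 0 < e ->
    \forall t \near 0^'+, `|D a b t - t ^+ 2 * pd b (pd a f) u| <= e * t ^+ 2.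
  move=> e0.
  have [d d0 [dU dP]] := C1_strict oU Uu (sm_pd a sf) e0.
  have d20 : 0 < d / 2 by lra.
  near=> t.
  have t0 : 0 < t by near: t; exact: nbhs_right_gt.
  have td : t < d / 2 by near: t; exact: nbhs_right_lt.
  have bb s r : s \in `[0, 1] -> r \in `[0, 1] ->
      ball u d ((s * t) *: delta_mx 0 a + ((r * t) *: delta_mx 0 b + u)).
    rewrite !in_itv /= => /andP[s0 s1] /andP[r0 r1].
    rewrite -ball_normE /= addrA opprD addrCA subrr addr0 normrN.
    have e1 (c : 'I_m) (x : R) : 0 <= x -> x <= 1 ->
        `|(x * t) *: (delta_mx 0 c : 'rV[R]_m)| <= t.
      move=> x0 x1; apply: mx_norm_le => [|k l]; first exact: ltW.
      rewrite !mxE; case: andP => _; rewrite ?mulr0 ?normr0 ?(ltW t0)//.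
      by rewrite mulr1 ger0_norm ?mulr_ge0 ?(ltW t0)// ler_piMl// ltW.
    rewrite (le_lt_trans (ler_normD _ _))//.
    by have := e1 a s s0 s1; have := e1 b r r0 r1; lra.
  (* The second difference is a first difference of [g] in direction [a]. The mean value theorem
     turns it into a difference of [pd a f] in direction [b], to which strict differentiability
     applies. *)
  pose g (v : 'rV[R]_m) := f (t *: delta_mx 0 b + v) - f v.
  have i01 : (1 : R) \in `[0, 1] by rewrite in_itv /= ler01 lexx.
  have i00 : (0 : R) \in `[0, 1] by rewrite in_itv /= ler01 lexx.
  have dg (s : R) : s \in `[0, 1] ->
     is_derive ((s * t) *: delta_mx 0 a + u) (delta_mx 0 a) g
      (pd a f ((s * t) *: delta_mx 0 a + (t *: delta_mx 0 b + u)) -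
       pd a f ((s * t) *: delta_mx 0 a + u)).
    move=> s01.
    have B1 := bb s 1 s01 i01; have B2 := bb s 0 s01 i00.
    rewrite mul1r in B1; rewrite mul0r scale0r add0r in B2.
    have D2 := sm_der (i := a) sf (dU _ B2).
    have D1 := sm_der (i := a) sf (dU _ B1).
    have sh : is_derive ((s * t) *: delta_mx 0 a + u) (delta_mx 0 a)
        (fun v => f (t *: delta_mx 0 b + v))
        (pd a f ((s * t) *: delta_mx 0 a + (t *: delta_mx 0 b + u))).
      have E h : f (t *: delta_mx 0 b + (h *: delta_mx 0 a + ((s * t) *: delta_mx 0 a + u)))
          = f (h *: delta_mx 0 a + ((s * t) *: delta_mx 0 a + (t *: delta_mx 0 b + u))).
        by congr f; rewrite addrCA; congr (_ + _); rewrite addrCA.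
      have E0 := E 0; rewrite !scale0r !add0r in E0.
      split.
        move: D1; rewrite /derivable /=.
        by under [X in cvg (X @ _)]eq_fun do rewrite -E -E0.
      rewrite /pd /derive /=; congr (lim _).
      by under [X in X @ _]eq_fun do rewrite E E0.
    exact: (is_deriveB sh (DeriveDef D2 erefl)).
  have [s s01 E] := MVT_line (f := g) (fun s s01 => ex_derive (is_derive := dg s s01)).
  have -> : D a b t = g (t *: delta_mx 0 a + u) - g u.
    by rewrite /D /g [t *: delta_mx 0 b + (_ + _)]addrCA; ring.
  rewrite E (derive_val (is_derive := dg s s01)).
  have B1 := bb s 1 s01 i01; have B2 := bb s 0 s01 i00.
  rewrite mul1r in B1; rewrite mul0r scale0r add0r in B2.
  have := dP _ _ B2 B1.
  set y := (_ + (_ + _)); set x := (_ + u); set pb := pd b _ u.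
  have yx : y - x = t *: delta_mx 0 b by rewrite /y /x addrCA addrK.
  have -> : \sum_j0 (y 0 j0 - x 0 j0) * pd j0 (pd a f) u = t * pb.
    rewrite (bigD1 b)//= big1 ?addr0 => [|k kb].
      have -> : y 0 b - x 0 b = (y - x) 0 b by rewrite !mxE.
      by rewrite yx !mxE !eqxx mulr1.
    have -> : y 0 k - x 0 k = (y - x) 0 k by rewrite !mxE.
    by rewrite yx !mxE (negPf kb) mulr0 mul0r.
  rewrite yx => H.
  have nt : `|t *: (delta_mx 0 b : 'rV[R]_m)| <= t.
    apply: mx_norm_le => [|k l]; first exact: ltW.
    rewrite !mxE; case: andP => _; rewrite ?mulr0 ?normr0 ?(ltW t0)//.
    by rewrite mulr1 gtr0_norm.
  rewrite expr2 -mulrA -mulrBr normrM gtr0_norm// mulrCA ler_pM2l//.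
  by rewrite (le_trans H)// ler_wpM2l// ltW.
apply/eqP; rewrite -subr_eq0 -normr_le0; apply/ler_addgt0Pl => e e0; rewrite addr0.
have e20 : 0 < e / 2 by lra.
have Hp : \forall t \near 0^'+, (0 : R) < t by exact: nbhs_right_gt.
have [t [t0 [k1 k2]]] := @filter_ex R _ (at_right_proper_filter (0 : R)) _
  (filterI Hp (filterI (key i j _ e20) (key j i _ e20))).
rewrite DC in k1.
have t20 : 0 < t ^+ 2 by rewrite exprn_gt0.
rewrite -(ler_pM2l t20) -{1}(gtr0_norm t20) -normrM.
move: (D j i t) (pd i (pd j f) u) (pd j (pd i f) u) k1 k2 => x y z k1 k2.
have -> : t ^+ 2 * (y - z) = (x - t ^+ 2 * z) - (x - t ^+ 2 * y) by ring.
by rewrite (le_trans (ler_normB _ _))//; lra.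
Unshelve. all: by end_near. Qed.

Lemma pdC_mx p q (F : 'rV[R]_m -> 'M[R]_(p, q)) i j u : U u -> Coo U F ->
  pd i (pd j F) u = pd j (pd i F) u.
move=> Uu sF; apply/matrixP => a b.
have H k l : pd k (pd l F) u a b = pd k (pd l (fun v => F v a b)) u.
  rewrite (pd_mxE Uu (sm_pd l sF)); apply: (pd_ext oU _ Uu) => v Uv.
  by rewrite (pd_mxE Uv sF).
exact: (etrans (H i j) (etrans (pdC i j Uu (sm_coord oU a b sF)) (esym (H j i)))).
Qed.

End Schwarz.

Section Coordinates.
Variables (R : realType) (m : nat) (U : set 'rV[R]_m).
Hypothesis oU : open U.

Lemma pd_id i u : pd i (@id 'rV[R]_m) u = delta_mx 0 i.
by rewrite /pd derive_id. Qed.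

Lemma sm_id : Coo U (@id 'rV[R]_m).
case=> [|k]; first by split=> // u _; exact: cvg_id.
split; first by move=> u _; exact: cvg_id.
split=> [u i _|i]; first exact: derivable_id.
apply: (Ck_ext oU _ (@sm_cst _ _ U oU _ (delta_mx 0 i) k)) => v _.
by rewrite pd_id.
Qed.

Lemma sm_coordX j : Coo U (fun x => x 0 j).
exact: (sm_coord oU 0 j sm_id). Qed.

Lemma pd_coordX i j u : U u -> pd i (fun x : 'rV[R]_m => x 0 j) u = (i == j)%:R.
by move=> Uu; rewrite -(pd_mxE Uu sm_id) pd_id mxE eqxx eq_sym.
Qed.

End Coordinates.

(** * A smooth cutoff function *)

Section Bump.
Variable R : realType.

(* [expbump 0] is the smooth function [exp (- 1 / t)] for [t > 0] and [0]
   otherwise; the span of the family is closed under derivation. *)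
Definition expbump (n : nat) (t : R) : R :=
  if 0 < t then t ^- n * expR (- t^-1) else 0.

(** A single term of the series of exp(1/t) already beats the pole. The surplus factor [t ^+ 2]
    makes the difference quotient at 0 tend to 0 in [is_derive_bump]. *)
Lemma expbump_le n t : 0 < t -> expbump n t <= (n.+2)`!%:R * t ^+ 2.
move=> t0; rewrite /expbump t0 expRN.
have ti0 : 0 <= t^-1 by rewrite invr_ge0 ltW.
have := expR_ge1Dxn n.+1 ti0.
set F := _%:R; have F0 : 0 < F by rewrite ltr0n fact_gt0.
move=> H; have H2 : t^-1 ^+ n.+2 / F <= expR t^-1 by lra.
have P : 0 < t^-1 ^+ n.+2 / F by rewrite divr_gt0// exprn_gt0// invr_gt0.
have : (expR t^-1)^-1 <= (t^-1 ^+ n.+2 / F)^-1 by rewrite lef_pV2// posrE// expR_gt0.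
rewrite invfM invrK exprVn invrK => H3.
have tn0 : 0 < t ^- n by rewrite invr_gt0 exprn_gt0.
rewrite (le_trans (ler_wpM2l (ltW tn0) H3))// le_eqVlt; apply/orP; left; apply/eqP.
rewrite -[in t ^+ n.+2]addn2 exprD !mulrA mulVf; last by rewrite expf_neq0// gt_eqF.
by rewrite mul1r [LHS]mulrC mulrA.
Qed.

Lemma expbump_ge0 n t : 0 <= expbump n t.
rewrite /expbump; case: ltP => // t0.
by rewrite mulr_ge0 ?expR_ge0// invr_ge0 exprn_ge0// ltW.
Qed.

Lemma expbump_gt0 n t : 0 < t -> 0 < expbump n t.
by move=> t0; rewrite /expbump t0 mulr_gt0 ?expR_gt0// invr_gt0 exprn_gt0. Qed.

Lemma expbump_le0 n t : t <= 0 -> expbump n t = 0.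
by rewrite /expbump; case: ltP. Qed.

Lemma is_derive_bump n (t : R) :
  is_derive t 1 (expbump n) (- n%:R * expbump n.+1 t + 1 * expbump n.+2 t).
have [t0|t0|->] := ltgtP t 0.
- rewrite !(expbump_le0 _ (ltW t0)) !mulr0 addr0.
  apply: near_eq_is_derive (is_derive_cst (0 : R) t (1 : R)).
  by near=> s; rewrite expbump_le0// ltW//; near: s; exact: lt_nbhsl.
- pose f (s : R) := (s^-1) ^+ n * expR (- s^-1).
  suff : is_derive t 1 f (- n%:R * expbump n.+1 t + 1 * expbump n.+2 t).
    apply: near_eq_is_derive; near=> s; rewrite /expbump /f (_ : 0 < s) ?exprVn//.
    by near: s; exact: lt_nbhsr.
  have tn : t != 0 by rewrite gt_eqF.
  have dV : is_derive t 1 (fun s : R => s^-1) (- t ^- 2).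
    have := @is_deriveV R id t 1 1 tn (is_derive_id t 1).
    by rewrite /= [_ *: _]mulr1.
  have dE : is_derive t 1 (fun s : R => expR (- s^-1)) (expR (- t^-1) * t ^- 2).
    have dN : is_derive t 1 (fun s : R => - s^-1) (t ^- 2).
      by rewrite -[t ^- 2]opprK; exact: is_deriveN dV.
    exact: (@is_derive1_comp R expR (fun s => - s^-1) t _ _ (is_derive_expR _) dN).
  have HM := is_deriveM (is_deriveX n dV) dE.
  have -> : f = (fun s : R => s^-1) ^+ n * (fun s : R => expR (- s^-1)).
    by apply/funext => s; rewrite /f !fctE.
  apply: (is_derive_eq HM); rewrite /expbump t0 !fctE /=.
  rewrite -[LHS]/((t^-1) ^+ n * (expR (- t^-1) * t ^- 2) +
    expR (- t^-1) * (n%:R * (t^-1) ^+ n.-1 * - t ^- 2)).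
  move: (expR _) => E; clear f HM dV dE.
  by case: n => [|n]; rewrite /= -?exprVn !exprS; ring.
- rewrite !(expbump_le0 _ (lexx _)) !mulr0 addr0.
  have C : h^-1 *: (expbump n (h *: 1 + 0) - expbump n 0) @[h --> 0^'] --> (0 : R).
    apply/cvgrPdist_le => e e0.
    pose F : R := (n.+2)`!%:R; have F0 : 0 < F by rewrite ltr0n fact_gt0.
    near=> h; rewrite sub0r normrN (expbump_le0 _ (lexx 0)) subr0 addr0 [h *: 1]mulr1.
    rewrite [_ *: _]mulrC.
    have [h0|h0] := leP h 0; first by rewrite expbump_le0// mul0r normr0 ltW.
    rewrite ger0_norm ?mulr_ge0 ?expbump_ge0 ?invr_ge0 ?(ltW h0)//.
    rewrite ler_pdivrMr// (le_trans (expbump_le n h0))// expr2 mulrA ler_pM2r//.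
    rewrite -/F -ler_pdivlMl// ltW// -(gtr0_norm h0).
    by near: h; apply: dnbhs0_lt; rewrite mulr_gt0// invr_gt0.
  by split; [apply/cvg_ex; exists 0|apply: cvg_lim].
Unshelve. all: by end_near. Qed.

Lemma sm_bump m (U : set 'rV[R]_m) (f : 'rV[R]_m -> R) : open U ->
  Coo U f -> Coo U (fun v => expbump 0 (f v)).
move=> oU sf; apply: (sm_comp1 oU _ sf) => n.
by exists (- n%:R), 1, n.+1, n.+2; exact: is_derive_bump.
Qed.

End Bump.

Section Local.
Variables (R : realType) (m : nat) (V : normedModType R).

(** Serves to extend a field by zero beyond its support, here to the whole space. *)
Lemma sm_setU (U U' : set 'rV[R]_m) (f : 'rV[R]_m -> V) :
  Coo U f -> Coo U' f -> Coo (U `|` U') f.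
move=> sf sf' k; move: (sf k) (sf' k); elim: k f {sf sf'} => [|k IH] f /=.
  by move=> [c _] [c' _]; split=> // u [/c|/c'].
move=> [c [d h]] [c' [d' h']]; split; first by move=> u [/c|/c'].
by split=> [u i [Uu|Uu]|i]; [exact: d|exact: d'|exact: IH].
Qed.

Lemma sm_sub (U U' : set 'rV[R]_m) (f : 'rV[R]_m -> V) :
  U' `<=` U -> Coo U f -> Coo U' f.
move=> UU sf k; move: (sf k); elim: k f {sf} => [|k IH] f /=.
  by move=> [c _]; split=> // u /UU /c.
move=> [c [d h]]; split; first by move=> u /UU /c.
by split=> [u i /UU Uu|i]; [exact: d|exact: IH].
Qed.

End Local.

Section Bounded.
Variables (R : realType) (m : nat).

Lemma compact_norm_le (r : R) : compact [set x : 'rV[R]_m | `|x| <= r].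
apply: bounded_closed_compact.
  exists r; split; first exact: num_real.
  by move=> M rM x /= xr; rewrite (le_trans xr)// ltW.
rewrite (_ : [set x | _] = (fun x : 'rV[R]_m => `|x|) @^-1` [set t | t <= r])//.
apply: closed_comp; last exact: closed_le.
by move=> x _; exact: norm_continuous.
Qed.

Lemma cont_compact_bounded (K : set 'rV[R]_m) (f : 'rV[R]_m -> R) : compact K ->
  (forall x, K x -> {for x, continuous f}) ->
  exists2 C, 0 < C & forall x, K x -> `|f x| <= C.
move=> cK cf; have [->|/set0P[x0 Kx0]] := eqVneq K set0; first by exists 1.
have [|c cK' H] := @EVT_max_rV R m (fun x => `|f x|) K (ex_intro _ x0 Kx0) cK.
  apply: continuous_in_subspaceT => x /set_mem Kx.
  apply: (@continuous_comp _ _ _ f (fun y : R => `|y|)); first exact: cf.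
  exact: norm_continuous.
exists (`|f c| + 1); first by rewrite ltr_pwDr.
by move=> x Kx; rewrite (le_trans (H x (mem_set Kx)))// lerDl.
Qed.

End Bounded.

(** * Riemann sums in place of integrals *)

Section RiemannSums.
Variables (R : realType) (m : nat) (L : nat).

Definition mesh (n : nat) : R := n.+1%:R^-1.

(** Lower corners of the grid of step 1/(n+1) on the cube $[-L,L)^m$, hence the $2L(n+1)$ indices
    per axis. *)
Definition node n (k : {ffun 'I_m -> 'I_(2 * L * n.+1)}) : 'rV[R]_m :=
  \row_i ((k i)%:R * mesh n - L%:R).

Definition riemann_sum n (F : 'rV[R]_m -> R) : R :=
  mesh n ^+ m * \sum_k F (@node n k).

(* "The integral of [F] is nonpositive", expressed by Riemann sums over the
   cube of half side [L] so that no integrability has to be discussed. *)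
Definition sum_le0 (F : 'rV[R]_m -> R) : Prop :=
  forall e : R, 0 < e -> \forall n \near \oo, riemann_sum n F <= e.

Lemma mesh_gt0 n : 0 < mesh n. by rewrite invr_gt0. Qed.

Lemma sum_le0D F G : sum_le0 F -> sum_le0 G -> sum_le0 (fun x => F x + G x).
move=> hF hG e e0; have e2 : 0 < e / 2 by lra.
near=> n.
have -> : riemann_sum n (fun x => F x + G x) = riemann_sum n F + riemann_sum n G.
  by rewrite /riemann_sum big_split mulrDr.
have HF : riemann_sum n F <= e / 2 by near: n; exact: hF.
have HG : riemann_sum n G <= e / 2 by near: n; exact: hG.
lra.
Unshelve. all: by end_near. Qed.

Lemma riemann_sum_le n F G : (forall x, F x <= G x) ->
  riemann_sum n F <= riemann_sum n G.
by move=> FG; rewrite ler_pM2l ?exprn_gt0 ?mesh_gt0//; apply: ler_sum.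
Qed.

Lemma sum_le0_le F G : (forall x, F x <= G x) -> sum_le0 G -> sum_le0 F.
move=> FG hG e e0; have := hG e e0; apply: filterS => n.
by apply: le_trans; exact: riemann_sum_le.
Qed.

Lemma sum_le0_sum (I : Type) (r : seq I) (F : I -> 'rV[R]_m -> R) :
  (forall i, sum_le0 (F i)) -> sum_le0 (fun x => \sum_(i <- r) F i x).
move=> hF; elim: r => [|a r IH].
  move=> e e0; near=> n; rewrite /riemann_sum big1 ?mulr0 ?ltW// => k _.
  by rewrite big_nil.
apply: sum_le0_le (sum_le0D (hF a) IH) => x; by rewrite big_cons.
Unshelve. all: by end_near. Qed.

Lemma riemann_sum1 n c : riemann_sum n (fun=> c) = (2 * L)%:R ^+ m * c.
rewrite /riemann_sum sumr_const card_ffun !card_ord -[c *+ _]mulr_natl natrX mulrA.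
by rewrite -exprMn natrM mulrCA mulVf ?mulr1 ?pnatr_eq0.
Qed.

(** The discrete divergence theorem: up to an error of second order in the mesh at each node, the
    derivative times the mesh is a difference of [V] at neighbouring nodes, and these differences
    add up to zero. *)
Lemma sum_le0_pd (V : 'rV[R]_m -> R) (i : 'I_m) : Coo setT V ->
  (forall x : 'rV[R]_m, L%:R <= `|x 0 i| -> V x = 0) -> sum_le0 (pd i V).
move=> sV V0.
(* The intermediate points of the mean value theorem leave the cube by at most one mesh, hence by at
   most 1. *)
pose K := [set x : 'rV[R]_m | `|x| <= L%:R + 1].
have [M M0 MP] : exists2 C, 0 < C & forall x, K x -> `|pd i (pd i V) x| <= C.
  apply: cont_compact_bounded; first exact: compact_norm_le.
  by move=> x _; apply: (sm_cont (sm_pd i (sm_pd i sV))).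
have Kn n k : `|@node n k| <= L%:R.
  apply: mx_norm_le => // a b; rewrite mxE ler_norml.
  have kN : (k b)%:R * mesh n <= 2 * L%:R.
    rewrite ler_pdivrMr// -!natrM ler_nat; exact: ltnW.
  have k0 : 0 <= (k b)%:R * mesh n by rewrite mulr_ge0// ltW// mesh_gt0.
  by apply/andP; split; lra.
pose e : 'rV[R]_m := delta_mx 0 i.
have ne : `|e| <= 1.
  apply: mx_norm_le => // a b; rewrite mxE; case: andP => _; rewrite ?normr1 ?normr0//.
have quot n k : `|pd i V (@node n k) * mesh n - (V (mesh n *: e + node k) - V (node k))|
    <= M * mesh n ^+ 2.
  have h0 := mesh_gt0 n; have h1 : mesh n <= 1 by rewrite invf_le1// ler1n.
  have dv (W : 'rV[R]_m -> R) x : Coo setT W -> derivable W x e by move=> sW; exact: (sm_der sW).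
  have [t t01 ->] := @MVT_line _ _ V e (node k) (mesh n) (fun t _ => dv V _ sV).
  have [s s01 E] := @MVT_line _ _ (pd i V) e (node k) (t * mesh n)
     (fun t _ => dv _ _ (sm_pd i sV)).
  move: t01 s01; rewrite !in_itv /= => /andP[t0 t1] /andP[s0 s1].
  rewrite mulrC -mulrBr -[pd i V _ - _]opprB {}E normrM normrN (gtr0_norm h0).
  have -> : M * mesh n ^+ 2 = mesh n * (M * mesh n) by ring.
  rewrite ler_pM2l// normrM mulrC ler_pM//; last first.
    by rewrite ger0_norm ?mulr_ge0 ?(ltW h0)// ler_piMl// ltW.
  apply: MP; rewrite /K /= (le_trans (ler_normD _ _))// addrC lerD// normrZ.
  rewrite mulr_ile1// ger0_norm ?mulr_ge0 ?(ltW h0)//.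
  by rewrite mulr_ile1 ?mulr_ge0 ?(ltW h0)// mulr_ile1 ?(ltW h0).
(* The cyclic shift of the index [k i] permutes the nodes. It is a translation by one mesh except
   where it wraps around, and there both values of [V] vanish, being taken on the faces $x_i=\pm
   L$. *)
have tele n : \sum_k (V (mesh n *: e + @node n k) - V (node k)) = 0.
  pose sh (k : {ffun 'I_m -> 'I_(2 * L * n.+1)}) :=
    [ffun j => if j == i then ordS (k j) else k j].
  have sh_inj : injective sh.
    move=> k k' /ffunP kk; apply/ffunP => j; have := kk j; rewrite !ffunE.
    by case: eqP => // _; apply: ordS_inj.
  rewrite sumrB; apply/eqP; rewrite subr_eq0; apply/eqP.
  rewrite [RHS](reindex_inj sh_inj); eqbig k.
  have [lt|ge] := ltnP (k i).+1 (2 * L * n.+1).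
    congr V; apply/rowP => j; rewrite !mxE !ffunE eqxx /= eq_sym.
    case: eqP => [<-|_]; last by rewrite mulr0 add0r.
    by rewrite /= modn_small// -natr1; ring.
  have kE : (k i).+1 = (2 * L * n.+1)%N.
    by apply/eqP; rewrite eqn_leq ge ltn_ord.
  rewrite !V0//.
    rewrite !mxE ffunE eqxx /= kE modnn mul0r sub0r normrN.
    by rewrite ler_norm.
  have -> : (mesh n *: e + node k) 0 i = L%:R; last by rewrite ler_norm.
  rewrite !mxE !eqxx /= mulr1.
  have -> : mesh n + ((k i)%:R * mesh n - L%:R) = (k i).+1%:R * mesh n - L%:R.
    by rewrite -natr1; ring.
  by rewrite kE !natrM /mesh mulfK ?pnatr_eq0//; ring.
move=> e' e'0.
near=> n.
have h0 := mesh_gt0 n.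
apply: (@le_trans _ _ (riemann_sum n (fun=> M * mesh n))).
  rewrite ler_pM2l ?exprn_gt0// -(ler_pM2r h0) !mulr_suml.
  apply: (@le_trans _ _ (\sum_k (pd i V (@node n k) * mesh n -
      (V (mesh n *: e + node k) - V (node k))))).
    by rewrite sumrB tele subr0.
  apply: ler_sum => k _.
  by rewrite (le_trans (ler_norm _))// (le_trans (quot n k))// expr2 mulrA.
rewrite riemann_sum1 mulrA; set C := _ * M.
have C0 : 0 <= C by rewrite mulr_ge0 ?exprn_ge0// ltW.
rewrite (@le_trans _ _ ((C + 1) * mesh n))// ?ler_wpM2r ?lerDl ?(ltW h0)//.
rewrite ler_pdivrMr// -ler_pdivrMl// ltW//.
rewrite (@lt_le_trans _ _ n%:R)// ?ler_nat//.
by near: n; exact: nbhs_infty_gtr.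
Unshelve. all: by end_near. Qed.

(** Once the mesh is below s/4, a subcube of the ball carries at least s/(4 mesh) nodes per axis,
    each contributing at least [c]; this gives the bound $c(s/4)^m$. *)
Lemma riemann_sum_pos F (x0 : 'rV[R]_m) r c : (forall x, 0 <= F x) -> 0 < r -> 0 < c ->
  (forall x, ball x0 r x -> c <= F x) -> (forall i, `|x0 0 i| < L%:R) ->
  exists2 c0, 0 < c0 & \forall n \near \oo, c0 <= riemann_sum n F.
move=> F0 r_0 c_0 Fc xL.
have [s s0 [sr sL]] : exists2 s, 0 < s & s <= r /\ forall i, `|x0 0 i| + s <= L%:R.
  have : \forall s \near 0^'+, s <= r /\ forall i, `|x0 0 i| + s <= L%:R.
    have H1 : \forall s \near 0^'+, s <= r by exact: nbhs_right_le.
    have H2 : \forall s \near 0^'+, forall i, `|x0 0 i| + s <= L%:R; last exact: filterI.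
    apply: filter_forall => i; have : 0 < L%:R - `|x0 0 i| by rewrite subr_gt0.
    by move=> /nbhs_right_le; apply: filterS => s; rewrite lerBrDl.
  move=> H; near (0 : R)^'+ => s; exists s; first by near: s; exact: nbhs_right_gt.
  by near: s.
exists (c * (s / 4) ^+ m); first by rewrite mulr_gt0// exprn_gt0//; lra.
near=> n.
have h0 := mesh_gt0 n.
have n1 : (n.+1%:R : R) * mesh n = 1 by rewrite mulfV.
have h4 : mesh n <= s / 4.
  rewrite -[s / 4]invrK lef_pV2 ?posrE ?invr_gt0//; last lra.
  rewrite (@le_trans _ _ n%:R)// ?ler_nat// ltW//.
  by near: n; exact: nbhs_infty_gtr.
pose y i := x0 0 i + L%:R.
have y0 i : 0 <= y i by have := xL i; rewrite ltr_norml /y => /andP[? ?]; lra.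
(* Index of the last grid coordinate not exceeding that of [x0]; the [q] next ones in each direction
   stay within distance [s]. *)
pose k0 i := Num.truncn (y i * n.+1%:R).
have k0P i : (k0 i)%:R * mesh n <= y i < (k0 i)%:R * mesh n + mesh n.
  have := truncn_itv (mulr_ge0 (y0 i) (ler0n R n.+1)).
  rewrite -/(k0 i) -(ler_pM2r h0) -(ltr_pM2r h0) -mulrA n1 mulr1 -natr1.
  by rewrite mulrDl mul1r.
have [s2 s2E] : exists s2, s2 = s / 2 by exists (s / 2).
have s20 : 0 <= s2 by lra.
pose q := Num.truncn (s2 * n.+1%:R).
have qP : q%:R * mesh n <= s2 < q%:R * mesh n + mesh n.
  have := truncn_itv (mulr_ge0 s20 (ler0n R n.+1)).
  rewrite -/q -(ler_pM2r h0) -(ltr_pM2r h0) -mulrA n1 mulr1 -natr1.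
  by rewrite mulrDl mul1r.
have lt_q (j : 'I_q) : (j%:R + 1) * mesh n <= q%:R * mesh n.
  by rewrite ler_pM2r// natr1 ler_nat.
have ltN i (j : 'I_q) : (k0 i + j < 2 * L * n.+1)%N.
  rewrite -(ltr_nat R) -(ltr_pM2r h0) natrD !natrM -mulrA n1 mulr1 mulrDl.
  have /andP[? ?] := k0P i; have /andP[? ?] := qP; have := lt_q j.
  have yE : y i = x0 0 i + L%:R by [].
  have := sL i; have := ler_norm (x0 0 i); lra.
pose g (j : {ffun 'I_m -> 'I_q}) : {ffun 'I_m -> 'I_(2 * L * n.+1)} :=
  [ffun i => Ordinal (ltN i (j i))].
have g_inj : injective g.
  move=> j j' /ffunP jj; apply/ffunP => i; have := jj i; rewrite !ffunE.
  by move=> /(congr1 val) /= /addnI /val_inj.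
rewrite /riemann_sum (bigID (fun k => k \in [set g j | j in [set: {ffun 'I_m -> 'I_q}]]%SET)) /=.
rewrite mulrDr; apply: ler_wpDr.
  by apply: mulr_ge0; [rewrite exprn_ge0// ltW|apply: sumr_ge0].
rewrite big_imset /=; last by move=> ? ? _ _; exact: g_inj.
apply: (@le_trans _ _ (mesh n ^+ m * \sum_(j in [set: {ffun 'I_m -> 'I_q}]%SET) c)).
  rewrite sumr_const cardsT card_ffun !card_ord -[c *+ _]mulr_natr natrX mulrCA.
  rewrite ler_pM2l// -exprMn; have /andP[? ?] := qP.
  by apply: lerXn2r; rewrite ?nnegrE ?mulr_ge0 ?(ltW h0)//; lra.
rewrite ler_pM2l ?exprn_gt0//; apply: ler_sum => j _; apply: Fc.
apply: (le_ball sr); rewrite -ball_normE /=; apply: mx_norm_lt => // a i.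
rewrite !ord1 !mxE ffunE /= natrD mulrDl.
have /andP[? ?] := k0P i; have /andP[? ?] := qP; have := lt_q (j i).
have : 0 <= (j i)%:R * mesh n by rewrite mulr_ge0// ltW.
have yE : y i = x0 0 i + L%:R by [].
rewrite ltr_norml => ? ?; apply/andP; split; lra.
Unshelve. all: by end_near. Qed.

End RiemannSums.

(** * Operators in divergence form and the Carleman multiplier identity *)

Section DivergenceForm.
Variables (R : realType) (m : nat) (U : set 'rV[R]_m).
Hypothesis oU : open U.
Variable a : 'rV[R]_m -> 'M[R]_m.
Hypothesis sa : Coo U a.
Hypothesis asym : forall u, U u -> (a u)^T = a u.
Implicit Types f h w psi : 'rV[R]_m -> R.

(** In the application [a] is the inverse of a metric. The divergence is the one of Lebesgue
    measure, so that sums over a grid apply; its discrepancy with the Laplacian is of first order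
    and is carried by the coefficients [beta] of the equation below. *)
Definition flux f i u : R := \sum_j a u i j * pd j f u.
Definition gradp f h u : R := \sum_i flux f i u * pd i h u.
Definition divop f u : R := \sum_i pd i (flux f i) u.

Let sM := @smoothM R m U oU.
Let sD f h := @smoothD R m U oU _ f h.

Let aE u i j : U u -> a u i j = a u j i.
by move=> Uu; rewrite -{1}(asym Uu) mxE. Qed.

Lemma sm_flux f i : Coo U f -> Coo U (flux f i).
move=> sf; apply: sm_sum => // j; apply: sM; last exact: sm_pd.
exact: sm_coord.
Qed.

Lemma sm_gradp f h : Coo U f -> Coo U h -> Coo U (gradp f h).
move=> sf sh; apply: sm_sum => // j; apply: sM; last exact: sm_pd.
exact: sm_flux.
Qed.

Lemma sm_divop f : Coo U f -> Coo U (divop f).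
by move=> sf; apply: sm_sum => // j; apply/sm_pd/sm_flux. Qed.

Lemma gradpC f h u : U u -> gradp f h u = gradp h f u.
move=> Uu; rewrite /gradp; under eq_bigr do rewrite mulr_suml.
under [RHS]eq_bigr do rewrite mulr_suml.
rewrite exchange_big; eqbig j; eqbig i.
by rewrite (aE j i Uu) mulrAC.
Qed.

Lemma gradpM f h k u : U u -> Coo U h -> Coo U k ->
  gradp f (fun v => h v * k v) u = h u * gradp f k u + k u * gradp f h u.
move=> Uu sh sk; rewrite /gradp !mulr_sumr -big_split; apply: eq_bigr => i _ /=.
by rewrite (pdM Uu)//; ring.
Qed.

Lemma gradpD f h k u : U u -> Coo U h -> Coo U k ->
  gradp f (fun v => h v + k v) u = gradp f h u + gradp f k u.
move=> Uu sh sk; rewrite /gradp -big_split; apply: eq_bigr => i _ /=.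
by rewrite (pdD Uu)//; ring.
Qed.

Lemma fluxM f h i u : U u -> Coo U f -> Coo U h ->
  flux (fun v => f v * h v) i u = f u * flux h i u + h u * flux f i u.
move=> Uu sf sh; rewrite /flux !mulr_sumr -big_split; apply: eq_bigr => j _ /=.
by rewrite (pdM Uu)//; ring.
Qed.

Lemma div_flux f h u : U u -> Coo U f -> Coo U h ->
  \sum_i pd i (fun v => f v * flux h i v) u = gradp h f u + f u * divop h u.
move=> Uu sf sh; rewrite /gradp /divop mulr_sumr -big_split /=.
eqbig i; rewrite (pdM Uu)//; last exact: sm_flux.
ring.
Qed.

Lemma divopM f h u : U u -> Coo U f -> Coo U h ->
  divop (fun v => f v * h v) u =
  f u * divop h u + 2 * gradp f h u + h u * divop f u.
move=> Uu sf sh.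
have sF := sm_flux; have E i : pd i (flux (fun v => f v * h v) i) u =
   pd i (fun v => f v * flux h i v) u + pd i (fun v => h v * flux f i v) u.
  rewrite -(pdD Uu); [|by apply: sM => //; exact: sF|by apply: sM => //; exact: sF].
  by apply: (pd_ext oU _ Uu) => v Uv; rewrite fluxM.
transitivity (\sum_i (pd i (fun v => f v * flux h i v) u +
    pd i (fun v => h v * flux f i v) u)).
  by eqbig i; exact: E.
transitivity (gradp h f u + f u * divop h u + (gradp f h u + h u * divop f u)).
  rewrite big_split /=.
  by congr (_ + _); [exact: (div_flux Uu sf sh)|exact: (div_flux Uu sh sf)].
rewrite (gradpC h f Uu).
by move: (gradp f h u) (divop h u) (divop f u) => x y z; ring.
Qed.

(* Twice the Hessian of [psi] on the gradient of [w], up to first-order terms. *)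
Definition hessq psi w u : R :=
  2 * (\sum_i flux w i u * \sum_k pd i (flux psi k) u * pd k w u)
  - \sum_k flux psi k u * \sum_i \sum_j pd k (fun v => a v i j) u * pd i w u * pd j w u.

(** The second derivatives of [w] occur in both terms and cancel, by the symmetry of [a] and of
    second derivatives; only first derivatives of [w] survive. *)
Lemma hessq_gradp psi w u : U u -> Coo U psi -> Coo U w ->
  2 * gradp w (gradp psi w) u - gradp psi (gradp w w) u = hessq psi w u.
move=> Uu sp sw.
have E1 i : pd i (gradp psi w) u = (\sum_k pd i (flux psi k) u * pd k w u) +
    \sum_k flux psi k u * pd i (pd k w) u.
  rewrite (pd_sum oU Uu); last first.
    by move=> k; apply: sM; [exact: sm_flux|exact: sm_pd].
  rewrite -big_split; apply: eq_bigr => k _ /=.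
  by rewrite (pdM Uu)//; [exact: sm_flux|exact: sm_pd].
have E2 k : pd k (gradp w w) u =
    (\sum_i \sum_j pd k (fun v => a v i j) u * pd i w u * pd j w u) +
    2 * \sum_i flux w i u * pd k (pd i w) u.
  have Ef i : pd k (flux w i) u = \sum_j (pd k (fun v => a v i j) u * pd j w u +
      a u i j * pd k (pd j w) u).
    rewrite (pd_sum oU Uu); last first.
      by move=> j; apply: sM; [exact: sm_coord|exact: sm_pd].
    eqbig j.
    by rewrite (pdM Uu)//; [exact: sm_coord|exact: sm_pd].
  rewrite (pd_sum oU Uu); last first.
    by move=> i; apply: sM; [exact: sm_flux|exact: sm_pd].
  transitivity (\sum_i (\sum_j pd k (fun v => a v i j) u * pd i w u * pd j w u +
    \sum_j a u i j * pd k (pd j w) u * pd i w u + flux w i u * pd k (pd i w) u)).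
    eqbig i.
    rewrite (pdM Uu)//; [|exact: sm_flux|exact: sm_pd].
    rewrite Ef mulr_suml -big_split; congr (_ + _); apply: eq_bigr => j _ /=.
    by rewrite mulrDl mulrAC.
  rewrite !big_split /= -addrA; congr (_ + _).
  rewrite mulrDl mul1r; congr (_ + _).
  rewrite exchange_big; eqbig j; rewrite mulr_suml.
  eqbig i.
  by rewrite (aE i j Uu) mulrAC.
have H1 : gradp w (gradp psi w) u =
    \sum_i flux w i u * (\sum_k pd i (flux psi k) u * pd k w u) +
    \sum_i flux w i u * (\sum_k flux psi k u * pd i (pd k w) u).
  rewrite -big_split; apply: eq_bigr => i _ /=.
  by rewrite -mulrDr; congr (_ * _); exact: E1.
have H2 : gradp psi (gradp w w) u =
    \sum_k flux psi k u *
      (\sum_i \sum_j pd k (fun v => a v i j) u * pd i w u * pd j w u) +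
    \sum_k flux psi k u * (2 * \sum_i flux w i u * pd k (pd i w) u).
  rewrite -big_split; apply: eq_bigr => k _ /=.
  by rewrite -mulrDr; congr (_ * _); exact: E2.
rewrite H1 H2 /hessq mulrDr opprD addrACA.
suff -> : 2 * (\sum_i flux w i u * \sum_k flux psi k u * pd i (pd k w) u) -
  \sum_i flux psi i u * (2 * \sum_i0 flux w i0 u * pd i (pd i0 w) u) = 0.
  by rewrite addr0.
apply/eqP; rewrite subr_eq0; apply/eqP; rewrite mulr_sumr.
transitivity (\sum_i \sum_k 2 * (flux w i u * (flux psi k u * pd i (pd k w) u))).
  by eqbig i; rewrite !mulr_sumr.
rewrite exchange_big; eqbig k; rewrite !mulr_sumr.
eqbig i; rewrite (pdC oU i k Uu sw).
by rewrite [RHS]mulrCA; congr (2 * _); rewrite mulrCA.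
Qed.

Local Opaque flux gradp divop hessq.

Section Multiplier.
Variables (psi w ga : 'rV[R]_m -> R) (t : R).
Hypotheses (sp : Coo U psi) (sw : Coo U w) (sg : Coo U ga).

(** The first four terms come from integrating by parts twice the product of
    $S=\mathrm{div}\,w+t^2|d\psi|^2w$ and $A=-2t\langle d\psi,dw\rangle-t\,\mathrm{div}(\psi)w$, the
    symmetric and antisymmetric parts of the conjugated operator. The fifth comes from pairing $S$
    with $\gamma w$. *)
Definition mult_field i u : R :=
  (- 4 * t) * (gradp psi w u * flux w i u)
  + (2 * t) * (gradp w w u * flux psi i u)
  + (- 2 * t) * ((divop psi u * w u) * flux w i u)
  + (- 2 * t ^+ 3) * ((gradp psi psi u * (w u * w u)) * flux psi i u)
  + (- 4 * t) * ((ga u * w u) * flux w i u).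

(** The operator conjugated by the weight, $e^{t\psi}\,\mathrm{div}(e^{-t\psi}w)$ with div standing
    for [divop]; see [carleman_op_expw]. *)
Definition carleman_op u : R :=
  divop w u + t ^+ 2 * gradp psi psi u * w u
  - 2 * t * gradp psi w u - t * divop psi u * w u.

Lemma sm_mult_field i : Coo U (mult_field i).
have sdv := sm_divop sp.
by repeat first [exact: sp|exact: sw|exact: sg|exact: sdv|apply: sm_cst
  |apply: sm_gradp|apply: sm_flux|apply: sM|apply: sD].
Qed.

Lemma div_mult_field u : U u ->
  \sum_i pd i (mult_field i) u =
  2 * (divop w u + t ^+ 2 * gradp psi psi u * w u)
    * (- 2 * t * gradp psi w u - t * divop psi u * w u)
  - 4 * t * ga u * w u * (divop w u + t ^+ 2 * gradp psi psi u * w u)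
  - 2 * t * hessq psi w u - 2 * t * w u * gradp w (divop psi) u
  - 2 * t ^+ 3 * w u ^+ 2 * gradp psi (gradp psi psi) u
  - 4 * t * ga u * gradp w w u - 4 * t * w u * gradp w ga u
  + 4 * t ^+ 3 * ga u * gradp psi psi u * w u ^+ 2.
move=> Uu.
have sdv := sm_divop sp.
have sGpw := sm_gradp sp sw; have sGww := sm_gradp sw sw.
have sGpp := sm_gradp sp sp.
have sc c : Coo U (fun=> c : R) by exact: sm_cst.
have sF f h i c : Coo U f -> Coo U h ->
    Coo U (fun v => c * (f v * flux h i v)).
  by move=> sf sh; apply: sM => //; apply: sM => //; exact: sm_flux.
have dF f h c : Coo U f -> Coo U h ->
    \sum_i pd i (fun v => c * (f v * flux h i v)) u =
    c * (gradp h f u + f u * divop h u).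
  move=> sf sh; rewrite -div_flux// mulr_sumr; eqbig i.
  rewrite (pdM Uu)//; last by apply: sM => //; exact: sm_flux.
  by rewrite pd_cst mul0r add0r.
have s1 : Coo U (fun v => divop psi v * w v) by exact: sM.
have s2 : Coo U (fun v => w v * w v) by exact: sM.
have s3 : Coo U (fun v => gradp psi psi v * (w v * w v)) by exact: sM.
have s4 : Coo U (fun v => ga v * w v) by exact: sM.
have -> : \sum_i pd i (mult_field i) u =
    \sum_i pd i (fun v => (- 4 * t) * (gradp psi w v * flux w i v)) u
  + \sum_i pd i (fun v => (2 * t) * (gradp w w v * flux psi i v)) u
  + \sum_i pd i (fun v => (- 2 * t) * ((divop psi v * w v) * flux w i v)) u
  + \sum_i pd i (fun v => (- 2 * t ^+ 3) *
       ((gradp psi psi v * (w v * w v)) * flux psi i v)) u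
  + \sum_i pd i (fun v => (- 4 * t) * ((ga v * w v) * flux w i v)) u.
  rewrite -!big_split /=; eqbig i.
  rewrite (pdD Uu); [|by repeat (apply: sD || apply: sF)|exact: sF].
  rewrite (pdD Uu); [|by repeat (apply: sD || apply: sF)|exact: sF].
  rewrite (pdD Uu); [|by repeat (apply: sD || apply: sF)|exact: sF].
  by rewrite (pdD Uu); [|exact: sF|exact: sF].
have addE (x x' y y' : R) : x = x' -> y = y' -> x + y = x' + y' by move=> -> ->.
rewrite [LHS](addE _ _ _ _ (addE _ _ _ _ (addE _ _ _ _ (addE _ _ _ _
  (dF _ _ _ sGpw sw) (dF _ _ _ sGww sp)) (dF _ _ _ s1 sw)) (dF _ _ _ s3 sp))
  (dF _ _ _ s4 sw)).
rewrite (gradpM _ Uu sdv sw) (gradpM _ Uu sGpp s2) (gradpM _ Uu sw sw) (gradpM _ Uu sg sw).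
rewrite -(hessq_gradp Uu sp sw).
move: (gradp w (gradp psi w) u) (gradp psi (gradp w w) u) (gradp w (divop psi) u)
  (gradp psi w u) (gradp w w u) (divop psi u) (divop w u) (gradp psi psi u)
  (gradp psi (gradp psi psi) u) (gradp w ga u) (w u) (ga u) => *; ring.
Qed.

(** In terms of the parts $S$ and $A$, the left side is $2SA-4t\gamma wS-4t^2\gamma^2w^2$ by
    [div_mult_field], so the difference of the two sides is the sum of squares $(S+2t\gamma
    w)^2+A^2$. *)
Lemma carleman_pointwise u : U u ->
  \sum_i pd i (mult_field i) u + 2 * t * hessq psi w u
  + 2 * t * w u * gradp w (divop psi) u + 4 * t * w u * gradp w ga u
  + 4 * t * ga u * gradp w w u
  + (2 * t ^+ 3 * (gradp psi (gradp psi psi) u - 2 * ga u * gradp psi psi u)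
     - 4 * t ^+ 2 * ga u ^+ 2) * w u ^+ 2
  <= carleman_op u ^+ 2.
move=> Uu; rewrite (div_mult_field Uu) /carleman_op -subr_ge0.
set P := divop w u; set q := gradp psi psi u; set S := gradp psi w u.
set th := divop psi u.
rewrite (_ : _ - _ = (P + t ^+ 2 * q * w u + 2 * t * ga u * w u) ^+ 2 +
  (- 2 * t * S - t * th * w u) ^+ 2); last by ring.
by rewrite addr_ge0 ?sqr_ge0.
Qed.

End Multiplier.

End DivergenceForm.

(** * Weights that are exponentials of a given function *)

Section ExponentialWeight.
Variables (R : realType) (m : nat) (U : set 'rV[R]_m).
Hypothesis oU : open U.
Variable a : 'rV[R]_m -> 'M[R]_m.
Hypothesis sa : Coo U a.
Hypothesis asym : forall u, U u -> (a u)^T = a u.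
Variables (rho : 'rV[R]_m -> R) (s : R).
Hypothesis srho : Coo U rho.
Notation gr := (gradp a).
Notation dv := (divop a).
Notation fl := (flux a).
Notation psi := (fun x => expR (s * rho x)).

Let sM := @smoothM R m U oU.
Let sc (c : R) : Coo U (fun=> c). exact: sm_cst. Qed.
Let ssrho : Coo U (fun x => s * rho x). exact: sM. Qed.
Let spsi : Coo U psi. exact: sm_expR. Qed.

Lemma pd_expw i u : U u -> pd i psi u = s * psi u * pd i rho u.
move=> Uu; rewrite (pd_expR ssrho Uu) (pdM Uu (sc s) srho) pd_cst.
by rewrite mul0r add0r mulrA [_ * s]mulrC.
Qed.

Lemma flux_expw i u : U u -> fl psi i u = s * psi u * fl rho i u.
move=> Uu; rewrite /flux mulr_sumr; eqbig j.
by rewrite (pd_expw _ Uu) mulrCA.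
Qed.

Lemma gradp_expwl (f : 'rV[R]_m -> R) u : U u -> gr psi f u = s * psi u * gr rho f u.
move=> Uu; rewrite /gradp mulr_sumr; eqbig j.
by rewrite (flux_expw _ Uu) mulrA.
Qed.

Lemma gradp_expwr (f : 'rV[R]_m -> R) u : U u -> gr f psi u = s * psi u * gr f rho u.
move=> Uu; rewrite /gradp mulr_sumr; eqbig j.
by rewrite (pd_expw _ Uu) mulrCA.
Qed.

Lemma divop_expw u : U u ->
  dv psi u = s * psi u * (dv rho u + s * gr rho rho u).
move=> Uu.
have sf : Coo U (fun x => s * psi x) by exact: sM.
transitivity (\sum_i pd i (fun v => (s * psi v) * fl rho i v) u).
  by eqbig i; apply: (pd_ext oU _ Uu) => v Uv; rewrite flux_expw.
rewrite [LHS](div_flux oU sa Uu sf srho).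
rewrite (gradpM _ _ Uu (sc s) spsi) (gradp_expwr _ Uu).
have -> : gr rho (fun=> s) u = 0.
  by rewrite /gradp big1// => i _; rewrite pd_cst mulr0.
ring.
Qed.

(** Passing from [rho] to its exponential adds a square with factor [2 * s], so a lower bound for
    [rho] remains one for the weight. *)
Lemma hessq_expw (w : 'rV[R]_m -> R) u : U u -> Coo U w ->
  hessq a psi w u = s * psi u * (hessq a rho w u + 2 * s * gr rho w u ^+ 2).
move=> Uu sw.
have E i k : pd i (fl psi k) u =
    s * psi u * (pd i (fl rho k) u + s * (pd i rho u * fl rho k u)).
  have sf : Coo U (fun x => s * psi x) by exact: sM.
  rewrite (pd_ext oU (g := fun v => (s * psi v) * fl rho k v) _ Uu).
    rewrite (pdM Uu sf (sm_flux oU sa k srho)) (pdM Uu (sc s) spsi).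
    rewrite pd_cst (pd_expw _ Uu); ring.
  by move=> v Uv; rewrite flux_expw.
have H1 : \sum_i fl w i u * (\sum_k pd i (fl psi k) u * pd k w u) =
   s * psi u * (\sum_i fl w i u * (\sum_k pd i (fl rho k) u * pd k w u) +
     s * gr rho w u ^+ 2).
  rewrite expr2 -{1}(gradpC asym w rho Uu) {1}/gradp mulr_suml mulr_sumr -big_split /=.
  rewrite mulr_sumr; eqbig i.
  have H0 : \sum_k pd i (fl psi k) u * pd k w u = s * psi u *
      (\sum_k pd i (fl rho k) u * pd k w u + s * (pd i rho u * gr rho w u)).
    rewrite /gradp mulr_sumr mulr_sumr -big_split mulr_sumr /=; eqbig k.
    rewrite (E i k).
    by move: (pd i (fl rho k) u) (fl rho k u) (pd i rho u) (pd k w u) (expR _) => *; ring.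
  apply: (etrans (congr1 (fun x => fl w i u * x) H0)).
  move: (\sum_k _) (gr rho w u) (fl w i u) (pd i rho u) (expR _) => *; ring.
have H2 : \sum_k fl psi k u * (\sum_i \sum_j pd k (fun v => a v i j) u * pd i w u * pd j w u)
  = s * psi u * \sum_k fl rho k u * (\sum_i \sum_j pd k (fun v => a v i j) u * pd i w u * pd j w u).
  by rewrite mulr_sumr; eqbig k; rewrite (flux_expw _ Uu) mulrA.
have aux (A B g p : R) : 2 * (s * p * (A + s * g ^+ 2)) - s * p * B =
    s * p * ((2 * A - B) + 2 * s * g ^+ 2) by ring.
exact: (etrans (congr2 (fun x y => 2 * x - y) H1 H2) (aux _ _ _ _)).
Qed.

(** The term $2s|d\rho|^4$ can be made as large as desired by the choice of [s]; this is why the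
    weight is an exponential. *)
Lemma gradp_gradp_expw u : U u ->
  gr psi (gr psi psi) u =
  (s * psi u) ^+ 3 * (2 * s * gr rho rho u ^+ 2 + gr rho (gr rho rho) u).
move=> Uu; rewrite (gradp_expwl _ Uu).
have sk := sm_gradp oU sa srho srho.
have spp : Coo U (fun v => psi v * psi v) by exact: sM.
have sf : Coo U (fun v => s ^+ 2 * (psi v * psi v)) by exact: sM.
have -> : gr rho (gr psi psi) u =
    gr rho (fun v => (s ^+ 2 * (psi v * psi v)) * gr rho rho v) u.
  eqbig i; congr (_ * _); apply: (pd_ext oU _ Uu) => v Uv.
  by rewrite (gradp_expwl _ Uv) (gradp_expwr _ Uv); ring.
rewrite (gradpM _ _ Uu sf sk) (gradpM _ _ Uu (sc _) spp) (gradpM _ _ Uu spsi spsi).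
rewrite (gradp_expwr _ Uu).
have -> : gr rho (fun=> s ^+ 2) u = 0.
  by rewrite /gradp big1// => i _; rewrite pd_cst mulr0.
ring.
Qed.

Lemma carleman_op_expw (v : 'rV[R]_m -> R) u : U u -> Coo U v ->
  carleman_op a rho (fun x => psi x * v x) s u = psi u * dv v u.
move=> Uu sv; rewrite /carleman_op (divopM oU sa asym Uu spsi sv).
rewrite (gradpM _ _ Uu spsi sv) (gradp_expwr _ Uu) (gradp_expwl _ Uu) (divop_expw Uu).
move: (expR _) (dv v u) (gr rho v u) (gr rho rho u) (dv rho u) (v u) => *; ring.
Qed.

Lemma gradp_conj (v : 'rV[R]_m -> R) u : U u -> Coo U v ->
  gr (fun x => psi x * v x) (fun x => psi x * v x) u =
  psi u ^+ 2 * (gr v v u + 2 * s * v u * gr rho v u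
    + s ^+ 2 * v u ^+ 2 * gr rho rho u).
move=> Uu sv; rewrite (gradpM _ _ Uu spsi sv).
have sw : Coo U (fun x => psi x * v x) by exact: sM.
rewrite !(gradpC asym (fun x => psi x * v x) _ Uu).
rewrite !(gradpM _ _ Uu spsi sv) (gradp_expwl _ Uu) !(gradp_expwr _ Uu) (gradp_expwl _ Uu).
rewrite (gradpC asym v rho Uu); ring.
Qed.

End ExponentialWeight.

(** * Uniform bounds on compact sets and bounds from ellipticity *)

Section SmoothBounds.
Variables (R : realType) (m : nat) (U K : set 'rV[R]_m).
Hypotheses (cK : compact K) (KU : K `<=` U).
Implicit Types f : 'rV[R]_m -> R.

Lemma sm_bounded f : Coo U f ->
  exists2 C, 0 < C & forall x, K x -> `|f x| <= C.
by move=> sf; exact: (cont_compact_bounded cK (fun x Kx => sm_cont sf (KU Kx))).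
Qed.

Lemma sm_pos_bound f : Coo U f -> (forall x, K x -> 0 < f x) ->
  exists2 c, 0 < c & forall x, K x -> c <= f x.
move=> sf f0.
have cV x : K x -> {for x, continuous (fun x => (f x)^-1)}.
  move=> Kx; apply: continuousV; first by rewrite gt_eqF ?f0.
  exact: (sm_cont sf (KU Kx)).
have [C C0 CP] := cont_compact_bounded cK cV.
exists C^-1; first by rewrite invr_gt0.
move=> x Kx; rewrite -[f x]invrK lef_pV2 ?posrE ?invr_gt0 ?f0//.
by rewrite (le_trans (ler_norm _) (CP x Kx)).
Qed.

End SmoothBounds.

Section ZeroOnOpen.
Variables (R : realType) (m : nat) (O : set 'rV[R]_m).
Hypothesis openO : open O.
Variable w : 'rV[R]_m -> R.
Hypothesis w0 : forall x, O x -> w x = 0.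

Lemma pd_zero i u : O u -> pd i w u = 0.
by move=> Ou; rewrite (pd_ext openO w0 Ou) pd_cst. Qed.

Variables (a : 'rV[R]_m -> 'M[R]_m) (psi ga : 'rV[R]_m -> R) (t : R).

Lemma mult_field_zero i u : O u -> mult_field a psi w ga t i u = 0.
move=> Ou.
have f0 j : flux a w j u = 0 by rewrite /flux big1// => k _; rewrite pd_zero// mulr0.
have g0 f : gradp a f w u = 0 by rewrite /gradp big1// => k _; rewrite pd_zero// mulr0.
by rewrite /mult_field f0 !g0 w0// !(mulr0, mul0r, addr0).
Qed.

End ZeroOnOpen.

Section QuadraticForm.
Variables (R : realType) (m : nat) (a : 'rV[R]_m -> 'M[R]_m) (U : set 'rV[R]_m).
Hypothesis asym : forall u, U u -> (a u)^T = a u.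
Hypothesis apsd : forall u (xi : 'I_m -> R), U u ->
  0 <= \sum_i (\sum_j a u i j * xi j) * xi i.

Lemma gradp_ge0 f u : U u -> 0 <= gradp a f f u.
by move=> Uu; exact: apsd. Qed.

(** Nonnegativity of the form on the combination $x\,df+y\,dh$; it stands in for the Cauchy-Schwarz
    inequality and avoids square roots. *)
Lemma gradp_psd f h x y u : U u ->
  0 <= x ^+ 2 * gradp a f f u + 2 * x * y * gradp a f h u + y ^+ 2 * gradp a h h u.
move=> Uu; have := apsd (fun j => x * pd j f u + y * pd j h u) Uu.
suff -> : \sum_i (\sum_j a u i j * (x * pd j f u + y * pd j h u)) *
    (x * pd i f u + y * pd i h u) =
  x * (x * gradp a f f u + y * gradp a f h u) +
  y * (x * gradp a h f u + y * gradp a h h u).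
  by rewrite (gradpC asym h f Uu) => H; apply: (le_trans H); rewrite le_eqVlt; apply/orP; left; apply/eqP; ring.
have E i : \sum_j a u i j * (x * pd j f u + y * pd j h u) =
    x * flux a f i u + y * flux a h i u.
  by rewrite /flux !mulr_sumr -big_split; apply: eq_bigr => j _ /=; ring.
transitivity (\sum_i (x * flux a f i u + y * flux a h i u) *
    (x * pd i f u + y * pd i h u)).
  by eqbig i; rewrite E.
rewrite /gradp !mulr_sumr -!big_split !mulr_sumr -big_split /=.
eqbig i; move: (flux a f i u) (flux a h i u) (pd i f u) (pd i h u) => *; ring.
Qed.

Variable B : 'rV[R]_m -> R.
Hypothesis ell : forall u (xi : 'I_m -> R) j, U u ->
  xi j ^+ 2 <= B u * \sum_i (\sum_j a u i j * xi j) * xi i.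
Hypothesis B0 : forall u, U u -> 0 < B u.

Lemma pd_le_gradp f j u : U u -> `|pd j f u| <= Num.sqrt (B u * gradp a f f u).
move=> Uu; rewrite -sqrtr_sqr; apply: ler_wsqrtr; exact: (ell (fun j => pd j f u) j Uu).
Qed.

Lemma lin_form_bound (b : 'I_m -> R) e f C u : U u -> 0 <= C ->
  (forall i, `|b i| <= C) -> `|e| <= C ->
  (\sum_i b i * pd i f u + e * f u) ^+ 2 <=
  2 * C ^+ 2 * (m%:R ^+ 2 * B u + 1) * (gradp a f f u + f u ^+ 2).
move=> Uu C0 bC eC.
have G0 := gradp_ge0 f Uu; have Bu := B0 Uu.
set n := Num.sqrt (B u * gradp a f f u).
have n0 : 0 <= n by exact: sqrtr_ge0.
have nE : n ^+ 2 = B u * gradp a f f u by rewrite sqr_sqrtr// mulr_ge0// ltW.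
have H1 : `|\sum_i b i * pd i f u| <= m%:R * C * n.
  rewrite (le_trans (ler_norm_sum _ _ _))// -mulrA mulr_natl -[m in leRHS]card_ord -sumr_const.
  by apply: ler_sum => i _; rewrite normrM ler_pM//; exact: pd_le_gradp.
have H2 : `|e * f u| <= C * `|f u| by rewrite normrM ler_wpM2r.
have H3 : (\sum_i b i * pd i f u + e * f u) ^+ 2 <= (m%:R * C * n + C * `|f u|) ^+ 2.
  rewrite -(real_normK (num_real (\sum_i _ + _))) lerXn2r ?nnegrE//.
    by rewrite addr_ge0 ?mulr_ge0.
  by rewrite (le_trans (ler_normD _ _))// lerD.
apply: (le_trans H3).
have f2 : `|f u| ^+ 2 = f u ^+ 2 by rewrite real_normK// num_real.
have -> : 2 * C ^+ 2 * (m%:R ^+ 2 * B u + 1) * (gradp a f f u + f u ^+ 2) =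
  2 * (m%:R * C * n) ^+ 2 + 2 * (C * `|f u|) ^+ 2 +
  2 * C ^+ 2 * (m%:R ^+ 2 * B u * f u ^+ 2 + gradp a f f u).
  by rewrite !exprMn nE f2; ring.
have : 0 <= (m%:R * C * n - C * `|f u|) ^+ 2 by exact: sqr_ge0.
have : 0 <= 2 * C ^+ 2 * (m%:R ^+ 2 * B u * f u ^+ 2 + gradp a f f u).
  apply: mulr_ge0; first by rewrite mulr_ge0// exprn_ge0.
  by apply: addr_ge0 => //; apply: mulr_ge0 (sqr_ge0 _); apply: mulr_ge0 (ltW Bu); exact: exprn_ge0.
move: (m%:R * C * n) (C * _) (2 * C ^+ 2 * _) => x y z; nra.
Qed.

(* [1 + x ^ 2] replaces [|x|] so that the bound is smooth. *)
Definition hessq_bound (psi : 'rV[R]_m -> R) u : R :=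
  2 * (\sum_i (\sum_j (1 + a u i j ^+ 2)) * (\sum_k (1 + pd i (flux a psi k) u ^+ 2)))
  + \sum_k (1 + flux a psi k u ^+ 2) *
      \sum_i \sum_j (1 + pd k (fun v => a v i j) u ^+ 2).

Lemma hessq_le psi w u : U u ->
  `|hessq a psi w u| <= hessq_bound psi u * B u * gradp a w w u.
move=> Uu.
have G0 := gradp_ge0 w Uu; have Bu := B0 Uu.
set n := Num.sqrt (B u * gradp a w w u).
have n0 : 0 <= n by exact: sqrtr_ge0.
have nE : B u * gradp a w w u = n * n by rewrite -expr2 sqr_sqrtr// mulr_ge0// ltW.
have nx (x : R) : `|x| <= 1 + x ^+ 2.
  by rewrite -(real_normK (num_real x)); have := normr_ge0 x; move: `|x| => y ?; nra.
have wn i : `|pd i w u| <= n by exact: pd_le_gradp.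
have mn (x y : R) : `|x * y| <= `|x| * `|y| by rewrite normrM.
rewrite -mulrA nE /hessq /hessq_bound [leRHS]mulrDl; apply: (le_trans (ler_normB _ _)); apply: lerD.
  rewrite normrM ger0_norm// -mulrA ler_wpM2l// mulr_suml.
  rewrite (le_trans (ler_norm_sum _ _ _))// ler_sum// => i _.
  rewrite normrM mulrACA ler_pM//.
    rewrite /flux mulr_suml (le_trans (ler_norm_sum _ _ _))// ler_sum// => j _.
    by rewrite normrM ler_pM.
  rewrite mulr_suml (le_trans (ler_norm_sum _ _ _))// ler_sum// => j _.
  by rewrite normrM ler_pM.
rewrite mulr_suml (le_trans (ler_norm_sum _ _ _))// ler_sum// => k _.
rewrite normrM -mulrA ler_pM// mulr_suml (le_trans (ler_norm_sum _ _ _))// ler_sum// => i _.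
rewrite mulr_suml (le_trans (ler_norm_sum _ _ _))// ler_sum// => j _.
by rewrite -mulrA !normrM ler_pM// ?ler_pM// mulr_ge0.
Qed.

End QuadraticForm.

Lemma sm_hessq_bound (R : realType) m (U : set 'rV[R]_m) a psi : open U ->
  Coo U a -> Coo U psi -> Coo U (hessq_bound a psi).
move=> oU sa sp.
have s1 f : Coo U f -> Coo U (fun v => 1 + (f v : R) ^+ 2).
  by move=> sf; apply: smoothD => //; [exact: sm_cst|exact: smoothX].
have sF := sm_flux oU sa.
apply: smoothD => //.
  apply: smoothM => //; first exact: sm_cst.
  apply: sm_sum => // i; apply: smoothM => //; apply: sm_sum => // j; apply: s1.
    exact: sm_coord.
  by apply/sm_pd/sF.
apply: sm_sum => // k; apply: smoothM => //; first by apply/s1/sF.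
by apply: sm_sum => // i; apply: sm_sum => // j; apply/s1/sm_pd/sm_coord.
Qed.

(** * The squared Euclidean distance to a point *)

Section SquaredDistance.
Variables (R : realType) (m : nat).
Implicit Types x z : 'rV[R]_m.

Definition sqdist z x : R := \sum_j (x 0 j - z 0 j) ^+ 2.

Lemma sm_sqdist z (U : set 'rV[R]_m) : open U -> Coo U (sqdist z).
move=> oU; apply: sm_sum => // j; apply: smoothX => //; apply: smoothB => //.
  exact: sm_coordX.
exact: sm_cst.
Qed.

Lemma pd_sqdist z i x : pd i (sqdist z) x = 2 * (x 0 i - z 0 i).
have Ux : [set: 'rV[R]_m] x by [].
have sX j : Coo setT (fun y : 'rV[R]_m => y 0 j - z 0 j).
  by apply: smoothB; [exact: openT|apply: sm_coordX; exact: openT|apply: sm_cst; exact: openT].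
have E j : pd i (fun y : 'rV[R]_m => y 0 j - z 0 j) x = (i == j)%:R.
  rewrite (pdB openT Ux); [|apply: sm_coordX; exact: openT|apply: sm_cst; exact: openT].
  by rewrite pd_cst subr0 (pd_coordX openT i j Ux).
have -> : pd i (sqdist z) x =
    \sum_j pd i (fun y : 'rV[R]_m => (y 0 j - z 0 j) * (y 0 j - z 0 j)) x.
  by rewrite -(pd_sum openT Ux)// => j; apply: smoothM => //; exact: openT.
rewrite (bigD1 i)//= big1 => [|j ji]; rewrite (pdM Ux)//.
  by rewrite E eqxx addr0 /= mulr1 mul1r; ring.
by rewrite E eq_sym (negPf ji) /= mulr0 mul0r addr0.
Qed.

Lemma sqdist_ge0 z x : 0 <= sqdist z x.
by apply: sumr_ge0 => j _; exact: sqr_ge0. Qed.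

Lemma sqdist_cont z : continuous (sqdist z).
move=> x; exact: (sm_cont (sm_sqdist z openT)). Qed.

Lemma sqdist_ge z x j : (x 0 j - z 0 j) ^+ 2 <= sqdist z x.
by rewrite /sqdist (bigD1 j)//= lerDl sumr_ge0// => k _; exact: sqr_ge0. Qed.

Lemma open_sqdist_lt z T : open [set x | sqdist z x < T].
rewrite (_ : [set x | _] = sqdist z @^-1` [set t | t < T])//.
apply: open_comp; last exact: open_lt.
by move=> x _; exact: sqdist_cont.
Qed.

Lemma open_sqdist_gt z T : open [set x | T < sqdist z x].
rewrite (_ : [set x | _] = sqdist z @^-1` [set t | T < t])//.
apply: open_comp; last exact: open_gt.
by move=> x _; exact: sqdist_cont.
Qed.

Lemma compact_annulus z T0 T1 : compact [set x | T0 <= sqdist z x <= T1].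
apply: bounded_closed_compact.
  exists (`|z| + (1 + T1)); split; first exact: num_real.
  move=> M MT x /= /andP[_ xT]; rewrite (le_trans _ (ltW MT))//.
  have T10 : 0 <= T1 by rewrite (le_trans (sqdist_ge0 z x)).
  rewrite -[x](subrK z) addrC (le_trans (ler_normD _ _))// lerD//.
  apply: mx_norm_le => [|i j]; first by rewrite addr_ge0.
  rewrite ord1 !mxE; have := le_trans (sqdist_ge z x j) xT.
  rewrite -(real_normK (num_real (_ - _))); have := normr_ge0 (x 0 j - z 0 j).
  move: `|_| => y; nra.
rewrite (_ : [set x | _] = sqdist z @^-1` ([set t | T0 <= t] `&` [set t | t <= T1])).
  apply: closed_comp; first by move=> x _; exact: sqdist_cont.
  by apply: closedI; [exact: closed_ge|exact: closed_le].
by apply/seteqP; split=> x /=; [move=> /andP|move=> [-> ->]].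
Qed.

End SquaredDistance.

Section Arithmetic.
Variable R : realFieldType.
Implicit Types g e w y t k q : R.

Lemma zeta_bound C g a1 a2 b w ga :
  0 <= ga ^+ 2 * g + 2 * ga * w * (a1 + 2 * a2) + w ^+ 2 * b ->
  w ^+ 2 * b <= w ^+ 2 * (C * ga) ->
  ga * (- ga * g - C * w ^+ 2) <= ga * (2 * w * a1 + 4 * w * a2).
lra. Qed.

Lemma conj_bound t k e G y L q ga c :
  t * k * (e * (G + 2 * t * y * L + t ^+ 2 * y ^+ 2 * q)) <=
    t * ga * (e * (G + 2 * t * y * L + t ^+ 2 * y ^+ 2 * q)) ->
  t ^+ 3 * e * y ^+ 2 * (k * q) <= t ^+ 3 * e * y ^+ 2 * c ->
  0 <= t * k / 2 * e * (1 ^+ 2 * G + 2 * 1 * (2 * t * y) * L + (2 * t * y) ^+ 2 * q) ->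
  t * k / 2 * (e * G) <=
    t * ga * (e * (G + 2 * t * y * L + t ^+ 2 * y ^+ 2 * q)) + t ^+ 3 * c * (e * y ^+ 2).
lra. Qed.

Lemma contradictory_bound (a b r C V E : R) : 0 < E -> a = b -> a <= r ->
  (C * V + 1) * E <= b -> r - V * (C * E) <= E / 2 -> False.
by move=> E0 -> br CV rC; lra. Qed.

End Arithmetic.

(** * Unique continuation from a small ball to a larger concentric ball *)

Section UniqueContinuation.
Variables (R : realType) (m : nat) (U : set 'rV[R]_m).
Hypothesis openU : open U.
Variable a : 'rV[R]_m -> 'M[R]_m.
Hypothesis sa : Coo U a.
Hypothesis asym : forall u, U u -> (a u)^T = a u.
Hypothesis apsd : forall u (xi : 'I_m -> R), U u ->
  0 <= \sum_i (\sum_j a u i j * xi j) * xi i.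
Variable B : 'rV[R]_m -> R.
Hypothesis ell : forall u (xi : 'I_m -> R) j, U u ->
  xi j ^+ 2 <= B u * \sum_i (\sum_j a u i j * xi j) * xi i.
Hypothesis B0 : forall u, U u -> 0 < B u.
Hypothesis sB : Coo U B.
Variables (phi mu : 'rV[R]_m -> R) (beta : 'I_m -> 'rV[R]_m -> R).
Hypotheses (sphi : Coo U phi) (smu : Coo U mu).
Hypothesis sbeta : forall i, Coo U (beta i).
Hypothesis phi_eq : forall u, U u ->
  divop a phi u = \sum_i beta i u * pd i phi u + mu u * phi u.
Variables (z : 'rV[R]_m) (T0 T : R).
Hypotheses (T00 : 0 < T0) (TU : forall x, sqdist z x <= T -> U x).
Hypothesis phi0 : forall x, sqdist z x < T0 -> phi x = 0.
Notation d2 := (sqdist z).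
Notation gr := (gradp a).
Notation rho := (fun x => - sqdist z x).

Let K := [set x | T0 <= d2 x <= T].
Let cK : compact K. exact: compact_annulus. Qed.
Let KU : K `<=` U. by move=> x /andP[_ /TU]. Qed.
Let sd : Coo U d2. exact: sm_sqdist. Qed.
Let srho : Coo U rho. exact: smoothN. Qed.
Let sM := @smoothM R m U openU.
Let sc (c : R) : Coo U (fun=> c). exact: sm_cst. Qed.
(** The cutoff has no plateau. It is positive wherever [d2 x < T], so there [phi] is [v / chi] and
    [v] solves an equation of the same type, with coefficients bounded on every smaller ball. This
    replaces the commutator with a cutoff constant near the centre. *)
Let chi (x : 'rV[R]_m) : R := expbump 0 (T - d2 x).
Let v (x : 'rV[R]_m) : R := chi x * phi x.

Let schi : Coo U chi.
by apply: sm_bump => //; apply: smoothB. Qed.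

Let sv : Coo U v. exact: sM. Qed.

(** The annulus avoids the centre, so the differential of the squared distance does not vanish there
    and ellipticity bounds $|d\rho|^2$ below by a positive constant; a large [s] then dominates all
    bounded terms. *)
Let weight_exists : exists (s C0 : R), [/\ 0 < s, 0 < C0,
  (forall x w, K x -> - C0 * gr w w x <= hessq a rho w x) &
  forall x, K x -> 1 <= 2 * s * gr rho rho x ^+ 2 + gr rho (gr rho rho) x
     - 2 * C0 * gr rho rho x].
have sk := sm_gradp openU sa srho srho.
have kpos x : K x -> 0 < gr rho rho x.
  move=> Kx; have Ux := KU Kx; have /andP[T0x _] := Kx.
  have H j : 4 * (x 0 j - z 0 j) ^+ 2 <= B x * gr rho rho x.
    have := ell (fun i => pd i rho x) j Ux; rewrite (pdN Ux sd) pd_sqdist.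
    by rewrite (_ : (- _) ^+ 2 = 4 * (x 0 j - z 0 j) ^+ 2)//; ring.
  have : 4 * d2 x <= m%:R * (B x * gr rho rho x).
    have -> : m%:R * (B x * gr rho rho x) = \sum_(j < m) (B x * gr rho rho x).
      by rewrite sumr_const card_ord mulr_natl.
    rewrite /sqdist mulr_sumr.
    exact: ler_sum.
  have G0 := gradp_ge0 apsd rho Ux.
  rewrite lt_neqAle G0 andbT eq_sym; apply: contraL => /eqP ->.
  by rewrite !mulr0 -ltNge mulr_gt0// (lt_le_trans T00).
have sq2 : Coo U (fun x => hessq_bound a rho x * B x).
  by apply: sM => //; exact: sm_hessq_bound.
have [C0 C00 C0P] := sm_bounded cK KU sq2.
have [k0 k00 k0P] := sm_pos_bound cK KU sk kpos.
have [C2 C20 C2P] := sm_bounded cK KU sk.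
have [C1 C10 C1P] := sm_bounded cK KU (sm_gradp openU sa srho sk).
(* With this [s], the number $2sk_0^2$ equals $1+C_1+2C_0C_2$, which absorbs the other two terms and
   leaves 1. *)
exists ((1 + C1 + 2 * C0 * C2) / (2 * k0 ^+ 2)), C0; split => //.
- by rewrite divr_gt0 ?mulr_gt0 ?exprn_gt0// !addr_gt0// !mulr_gt0.
- move=> x w Kx; have Ux := KU Kx.
  have := hessq_le apsd ell B0 rho w Ux; rewrite ler_norml => /andP[+ _].
  apply: le_trans; rewrite mulNr lerN2 ler_wpM2r ?(gradp_ge0 apsd)//.
  by rewrite (le_trans (ler_norm _))// C0P.
- move=> x Kx.
  have c1 := C1P x Kx; have c2 := C2P x Kx; have k1 := k0P x Kx.
  move: c1 c2; rewrite !ler_norml => /andP[c1 _] /andP[_ c2].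
  have E : 1 + C1 + 2 * C0 * C2 <=
      2 * ((1 + C1 + 2 * C0 * C2) / (2 * k0 ^+ 2)) * gr rho rho x ^+ 2.
    have S0 : 0 <= 1 + C1 + 2 * C0 * C2 by move: C10 C00 C20 => ? ? ?; rewrite addr_ge0 ?mulr_ge0 ?addr_ge0 ?ler01//; exact: ltW.
    move: S0; set S := 1 + _ + _ => S0; have k0n : k0 != 0 by rewrite gt_eqF.
    have -> : 2 * (S / (2 * k0 ^+ 2)) * gr rho rho x ^+ 2 =
        S * (gr rho rho x ^+ 2 / k0 ^+ 2) by field.
    rewrite ler_peMr// ler_pdivlMr ?exprn_gt0// mul1r lerXn2r ?nnegrE ?(ltW k00)//.
    by rewrite (le_trans (ltW k00)).
  have E2 : C0 * gr rho rho x <= C0 * C2 by rewrite ler_wpM2l// ltW.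
  lra.
Qed.

Let inner_bound t1 : t1 < T -> exists2 C, 0 < C &
  forall x, K x -> d2 x <= t1 -> divop a v x ^+ 2 <= C * (gr v v x + v x ^+ 2).
move=> t1T; pose U1 := [set x | d2 x < T].
have oU1 : open U1 by exact: open_sqdist_lt.
have U1U : U1 `<=` U by move=> x /ltW /TU.
have chi_gt0 x : U1 x -> 0 < chi x by move=> Ux; rewrite expbump_gt0// subr_gt0.
have S (f : 'rV[R]_m -> R) : Coo U f -> Coo U1 f := sm_sub U1U.
have sa1 : Coo U1 a := sm_sub U1U sa.
have as1 u : U1 u -> (a u)^T = a u by move=> /U1U; exact: asym.
pose eta x := (chi x)^-1.
have seta : Coo U1 eta.
  by apply: smoothV => //; [exact: S|move=> u /chi_gt0; case: ltgtP].
pose b i x := beta i x + (- 2) * (chi x * flux a eta i x).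
pose e x := \sum_i beta i x * pd i eta x * chi x + mu x + - (chi x * divop a eta x).
have sb i : Coo U1 (b i).
  apply: smoothD => //; first exact: S.
  apply: smoothM => //; first exact: sm_cst.
  by apply: smoothM => //; [exact: S|exact: sm_flux].
have se : Coo U1 e.
  apply: smoothD => //; first apply: smoothD => //; last 2 first.
  - exact: S.
  - by apply: smoothN => //; apply: smoothM => //; [exact: S|exact: sm_divop].
  apply: sm_sum => // i; apply: smoothM => //; last exact: S.
  by apply: smoothM => //; [exact: S|exact: sm_pd].
(* Insert $\varphi=\eta v$ into the equation of [phi] and multiply by [chi]; the coefficients [b]
   and [e] are read off from the result. *)
have Pv x : U1 x -> divop a v x = \sum_i b i x * pd i v x + e x * v x.
  move=> Ux; have Uxx := U1U _ Ux; have c0 := chi_gt0 _ Ux.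
  have sv1 := S _ sv.
  have phiE y : U1 y -> eta y * v y = phi y.
    by move=> Uy; rewrite /eta /v mulKf// gt_eqF// chi_gt0.
  have pdphi i : pd i phi x = eta x * pd i v x + v x * pd i eta x.
    rewrite -(pd_ext oU1 phiE Ux) (pdM Ux seta sv1); ring.
  have dphi : divop a phi x =
      eta x * divop a v x + 2 * gr eta v x + v x * divop a eta x.
    rewrite -(divopM oU1 sa1 as1 Ux seta sv1); eqbig i.
    apply: (pd_ext oU1 _ Ux) => y Uy; eqbig j; congr (_ * _).
    by rewrite (pd_ext oU1 phiE Uy).
  have ce : chi x * eta x = 1 by rewrite /eta mulfV// gt_eqF.
  have := phi_eq Uxx; rewrite dphi -(phiE x Ux).
  have -> : \sum_i beta i x * pd i phi x =
     eta x * (\sum_i beta i x * pd i v x) + v x * (\sum_i beta i x * pd i eta x).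
    rewrite !mulr_sumr -big_split; apply: eq_bigr => i _ /=; rewrite pdphi; ring.
  have -> : \sum_i b i x * pd i v x =
      \sum_i beta i x * pd i v x - 2 * chi x * gr eta v x.
    rewrite /gradp mulr_sumr -sumrB; eqbig i; rewrite /b; ring.
  rewrite /e -mulr_suml.
  move: (\sum_i beta i x * pd i v x) (\sum_i beta i x * pd i eta x) (gr eta v x) (divop a v x)
    (divop a eta x) (v x) (mu x) (chi x) (eta x) ce => A1 A2 g P Q y n c h ce E.
  have -> : P = c * (h * P + 2 * g + y * Q) - 2 * c * g - c * y * Q.
    rewrite -[LHS]mul1r -ce; ring.
  rewrite E; transitivity ((c * h) * (A1 + n * y) + c * y * A2 - 2 * c * g - c * y * Q); first ring.
  rewrite ce; ring.
pose K1 := [set x | T0 <= d2 x <= t1].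
have cK1 : compact K1 by exact: compact_annulus.
have K1U : K1 `<=` U1 by move=> x /andP[_ xt]; exact: le_lt_trans xt t1T.
have K1U' : K1 `<=` U by move=> x /K1U /U1U.
have [CB CB0 CBP] := sm_bounded cK1 K1U' sB.
have [Ce Ce0 CeP] := sm_bounded cK1 K1U se.
have [Cb Cb0 CbP] : exists2 C, 0 < C & forall i x, K1 x -> `|b i x| <= C.
  have H i := sm_bounded cK1 K1U (sb i).
  exists (1 + \sum_i sval (cid2 (H i))).
    by rewrite ltr_pwDl// sumr_ge0// => i _; case: cid2 => /= C /ltW.
  move=> i x Kx; rewrite (bigD1 i)//=; case: (cid2 (H i)) => /= C C0 /(_ x Kx) h.
  have : 0 <= \sum_(j < m | j != i) sval (cid2 (H j)).
    by rewrite sumr_ge0// => j _; case: cid2 => /= C' /ltW.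
  lra.
pose C := Num.max Ce Cb.
have CC : 0 < C by rewrite lt_max Ce0.
exists (2 * C ^+ 2 * (m%:R ^+ 2 * CB + 1)).
  rewrite !mulr_gt0 ?exprn_gt0// ltr_wpDl// mulr_ge0 ?exprn_ge0// ltW//.
move=> x /andP[xT0 _] xt1; have Kx : K1 x by apply/andP.
have Ux := K1U' x Kx.
rewrite Pv; last exact: K1U.
have bC i : `|b i x| <= C by rewrite (le_trans (CbP i x Kx))// le_max lexx orbT.
have eC : `|e x| <= C by rewrite (le_trans (CeP x Kx))// le_max lexx.
apply: (le_trans (lin_form_bound apsd ell B0 v Ux (ltW CC) bC eC)).
rewrite ler_wpM2r ?addr_ge0 ?sqr_ge0 ?(gradp_ge0 apsd)//.
rewrite ler_wpM2l ?mulr_ge0 ?exprn_ge0 ?(ltW CC)// lerD2r ler_wpM2l ?exprn_ge0//.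
by rewrite (le_trans (ler_norm _) (CBP x Kx)).
Qed.

(* The Carleman estimate for [v], integrated against the weight [exp (2 t psi)]
   with [psi = exp (s rho)]; the divergence has compact support. *)
Let carleman t1 : t1 < T ->
  exists (s c C t0 : R), [/\ 0 < s, 0 < c, 0 < C, 0 < t0 & forall t, t0 <= t ->
   exists W : 'I_m -> 'rV[R]_m -> R,
   [/\ forall i, Coo setT (W i), forall i x, T < d2 x -> W i x = 0 &
     forall x, t ^+ 3 * c * expR (t * expR (s * rho x)) ^+ 2 * v x ^+ 2 <=
       \sum_i pd i (W i) x + C * expR (t * expR (- (s * t1))) ^+ 2]].
move=> t1T.
have [s [C0 [s0 C00 hess_ge deg]]] := weight_exists.
have [C6 C60 C6P] := inner_bound t1T.
have spsi : Coo U (fun x => expR (s * rho x)) by apply: sm_expR => //; exact: sM.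
pose psi x := expR (s * rho x).
have psi0 x : 0 < psi x := expR_gt0 _.
(* Chosen so that [hessq] of the weight is at least $-\gamma|dw|^2$; against the term
   $4t\gamma|dw|^2$ of the pointwise inequality this leaves $2t\gamma|dw|^2$ to spend. *)
pose ga x := C0 * s * psi x.
have sga : Coo U ga by exact: sM.
have sq := sm_gradp openU sa spsi spsi.
have sdv := sm_divop openU sa spsi.
(* The two cross terms of first order combine to $2w\langle dw,d\zeta\rangle$, which is bounded
   below through the square of $\gamma\,dw+w\,d\zeta$. *)
pose zeta x := divop a psi x + 2 * ga x.
have szeta : Coo U zeta by apply: smoothD => //; exact: sM.
have ga0 x : K x -> 0 < ga x by rewrite !mulr_gt0.
have [g0 g00 g0P] := sm_pos_bound cK KU sga ga0.
have [C4 C40 C4P] := sm_bounded cK KU (smoothX openU 2 sga).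
have [C3' C3'0 C3'P] := sm_bounded cK KU (sm_gradp openU sa szeta szeta).
have [C5 C50 C5P] := sm_bounded cK KU sq.
have [C7 C70 C7P] := sm_bounded cK KU (smoothX openU 2 (sm_divop openU sa sv)).
have [c0 c00 c0P] : exists2 c, 0 < c & forall x, K x -> c <= (s * psi x) ^+ 3.
  apply: (sm_pos_bound cK KU (U := U)); last by move=> x _; rewrite exprn_gt0// mulr_gt0.
  by apply: smoothX => //; exact: sM.
pose C3 := C3' / g0; have C30 : 0 < C3 by rewrite divr_gt0.
(* The inequalities $k\le\gamma$ and $k|d\psi|^2\le c_0$ allow part of the gradient of [w] to be
   traded for the gradient of [v]. *)
pose k := Num.min g0 (c0 / C5).
have k0 : 0 < k by rewrite lt_min g00 divr_gt0.
(* The three summands ensure that [t] is at least 1, that [C6] is at most $tk/2$, and that the terms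
   of lower order in $w^2$ stay below $tc_0/2$. *)
pose t0 := 1 + 2 * C6 / k + 2 * (4 * C4 + C3 + C6) / c0.
have P1 : 0 < 2 * C6 / k by rewrite divr_gt0// mulr_gt0.
have P2 : 0 < 2 * (4 * C4 + C3 + C6) / c0.
  by rewrite divr_gt0// mulr_gt0// !addr_gt0// mulr_gt0.
exists s, (c0 / 2), C7, t0; split => //; first by rewrite divr_gt0.
  by rewrite /t0; lra.
move=> t tt0; have t_1 : 1 <= t by move: tt0; rewrite /t0; lra.
have tp : 0 < t by lra.
have tk : C6 <= t * k / 2.
  have : 2 * C6 / k <= t by move: tt0; rewrite /t0; lra.
  by rewrite ler_pdivrMr//; lra.
have tc : 4 * C4 + C3 + C6 <= t * c0 / 2.
  have : 2 * (4 * C4 + C3 + C6) / c0 <= t by move: tt0; rewrite /t0; lra.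
  by rewrite ler_pdivrMr//; lra.
pose Psi x := t * psi x.
have sPsi : Coo U Psi by exact: sM.
pose w x := expR (t * psi x) * v x.
have sw : Coo U w by apply: sM => //; apply: sm_expR.
pose W i x := - mult_field a psi w ga t i x.
have sWU i : Coo U (W i).
  by apply: smoothN => //; exact: sm_mult_field.
pose O2 := [set x | T < d2 x]; have oO2 : open O2 by exact: open_sqdist_gt.
pose O1 := [set x | d2 x < T0]; have oO1 : open O1 by exact: open_sqdist_lt.
have v0 x : O1 x \/ O2 x -> v x = 0.
  move=> [xO|xO]; rewrite /v; first by rewrite phi0 ?mulr0.
  by rewrite /chi expbump_le0 ?mul0r// subr_le0 ltW.
have w1 x : O1 x -> w x = 0 by move=> xO; rewrite /w v0 ?mulr0//; left.
have w2 x : O2 x -> w x = 0 by move=> xO; rewrite /w v0 ?mulr0//; right.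
have W1 i x : O1 x -> W i x = 0.
  by move=> xO; rewrite /W (mult_field_zero oO1 w1 a psi ga t i xO) oppr0.
have W2 i x : O2 x -> W i x = 0.
  by move=> xO; rewrite /W (mult_field_zero oO2 w2 a psi ga t i xO) oppr0.
exists W; split => //.
  (* The field vanishes on the open set [O2], which together with [U] covers the whole space. *)
  move=> i; apply: (@sm_sub _ _ _ (U `|` O2)).
    by move=> x _; have [/TU|] := leP (d2 x) T; [left|right].
  apply: sm_setU (sWU i) _.
  by apply: (sm_ext oO2 _ (@sm_cst _ _ _ oO2 _ (0 : R))) => x /W2 ->.
move=> x.
have E10 : 0 <= C7 * expR (t * expR (- (s * t1))) ^+ 2.
  by rewrite mulr_ge0 ?exprn_ge0 ?expR_ge0// ltW.
have [xO1|xT0] := ltP (d2 x) T0.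
  rewrite v0; last by left.
  rewrite expr0n /= mulr0 big1 ?add0r// => i _.
  exact: (pd_zero oO1 (W1 i) i xO1).
have [xT|xO2] := leP (d2 x) T; last first.
  rewrite v0; last by right.
  rewrite expr0n /= mulr0 big1 ?add0r// => i _.
  exact: (pd_zero oO2 (W2 i) i xO2).
have Kx : K x by apply/andP.
have Ux := KU Kx.
have dW : \sum_i pd i (W i) x = - \sum_i pd i (mult_field a psi w ga t i) x.
  rewrite -sumrN; eqbig i; apply: (pdN Ux).
  exact: sm_mult_field.
rewrite -/(psi x) dW.
have := carleman_pointwise openU sa asym t spsi sw sga Ux.
rewrite -/psi.
have -> : carleman_op a psi w t x = expR (t * psi x) * divop a v x.
  exact: (carleman_op_expw openU sa asym t spsi Ux sv).
have Gw := gradp_conj openU asym t spsi Ux sv.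
rewrite -/w in Gw.
have Gw0 := gradp_ge0 apsd w Ux.
have Gv0 := gradp_ge0 apsd v Ux.
have q0 := gradp_ge0 apsd psi Ux.
have H1 : - ga x * gr w w x <= hessq a psi w x.
  rewrite (hessq_expw openU sa asym s srho Ux sw) /ga -/(psi x).
  have -> : - (C0 * s * psi x) * gr w w x = s * psi x * (- C0 * gr w w x) by ring.
  rewrite ler_pM2l ?mulr_gt0// (le_trans (hess_ge x w Kx))// lerDl.
  by rewrite mulr_ge0 ?sqr_ge0// mulr_ge0// ltW.
have H2 : c0 <= gr psi (gr psi psi) x - 2 * ga x * gr psi psi x.
  rewrite (gradp_gradp_expw openU sa s srho Ux) (gradp_expwl openU a s srho _ Ux).
  rewrite (gradp_expwr openU a s srho _ Ux) /ga -/(psi x).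
  have := c0P x Kx; have := deg x Kx; have S3 : 0 < (s * psi x) ^+ 3.
    by rewrite exprn_gt0// mulr_gt0.
  move: (gr rho (gr rho rho) x) (gr rho rho x) => g1 g2 d c.
  have -> : (s * psi x) ^+ 3 * (2 * s * g2 ^+ 2 + g1) -
    2 * (C0 * s * psi x) * (s * psi x * (s * psi x * g2)) =
    (s * psi x) ^+ 3 * (2 * s * g2 ^+ 2 + g1 - 2 * C0 * g2) by ring.
  by rewrite (le_trans c)// ler_peMr// ltW.
have H3 : - ga x * gr w w x - C3 * w x ^+ 2 <=
    2 * w x * gr w (divop a psi) x + 4 * w x * gr w ga x.
  have P := gradp_psd asym apsd w zeta (ga x) (w x) Ux.
  have Z : gr w zeta x = gr w (divop a psi) x + 2 * gr w ga x.
    rewrite (gradpD a w Ux sdv (sM (sc 2) sga)) (gradpM a w Ux (sc 2) sga).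
    have -> : gr w (fun=> 2) x = 0.
      by rewrite /gradp big1// => i _; rewrite pd_cst mulr0.
    by rewrite mulr0 addr0.
  have gx := ga0 x Kx; have g1 := g0P x Kx.
  have z1 := le_trans (ler_norm _) (C3'P x Kx).
  have zz : gr zeta zeta x <= C3 * ga x.
    rewrite (le_trans z1)// /C3 -mulrA ler_peMr ?(ltW C3'0)//.
    by rewrite mulrC ler_pdivlMr// mul1r.
  rewrite -(ler_pM2l gx).
  have wz : w x ^+ 2 * gr zeta zeta x <= w x ^+ 2 * (C3 * ga x) by rewrite ler_wpM2l// sqr_ge0.
  move: P wz; rewrite Z.
  exact: zeta_bound.
have w2E : w x ^+ 2 = expR (t * psi x) ^+ 2 * v x ^+ 2 by exact: exprMn.
have H4 : (t * k / 2) * (expR (t * psi x) ^+ 2 * gr v v x) <=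
    t * ga x * gr w w x + t ^+ 3 * c0 * w x ^+ 2.
  have kg : k <= ga x by rewrite (le_trans _ (g0P x Kx))// ge_min lexx.
  have kq : k * gr psi psi x <= c0.
    rewrite (@le_trans _ _ (c0 / C5 * C5))//; last by rewrite divfK// gt_eqF.
    rewrite ler_pM//; [exact: ltW|by rewrite ge_min lexx orbT|].
    exact: le_trans (ler_norm _) (C5P x Kx).
  have S := gradp_psd asym apsd v psi 1 (2 * t * v x) Ux.
  rewrite (gradpC asym v psi Ux) in S.
  rewrite Gw w2E; set e := expR (t * psi x) ^+ 2.
  have e0 : 0 <= e by rewrite exprn_ge0// expR_ge0.
  move: S; set G := gr v v x; set q := gr psi psi x; set L := gr psi v x => S.
  set y := v x in S *.
  rewrite Gw -/e -/G -/L -/q -/y in Gw0.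
  have X1 : t * k * (e * (G + 2 * t * y * L + t ^+ 2 * y ^+ 2 * q)) <=
            t * ga x * (e * (G + 2 * t * y * L + t ^+ 2 * y ^+ 2 * q)).
    by rewrite ler_wpM2r// ler_wpM2l// ltW.
  have X2 : t ^+ 3 * e * y ^+ 2 * (k * q) <= t ^+ 3 * e * y ^+ 2 * c0.
    by rewrite ler_wpM2l// mulr_ge0 ?sqr_ge0// mulr_ge0// exprn_ge0// ltW.
  have X3 : 0 <= t * k / 2 * e * (1 ^+ 2 * G + 2 * 1 * (2 * t * y) * L + (2 * t * y) ^+ 2 * q).
    by rewrite mulr_ge0// mulr_ge0// mulr_ge0 ?invr_ge0// mulr_ge0// ltW.
  exact: conj_bound X1 X2 X3.
have H5 : t * hessq a psi w x >= t * (- ga x * gr w w x) by rewrite ler_wpM2l// ltW.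
have H6 : t ^+ 3 * w x ^+ 2 * (gr psi (gr psi psi) x - 2 * ga x * gr psi psi x) >=
    t ^+ 3 * w x ^+ 2 * c0.
  by rewrite ler_wpM2l// mulr_ge0 ?sqr_ge0// exprn_ge0// ltW.
have H7 : t * (2 * w x * gr w (divop a psi) x + 4 * w x * gr w ga x) >=
    t * (- ga x * gr w w x - C3 * w x ^+ 2) by rewrite ler_wpM2l// ltW.
have H8 : t ^+ 2 * w x ^+ 2 * ga x ^+ 2 <= t ^+ 2 * w x ^+ 2 * C4.
  rewrite ler_wpM2l//; first by rewrite mulr_ge0 ?sqr_ge0.
  exact: le_trans (ler_norm _) (C4P x Kx).
(* For [d2 x] up to [t1] the bound [inner_bound] applies. Farther out the square of [divop a v] is
   at most [C7], and the weight, which decreases with the distance, is at most its value at [t1]. *)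
have H9 : (expR (t * psi x) * divop a v x) ^+ 2 <=
    C6 * (expR (t * psi x) ^+ 2 * gr v v x + w x ^+ 2) +
    C7 * expR (t * expR (- (s * t1))) ^+ 2.
  rewrite exprMn w2E -mulrDr [C6 * _]mulrCA.
  have e0 : 0 <= expR (t * psi x) ^+ 2 by rewrite exprn_ge0// expR_ge0.
  have [xt1|xt1] := leP (d2 x) t1.
    by rewrite ler_wpDr// ler_wpM2l// C6P.
  rewrite ler_wpDl//; first by rewrite !mulr_ge0 ?addr_ge0 ?sqr_ge0// ltW.
  rewrite mulrC ler_pM ?sqr_ge0//; first exact: le_trans (ler_norm _) (C7P x Kx).
  rewrite lerXn2r ?nnegrE ?expR_ge0// ler_expR ler_wpM2l ?(ltW tp)//.
  by rewrite ler_expR mulrN lerN2; apply: ler_wpM2l; exact: ltW.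
have H10 : C6 * (expR (t * psi x) ^+ 2 * gr v v x) <=
    t * k / 2 * (expR (t * psi x) ^+ 2 * gr v v x).
  by rewrite ler_wpM2r// mulr_ge0// exprn_ge0// expR_ge0.
have H11 : (4 * t ^+ 2 * C4 + t * C3 + C6) * w x ^+ 2 <= t ^+ 3 * c0 / 2 * w x ^+ 2.
  rewrite ler_wpM2r ?sqr_ge0//.
  have : t ^+ 2 * (4 * C4 + C3 + C6) <= t ^+ 2 * (t * c0 / 2) by rewrite ler_wpM2l ?sqr_ge0.
  have : t * C3 <= t ^+ 2 * C3 by rewrite ler_wpM2r ?(ltW C30)// expr2 ler_peMl// ltW.
  have : C6 <= t ^+ 2 * C6 by rewrite ler_peMl ?(ltW C60)// expr_ge1// ltW.
  lra.
have -> : t ^+ 3 * (c0 / 2) * expR (t * psi x) ^+ 2 * v x ^+ 2 = t ^+ 3 * c0 / 2 * w x ^+ 2.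
  by rewrite w2E; ring.
move: H4 H5 H6 H7 H8 H9 H10 H11.
move: (hessq _ _ _ _) (gr psi (gr psi psi) x) (gr psi psi x) (gr w (divop a psi) x)
  (gr w ga x) (gr w w x) (ga x) (w x ^+ 2) (_ * gr v v x) (\sum_i _)
  ((_ * divop a v x) ^+ 2) (C7 * _).
clear; move=> *; lra.
Qed.

(** If [phi x] were nonzero, the Riemann sums of $v^2$ over the ball [d2 y < t1] would stay above
    some [ch > 0]. The weight there is at least its value [E] at [t1], so summing the Carleman
    estimate bounds $t^3$ by a constant, against the freedom to enlarge [t]. *)
Lemma unique_continuation_ball x : d2 x < T -> phi x = 0.
move=> xT; apply: contrapT => /eqP p0.
pose t1 := (d2 x + T) / 2.
have xt1 : d2 x < t1 by rewrite /t1; lra.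
have t1T : t1 < T by rewrite /t1; lra.
have [s [c [C [t0 [s0 c_0 C0 t00 HW]]]]] := carleman t1T.
have T0' : 0 < T by rewrite (le_lt_trans (sqdist_ge0 z x)).
pose L := (Num.truncn (`|z| + T + 1)).+1.
have LP : `|z| + T + 1 < L%:R by rewrite /L real_truncnS_gt// num_real.
have coordL y i : d2 y <= T -> `|y 0 i| < L%:R.
  move=> yT; have := le_trans (sqdist_ge z y i) yT.
  move=> h2; have h1 := mx_norm_ge z 0 i.
  rewrite -(subrK (z 0 i) (y 0 i)) (le_lt_trans (ler_normD _ _))//.
  move: h2; rewrite -(real_normK (num_real (_ - _))).
  have := normr_ge0 (y 0 i - z 0 i); move: `|y 0 i - z 0 i| => r r0 h2; nra.
pose h y := if d2 y < t1 then v y ^+ 2 else 0.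
have h0 y : 0 <= h y by rewrite /h; case: ifP => // _; exact: sqr_ge0.
have vx : 0 < v x ^+ 2.
  rewrite exprn_even_gt0//= mulf_neq0// gt_eqF// expbump_gt0// subr_gt0//.
have Ux : U x by apply: TU; exact: ltW.
have [r r_0 rP] : exists2 r, 0 < r & forall y, ball x r y -> v x ^+ 2 / 2 <= h y.
  have : \forall y \near x, d2 y < t1 /\ v x ^+ 2 / 2 < v y ^+ 2.
    have cv := sm_cont (smoothX openU 2 sv) Ux.
    near=> y; split.
      by near: y; apply: open_nbhs_nbhs; split=> //; exact: open_sqdist_lt.
    near: y; apply: (cvgr_gt _ cv); lra.
  move=> /nbhs_ballP[r /= r_0 rP]; exists r => // y /rP[y1 y2].
  by rewrite /h y1 ltW.
have [ch ch0 chP] := @riemann_sum_pos R m L h x r (v x ^+ 2 / 2) h0 r_0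
  (divr_gt0 vx (ltr0n R 2)) rP (fun i => coordL x i (ltW xT)).
pose V := (2 * L)%:R ^+ m : R.
have V0 : 0 < V by rewrite exprn_gt0// ltr0n muln_gt0.
(* Makes [t * (c * ch)] at least [C * V + 1], where [V] is the volume of the cube, and [t] at least
   1, so that $t^3\ge t$. *)
pose t := t0 + 1 + (C * V + 1) / (c * ch).
have tt0 : 0 < (C * V + 1) / (c * ch) by rewrite divr_gt0 ?mulr_gt0// addr_gt0// mulr_gt0.
have t_0 : t0 <= t by rewrite /t; lra.
have [W [sW W0 WP]] := HW t t_0.
set E := expR (t * expR (- (s * t1))) ^+ 2 in WP.
have E0 : 0 < E by rewrite exprn_gt0// expR_gt0.
have tp : 0 < t by lra.
have key2 : sum_le0 L (fun y => \sum_i pd i (W i) y).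
  apply: sum_le0_sum => i; apply: sum_le0_pd; first exact: sW.
  move=> y yL; rewrite W0// ltNge; apply: contraTN yL => yT.
  by rewrite -ltNge coordL.
have fin : sum_le0 L (fun y => t ^+ 3 * c * E * h y - C * E).
  apply: sum_le0_le key2 => y; rewrite lerBlDr; apply: le_trans (WP y).
  rewrite /h; case: ltP => yt; last first.
    rewrite mulr0; apply: mulr_ge0 (sqr_ge0 _); apply: mulr_ge0 (sqr_ge0 _).
    by apply: mulr_ge0 (ltW c_0); apply: exprn_ge0; exact: ltW.
  rewrite ler_wpM2r ?sqr_ge0// ler_wpM2l//.
    by apply: mulr_ge0 (ltW c_0); apply: exprn_ge0; exact: ltW.
  rewrite lerXn2r ?nnegrE ?expR_ge0// ler_expR ler_wpM2l ?(ltW tp)//.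
  by rewrite ler_expR mulrN lerN2; apply: ler_wpM2l; exact: ltW.
have bad n : ch <= @riemann_sum R m L n h ->
    @riemann_sum R m L n (fun y => t ^+ 3 * c * E * h y - C * E) <= E / 2 -> False.
  move=> h1; have -> : @riemann_sum R m L n (fun y => t ^+ 3 * c * E * h y - C * E) =
     t ^+ 3 * c * E * @riemann_sum R m L n h - V * (C * E).
    rewrite -(@riemann_sum1 R m L n) /riemann_sum sumrB -mulr_sumr mulrBr; ring.
  move=> h2.
  have q1 : t ^+ 3 * c * E * ch <= t ^+ 3 * c * E * @riemann_sum R m L n h.
    by rewrite ler_wpM2l// !mulr_ge0 ?exprn_ge0// ltW.
  have q2 : t * (c * ch) >= C * V + 1.
    rewrite /t mulrDl divfK ?mulf_neq0 ?gt_eqF//.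
    by rewrite lerDr mulr_ge0//; [lra|rewrite mulr_ge0// ltW].
  have q3 : t * (c * ch) <= t ^+ 3 * (c * ch).
    rewrite ler_wpM2r ?mulr_ge0 ?(ltW c_0) ?(ltW ch0)//.
    by rewrite exprS ler_peMr ?(ltW tp)// exprn_ege1// /t; lra.
  have q4 : (C * V + 1) * E <= t ^+ 3 * (c * ch) * E by rewrite ler_wpM2r ?(ltW E0)//; lra.
  have : t ^+ 3 * c * E * ch = t ^+ 3 * (c * ch) * E by ring.
  move=> q5; exact: contradictory_bound E0 q5 q1 q4 h2.
near \oo => n; apply: (bad n); near: n; first exact: chP.
by apply: fin; lra.
Unshelve. all: by end_near. Qed.

End UniqueContinuation.

(* The locked derivative and matrix calculus with it *)
Opaque pd.

(* Conversion of two distinct partial derivatives unfolds limits in function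
   spaces, so every computation is done with a locked copy of [pd]. *)
Lemma dd_key : unit. exact: tt. Qed.
Definition dd (R : realType) (m : nat) (V : normedModType R) :=
  locked_with dd_key (@pd R m V).

Lemma ddE (R : realType) (m : nat) (V : normedModType R) : @dd R m V = @pd R m V.
exact: unlock. Qed.

Section LockedDerivative.
Variables (R : realType) (m : nat) (U : set 'rV[R]_m).
Hypothesis openU : open U.

Lemma sm_dd (V : normedModType R) (f : 'rV[R]_m -> V) i :
  Coo U f -> Coo U (dd i f).
by rewrite ddE; exact: sm_pd. Qed.

Lemma dd_ext (V : normedModType R) (f g : 'rV[R]_m -> V) i u : U u ->
  (forall v, U v -> f v = g v) -> dd i f u = dd i g u.
by move=> Uu fg; rewrite ddE; exact: (pd_ext openU fg Uu). Qed.

Lemma dd_cst (V : normedModType R) (c : V) i (u : 'rV[R]_m) : dd i (fun=> c) u = 0.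
by rewrite ddE pd_cst. Qed.

Lemma ddD (V : normedModType R) (f g : 'rV[R]_m -> V) i u : U u ->
  Coo U f -> Coo U g -> dd i (fun v => f v + g v) u = dd i f u + dd i g u.
by rewrite ddE; exact: pdD. Qed.

Lemma ddN (V : normedModType R) (f : 'rV[R]_m -> V) i u : U u ->
  Coo U f -> dd i (fun v => - f v) u = - dd i f u.
by rewrite ddE; exact: pdN. Qed.

Lemma ddB (V : normedModType R) (f g : 'rV[R]_m -> V) i u : U u ->
  Coo U f -> Coo U g -> dd i (fun v => f v - g v) u = dd i f u - dd i g u.
by rewrite ddE; exact: (pdB openU). Qed.

Lemma dd_sum (V : normedModType R) (I : Type) (r : seq I) (P : pred I)
    (F : I -> 'rV[R]_m -> V) j u : U u -> (forall i, Coo U (F i)) ->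
  dd j (fun v => \sum_(i <- r | P i) F i v) u = \sum_(i <- r | P i) dd j (F i) u.
by rewrite ddE; exact: (pd_sum openU). Qed.

Lemma ddM (f g : 'rV[R]_m -> R) i u : U u ->
  Coo U f -> Coo U g -> dd i (fun v => f v * g v) u = dd i f u * g u + f u * dd i g u.
by rewrite ddE; exact: pdM. Qed.

Lemma dd_mxE p q (F : 'rV[R]_m -> 'M[R]_(p, q)) l u i j : U u -> Coo U F ->
  dd l (fun v => F v i j) u = dd l F u i j.
by move=> Uu sF; rewrite !ddE (pd_mxE Uu sF). Qed.

Lemma dd_mulmx p q r (F : 'rV[R]_m -> 'M[R]_(p, q)) (G : 'rV[R]_m -> 'M[R]_(q, r)) l u :
  U u -> Coo U F -> Coo U G ->
  dd l (fun v => F v *m G v) u = dd l F u *m G u + F u *m dd l G u.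
by rewrite !ddE; exact: (pd_mulmx openU). Qed.

Lemma dd_mulmxl p q r (F : 'rV[R]_m -> 'M[R]_(p, q)) (B : 'M[R]_(q, r)) l u :
  U u -> Coo U F -> dd l (fun v => F v *m B) u = dd l F u *m B.
by move=> Uu sF; rewrite dd_mulmx ?dd_cst ?mulmx0 ?addr0//; exact: sm_cst.
Qed.

Lemma dd_scale p q (a : 'rV[R]_m -> R) (F : 'rV[R]_m -> 'M[R]_(p, q)) l u :
  U u -> Coo U a -> Coo U F ->
  dd l (fun v => a v *: F v) u = dd l a u *: F u + a u *: dd l F u.
by rewrite !ddE; exact: (pd_scale openU). Qed.

Lemma dd_scalel p q (a : R) (F : 'rV[R]_m -> 'M[R]_(p, q)) l u :
  U u -> Coo U F -> dd l (fun v => a *: F v) u = a *: dd l F u.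
by move=> Uu sF; rewrite dd_scale ?dd_cst ?scale0r ?add0r//; exact: sm_cst.
Qed.

Lemma dd_tr p q (F : 'rV[R]_m -> 'M[R]_(p, q)) l u : U u -> Coo U F ->
  dd l (fun v => (F v)^T) u = (dd l F u)^T.
by rewrite !ddE; exact: (pd_tr openU). Qed.

Lemma dd_invmx n (F : 'rV[R]_m -> 'M[R]_n) l u : U u -> Coo U F ->
  (forall v, U v -> F v \in unitmx) ->
  dd l (fun v => invmx (F v)) u = - (invmx (F u) *m dd l F u *m invmx (F u)).
by rewrite !ddE; exact: (pd_invmx openU). Qed.

Lemma ddC p q (F : 'rV[R]_m -> 'M[R]_(p, q)) i j u : U u -> Coo U F ->
  dd i (dd j F) u = dd j (dd i F) u.
by rewrite !ddE; exact: (pdC_mx openU). Qed.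

Lemma sm_row p q (F : 'rV[R]_m -> 'M[R]_(p, q)) i :
  Coo U F -> Coo U (fun v => row i (F v)).
move=> sF; apply/(sm_mxP openU) => a j.
by apply: (sm_ext openU _ (sm_coord openU i j sF)) => v _; rewrite mxE.
Qed.

Lemma dd_row p q (F : 'rV[R]_m -> 'M[R]_(p, q)) l u i : U u -> Coo U F ->
  dd l (fun v => row i (F v)) u = row i (dd l F u).
move=> Uu sF; apply/rowP => j; rewrite -(dd_mxE l _ _ Uu (sm_row i sF)) mxE.
by rewrite -(dd_mxE l i j Uu sF); apply: dd_ext => // v _; rewrite mxE.
Qed.

Lemma sm_rows p q (F : 'I_p -> 'rV[R]_m -> 'rV[R]_q) :
  (forall i, Coo U (F i)) -> Coo U (fun v => \matrix_i F i v).
move=> sF; apply/(sm_mxP openU) => i j.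
by apply: (sm_ext openU _ (sm_coord openU 0 j (sF i))) => v _; rewrite mxE.
Qed.

Lemma dd_rows p q (F : 'I_p -> 'rV[R]_m -> 'rV[R]_q) l u i : U u ->
  (forall i, Coo U (F i)) -> row i (dd l (fun v => \matrix_i F i v) u) = dd l (F i) u.
move=> Uu sF; rewrite -dd_row//; last exact: sm_rows.
by apply: dd_ext => // v _; rewrite rowK.
Qed.

Lemma sm_const_mulmxl p q r (F : 'rV[R]_m -> 'M[R]_(p, q)) (B : 'M[R]_(q, r)) :
  Coo U F -> Coo U (fun v => F v *m B).
by move=> sF; apply: sm_mulmx => //; exact: sm_cst. Qed.

End LockedDerivative.

Lemma dd_comp (R : realType) (m n : nat) (U : set 'rV[R]_m) (U' : set 'rV[R]_n)
  (phi : 'rV[R]_n -> 'rV[R]_m) p q (F : 'rV[R]_m -> 'M[R]_(p, q)) i u :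
  open U -> open U' -> Coo U' phi -> (forall u, U' u -> U (phi u)) -> U' u ->
  Coo U F ->
  dd i (fun v => F (phi v)) u = \sum_j dd i phi u 0 j *: dd j F (phi u).
by move=> oU oU' sphi phiU U'u sF; rewrite !ddE -(pd_comp oU oU' sphi phiU i U'u sF).
Qed.

Create HintDb smo.
Ltac smo :=
  first
  [ assumption
  | lazymatch goal with
    | |- Coo _ (fun v => mulmx (@?F v) (@?G v)) => eapply sm_mulmx; [eassumption | smo | smo]
    | |- Coo _ (fun v => GRing.scale (@?F v) (@?G v)) => eapply sm_scale; [eassumption | smo | smo]
    | |- Coo _ (fun v => GRing.add (@?F v) (GRing.opp (@?G v))) => eapply smoothB; [eassumption | smo | smo]
    | |- Coo _ (fun v => GRing.add (@?F v) (@?G v)) => eapply smoothD; [eassumption | smo | smo]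
    | |- Coo _ (fun v => GRing.mul (@?F v) (@?G v)) => eapply smoothM; [eassumption | smo | smo]
    | |- Coo _ (fun v => GRing.opp (@?F v)) => eapply smoothN; [eassumption | smo]
    | |- Coo _ (fun v => trmx (@?F v)) => eapply sm_tr; [eassumption | smo]
    | |- Coo _ (fun v => row ?i (@?F v)) => eapply sm_row; [eassumption | smo]
    | |- Coo _ (fun v => fun_of_matrix (@?F v) ?i ?j) => eapply sm_coord; [eassumption | smo]
    | |- Coo _ (fun v => bigop _ _ _) => eapply sm_sum; [eassumption | intro; smo]
    | |- Coo _ (dd ?i _) => eapply sm_dd; smo
    | |- Coo _ (fun v => dd ?i ?F v) => eapply sm_dd; smo
    | |- Coo _ (fun v => ?c) => eapply sm_cst; eassumption
    | |- _ => solve [eauto with smo]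
    end
  | solve [eauto with smo] ].

(** * Index contractions of families of matrices *)

Section Families.
Variables (R : realType) (m : nat).

(* The matrix [P] acts on the first index of a family [X]. *)
Definition act p q (P : 'M[R]_m) (X : 'I_m -> 'M[R]_(p, q)) k : 'M[R]_(p, q) :=
  \sum_s P k s *: X s.

Lemma actM p q P P' (X : 'I_m -> 'M[R]_(p, q)) k : act (P *m P') X k = act P (act P' X) k.
rewrite /act; transitivity (\sum_s \sum_t (P k t * P' t s) *: X s).
  by eqbig s; rewrite mxE scaler_suml.
rewrite exchange_big; eqbig t; rewrite scaler_sumr.
by eqbig s; rewrite scalerA.
Qed.

Lemma actB p q P P' (X : 'I_m -> 'M[R]_(p, q)) k : act (P - P') X k = act P X k - act P' X k.
by rewrite -sumrB; eqbig s; rewrite !mxE scalerBl. Qed.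

Lemma act_fB p q P (X Z : 'I_m -> 'M[R]_(p, q)) k :
  act P (fun s => X s - Z s) k = act P X k - act P Z k.
by rewrite -sumrB; eqbig s; rewrite scalerBr. Qed.

Lemma act_mulmx p q r P (A : 'M[R]_(r, p)) (X : 'I_m -> 'M[R]_(p, q)) k :
  act P (fun s => A *m X s) k = A *m act P X k.
by rewrite mulmx_sumr; eqbig s; rewrite scalemxAr. Qed.

Lemma act_mulmxr p q r P (A : 'M[R]_(q, r)) (X : 'I_m -> 'M[R]_(p, q)) k :
  act P (fun s => X s *m A) k = act P X k *m A.
by rewrite mulmx_suml; eqbig s; rewrite scalemxAl. Qed.

Lemma eq_act p q P (X Z : 'I_m -> 'M[R]_(p, q)) k : (forall s, X s = Z s) ->
  act P X k = act P Z k.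
by move=> XZ; eqbig s; rewrite XZ. Qed.

(* [\sum_(k, i) Q_ki X_ki], where [X_ki] is row [i] of [X k]. *)
Definition ctr q (Q : 'M[R]_m) (X : 'I_m -> 'M[R]_(m, q)) : 'rV[R]_q :=
  \sum_k row k Q *m X k.

Lemma contractE q (Q : 'M[R]_m) (X : 'I_m -> 'M[R]_(m, q)) :
  ctr Q X = \sum_k \sum_i Q k i *: row i (X k).
by eqbig k; rewrite mulmx_sum_row; eqbig i; rewrite mxE.
Qed.

Lemma eq_contract q Q (X Z : 'I_m -> 'M[R]_(m, q)) : (forall s, X s = Z s) ->
  ctr Q X = ctr Q Z.
by move=> XZ; eqbig s; rewrite XZ. Qed.

Lemma contractMr q Q P (X : 'I_m -> 'M[R]_(m, q)) :
  ctr (Q *m P) X = ctr Q (fun k => P *m X k).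
by eqbig k; rewrite row_mul mulmxA. Qed.

Lemma contract_trM q Q P (X : 'I_m -> 'M[R]_(m, q)) :
  ctr (P^T *m Q) X = ctr Q (act P X).
rewrite /ctr; transitivity (\sum_k \sum_s P s k *: (row s Q *m X k)).
  eqbig k.
  have -> : row k (P^T *m Q) = \sum_s P s k *: row s Q.
    by rewrite row_mul mulmx_sum_row; eqbig s; rewrite !mxE.
  by rewrite mulmx_suml; eqbig s; rewrite scalemxAl.
rewrite exchange_big; eqbig s; rewrite /act mulmx_sumr.
by eqbig k; rewrite scalemxAr.
Qed.

Lemma contractD q Q Q' (X : 'I_m -> 'M[R]_(m, q)) :
  ctr (Q + Q') X = ctr Q X + ctr Q' X.
by rewrite -big_split; eqbig k; rewrite raddfD mulmxDl. Qed.

Lemma contractN q Q (X : 'I_m -> 'M[R]_(m, q)) : ctr (- Q) X = - ctr Q X.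
by rewrite -sumrN; eqbig k; rewrite raddfN mulNmx. Qed.

Lemma contractZ q c Q (X : 'I_m -> 'M[R]_(m, q)) : ctr (c *: Q) X = c *: ctr Q X.
by rewrite scaler_sumr; eqbig k; rewrite linearZ -scalemxAl. Qed.

Lemma contract_fB q Q (X Z : 'I_m -> 'M[R]_(m, q)) :
  ctr Q (fun k => X k - Z k) = ctr Q X - ctr Q Z.
by rewrite -sumrB; eqbig k; rewrite mulmxBr. Qed.

Lemma contract_fD q Q (X Z : 'I_m -> 'M[R]_(m, q)) :
  ctr Q (fun k => X k + Z k) = ctr Q X + ctr Q Z.
by rewrite -big_split; eqbig k; rewrite mulmxDr. Qed.

Lemma contract_mulmxr q r Q (A : 'M[R]_(q, r)) (X : 'I_m -> 'M[R]_(m, q)) :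
  ctr Q (fun k => X k *m A) = ctr Q X *m A.
by rewrite mulmx_suml; eqbig k; rewrite mulmxA. Qed.

Lemma contract_act q Q P (X : 'I_m -> 'I_m -> 'M[R]_(m, q)) l :
  ctr Q (fun k => act P (X k) l) = \sum_s P l s *: ctr Q (fun k => X k s).
rewrite /ctr; transitivity (\sum_k \sum_s P l s *: (row k Q *m X k s)).
  by eqbig k; rewrite mulmx_sumr; eqbig s; rewrite -scalemxAr.
by rewrite exchange_big; eqbig s; rewrite scaler_sumr.
Qed.

End Families.

(** * Hessian, Levi-Civita connection and curvature of a submanifold of a flat space *)

Section Parametrization.
Variables (R : realType) (m N : nat) (E : 'M[R]_N).
Hypothesis E_sym : E^T = E.
Variables (U : set 'rV[R]_m) (Y : 'rV[R]_m -> 'rV[R]_N).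
Hypotheses (oU : open U) (sY : Coo U Y).

(** Geometry in matrix form: the rows of [jac] are the coordinate tangent vectors, [cov k] holds in
    row [i] the coefficients of the Levi-Civita derivative of the i-th one along the k-th, and row
    [i] of [hes k] is the corresponding value of the covariant Hessian of [Y], that is, the part of
    the second derivative orthogonal to the tangent space. *)
Definition jac := locked_with dd_key (fun u : 'rV[R]_m => \matrix_i dd i Y u : 'M[R]_(m, N)).
Definition gm := locked_with dd_key (fun u => jac u *m E *m (jac u)^T).
Hypothesis gU : forall u, U u -> gm u \in unitmx.

Definition cov := locked_with dd_key
  (fun k u => dd k jac u *m E *m (jac u)^T *m invmx (gm u)).
Definition hes := locked_with dd_key (fun k u => dd k jac u - cov k u *m jac u).
Definition lap := locked_with dd_key
  (fun u => ctr (invmx (gm u)) (hes^~ u)).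
(** The commutator stands in this order because coefficients multiply a column of frame vectors from
    the left: differentiating [cov k] times the frame along [l] gives the product [cov k] times
    [cov l]. *)
Definition curv := locked_with dd_key (fun l k u =>
  dd l (cov k) u - dd k (cov l) u + (cov k u *m cov l u - cov l u *m cov k u)).
Definition hes3 := locked_with dd_key (fun l k u =>
  dd l (hes k) u - cov l u *m hes k u - act (cov l u) (hes^~ u) k).

Lemma jacE : jac = fun u => \matrix_i dd i Y u. exact: unlock. Qed.
Lemma gmE : gm = fun u => jac u *m E *m (jac u)^T. exact: unlock. Qed.
Lemma covE k : cov k = fun u => dd k jac u *m E *m (jac u)^T *m invmx (gm u).
by rewrite /cov unlock. Qed.
Lemma hesE k : hes k = fun u => dd k jac u - cov k u *m jac u.
by rewrite /hes unlock. Qed.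
Lemma lapE : lap = fun u => ctr (invmx (gm u)) (hes^~ u). exact: unlock. Qed.
Lemma curvE l k u : curv l k u =
  dd l (cov k) u - dd k (cov l) u + (cov k u *m cov l u - cov l u *m cov k u).
by rewrite /curv unlock. Qed.
Lemma hes3E l k u : hes3 l k u =
  dd l (hes k) u - cov l u *m hes k u - act (cov l u) (hes^~ u) k.
by rewrite /hes3 unlock. Qed.

Lemma sm_jac : Coo U jac.
rewrite jacE; by apply: sm_rows => // i; exact: sm_dd. Qed.
Hint Resolve sm_jac : smo.

Lemma sm_gm : Coo U gm.
by rewrite gmE; smo. Qed.
Hint Resolve sm_gm : smo.

Lemma sm_ginv : Coo U (fun u => invmx (gm u)).
by apply: sm_invmx => //; smo. Qed.
Hint Resolve sm_ginv : smo.

Lemma sm_cov k : Coo U (cov k).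
by rewrite covE; smo. Qed.
Hint Resolve sm_cov : smo.

Lemma sm_hes k : Coo U (hes k).
by rewrite hesE; smo. Qed.
Hint Resolve sm_hes : smo.

Lemma sm_contract (Q : 'rV[R]_m -> 'M[R]_m) (X : 'I_m -> 'rV[R]_m -> 'M[R]_(m, N)) :
  Coo U Q -> (forall k, Coo U (X k)) ->
  Coo U (fun u => ctr (Q u) (X^~ u)).
move=> sQ sX; rewrite /ctr; apply: sm_sum => // k.
by apply: sm_mulmx => //; smo.
Qed.

Lemma sm_lap : Coo U lap.
by rewrite lapE; apply: sm_contract => //; smo. Qed.
Hint Resolve sm_lap : smo.

Lemma gm_sym u : (gm u)^T = gm u.
by rewrite gmE !trmx_mul trmxK E_sym mulmxA. Qed.

Lemma ginv_sym u : (invmx (gm u))^T = invmx (gm u).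
by rewrite trmx_inv gm_sym. Qed.

Lemma jacC i k u : U u -> row i (dd k jac u) = row k (dd i jac u).
by move=> Uu; rewrite jacE !(dd_rows oU)//; [exact: (ddC oU)|move=> j; smo|move=> j; smo].
Qed.

Lemma covC i k u : U u -> row i (cov k u) = row k (cov i u).
by move=> Uu; rewrite !covE -!mulmxA !row_mul jacC. Qed.

Lemma hesC i k u : U u -> row i (hes k u) = row k (hes i u).
by move=> Uu; rewrite !hesE !raddfB /= !row_mul jacC// covC. Qed.

Lemma cov_gm k u : U u -> cov k u *m gm u = dd k jac u *m E *m (jac u)^T.
by move=> Uu; rewrite covE mulmxKV// gU. Qed.

Lemma hes_jac k u : U u -> hes k u *m E *m (jac u)^T = 0.
move=> Uu; rewrite hesE !mulmxBl -(cov_gm k Uu) gmE.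
by rewrite !mulmxA subrr.
Qed.

Lemma lap_jac u : U u -> lap u *m E *m (jac u)^T = 0.
move=> Uu; rewrite lapE /ctr !mulmx_suml big1// => k _.
by rewrite -!mulmxA (mulmxA (hes k u)) hes_jac// mulmx0.
Qed.

Lemma dd_jac k u : dd k jac u = hes k u + cov k u *m jac u.
by rewrite hesE subrK. Qed.

Lemma dd_gm k u : U u -> dd k gm u = cov k u *m gm u + gm u *m (cov k u)^T.
move=> Uu; rewrite cov_gm//.
have -> : gm u *m (cov k u)^T = (cov k u *m gm u)^T by rewrite [RHS]trmx_mul gm_sym.
rewrite cov_gm// gmE (dd_mulmx oU)//; [|smo|smo].
rewrite (dd_mulmxl oU)//; last smo.
rewrite (dd_tr oU)//; last smo.
by rewrite !trmx_mul trmxK E_sym !mulmxA.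
Qed.

Lemma dd_ginv k u : U u ->
  dd k (fun v => invmx (gm v)) u = - ((cov k u)^T *m invmx (gm u)) - invmx (gm u) *m cov k u.
move=> Uu; rewrite (dd_invmx oU)//; last smo.
rewrite dd_gm// mulmxDr mulmxDl opprD addrC; congr (_ - _).
  by rewrite mulmxA mulVmx ?gU// mul1mx.
by rewrite mulmxA (mulmxK (gU Uu)).
Qed.

Lemma tangent_eq0 p (c : 'M[R]_(p, m)) u : U u ->
  c *m jac u *m E *m (jac u)^T = 0 -> c = 0.
move=> Uu H; rewrite -[c](mulmxK (gU Uu)) gmE !mulmxA H mul0mx //.
Qed.

(** Replaces transformation laws: for a new parametrisation or an image, any splitting of the second
    derivative into an orthogonal and a tangential part identifies both [hes] and [cov]. *)
Lemma hes_unique k u (h : 'M[R]_(m, N)) (c : 'M[R]_m) : U u ->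
  dd k jac u = h + c *m jac u -> h *m E *m (jac u)^T = 0 -> hes k u = h /\ cov k u = c.
move=> Uu dE h0; have cE : cov k u = c.
  rewrite covE dE !mulmxDl h0 mul0mx add0r -[RHS](mulmxK (gU Uu)) gmE.
  by rewrite !mulmxA.
by rewrite hesE dE cE addrK.
Qed.

(** Ordinary second derivatives of [jac] commute, so exchanging the two differentiations of the
    covariant Hessian costs only a tangential curvature term. Codazzi and Gauss equations are both
    contained in it. *)
Lemma ricci l k u : U u -> hes3 l k u = hes3 k l u - curv l k u *m jac u.
move=> Uu.
have dh a c : dd a (hes c) u = dd a (dd c jac) u - (dd a (cov c) u *m jac u +
    (cov c u *m hes a u + cov c u *m cov a u *m jac u)).
  rewrite (hesE c) (ddB oU)//; [|smo|smo]; congr (_ - _).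
  rewrite (dd_mulmx oU)//; [|smo|smo]; congr (_ + _).
  by rewrite dd_jac mulmxDr mulmxA.
have ddC' : dd l (dd k jac) u = dd k (dd l jac) u by exact: ddC sm_jac.
have aE : act (cov k u) (hes^~ u) l = act (cov l u) (hes^~ u) k.
  eqbig s; congr (_ *: _).
  by have /rowP/(_ s) := covC l k Uu; rewrite !mxE.
rewrite !hes3E !dh aE ddC' curvE !mulmxDl !mulNmx.
move: (dd k (dd l jac) u) (dd l (cov k) u *m _) (cov k u *m hes l u) (cov k u *m _ *m _)
  (cov l u *m hes k u) (act _ _ _) (dd k (cov l) u *m _) (cov l u *m _ *m _) => a1 a2 a3 a4 a5 a6 a7 a8.
apply/matrixP => i j; rewrite !mxE; ring.
Qed.

(** Derivative of the orthogonality between Hessian and tangent vectors. *)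
Lemma hes3_jac l k u : U u ->
  hes3 l k u *m E *m (jac u)^T = - (hes k u *m E *m (hes l u)^T).
move=> Uu; have c0 : cov l u *m hes k u *m E *m (jac u)^T = 0.
  by rewrite -!mulmxA (mulmxA (hes k u)) hes_jac// mulmx0.
rewrite hes3E 2!mulmxBl 2!mulmxBl c0.
have -> : act (cov l u) (hes^~ u) k *m E *m (jac u)^T = 0.
  by rewrite /act !mulmx_suml big1// => s _; rewrite -!scalemxAl hes_jac// scaler0.
rewrite !subr0.
have : dd l (fun v => hes k v *m E *m (jac v)^T) u = 0.
  by rewrite (dd_ext oU _ Uu (fun v Uv => hes_jac k Uv)) dd_cst.
rewrite (dd_mulmx oU)//; [|smo|smo].
rewrite (dd_mulmxl oU)//; last smo.
rewrite (dd_tr oU)//; last smo.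
move/eqP; rewrite addr_eq0 => /eqP ->; congr (- _).
rewrite dd_jac raddfD /= mulmxDr trmx_mul [_ *m (_ *m (cov _ _)^T)]mulmxA.
by rewrite hes_jac// mul0mx addr0.
Qed.

(** The tangential component of [ricci], evaluated by [hes3_jac]. *)
Lemma gauss l k u : U u -> curv l k u *m gm u =
  hes k u *m E *m (hes l u)^T - hes l u *m E *m (hes k u)^T.
move=> Uu; have := hes3_jac l k Uu; rewrite (ricci l k Uu) 2!mulmxBl (hes3_jac k l Uu).
have -> : curv l k u *m jac u *m E *m (jac u)^T = curv l k u *m gm u by rewrite gmE !mulmxA.
move=> /eqP; rewrite -opprD eqr_opp => /eqP <-.
by rewrite addrAC subrr add0r.
Qed.

Lemma hes_pair i j k l u : U u ->
  (hes k u *m E *m (hes l u)^T) i j = (hes i u *m E *m (hes l u)^T) k j.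
move=> Uu.
have -> : (hes k u *m E *m (hes l u)^T) i j = (row i (hes k u) *m E *m (hes l u)^T) 0 j.
  by rewrite -!row_mul [RHS]mxE.
by rewrite hesC// -!row_mul [LHS]mxE.
Qed.

Lemma form_trE p q (A : 'M[R]_(p, N)) (B : 'M[R]_(q, N)) i j :
  (A *m E *m B^T) i j = (B *m E *m A^T) j i.
transitivity ((B *m E *m A^T)^T i j); last by rewrite mxE.
by rewrite !trmx_mul trmxK E_sym mulmxA. Qed.

Lemma curv_pair l k i j u : U u ->
  (curv l k u *m gm u) i j = (curv i j u *m gm u) l k.
have XB (A B : 'M[R]_m) a c : (A - B) a c = A a c - B a c by rewrite !mxE.
move=> Uu; rewrite (gauss l k Uu) (gauss i j Uu) !XB; congr (_ - _).
  by rewrite (hes_pair i j k l Uu) form_trE (hes_pair j k l i Uu) form_trE.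
by rewrite (hes_pair i j l k Uu) form_trE (hes_pair j l k i Uu) form_trE.
Qed.

Definition parallel (P : 'rV[R]_m -> 'M[R]_m) :=
  Coo U P /\
  forall l u, U u -> dd l P u = cov l u *m P u - P u *m cov l u.

(** Integrability condition of the equation for [P]: the difference of its two mixed second
    derivatives is the commutator with the curvature. *)
Lemma parallel_curv P l k u : U u -> parallel P -> P u *m curv l k u = curv l k u *m P u.
move=> Uu [sP dP].
have d2 a c : dd a (dd c P) u = dd a (cov c) u *m P u + cov c u *m (cov a u *m P u - P u *m cov a u)
   - ((cov a u *m P u - P u *m cov a u) *m cov c u + P u *m dd a (cov c) u).
  rewrite (dd_ext oU _ Uu (fun v Uv => dP c v Uv)) (ddB oU)//; [|smo|smo].
  by rewrite !(dd_mulmx oU) ?dP//; smo.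
have := ddC oU l k Uu sP; rewrite !d2 curvE.
rewrite !(mulmxDr, mulmxDl, mulmxN, mulNmx, mulmxBl, mulmxBr, mulmxA).
move: (dd l (cov k) u *m _) (dd k (cov l) u *m _) (_ *m dd l (cov k) u) (_ *m dd k (cov l) u)
  (cov l u *m cov k u *m P u) (cov k u *m cov l u *m P u)
  (P u *m cov l u *m cov k u) (P u *m cov k u *m cov l u)
  (cov l u *m P u *m cov k u) (cov k u *m P u *m cov l u) => a1 a2 a3 a4 a5 a6 a7 a8 a9 a10 /matrixP H.
by apply/matrixP => i j; move: (H i j); rewrite !mxE => Hij; lra.
Qed.

(** The hypothesis on [dd l Q] says that [Q] is parallel as a contravariant tensor; the connection
    terms then cancel and the derivative falls on the Hessian as [hes3]. *)
Lemma dd_contract (Q : 'rV[R]_m -> 'M[R]_m) l u : U u -> Coo U Q ->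
  dd l Q u = - ((cov l u)^T *m Q u) - Q u *m cov l u ->
  dd l (fun v => ctr (Q v) (hes^~ v)) u = ctr (Q u) (hes3 l ^~ u).
move=> Uu sQ dQ.
transitivity (ctr (dd l Q u) (hes^~ u) + ctr (Q u) (fun k => dd l (hes k) u)).
  rewrite /ctr (dd_sum oU)//; last by move=> k; smo.
  rewrite -big_split; apply: eq_bigr => k _ /=.
  rewrite (dd_mulmx oU)//; [|smo|smo].
  by rewrite (dd_row oU).
rewrite (eq_contract _ (fun k => hes3E l k u)) !contract_fB.
rewrite dQ contractD !contractN contract_trM contractMr.
move: (ctr _ _) (ctr _ _) (ctr _ _) => a1 a2 a3.
by rewrite addrC addrA addrAC.
Qed.

Lemma dd_lap l u : U u -> dd l lap u = ctr (invmx (gm u)) (hes3 l ^~ u).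
by move=> Uu; rewrite lapE; apply: dd_contract => //; [smo|exact: dd_ginv]. Qed.

(** Covariant derivative of the commutation of [P] with the Hessian, through which the parallel [P]
    passes. *)
Lemma parallel_hes3 P l k u : parallel P ->
  (forall v j, U v -> act (P v) (hes^~ v) j = P v *m hes j v) -> U u ->
  act (P u) (hes3 l ^~ u) k = P u *m hes3 l k u.
move=> [sP dP] PH Uu.
have dA : dd l (fun v => act (P v) (hes^~ v) k) u =
    act (dd l P u) (hes^~ u) k + act (P u) (fun s => dd l (hes s) u) k.
  rewrite /act (dd_sum oU)//; last by move=> s; smo.
  rewrite -big_split; apply: eq_bigr => s _ /=.
  rewrite (dd_scale oU)//; [|smo|smo].
  by rewrite (dd_mxE l k s Uu sP).
have : dd l (fun v => act (P v) (hes^~ v) k) u = dd l (fun v => P v *m hes k v) u.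
  by apply: (dd_ext oU _ Uu) => v Uv; exact: PH.
rewrite dA (dd_mulmx oU)//; [|smo].
rewrite dP// actB !actM mulmxBl.
have -> : act (cov l u) (act (P u) (hes^~ u)) k = P u *m act (cov l u) (hes^~ u) k.
  by rewrite -act_mulmx; apply: eq_act => s; exact: PH.
rewrite (eq_act _ _ (fun s => hes3E l s u)) hes3E !act_fB act_mulmx PH// !mulmxBr !mulmxA -actM => H.
move: H.
move: (act _ (fun s => dd _ _ _) k) (act (P u *m _) _ _) (P u *m act _ _ _) (P u *m dd _ _ _)
  (cov _ _ *m P u *m _) (P u *m cov _ _ *m _) => a1 a2 a3 a4 a5 a6 /matrixP H.
by apply/matrixP => i j; move: (H i j); rewrite !mxE => Hij; lra.
Qed.

(* For a parallel self-adjoint [P] commuting with the Hessian, the [P]-trace of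
   the Hessian satisfies a Codazzi-type identity: its derivative is [P] applied to
   that of the Laplacian. *)
Lemma dd_parallel_trace P l u : parallel P ->
  (forall v, U v -> P v *m gm v = gm v *m (P v)^T) ->
  (forall v j, U v -> act (P v) (hes^~ v) j = P v *m hes j v) -> U u ->
  dd l (fun v => ctr (invmx (gm v) *m P v) (hes^~ v)) u =
  \sum_s P u l s *: dd s lap u.
move=> pP Psym PH Uu; have [sP dP] := pP; have gu := gU Uu.
set gi := invmx (gm u).
have QP : gi *m P u = (P u)^T *m gi.
  rewrite -[LHS](mulmxK gu) -(mulmxA gi) (Psym _ Uu).
  by rewrite [gi *m _]mulmxA mulVmx// mul1mx.
rewrite (dd_contract Uu); last first.
- rewrite (dd_mulmx oU)//; [|smo].
  rewrite dd_ginv// dP// mulmxBl mulmxBr mulNmx !mulmxA.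
  by rewrite addrA subrK.
- by smo.
transitivity (ctr (gi *m P u) (fun k => hes3 k l u - curv l k u *m jac u)).
  by apply: eq_contract => k; rewrite ricci.
rewrite contract_fB contract_mulmxr.
have -> : ctr (gi *m P u) (fun k => hes3 k l u) =
   \sum_s P u l s *: (dd s lap u + ctr gi (fun k => curv s k u *m jac u)).
  rewrite contractMr.
  transitivity (ctr gi (fun k => act (P u) (hes3 k ^~ u) l)).
    by apply: eq_contract => k; rewrite (parallel_hes3 k l pP PH Uu).
  rewrite contract_act; eqbig s; congr (_ *: _).
  rewrite dd_lap// -contract_fD; apply: eq_contract => k.
  by rewrite (ricci s k Uu) subrK.
(* What remains is that the P-trace of the curvature is [P] applied to the Ricci tensor. Pair
   symmetry moves [P] to the other pair of indices, where [parallel_curv] lets it pass through the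
   curvature to the free index. *)
suff -> : ctr (gi *m P u) (fun k => curv l k u) =
    \sum_s P u l s *: ctr gi (fun k => curv s k u).
  rewrite mulmx_suml -sumrB; eqbig s.
  by rewrite scalerDr contract_mulmxr scalemxAl addrK.
rewrite -[LHS](mulmxK gu) -[RHS](mulmxK gu); congr (_ *m _).
rewrite -contract_mulmxr mulmx_suml; apply/rowP => j.
transitivity (\sum_i (curv i j u *m gm u *m (gi *m P u)) l i).
  rewrite contractE summxE; transitivity (\sum_k \sum_i (gi *m P u) k i * (curv i j u *m gm u) l k).
    eqbig k; rewrite summxE; eqbig i; rewrite !mxE; congr (_ * _).
    by have := curv_pair l k i j Uu; rewrite !mxE.
  rewrite exchange_big; eqbig i; rewrite [RHS]mxE.
  by eqbig k; rewrite mulrC.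
transitivity (\sum_i \sum_s P u l s * (curv i j u) s i).
  eqbig i; rewrite mulmxA mulmxK// -(parallel_curv _ _ Uu pP) mxE //.
rewrite exchange_big [RHS]summxE; eqbig s.
rewrite -scalemxAl mxE -mulr_sumr; congr (_ * _).
rewrite -contract_mulmxr contractE summxE.
transitivity (\sum_i (curv i j u *m gm u *m gi) s i).
  by eqbig i; rewrite mulmxK.
transitivity (\sum_i \sum_k gi k i * (curv i j u *m gm u) s k).
  by eqbig i; rewrite mxE; eqbig k; rewrite mulrC.
rewrite exchange_big; eqbig k; rewrite summxE; eqbig i.
by rewrite !mxE; congr (_ * _); have := curv_pair i j s k Uu; rewrite !mxE => ->.
Qed.

End Parametrization.

(** * Agreement of the matrix calculus with Christoffel symbols, curvature and Laplacian in
    coordinates *)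

Section DefsBridge.
Variables (R : realType) (m N : nat) (b : 'rV[R]_N -> 'rV[R]_N -> R) (E : 'M[R]_N).
Hypothesis E_sym : E^T = E.
Hypothesis bE : forall u v, b u v = (u *m E *m v^T) 0 0.
Variables (U : set 'rV[R]_m) (Y : 'rV[R]_m -> 'rV[R]_N).
Hypotheses (oU : open U) (sY : Coo U Y).
Notation jac := (jac Y).
Notation gm := (gm E Y).
Notation cov := (cov E Y).
Notation hes := (hes E Y).
Notation lap := (lap E Y).
Notation curv := (curv E Y).
Hypothesis gU : forall u, U u -> gm u \in unitmx.
Notation G := (induced_metric b Y).

Lemma form_rowE p q (A : 'M[R]_(p, N)) (B : 'M[R]_(q, N)) i j :
  b (row i A) (row j B) = (A *m E *m B^T) i j.
rewrite bE -row_mul tr_row !mxE; eqbig k; rewrite !mxE.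
by congr (_ * _).
Qed.

Lemma row_jac i u : row i (jac u) = dd i Y u.
by rewrite jacE rowK. Qed.

Lemma induced_metricE u : G u = gm u.
apply/matrixP => i j; rewrite gmE -form_rowE !row_jac ddE mxE.
by [].
Qed.

Lemma dd_gm_entry k i j u : U u -> pd k (fun v => G v i j) u =
  (cov k u *m gm u) i j + (cov k u *m gm u) j i.
move=> Uu; rewrite -ddE.
have sg := sm_gm E oU sY.
transitivity (dd k (fun v => gm v i j) u).
  by apply: (dd_ext oU _ Uu) => v _; rewrite induced_metricE.
rewrite (dd_mxE k i j Uu sg) (dd_gm E_sym oU sY gU k Uu) mxE; congr (_ + _).
have -> : gm u *m (cov k u)^T = (cov k u *m gm u)^T by rewrite [RHS]trmx_mul gm_sym.
by rewrite mxE.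
Qed.

Lemma covg_sym k i s u : U u -> (cov k u *m gm u) i s = (cov i u *m gm u) k s.
move=> Uu; have /rowP/(_ s) := congr1 (fun r => r *m gm u) (covC E oU sY i k Uu).
by rewrite -!row_mul ![row _ _ _ _]mxE.
Qed.

Lemma christoffelE l k i u : U u -> christoffel G l k i u = cov k u i l.
move=> Uu; transitivity (\sum_s (invmx (gm u)) l s * (cov k u *m gm u) i s).
  rewrite /christoffel mulr_sumr; eqbig s.
  rewrite !dd_gm_entry// induced_metricE.
  rewrite (covg_sym k s i Uu) (covg_sym s i k Uu) (covg_sym s k i Uu) (covg_sym i k s Uu).
  move: (invmx (gm u) l s) ((cov k u *m gm u) i s) ((cov k u *m gm u) s i) ((cov i u *m gm u) s k) => a c d e.
  by field.
transitivity ((cov k u *m gm u *m invmx (gm u)) i l); last by rewrite mulmxK ?gU.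
rewrite mxE; eqbig s; rewrite mulrC; congr (_ * _).
by rewrite -[in LHS](ginv_sym E_sym Y u) mxE.
Qed.

Lemma laplacianE u : U u -> laplacian G Y u = lap u.
move=> Uu; rewrite lapE contractE; eqbig i; eqbig j.
rewrite induced_metricE; congr (_ *: _).
rewrite hesE raddfB /= jacE (dd_rows oU)//; last by move=> ?; exact: sm_dd.
rewrite -!ddE; congr (_ - _); rewrite row_mul mulmx_sum_row.
by eqbig k; rewrite christoffelE// rowK mxE.
Qed.

Lemma curvatureE t i l k u : U u -> curvature G t i l k u = curv l k u i t.
move=> Uu; have sc c := sm_cov oU sY gU c.
have dG a c d : pd a (christoffel G d c i) u = dd a (cov c) u i d.
  rewrite -ddE -(dd_mxE a i d Uu (sc c)); apply: (dd_ext oU _ Uu) => v Uv.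
  exact: christoffelE.
rewrite /curvature !dG curvE !mxE; congr (_ + _); rewrite -sumrB; eqbig s.
by rewrite !christoffelE// mulrC [_ * cov k u s t]mulrC.
Qed.

Definition hes_sqnorm u : R :=
  \sum_i \sum_k invmx (gm u) i k * \tr (hes k u *m E *m (hes i u)^T *m invmx (gm u)).

(** The Gauss equation traced twice. *)
Lemma gauss_scalar u : U u ->
  scalar_curvature G u = b (lap u) (lap u) - hes_sqnorm u.
move=> Uu; set gi := invmx (gm u).
have h4 (A : 'M[R]_m) : \tr (A *m gi) = \sum_i \sum_s gi s i * A i s.
  by eqbig i; rewrite mxE; eqbig s; rewrite mulrC.
have -> : b (lap u) (lap u) = \sum_j \sum_k gi j k * \sum_i \sum_s gi s i *
    (hes j u *m E *m (hes i u)^T) k s.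
  rewrite lapE contractE bE !mulmx_suml summxE; eqbig j.
  rewrite !mulmx_suml summxE; eqbig k.
  rewrite -!scalemxAl mxE; congr (_ * _).
  rewrite raddf_sum /= mulmx_sumr summxE; eqbig i.
  rewrite raddf_sum /= mulmx_sumr summxE; eqbig s.
  rewrite linearZ /= -scalemxAr mxE -bE form_rowE; congr (_ * _).
  by rewrite -[gi](ginv_sym E_sym) mxE.
rewrite -sumrB; eqbig j; rewrite -sumrB; eqbig k.
rewrite induced_metricE -mulrBr; congr (_ * _).
rewrite h4 /ricci -sumrB; eqbig i; rewrite -sumrB.
transitivity ((curv i j u *m gm u *m gi) k i).
  by rewrite mulmxK ?gU// curvatureE.
rewrite mxE; eqbig s; rewrite mulrC -mulrBr; congr (_ * _).
rewrite (gauss oU sY gU i j Uu) mxE; congr (_ + _); rewrite mxE; congr (- _).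
exact: (hes_pair E oU sY k s i j Uu).
Qed.

Lemma cov_derivE (P : 'rV[R]_m -> 'M[R]_m) k i j u : U u -> Coo U P ->
  cov_deriv G P k i j u = (dd k P u - cov k u *m P u - P u *m (cov k u)^T) i j.
move=> Uu sP; rewrite /cov_deriv !mxE -ddE (dd_mxE k i j Uu sP).
congr (_ - _ - _); eqbig l; rewrite christoffelE// !mxE//.
by rewrite mulrC.
Qed.

End DefsBridge.

Section BilinearForm.
Variables (R : realType) (N : nat) (b : 'rV[R]_N -> 'rV[R]_N -> R) (eta : 'M[R]_N).
Hypothesis eta_sym : eta^T = eta.
Hypothesis bE : forall u v, b u v = (u *m eta *m v^T) 0 0.

Lemma bformC u v : b u v = b v u.
rewrite !bE; transitivity ((v *m eta *m u^T)^T 0 0); last by rewrite mxE.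
by rewrite !trmx_mul trmxK eta_sym mulmxA.
Qed.

Lemma bformDl u v w : b (u + v) w = b u w + b v w.
by rewrite !bE !mulmxDl mxE. Qed.

Lemma bformDr u v w : b w (u + v) = b w u + b w v.
by rewrite !(bformC w) bformDl. Qed.

Lemma bformZl k u w : b (k *: u) w = k * b u w.
by rewrite !bE -!scalemxAl mxE. Qed.

Lemma bformZr k u w : b w (k *: u) = k * b w u.
by rewrite !(bformC w) bformZl. Qed.

Lemma bformNl u w : b (- u) w = - b u w.
by rewrite -scaleN1r bformZl mulN1r. Qed.

Lemma bformNr u w : b w (- u) = - b w u.
by rewrite !(bformC w) bformNl. Qed.

Lemma bformBl u v w : b (u - v) w = b u w - b v w.
by rewrite bformDl bformNl. Qed.

Lemma bformBr u v w : b w (u - v) = b w u - b w v.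
by rewrite bformDr bformNr. Qed.

Lemma bform0l w : b 0 w = 0. by rewrite -(scale0r 0) bformZl mul0r. Qed.
Lemma bform0r w : b w 0 = 0. by rewrite bformC bform0l. Qed.

End BilinearForm.

Lemma mx11_eq (R : Type) (A B : 'M[R]_1) : A 0 0 = B 0 0 -> A = B.
by move=> AB; apply/matrixP => i j; rewrite !ord1. Qed.

(** * Position vectors of constant square *)

Section ConstantLength.
Variables (R : realType) (m N : nat) (E : 'M[R]_N).
Hypothesis E_sym : E^T = E.
Variables (U : set 'rV[R]_m) (f : 'rV[R]_m -> 'rV[R]_N) (a : 'M[R]_1).
Hypotheses (oU : open U) (sf : Coo U f).
Notation jac := (jac f).
Notation gm := (gm E f).
Notation cov := (cov E f).
Notation hes := (hes E f).
Notation lap := (lap E f).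
Hypothesis gU : forall u, U u -> gm u \in unitmx.
Hypothesis ffa : forall u, U u -> f u *m E *m (f u)^T = a.

(** The constant [a] is 0 for maps into the light cone and the inverse of the curvature for maps
    into a quadric; successive differentiation of it gives the next lemmas. *)
Lemma jac_pos u : U u -> jac u *m E *m (f u)^T = 0.
move=> Uu; have H i : dd i (fun v => f v *m E *m (f v)^T) u = 0.
  by rewrite (dd_ext oU i Uu (g := fun=> a)) ?dd_cst.
apply/matrixP => i j; rewrite ord1 [RHS]mxE; have /matrixP/(_ 0 0) := H i.
rewrite (dd_mulmx oU)//; [|smo|smo].
rewrite (dd_mulmxl oU)// (dd_tr oU)// -[dd i f u](row_jac f i u).
have XD (A B : 'M[R]_1) : (A + B) 0 0 = A 0 0 + B 0 0 by rewrite mxE.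
rewrite XD [X in _ + X](form_trE E_sym) -!row_mul.
have -> : row i (jac u *m E *m (f u)^T) 0 0 = (jac u *m E *m (f u)^T) i 0 by rewrite mxE.
have -> : (0 : 'M[R]_1) 0 0 = 0 by rewrite mxE.
by rewrite -mulr2n => /eqP; rewrite mulrn_eq0 => /eqP.
Qed.

Lemma hes_pos k u : U u -> hes k u *m E *m (f u)^T = - col k (gm u).
move=> Uu; have : dd k (fun v => jac v *m E *m (f v)^T) u = 0.
  by rewrite (dd_ext oU _ Uu (fun v Uv => jac_pos Uv)) dd_cst.
have sj := sm_jac oU sf.
rewrite (dd_mulmx oU)//; [|smo|smo].
rewrite (dd_mulmxl oU)// (dd_tr oU)//.
rewrite (dd_jac E f k u) mulmxDl mulmxDl.
have -> : jac u *m E *m (dd k f u)^T = col k (gm u).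
  by rewrite gmE -(row_jac f k u) tr_row !colE !mulmxA.
have -> : cov k u *m jac u *m E *m (f u)^T = 0.
  by rewrite -!mulmxA [jac u *m _]mulmxA jac_pos// mulmx0.
by rewrite addr0 => /eqP; rewrite addr_eq0 => /eqP.
Qed.

Lemma lap_pos u : U u -> lap u *m E *m (f u)^T = - (m%:R)%:M.
move=> Uu; apply: mx11_eq; rewrite lapE -!contract_mulmxr.
rewrite (eq_contract _ (fun k => hes_pos k Uu)) /ctr summxE.
have -> : (- (m%:R)%:M : 'M[R]_1) 0 0 = - m%:R by rewrite !mxE.
have -> : m%:R = \tr (invmx (gm u) *m gm u) by rewrite mulVmx ?gU// mxtrace1.
rewrite -sumrN; eqbig k.
rewrite mulmxN [LHS]mxE; congr (- _); rewrite [LHS]mxE [RHS]mxE; eqbig j.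
by rewrite !mxE.
Qed.

End ConstantLength.

(** * Second fundamental form and mean curvature in a space form *)

Section SpaceForm.
Variables (R : realType) (m N : nat) (Q : space_form R N) (E : 'M[R]_N).
Hypothesis E_sym : E^T = E.
Hypothesis QE : forall u v, sf_form Q u v = (u *m E *m v^T) 0 0.
Variables (U : set 'rV[R]_m) (f : 'rV[R]_m -> 'rV[R]_N).
Hypotheses (oU : open U) (sf : Coo U f).
Notation jac := (jac f).
Notation gm := (gm E f).
Notation cov := (cov E f).
Notation hes := (hes E f).
Notation lap := (lap E f).
Hypothesis gU : forall u, U u -> gm u \in unitmx.
Notation c := (sf_curv Q).
(** For nonzero [c] it says that the square of [f] is 1/c, for [c = 0] it says nothing; quadrics and
    flat space are thus treated together. *)
Hypothesis cff : forall u, U u -> c * (c * sf_form Q (f u) (f u)) = c.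

Let curv_length : c != 0 -> forall u, U u -> f u *m E *m (f u)^T = (c^-1)%:M.
move=> cn0 v Uv; apply: mx11_eq; rewrite -QE mxE mulr1n; have := cff Uv.
by move=> /(congr1 (fun x => c^-1 * x)); rewrite mulKf// mulVf// => /(congr1 (fun x => c^-1 * x)); rewrite mulKf// mulr1.
Qed.

Lemma curv_jac_pos u : U u -> c *: (jac u *m E *m (f u)^T) = 0.
move=> Uu; have [->|cn0] := eqVneq c 0; first by rewrite scale0r.
by rewrite (jac_pos E_sym oU sf (curv_length cn0) Uu) scaler0.
Qed.

Lemma curv_hes_pos k u : U u -> c *: (hes k u *m E *m (f u)^T) = - (c *: col k (gm u)).
move=> Uu; have [->|cn0] := eqVneq c 0; first by rewrite !scale0r oppr0.
by rewrite (hes_pos E_sym oU sf (curv_length cn0) k Uu) scalerN.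
Qed.

Lemma curv_lap_pos u : U u -> c * (lap u *m E *m (f u)^T) 0 0 = - (c * m%:R).
move=> Uu; have [->|cn0] := eqVneq c 0; first by rewrite !mul0r oppr0.
by rewrite (lap_pos E_sym oU sf gU (curv_length cn0) Uu) !mxE mulr1n mulrN.
Qed.

(** The ambient Hessian is already orthogonal to the submanifold; passing to the quadric only
    removes its component along the position vector, and that component is known from
    [curv_hes_pos]. *)
Lemma sffE i j u : U u -> sff Q f i j u = row j (hes i u) + (c * gm u i j) *: f u.
move=> Uu; have gs := gm_sym E_sym f u.
have dE : pd i (pd j f) u = row j (hes i u) + row j (cov i u *m jac u).
  rewrite -raddfD /= -dd_jac jacE (dd_rows oU)//; last by move=> ?; exact: sm_dd.
  by rewrite -!ddE.
rewrite /sff /normal_proj /space_proj.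
have -> : c * sf_form Q (pd i (pd j f) u) (f u) = - (c * gm u i j).
  rewrite dE QE mulmxDl mulmxDl mxE mulrDr.
  have -> : c * (row j (hes i u) *m E *m (f u)^T) 0 0 = - (c * gm u i j).
    have /matrixP/(_ j 0) := curv_hes_pos i Uu; rewrite -!row_mul !mxE => ->.
    by rewrite -{1}gs mxE.
  have -> : c * (row j (cov i u *m jac u) *m E *m (f u)^T) 0 0 = 0.
    have /matrixP/(_ j 0) : cov i u *m (c *: (jac u *m E *m (f u)^T)) = 0.
      by rewrite curv_jac_pos// mulmx0.
    by rewrite -scalemxAr -!row_mul !mulmxA !mxE.
  by rewrite addr0.
rewrite scaleNr opprK.
suff -> : \sum_k \sum_l ((invmx (induced_metric (sf_form Q) f u)) k l *
    sf_form Q (pd i (pd j f) u) (pd k f u)) *: pd l f u = row j (cov i u *m jac u).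
  by rewrite dE addrAC addrK.
have H k : sf_form Q (pd i (pd j f) u) (pd k f u) = (cov i u *m gm u) j k.
  rewrite dE -[pd k f u]/(pd k f u) -ddE -(row_jac f k u) QE 2!mulmxDl mxE.
  have -> : (row j (hes i u) *m E *m (row k (jac u))^T) 0 0 = 0.
    by rewrite -QE (form_rowE QE) (hes_jac gU)// mxE.
  by rewrite add0r -QE (form_rowE QE) gmE !mulmxA.
rewrite exchange_big /= row_mul mulmx_sum_row; eqbig l.
rewrite -scaler_suml row_jac ddE; congr (_ *: _).
transitivity ((cov i u *m gm u *m invmx (gm u)) j l); last by rewrite mulmxK ?gU// mxE.
rewrite mxE; eqbig k; rewrite H mulrC; congr (_ * _).
by rewrite (induced_metricE QE).
Qed.

Lemma trace_ginv_gm u : U u -> \sum_i \sum_j (invmx (gm u)) i j * gm u i j = m%:R.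
move=> Uu; have -> : m%:R = \tr (invmx (gm u) *m gm u) by rewrite mulVmx ?gU// mxtrace1.
eqbig i; rewrite mxE; eqbig j; congr (_ * _).
by rewrite -[in LHS](gm_sym E_sym f u) mxE.
Qed.

Hypothesis m_gt0 : (0 < m)%N.

Lemma mean_curvatureE u : U u ->
  mean_curvature Q f u = m%:R^-1 *: lap u + c *: f u.
move=> Uu; rewrite /mean_curvature.
have -> : \sum_i \sum_j (invmx (induced_metric (sf_form Q) f u)) i j *: sff Q f i j u =
   lap u + (c * m%:R) *: f u.
  rewrite lapE contractE -(trace_ginv_gm Uu) mulr_sumr scaler_suml -big_split.
  eqbig i; rewrite mulr_sumr scaler_suml -big_split; apply: eq_bigr => j _ /=.
  by rewrite (induced_metricE QE) sffE// scalerDr scalerA mulrCA.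
by rewrite scalerDr scalerA mulrCA mulVf ?mulr1// pnatr_eq0 -lt0n.
Qed.

Lemma mean_curvature_sqnorm u : U u ->
  sf_form Q (mean_curvature Q f u) (mean_curvature Q f u) =
  m%:R ^- 2 * sf_form Q (lap u) (lap u) - c.
move=> Uu; rewrite mean_curvatureE// (bformDl QE) !(bformDr E_sym QE) !(bformZl QE) !(bformZr E_sym QE).
rewrite (bformC E_sym QE (f u)).
have := curv_lap_pos Uu; rewrite -QE; have := cff Uu.
have mn0 : m%:R != 0 :> R by rewrite pnatr_eq0 -lt0n.
move: (sf_form _ _ _) (sf_form _ _ _) (sf_form _ _ _) => x y z -> H.
rewrite mulrCA H mulrA.
have -> : c * (m%:R^-1 * y) = m%:R^-1 * (c * y) by rewrite mulrCA.
by rewrite H; field.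
Qed.

Lemma sff_sqnormE u : U u -> sff_sqnorm Q f u = hes_sqnorm E f u - c * m%:R.
move=> Uu; have gs := gm_sym E_sym f u; have is_ := ginv_sym E_sym f u.
rewrite /sff_sqnorm (induced_metricE QE); set gi := invmx (gm u).
have H i j k l : sf_form Q (sff Q f i j u) (sff Q f k l u) =
    (hes k u *m E *m (hes i u)^T) l j - c * (gm u i j * gm u k l).
  rewrite !sffE// (bformDl QE) !(bformDr E_sym QE) !(bformZl QE) !(bformZr E_sym QE).
  rewrite (form_rowE QE) (form_trE E_sym (hes i u)).
  have A a d : c * sf_form Q (row d (hes a u)) (f u) = - (c * gm u a d).
    rewrite QE -!row_mul mxE; have /matrixP/(_ d 0) := curv_hes_pos a Uu.
    by rewrite !mxE => ->; rewrite -{1}gs mxE.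
  have A1 := A i j; have A2 := A k l; have A3 := cff Uu.
  rewrite (bformC E_sym QE (f u)).
  move: A1 A2 A3; move: (sf_form _ _ _) (sf_form _ _ _) (sf_form _ _ _) (gm u i j) (gm u k l) ((_ *m _) _ _).
  move=> x y z a d e A1 A2 A3.
  have -> : c * d * z = d * (c * z) by ring.
  have -> : c * a * y = a * (c * y) by ring.
  have -> : c * a * (c * d * x) = a * d * (c * (c * x)) by ring.
  by rewrite A1 A2 A3; ring.
transitivity (\sum_i \sum_j \sum_k \sum_l gi i k * gi j l * (hes k u *m E *m (hes i u)^T) l j -
  c * \sum_i \sum_j \sum_k \sum_l gi i k * gi j l * (gm u i j * gm u k l)).
  rewrite mulr_sumr -sumrB; eqbig i; rewrite mulr_sumr -sumrB; eqbig j.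
  rewrite mulr_sumr -sumrB; eqbig k; rewrite mulr_sumr -sumrB; eqbig l.
  by rewrite H; ring.
congr (_ - c * _).
  eqbig i; rewrite exchange_big; apply: eq_bigr => k _ /=.
  rewrite mulr_sumr exchange_big; apply: eq_bigr => l _ /=.
  rewrite mxE mulr_sumr; eqbig j.
  by rewrite -mulrA mulrCA mulrC -!mulrA mulrCA; congr (_ * _); rewrite mulrC.
rewrite -(trace_ginv_gm Uu); eqbig i.
transitivity (\sum_j \sum_l gi j l * gm u i j * (gi *m gm u) i l).
  eqbig j; rewrite exchange_big; apply: eq_bigr => l _ /=.
  by rewrite mxE mulr_sumr; eqbig k; ring.
rewrite exchange_big /=; transitivity (\sum_l (gm u *m gi) i l * (gi *m gm u) i l).
  by eqbig l; rewrite [in RHS]mxE mulr_suml; eqbig j; rewrite [gi j l * _]mulrC.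
transitivity ((gm u *m gi) i i).
  rewrite mulVmx ?gU// mulmxV ?gU// (bigD1 i)//= big1 ?addr0 => [|l li].
    by rewrite !mxE eqxx mulr1.
  by rewrite !mxE eq_sym (negPf li) mulr0.
rewrite mxE; eqbig j; rewrite mulrC; congr (_ * _).
by rewrite /gi -{1}is_ mxE.
Qed.

(** The curvature of the space form disappears, since both terms on the left are shifted by
    $-cm$. *)
Lemma sff_traceless_sqnorm u : U u ->
  sff_sqnorm Q f u - m%:R * sf_form Q (mean_curvature Q f u) (mean_curvature Q f u) =
  hes_sqnorm E f u - m%:R^-1 * sf_form Q (lap u) (lap u).
move=> Uu; rewrite sff_sqnormE// mean_curvature_sqnorm//.
have mn0 : m%:R != 0 :> R by rewrite pnatr_eq0 -lt0n.
by move: (hes_sqnorm E f u) (sf_form _ _ _) => x y; field.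
Qed.

End SpaceForm.

(** * The Lorentz form and positivity of Gram matrices *)

Section Lorentz.
Variables (R : realType) (n : nat).

Definition mink : 'M[R]_(1 + n) := block_mx (-1)%:M 0 0 1%:M.

Lemma mink_sym : mink^T = mink.
by rewrite /mink tr_block_mx !trmx0 !tr_scalar_mx. Qed.

Lemma dotE k (u v : 'rV[R]_k) : dot u v = (u *m 1%:M *m v^T) 0 0.
by rewrite mulmx1 mxE; eqbig i; rewrite mxE. Qed.

Lemma lorentzE (u v : 'rV[R]_(1 + n)) : lorentz u v = (u *m mink *m v^T) 0 0.
rewrite -{2}[u]hsubmxK -{2}[v]hsubmxK /mink tr_row_mx mul_row_block !mulmx0 addr0 add0r.
rewrite mul_row_col mxE /lorentz dotE; congr (_ + _).
rewrite mul_mx_scalar -scalemxAl mxE mulN1r; congr (- _).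
rewrite mxE big_ord1 !mxE; congr (u 0 _ * v 0 _); exact/val_inj.
Qed.

Lemma row_mx_mink m p (a : 'M[R]_(m, 1)) (x : 'M[R]_(m, n)) (d : 'M[R]_(p, 1)) (y : 'M[R]_(p, n)) :
  row_mx a x *m mink *m (row_mx d y)^T = - (a *m d^T) + x *m y^T.
rewrite /mink tr_row_mx mul_row_block !mulmx0 addr0 add0r mul_row_col mulmx1.
by rewrite mul_mx_scalar -scalemxAl scaleN1r.
Qed.

Lemma mink_tr p q (A : 'M[R]_(p, 1 + n)) (B : 'M[R]_(q, 1 + n)) :
  (A *m mink *m B^T)^T = B *m mink *m A^T.
by rewrite !trmx_mul trmxK mink_sym mulmxA. Qed.

Lemma mink_tr0 p q (A : 'M[R]_(p, 1 + n)) (B : 'M[R]_(q, 1 + n)) :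
  A *m mink *m B^T = 0 -> B *m mink *m A^T = 0.
by move=> H; rewrite -mink_tr H trmx0. Qed.

Lemma dot_ge0 k (u : 'rV[R]_k) : 0 <= dot u u.
by apply: sumr_ge0 => i _; exact: sqr_ge0. Qed.

Lemma dot_eq0 k (u : 'rV[R]_k) : dot u u = 0 -> u = 0.
move=> /eqP; rewrite psumr_eq0; last by move=> i _; exact: sqr_ge0.
move=> /allP H; apply/rowP => i; rewrite mxE; apply/eqP.
by have := H i (mem_index_enum i); rewrite /= mulf_eq0 orbb.
Qed.

Lemma frob_ge0 p q (A : 'M[R]_(p, q)) : 0 <= \tr (A *m A^T).
apply: sumr_ge0 => i _; rewrite mxE; apply: sumr_ge0 => j _; rewrite mxE; exact: sqr_ge0.
Qed.

Lemma frob_eq0 p q (A : 'M[R]_(p, q)) : \tr (A *m A^T) = 0 -> A = 0.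
move=> /eqP; rewrite psumr_eq0 => [/allP H|i _]; last first.
  by rewrite mxE; apply: sumr_ge0 => j _; rewrite mxE; exact: sqr_ge0.
apply/row_matrixP => i; rewrite row0; apply: dot_eq0; apply/eqP.
have := H i (mem_index_enum i) => /= /eqP <-; rewrite mxE; apply/eqP; eqbig j.
by rewrite !mxE.
Qed.

Lemma definite_unitmx k (P : 'M[R]_k) :
  (forall v : 'rV_k, (v *m P *m v^T) 0 0 = 0 -> v = 0) -> P \in unitmx.
move=> H; rewrite -row_free_unit; apply: inj_row_free => v vP; apply: H.
by rewrite vP mul0mx mxE.
Qed.

Lemma gram_definite p q (J : 'M[R]_(p, q)) (v : 'rV_p) : row_free J ->
  (v *m (J *m J^T) *m v^T) 0 0 = 0 -> v = 0.
move=> fJ H; have : v *m J = 0.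
  by apply: dot_eq0; rewrite dotE mulmx1 trmx_mul !mulmxA -[RHS]H !mulmxA.
move=> /(congr1 (mulmx^~ (pinvmx J))) /=; rewrite mul0mx.
by rewrite -mulmxA mulmxVp// mulmx1.
Qed.

End Lorentz.

(** * The traceless Hessian and its norm *)

Section Traceless.
Variables (R : realType) (m N : nat) (E : 'M[R]_N).
Hypothesis E_sym : E^T = E.
Variables (f : 'rV[R]_m -> 'rV[R]_N) (u : 'rV[R]_m).
Notation gm := (gm E f u).
Notation gi := (invmx gm).
Notation lap := (lap E f u).
Hypothesis gU : gm \in unitmx.
Hypothesis m_gt0 : (0 < m)%N.

Definition tless := locked_with dd_key
  (fun k => hes E f k u - m%:R^-1 *: (col k gm *m lap)).

Lemma tlessE k : tless k = hes E f k u - m%:R^-1 *: (col k gm *m lap).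
by rewrite /tless unlock. Qed.

Definition tless_sqnorm : R :=
  \sum_i \sum_k gi i k * \tr (tless k *m E *m (tless i)^T *m gi).

Lemma tless_lap : ctr gi tless = 0.
have -> : ctr gi tless = ctr gi (hes E f ^~ u) - m%:R^-1 *: ctr gi (fun k => col k gm *m lap).
  rewrite /ctr scaler_sumr -sumrB; eqbig k.
  rewrite tlessE.
  by rewrite mulmxBr -scalemxAr.
have lE : ctr gi (hes E f ^~ u) = lap by rewrite lapE.
rewrite (contract_mulmxr gi lap) lE.
have -> : ctr gi (fun k => col k gm) = (m%:R)%:M.
  apply: mx11_eq; rewrite /ctr summxE mxE mulr1n.
  have -> : m%:R = \tr (gi *m gm) by rewrite mulVmx ?mxtrace1.
  eqbig k; rewrite [LHS]mxE [RHS]mxE; eqbig j; rewrite !mxE//.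
by rewrite mul_scalar_mx scalerA mulVf ?scale1r ?subrr// pnatr_eq0 -lt0n.
Qed.

Lemma sum_trace_contract (X : 'I_m -> 'M[R]_(m, N)) (w : 'rV[R]_N) :
  \sum_i \sum_k gi i k * \tr (X k *m E *m (col i gm *m w)^T *m gi) =
  (ctr gi X *m E *m w^T) 0 0.
rewrite exchange_big /ctr !mulmx_suml summxE; eqbig k.
have -> : \sum_i gi i k * \tr (X k *m E *m (col i gm *m w)^T *m gi) =
   \tr (X k *m E *m w^T *m (\sum_i gi i k *: (col i gm)^T *m gi)).
  rewrite mulmx_sumr raddf_sum; apply: eq_bigr => i _ /=.
  by rewrite -!scalemxAl -scalemxAr linearZ /= trmx_mul !mulmxA.
have -> : \sum_i gi i k *: (col i gm)^T *m gi = row k gi.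
  rewrite -mulmx_suml -[RHS](mulmxK gU); congr (_ *m _).
  apply/rowP => j; rewrite summxE [RHS]mxE; eqbig i.
  have -> : (gi i k *: (col i gm)^T) 0 j = gi i k * gm j i by rewrite !mxE.
  have -> : gi i k = gi k i by rewrite -{1}(ginv_sym E_sym f u) mxE.
  have -> : gm j i = gm i j by rewrite -{1}(gm_sym E_sym f u) mxE.
  by rewrite [row k gi 0 i]mxE.
by rewrite mxtrace_mulC trace_mx11 !mulmxA.
Qed.

Lemma tless_sqnormE :
  tless_sqnorm = hes_sqnorm E f u - m%:R^-1 * (lap *m E *m lap^T) 0 0.
have A : tless_sqnorm = \sum_i \sum_k gi i k * \tr (tless k *m E *m (hes E f i u)^T *m gi).
  apply/eqP; rewrite -subr_eq0 -sumrB; apply/eqP.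
  transitivity (- (m%:R^-1 * (ctr gi tless *m E *m lap^T) 0 0)); last first.
    by rewrite tless_lap !mul0mx mxE mulr0 oppr0.
  rewrite -sum_trace_contract mulr_sumr -sumrN; eqbig i.
  rewrite -sumrB mulr_sumr -sumrN; eqbig k.
  rewrite -mulrBr -raddfB /= -mulmxBl -mulmxBr -raddfB /= (tlessE i) addrAC subrr add0r.
  have -> : (- (m%:R^-1 *: (col i gm *m lap)))^T = - (m%:R^-1 *: (col i gm *m lap)^T).
    by rewrite linearN linearZ.
  by rewrite mulmxN mulNmx -scalemxAr -scalemxAl raddfN /= mxtraceZ mulrN mulrCA.
rewrite A /hes_sqnorm.
have -> : (lap *m E *m lap^T) 0 0 = \sum_i \sum_k gi i k * \tr (hes E f k u *m E *m (col i gm *m lap)^T *m gi).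
  by rewrite sum_trace_contract lapE.
have -> : \sum_i \sum_k gi i k * \tr (hes E f k u *m E *m (col i gm *m lap)^T *m gi) =
  \sum_i \sum_k gi i k * \tr ((col k gm *m lap) *m E *m (hes E f i u)^T *m gi).
  rewrite exchange_big; eqbig k; eqbig i.
  rewrite -[in RHS](ginv_sym E_sym f u) mxE; congr (_ * _).
  rewrite -[LHS]mxtrace_tr !trmx_mul !trmxK E_sym (ginv_sym E_sym) mxtrace_mulC.
  by rewrite !mulmxA.
rewrite mulr_sumr -sumrB; eqbig i; rewrite mulr_sumr -sumrB; eqbig k.
rewrite mulrCA -mulrBr (tlessE k) !mulmxBl raddfB /= -!scalemxAl linearZ /=.
by [].
Qed.

End Traceless.

Section TracelessPositive.
Variables (R : realType) (m N : nat) (f : 'rV[R]_m -> 'rV[R]_N) (u : 'rV[R]_m).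
Notation g := (gm 1%:M f u).
Hypothesis gU : g \in unitmx.
Notation gi := (invmx g).
Notation T := (tless 1%:M f u).

Let K := gi *m jac f u.
Let KK : K *m K^T = gi.
rewrite /K trmx_mul (ginv_sym (trmx1 _ _)) -!mulmxA [jac f u *m _]mulmxA.
have -> : jac f u *m (jac f u)^T = g by rewrite gmE mulmx1.
by rewrite mulmxA mulVmx// mul1mx.
Qed.

Let JK : jac f u *m K^T = 1%:M.
rewrite /K trmx_mul (ginv_sym (trmx1 _ _)) mulmxA.
have -> : jac f u *m (jac f u)^T = g by rewrite gmE mulmx1.
by rewrite mulmxV.
Qed.

(** The factorisation $g^{-1}=KK^T$ with $K=g^{-1}J$ plays the role of an orthonormal frame and
    turns the double contraction into a sum of Frobenius norms. *)
Lemma tless_sqnorm_sum : tless_sqnorm 1%:M f u =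
  \sum_a \tr ((K^T *m (\sum_k K k a *: T k)) *m (K^T *m (\sum_k K k a *: T k))^T).
rewrite /tless_sqnorm; transitivity (\sum_i \sum_k \sum_a (K i a * K k a) * \tr (K^T *m T k *m (K^T *m T i)^T)).
  eqbig i; eqbig k; rewrite -mulr_suml; congr (_ * _).
    by rewrite -[in LHS]KK mxE; eqbig a; rewrite !mxE.
  have -> : T k *m 1%:M *m (T i)^T *m gi = T k *m (T i)^T *m (K *m K^T) by rewrite KK mulmx1.
  have -> : (K^T *m T i)^T = (T i)^T *m K by rewrite trmx_mul trmxK.
  by rewrite -(mulmxA K^T) [RHS]mxtrace_mulC !mulmxA.
rewrite (exchange_big_dep xpredT)//=.
transitivity (\sum_k \sum_a \sum_i (K i a * K k a) * \tr (K^T *m T k *m (K^T *m T i)^T)).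
  by eqbig k; exact: exchange_big.
rewrite exchange_big; eqbig a.
rewrite mulmx_sumr mulmx_suml raddf_sum; apply: eq_bigr => k _ /=.
rewrite raddf_sum /= mulmx_sumr raddf_sum; apply: eq_bigr => i _ /=.
rewrite -!scalemxAr [(_ *: _)^T]linearZ /= -scalemxAl -scalemxAr !mxtraceZ.
by rewrite mulrA [K k a * _]mulrC.
Qed.

Lemma tless_sqnorm_ge0 : 0 <= tless_sqnorm 1%:M f u.
by rewrite tless_sqnorm_sum; apply: sumr_ge0 => a _; exact: frob_ge0. Qed.

Lemma tless_sqnorm_eq0 k : tless_sqnorm 1%:M f u = 0 -> T k = 0.
rewrite tless_sqnorm_sum => /eqP; rewrite psumr_eq0 => [/allP H|a _]; last exact: frob_ge0.
have Z a : \sum_k K k a *: T k = 0.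
  have /eqP/frob_eq0 := H a (mem_index_enum a) => /(congr1 (mulmx (jac f u))).
  by rewrite mulmxA JK mul1mx mulmx0.
transitivity (\sum_i (jac f u *m K^T) k i *: T i).
  rewrite JK (bigD1 k)//= big1 ?addr0 => [|i ik]; first by rewrite mxE eqxx scale1r.
  by rewrite mxE eq_sym (negPf ik) scale0r.
transitivity (\sum_a jac f u k a *: \sum_i K i a *: T i); last first.
  by rewrite big1// => a _; rewrite Z scaler0.
under eq_bigr do rewrite mxE scaler_suml.
rewrite exchange_big; eqbig a; rewrite scaler_sumr; eqbig i.
by rewrite mxE scalerA.
Qed.

End TracelessPositive.

(** * The Moebius position vector of an umbilic-free immersion in the sphere *)

Section MobiusPosition.
Variables (R : realType) (m n : nat) (U : set 'rV[R]_m) (f : 'rV[R]_m -> 'rV[R]_n.+1).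
Notation Q := (sphere n (1 : R)).
Hypotheses (oU : open U) (sf : Coo U f) (m_gt1 : (1 < m)%N).
Hypothesis ff : forall u, U u -> dot (f u) (f u) = 1.
Hypothesis f_free : forall u, U u -> row_free (\matrix_(i < m) pd i f u).
Hypothesis f_umb : forall u, U u -> exists i j,
  sff Q f i j u <> induced_metric (sf_form Q) f u i j *: mean_curvature Q f u.

Notation J0 := (jac f).
Notation g0 := (gm 1%:M f).
Notation Y := (mobius_position f).
Notation E := (mink R n.+1).

Let E1 : (1%:M : 'M[R]_n.+1)^T = 1%:M. exact: trmx1. Qed.
Let QE u v : sf_form Q u v = (u *m 1%:M *m v^T) 0 0. exact: dotE. Qed.
Let curv1 : sf_curv Q = 1. by rewrite /= expr1n invr1. Qed.
Let cff u : U u -> sf_curv Q * (sf_curv Q * sf_form Q (f u) (f u)) = sf_curv Q.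
by move=> Uu; rewrite curv1 !mul1r; exact: ff. Qed.
Let m_gt0 : (0 < m)%N. exact: ltnW. Qed.
Let mn0 : m%:R != 0 :> R. by rewrite pnatr_eq0 -lt0n. Qed.
Let m1n0 : m%:R - 1 != 0 :> R.
by rewrite subr_eq0 -[1]/(1%:R) eqr_nat neq_ltn m_gt1 orbT. Qed.

Lemma immersion_gm_unit u : U u -> g0 u \in unitmx.
move=> Uu; apply: definite_unitmx => v H; apply: (gram_definite (f_free Uu)).
rewrite -[RHS]H; congr ((v *m _ *m _) 0 0); rewrite gmE mulmx1 jacE.
by rewrite ddE.
Qed.
Let g0U := immersion_gm_unit.

Let fff u : U u -> f u *m 1%:M *m (f u)^T = 1%:M.
by move=> Uu; apply: mx11_eq; rewrite -dotE ff// mxE. Qed.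

Let tlsq u := tless_sqnorm 1%:M f u.

Lemma tless_sqnorm_gt0 u : U u -> 0 < tlsq u.
move=> Uu; rewrite lt_neqAle (tless_sqnorm_ge0 (g0U Uu)) andbT; apply/eqP => /esym T0.
have [i [j]] := f_umb Uu; apply.
have /(congr1 (row j)) := tless_sqnorm_eq0 (g0U Uu) i T0.
rewrite row0 tlessE raddfB /= linearZ /= row_mul => /eqP; rewrite subr_eq0 => /eqP H.
rewrite (sffE E1 QE oU sf g0U cff i j Uu) (mean_curvatureE E1 QE oU sf g0U cff m_gt0 Uu).
rewrite (induced_metricE QE) curv1 mul1r scale1r H scalerDr; congr (_ + _).
have -> : row j (col i (g0 u)) *m lap 1%:M f u = g0 u i j *: lap 1%:M f u.
  rewrite -[in RHS](gm_sym E1 f u) [X in X *m _](_ : _ = (g0 u j i)%:M).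
    by rewrite mul_scalar_mx mxE.
  by apply: mx11_eq; rewrite !mxE mulr1n.
by rewrite !scalerA mulrC.
Qed.

Lemma rho_sq u : U u -> rho f u ^+ 2 = m%:R / (m%:R - 1) * tlsq u.
move=> Uu; rewrite /rho sqr_sqrtr.
  rewrite (sff_traceless_sqnorm E1 QE oU sf g0U cff m_gt0 Uu).
  by rewrite /tlsq (tless_sqnormE E1 (g0U Uu) m_gt0) QE.
rewrite (sff_traceless_sqnorm E1 QE oU sf g0U cff m_gt0 Uu) QE -(tless_sqnormE E1 (g0U Uu) m_gt0).
apply: mulr_ge0; last exact: ltW (tless_sqnorm_gt0 Uu).
by apply: divr_ge0 => //; rewrite subr_ge0 -[1]/(1%:R) ler_nat ltnW.
Qed.

Lemma rho_gt0 u : U u -> 0 < rho f u.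
move=> Uu; rewrite lt_neqAle sqrtr_ge0 andbT eq_sym -sqrf_eq0 rho_sq//.
rewrite mulf_neq0 ?gt_eqF ?tless_sqnorm_gt0//.
apply: divr_gt0; first by rewrite ltr0n.
by rewrite subr_gt0 -[1]/(1%:R) ltr_nat.
Qed.

Lemma sm_tless_sqnorm : Coo U tlsq.
have s1 := sm_jac oU sf; have s2 := sm_gm 1%:M oU sf.
have s3 := sm_ginv oU sf g0U; have s4 := sm_hes oU sf g0U.
have s5 := sm_lap oU sf g0U.
have sc k : Coo U (fun v => col k (g0 v)).
  apply/(sm_mxP oU) => i j.
  by apply: (sm_ext oU _ (sm_coord oU i k s2)) => v _; rewrite mxE.
have st k : Coo U (fun v => tless 1%:M f v k).
  apply: (sm_ext oU (f := fun v => hes 1%:M f k v - m%:R^-1 *: (col k (g0 v) *m lap 1%:M f v))) => [v _|]; first by rewrite tlessE.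
  by apply: smoothB => //; apply: sm_scale; smo.
rewrite /tlsq /tless_sqnorm /mxtrace; apply: sm_sum => // i; apply: sm_sum => // k.
apply: smoothM => //; first by smo.
apply: sm_sum => // j; apply: (sm_coord oU j j).
have := st i; have := st k; move=> sk si; smo.
Qed.

Lemma sm_rho : Coo U (rho f).
have s : Coo U (fun u => m%:R / (m%:R - 1) * tlsq u).
  apply: smoothM => //; first exact: sm_cst.
  exact: sm_tless_sqnorm.
apply: (sm_ext oU _ (sm_sqrt oU s _)) => u Uu.
  by rewrite -rho_sq// sqrtr_sqr ger0_norm// ltW// rho_gt0.
by rewrite -rho_sq// exprn_gt0// rho_gt0.
Qed.

Let W : 'M[R]_(n.+1, 1 + n.+1) := row_mx 0 1%:M.
Let L u := light (f u).
Let LE u : L u = row_mx 1%:M 0 + f u *m W.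
by rewrite /L /light /W mul_mx_row mulmx0 mulmx1 add_row_mx addr0 add0r. Qed.

Let sL : Coo U L.
have -> : L = fun u => row_mx 1%:M 0 + f u *m W by apply/funext => u; exact: LE.
by smo.
Qed.

Let ddL i u : U u -> dd i L u = dd i f u *m W.
move=> Uu; rewrite (dd_ext oU i Uu (fun v _ => LE v)) (ddD _ Uu); [|smo|smo].
by rewrite dd_cst add0r (dd_mulmxl oU).
Qed.

Lemma sm_mobius_position : Coo U Y.
have sr := sm_rho; rewrite /mobius_position; exact: sm_scale. Qed.
Notation sY := sm_mobius_position.

Let r u : 'cV[R]_m := \col_i dd i (rho f) u.

Let sr : Coo U r.
apply/(sm_mxP oU) => i j.
have := sm_dd i sm_rho; apply: sm_ext => // v _.
by rewrite mxE.
Qed.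

Let jacY u : U u -> jac Y u = rho f u *: (J0 u *m W) + r u *m L u.
move=> Uu; apply/row_matrixP => i; rewrite row_jac raddfD /= linearZ /= !row_mul row_jac.
rewrite /mobius_position (dd_scale oU i Uu sm_rho sL) ddL// addrC; congr (_ + _).
have -> : row i (r u) = (dd i (rho f) u)%:M by apply: mx11_eq; rewrite !mxE mulr1n.
by rewrite mul_scalar_mx.
Qed.

Let WW : W *m E *m W^T = 1%:M.
rewrite row_mx_mink. rewrite mul0mx. by rewrite oppr0 add0r trmx1 mulmx1. Qed.

Let LW p (X : 'M[R]_(p, n.+1)) u : X *m W *m E *m (L u)^T = X *m (f u)^T.
rewrite /L /light /W mul_mx_row mulmx0 mulmx1. rewrite row_mx_mink. rewrite mul0mx oppr0 add0r. by [].
Qed.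

Let LL u : U u -> L u *m E *m (L u)^T = 0.
move=> Uu; rewrite /L /light row_mx_mink. rewrite trmx1 mulmx1.
by have := fff Uu; rewrite mulmx1 => ->; rewrite addNr.
Qed.

Let WXW p q (X : 'M[R]_(p, n.+1)) (Z : 'M[R]_(q, n.+1)) :
  X *m W *m E *m (Z *m W)^T = X *m Z^T.
by rewrite trmx_mul mulmxA -(mulmxA X) -(mulmxA X) WW mulmx1.
Qed.

Let J0f u : U u -> J0 u *m (f u)^T = 0.
by move=> Uu; have := jac_pos E1 oU sf fff Uu; rewrite mulmx1. Qed.

Lemma mobius_position_null u : U u -> Y u *m E *m (Y u)^T = 0.
by move=> Uu; rewrite /mobius_position linearZ /= -!scalemxAl -scalemxAr LL// !scaler0.
Qed.

Lemma mobius_gmE u : U u -> gm E Y u = rho f u ^+ 2 *: g0 u.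
move=> Uu; rewrite gmE jacY// mulmxDl linearD /= mulmxDr !mulmxDl.
rewrite [(_ *: _)^T]linearZ /= -!scalemxAr -!scalemxAl WXW.
rewrite -[r u *m _ *m _ *m (r u *m _)^T]mulmxA.
have JL : J0 u *m W *m E *m (r u *m L u)^T = 0.
  by rewrite trmx_mul mulmxA LW J0f// mul0mx.
have LJ : r u *m L u *m E *m (J0 u *m W)^T = 0.
  exact: mink_tr0 JL.
rewrite JL LJ !scaler0 addr0 add0r.
have -> : r u *m L u *m (E *m (r u *m L u)^T) = 0.
  by rewrite trmx_mul !mulmxA -(mulmxA (r u)) -(mulmxA (r u)) LL// mulmx0 mul0mx.
by rewrite addr0 gmE mulmx1 scalerA expr2.
Qed.

Lemma mobius_gm_unit u : U u -> gm E Y u \in unitmx.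
move=> Uu; rewrite mobius_gmE// unitmxZ ?g0U//.
by rewrite unitfE expf_neq0// gt_eqF// rho_gt0.
Qed.
Notation gU := mobius_gm_unit.

Let mobius_ginv u : U u -> invmx (gm E Y u) = rho f u ^- 2 *: invmx (g0 u).
move=> Uu; have rn0 : rho f u ^+ 2 != 0 by rewrite expf_neq0// gt_eqF// rho_gt0.
by rewrite mobius_gmE// invmxZ// -mobius_gmE// gU.
Qed.

(** Only the part transversal to the tangent space and to the light ray is computed; the rest enters
    with unspecified coefficients [A] and [a], so that second derivatives of [rho] never appear. *)
Let hesY k u : U u -> exists A a,
  hes E Y k u = rho f u *: (hes 1%:M f k u *m W) + A *m (J0 u *m W) + a *m L u.
move=> Uu; have sJ := sm_jac oU sf; have srho := sm_rho.
have H : dd k (jac Y) u = dd k (rho f) u *: (J0 u *m W) +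
   rho f u *: ((hes 1%:M f k u + cov 1%:M f k u *m J0 u) *m W) +
   (dd k r u *m L u + r u *m (row k (J0 u) *m W)).
  rewrite (dd_ext oU k Uu jacY) (ddD _ Uu); [|smo|smo]; congr (_ + _).
    by rewrite (dd_scale oU)//; [|smo]; rewrite (dd_mulmxl oU)// (dd_jac 1%:M f k u).
  by rewrite (dd_mulmx oU)// ddL// row_jac.
exists ((dd k (rho f) u)%:M + rho f u *: cov 1%:M f k u + r u *m row k 1%:M - rho f u *: cov E Y k u).
exists (dd k r u - cov E Y k u *m r u).
rewrite hesE H jacY// mulmxDr !mulmxDl !mulNmx mul_scalar_mx -!scalemxAl -scalemxAr.
have -> : r u *m row k 1%:M *m (J0 u *m W) = r u *m (row k (J0 u) *m W).
  by rewrite -mulmxA -!row_mul mul1mx.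
rewrite !mulmxA scalerDr.
move: (dd k (rho f) u *: _) (rho f u *: (hes _ _ _ _ *m _)) (rho f u *: (cov 1%:M f k u *m _ *m _))
  (dd k r u *m _) (r u *m _ *m _) (rho f u *: (cov E Y k u *m _ *m _)) (cov E Y k u *m _ *m _).
move=> a1 a2 a3 a4 a5 a6 a7; apply/matrixP => i j; rewrite !mxE; ring.
Qed.

Let lapY u : U u -> exists A a,
  lap E Y u = (rho f u)^-1 *: (lap 1%:M f u *m W) + A *m (J0 u *m W) + a *m L u.
move=> Uu; have rn0 : rho f u != 0 by rewrite gt_eqF// rho_gt0.
have H k := hesY k Uu.
have [A HA] := choice H; have [a Ha] := choice HA.
exists (\sum_k row k (invmx (gm E Y u)) *m A k); exists (\sum_k row k (invmx (gm E Y u)) *m a k).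
rewrite lapE /ctr !mulmx_suml.
transitivity (\sum_k (rho f u)^-1 *: (row k (invmx (g0 u)) *m (hes 1%:M f k u *m W)) +
  \sum_k row k (invmx (gm E Y u)) *m A k *m (J0 u *m W) +
  \sum_k row k (invmx (gm E Y u)) *m a k *m L u).
  rewrite -!big_split; apply: eq_bigr => k _ /=; rewrite Ha !mulmxDr !mulmxA; congr (_ + _ + _).
  rewrite mobius_ginv// -scalemxAr [row k (_ *: _)]linearZ /= -scalemxAl scalerA !mulmxA; congr (_ *: _).
  by rewrite expr2 invfM mulrA mulfV// mul1r.
congr (_ + _ + _); rewrite lapE /ctr mulmx_suml scaler_sumr.
by eqbig k; rewrite mulmxA.
Qed.

Lemma mobius_hes_position k u : U u -> hes E Y k u *m E *m (Y u)^T = - col k (gm E Y u).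
by move=> Uu; exact: (hes_pos (mink_sym _ _) oU sY mobius_position_null k Uu). Qed.

Lemma mobius_lap_position u : U u -> lap E Y u *m E *m (Y u)^T = - (m%:R)%:M.
by move=> Uu; exact: (lap_pos (mink_sym _ _) oU sY gU mobius_position_null Uu). Qed.

Let tlessY k u : U u -> exists A a,
  tless E Y u k = rho f u *: (tless 1%:M f u k *m W) + A *m (J0 u *m W) + a *m L u.
move=> Uu; have rn0 : rho f u != 0 by rewrite gt_eqF// rho_gt0.
have [A [a HA]] := hesY k Uu; have [B [b HB]] := lapY Uu.
exists (A - m%:R^-1 *: (col k (gm E Y u) *m B)); exists (a - m%:R^-1 *: (col k (gm E Y u) *m b)).
rewrite !tlessE HA HB !mulmxBl !mulmxDr -!scalemxAl !mulmxA.
have -> : col k (gm E Y u) *m ((rho f u)^-1 *: (lap 1%:M f u *m W)) =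
    rho f u *: (col k (g0 u) *m lap 1%:M f u *m W).
  rewrite mobius_gmE// -scalemxAr [col k (_ *: _)]linearZ /= -scalemxAl scalerA expr2 mulKf//.
  by rewrite mulmxA.
rewrite !scalerDr !scalerN !scalerA [m%:R^-1 * _]mulrC.
move: (rho f u *: _) ((_ * _) *: _) (A *m _ *m _) (m%:R^-1 *: _) (a *m _) (m%:R^-1 *: _) => a1 a2 a3 a4 a5 a6.
apply/matrixP => i j; rewrite !mxE; ring.
Qed.

Let lap0f u : U u -> lap 1%:M f u *m (f u)^T = - (m%:R)%:M.
by move=> Uu; have := lap_pos E1 oU sf g0U fff Uu; rewrite mulmx1. Qed.

Let tless0f k u : U u -> tless 1%:M f u k *m (f u)^T = 0.
move=> Uu; rewrite tlessE mulmxBl -scalemxAl -mulmxA lap0f// mulmxN mul_mx_scalar scalerN.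
have := hes_pos E1 oU sf fff k Uu; rewrite mulmx1 => ->.
by rewrite scalerA mulVf// scale1r subrr.
Qed.

Let tless0J k u : U u -> tless 1%:M f u k *m (J0 u)^T = 0.
move=> Uu; rewrite tlessE mulmxBl -scalemxAl -mulmxA.
have := hes_jac g0U k Uu; rewrite mulmx1 => ->.
by have := lap_jac g0U Uu; rewrite mulmx1 => ->; rewrite mulmx0 scaler0 subrr.
Qed.

(** The traceless Hessian is orthogonal to [Y] and to the tangent vectors, which forces the
    tangential coefficient [A] to vanish. The component along the light ray remains, but it is null
    and orthogonal to everything else. *)
Let tlessYL k u : U u -> exists a,
  tless E Y u k = rho f u *: (tless 1%:M f u k *m W) + a *m L u.
move=> Uu; have rn0 : rho f u != 0 by rewrite gt_eqF// rho_gt0.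
have [A [a H]] := tlessY k Uu; exists a; rewrite H; suff -> : A = 0 by rewrite mul0mx addr0.
have tY : tless E Y u k *m E *m (Y u)^T = 0.
  rewrite tlessE !mulmxBl -!scalemxAl mobius_hes_position// -mulmxA -mulmxA [lap E Y u *m _]mulmxA.
  by rewrite mobius_lap_position// mulmxN mul_mx_scalar scalerN scalerA mulVf// scale1r subrr.
have tL : tless E Y u k *m E *m (L u)^T = 0.
  have : rho f u *: (tless E Y u k *m E *m (L u)^T) = 0.
    by rewrite -[RHS]tY /mobius_position [(_ *: light _)^T]linearZ /= -scalemxAr.
  by move=> /eqP; rewrite scaler_eq0 (negPf rn0) => /eqP.
have tJ : tless E Y u k *m E *m (jac Y u)^T = 0.
  rewrite tlessE !mulmxBl -!scalemxAl (hes_jac gU)// -mulmxA -mulmxA [lap E Y u *m _]mulmxA.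
  by rewrite (lap_jac gU)// mulmx0 scaler0 subrr.
have tJ0 : tless E Y u k *m E *m (J0 u *m W)^T = 0.
  move: tJ; rewrite jacY// [(_ + _)^T]linearD /= mulmxDr [(_ *: _)^T]linearZ /= -scalemxAr.
  rewrite [(r u *m _)^T]trmx_mul [_ *m (_ *m (r u)^T)]mulmxA tL mul0mx addr0 => /eqP.
  by rewrite scaler_eq0 (negPf rn0) => /eqP.
have LJ : L u *m E *m (J0 u *m W)^T = 0.
  by apply: mink_tr0; rewrite LW J0f.
move: tJ0; rewrite H !mulmxDl -!scalemxAl WXW tless0J// scaler0 add0r.
rewrite -[a *m _ *m _]mulmxA -[a *m _ *m _]mulmxA LJ mulmx0 addr0.
rewrite -[A *m _ *m _]mulmxA -[A *m _ *m _]mulmxA WXW => H0.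
rewrite -[A](mulmxK (g0U Uu)).
have -> : A *m g0 u = 0 by rewrite gmE mulmx1.
by rewrite mul0mx.
Qed.

(** The traceless Hessian scales by $\rho$ and the inverse metric by $\rho^{-2}$, so the norm is
    that of [f] divided by $\rho^2$; the normalisation of [rho] is made for this value. *)
Lemma mobius_tless_sqnorm u : U u -> tless_sqnorm E Y u = (m%:R - 1) / m%:R.
move=> Uu; have r0 := rho_gt0 Uu; have rn0 : rho f u != 0 by rewrite gt_eqF.
have H k i : tless E Y u k *m E *m (tless E Y u i)^T =
    rho f u ^+ 2 *: (tless 1%:M f u k *m 1%:M *m (tless 1%:M f u i)^T).
  have [a ->] := tlessYL k Uu; have [b ->] := tlessYL i Uu.
  have tL p (X : 'M[R]_(p, 1)) j : tless 1%:M f u j *m W *m E *m (X *m L u)^T = 0.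
    by rewrite trmx_mul mulmxA LW tless0f// mul0mx.
  have Lt p (X : 'M[R]_(p, 1)) j : X *m L u *m E *m (tless 1%:M f u j *m W)^T = 0.
    exact: mink_tr0 (tL _ _ _).
  have LL' p q (X : 'M[R]_(p, 1)) (Z : 'M[R]_(q, 1)) : X *m L u *m E *m (Z *m L u)^T = 0.
    by rewrite trmx_mul !mulmxA -(mulmxA X) -(mulmxA X) LL// mulmx0 mul0mx.
  rewrite [(_ + _)^T]linearD /= mulmxDl mulmxDr !mulmxDl LL' [(_ *: _)^T]linearZ /= -!scalemxAr -!scalemxAl.
  by rewrite tL Lt WXW !scaler0 !addr0 scalerA expr2 mulmx1.
have r2 := rho_sq Uu; rewrite /tlsq in r2.
have -> : tless_sqnorm E Y u = rho f u ^- 2 * tless_sqnorm 1%:M f u.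
  rewrite /tless_sqnorm mulr_sumr; eqbig i; rewrite mulr_sumr; eqbig k.
  rewrite H mobius_ginv// mxE -scalemxAl -scalemxAr scalerA mxtraceZ mulfV ?expf_neq0// mul1r.
  by rewrite mulrA.
have tn0 : tless_sqnorm 1%:M f u != 0 by rewrite gt_eqF// tless_sqnorm_gt0.
rewrite r2; have A := mn0; have B := m1n0; move: tn0 A B; move: (tless_sqnorm _ _ _) (m%:R : R).
by move=> t a t0 a0 a1; field; rewrite ?t0 ?a0 ?a1.
Qed.

End MobiusPosition.

(** * Structure equations with vanishing Moebius form and parallel Blaschke tensor *)

Section MobiusFrame.
Variables (R : realType) (m n : nat) (U : set 'rV[R]_m) (Y : 'rV[R]_m -> 'rV[R]_(1 + n)).
Notation E := (mink R n).
Hypotheses (oU : open U) (sY : Coo U Y) (m_gt0 : (0 < m)%N).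
Notation J := (jac Y).
Notation g := (gm E Y).
Notation gi u := (invmx (g u)).
Notation cov := (cov E Y).
Notation hes := (hes E Y).
Notation lap := (lap E Y).
Hypothesis gU : forall u, U u -> g u \in unitmx.
Hypothesis Ynull : forall u, U u -> Y u *m E *m (Y u)^T = 0.

Let E_sym := mink_sym R n.
Let mn0 : m%:R != 0 :> R. by rewrite pnatr_eq0 -lt0n. Qed.

Definition conj_pos := locked_with dd_key (fun u =>
  - (m%:R^-1 *: lap u) - ((2 * m%:R ^+ 2)^-1 * lorentz (lap u) (lap u)) *: Y u).
Notation N := conj_pos.

Lemma conj_posE : N = fun u => - (m%:R^-1 *: lap u)
  - ((2 * m%:R ^+ 2)^-1 * lorentz (lap u) (lap u)) *: Y u.
exact: unlock. Qed.

Definition btensor := locked_with dd_key (fun u => jac N u *m E *m (J u)^T).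
Notation A := btensor.
Lemma btensorE : A = fun u => jac N u *m E *m (J u)^T. exact: unlock. Qed.

Definition bshape := locked_with dd_key (fun u => A u *m gi u).
Notation S := bshape.
Lemma bshapeE : S = fun u => A u *m gi u. exact: unlock. Qed.

Hypothesis form0 : forall u, U u -> jac N u = S u *m J u.
Hypothesis A_parallel : forall k u, U u -> dd k A u = cov k u *m A u + A u *m (cov k u)^T.

Let sJ := sm_jac oU sY.
Let sg := sm_gm E oU sY.
Let sgi := sm_ginv oU sY gU.
Let sc k := sm_cov oU sY gU k.
Let sh k := sm_hes oU sY gU k.
Let sl := sm_lap oU sY gU.

Let kappa u := (2 * m%:R ^+ 2)^-1 * lorentz (lap u) (lap u).

Let sk : Coo U kappa.
apply: (sm_ext oU (f := fun u => (2 * m%:R ^+ 2)^-1 * (lap u *m E *m (lap u)^T) 0 0)).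
  by move=> v _; rewrite /kappa lorentzE.
apply: smoothM => //; first exact: sm_cst.
by apply: sm_coord => //; smo.
Qed.

Lemma sm_conj_pos : Coo U N.
rewrite conj_posE; apply: smoothB => //; last exact: sm_scale.
by apply: smoothN => //; apply: sm_scale => //; exact: sm_cst.
Qed.
Notation sN := sm_conj_pos.
Let sjN := sm_jac oU sN.

Lemma sm_btensor : Coo U A. by rewrite btensorE; smo. Qed.
Let sA := sm_btensor.
Lemma sm_shape : Coo U S. by rewrite bshapeE; smo. Qed.
Let sS := sm_shape.

Lemma J_pos u : U u -> J u *m E *m (Y u)^T = 0.
by move=> Uu; exact: (jac_pos E_sym oU sY Ynull). Qed.

Lemma hes_position k u : U u -> hes k u *m E *m (Y u)^T = - col k (g u).
by move=> Uu; exact: (hes_pos E_sym oU sY Ynull). Qed.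

Lemma lap_position u : U u -> lap u *m E *m (Y u)^T = - (m%:R)%:M.
by move=> Uu; exact: (lap_pos E_sym oU sY gU Ynull). Qed.

Let NE u X : N u *m E *m X = - (m%:R^-1 *: (lap u *m E *m X)) - kappa u *: (Y u *m E *m X) :> 'M[R]_(1, m).
by rewrite conj_posE !mulmxBl !mulNmx -!scalemxAl. Qed.

Lemma conj_pos_position u : U u -> N u *m E *m (Y u)^T = 1%:M.
move=> Uu; rewrite conj_posE !mulmxBl !mulNmx -!scalemxAl Ynull// scaler0 subr0.
rewrite lap_position// scalerN opprK; apply: mx11_eq; rewrite !mxE mulVf//.
Qed.

Lemma conj_pos_null u : U u -> N u *m E *m (N u)^T = 0.
move=> Uu; rewrite {2}conj_posE [(_ - _)^T]linearB /= [(- _)^T]linearN /= ![(_ *: _)^T]linearZ /=.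
rewrite mulmxBr mulmxN -!scalemxAr conj_pos_position//.
rewrite conj_posE !mulmxBl !mulNmx -!scalemxAl.
have -> : Y u *m E *m (lap u)^T = - (m%:R)%:M by rewrite -mink_tr lap_position// linearN /= tr_scalar_mx.
have -> : lap u *m E *m (lap u)^T = (lorentz (lap u) (lap u))%:M.
  by apply: mx11_eq; rewrite lorentzE [RHS]mxE mulr1n.
by apply: mx11_eq; rewrite !mxE !mulr1n; move: (lorentz _ _) => x; field.
Qed.

Lemma conj_pos_J u : U u -> N u *m E *m (J u)^T = 0.
move=> Uu; rewrite NE (lap_jac gU)//.
by rewrite (mink_tr0 (J_pos Uu)) !scaler0 oppr0 addr0.
Qed.

(** Differentiate the orthogonality of [N] to the tangent space; the symmetry of the Blaschke tensor
    follows from that of the Hessian. *)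
Lemma btensor_row i u : U u -> row i (A u) = - (N u *m E *m (hes i u)^T).
move=> Uu; have : dd i (fun v => N v *m E *m (J v)^T) u = 0.
  by rewrite (dd_ext oU i Uu conj_pos_J) dd_cst.
have sN' := sN.
rewrite (dd_mulmx oU)//; [|smo|smo].
rewrite (dd_mulmxl oU)// (dd_tr oU)// (dd_jac E Y i u) [(_ + _)^T]linearD /= mulmxDr.
rewrite [(cov i u *m _)^T]trmx_mul [_ *m (_ *m (cov i u)^T)]mulmxA conj_pos_J// mul0mx addr0.
rewrite -(row_jac N i u) -!row_mul -[jac N u *m _ *m _]/(jac N u *m E *m (J u)^T).
by rewrite btensorE => /eqP; rewrite addr_eq0 => /eqP.
Qed.

Lemma btensor_sym u : U u -> (A u)^T = A u.
move=> Uu; apply/matrixP => i j; rewrite [LHS]mxE.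
have rE a b : A u a b = - (N u *m E *m (row b (hes a u))^T) 0 0.
  have -> : A u a b = row a (A u) 0 b by rewrite mxE.
  rewrite btensor_row// [LHS]mxE; congr (- _); by rewrite tr_row colE mulmxA -colE [RHS]mxE.
by rewrite !rE (hesC E oU sY i j Uu).
Qed.

Lemma shape_gm u : U u -> S u *m g u = A u.
by move=> Uu; rewrite bshapeE mulmxKV ?gU. Qed.

Lemma shape_parallel : parallel E U Y S.
split=> // l u Uu; rewrite [in dd _ _]bshapeE (dd_mulmx oU)//.
rewrite A_parallel// (dd_ginv E_sym oU sY gU)// -shape_gm//.
rewrite mulmxDl mulmxBr mulmxN !mulmxA !(mulmxK (gU Uu)).
by rewrite addrA addrK.
Qed.

Lemma shape_sym u : U u -> S u *m g u = g u *m (S u)^T.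
move=> Uu; rewrite shape_gm// bshapeE trmx_mul btensor_sym// (ginv_sym E_sym) mulmxA.
by rewrite mulmxV ?gU// mul1mx.
Qed.

(** Second derivatives of [N] commute, and [jac N] is [S] times [jac Y]. After the connection terms
    are removed, [S] times the Hessian is symmetric in its two indices, so [S] may act on either of
    them. *)
Lemma shape_hes u k : U u -> act (S u) (hes^~ u) k = S u *m hes k u.
move=> Uu.
have dN l : dd l (jac N) u = cov l u *m S u *m J u + S u *m hes l u.
  rewrite (dd_ext oU l Uu form0) (dd_mulmx oU)//.
  have [_ ->//] := shape_parallel; rewrite (dd_jac E Y l u) mulmxBl mulmxDr !mulmxA.
  by rewrite addrA addrAC subrK addrC addrC.
have H i l : row i (S u *m hes l u) = row l (S u *m hes i u).
  have := jacC oU sN i l Uu; rewrite !dN !linearD /=.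
  rewrite -!mulmxA ![row _ (cov _ _ *m _)]row_mul (covC E oU sY i l Uu).
  by move=> /addrI.
apply/row_matrixP => i; rewrite linear_sum /= H row_mul mulmx_sum_row.
by eqbig s; rewrite linearZ /= mxE (hesC E oU sY i s Uu).
Qed.

Lemma trace_shape u : U u -> \tr (S u) = m%:R * kappa u.
move=> Uu; have -> : \tr (S u) = \sum_i (row i (A u) *m (row i (gi u))^T) 0 0.
  rewrite bshapeE; eqbig i; rewrite mxE [RHS]mxE; eqbig j.
  by rewrite !mxE -[in LHS](ginv_sym E_sym Y u) mxE.
transitivity (\sum_i (m%:R^-1 * (lap u *m E *m (row i (gi u) *m hes i u)^T) 0 0 - kappa u * (gi u *m g u) i i)).
  eqbig i; rewrite btensor_row// NE opprB opprK.
  have -> : Y u *m E *m (hes i u)^T = - (col i (g u))^T.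
    by rewrite -mink_tr hes_position// linearN.
  rewrite scalerN addrC mulmxBl -!scalemxAl trmx_mul !mulmxA [LHS]mxE; congr (_ + _).
    by rewrite mxE.
  rewrite mxE; congr (- _); rewrite mxE; congr (_ * _); rewrite !mxE; eqbig j.
  by rewrite !mxE mulrC.
rewrite sumrB -!mulr_sumr.
have -> : \sum_i (gi u *m g u) i i = m%:R by rewrite -[LHS]/(\tr _) mulVmx ?gU// mxtrace1.
have -> : \sum_i (lap u *m E *m (row i (gi u) *m hes i u)^T) 0 0 = lorentz (lap u) (lap u).
  have lT : (lap u)^T = \sum_i (row i (gi u) *m hes i u)^T by rewrite lapE linear_sum.
  by rewrite lorentzE lT mulmx_sumr summxE.
by rewrite /kappa; move: (lorentz _ _) => x; field.
Qed.

(** The form of the Laplacian that can be differentiated: the differential of [N] is [S] applied to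
    that of [Y], and the trace of [S] is constant. *)
Lemma lap_conj_pos u : U u -> lap u = - (m%:R *: N u) - \tr (S u) *: Y u.
move=> Uu; rewrite trace_shape// conj_posE scalerBr scalerN scalerA mulfV// scale1r scalerA.
by rewrite -/(kappa u) opprB opprK addrAC subrr add0r.
Qed.

(** Parallel, self-adjoint, and free to act on either index of the Hessian. Shifts by scalars and
    commuting products keep these properties, so polynomials in [S], and with them its spectral
    projections, are of this kind. *)
Definition adm (P : 'rV[R]_m -> 'M[R]_m) :=
  [/\ parallel E U Y P, forall u, U u -> P u *m g u = g u *m (P u)^T &
      forall u k, U u -> act (P u) (hes^~ u) k = P u *m hes k u].

Lemma adm_shape : adm S.
by split=> [|u Uu|u k Uu]; [exact: shape_parallel|exact: shape_sym|exact: shape_hes].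
Qed.

Lemma admB_scalar P (a : R) : adm P -> adm (fun u => P u - a%:M).
move=> [[sP dP] P1 P2]; split=> [|u Uu|u k Uu].
- split=> [|l u Uu]; first by smo.
  rewrite (ddB oU)//; last by smo.
  rewrite dd_cst subr0 dP// mulmxBr mulmxBl scalar_mxC.
  by rewrite opprB addrA subrK.
- by rewrite mulmxBl [(_ - _)^T]linearB /= mulmxBr P1// tr_scalar_mx scalar_mxC.
rewrite actB P2// mulmxBl; congr (_ - _); rewrite mul_scalar_mx /act (bigD1 k)//= big1 ?addr0 => [|s sk'].
  by rewrite mxE eqxx mulr1n.
by rewrite mxE eq_sym (negPf sk') scale0r.
Qed.

Lemma admM P P' : adm P -> adm P' -> (forall u, U u -> P u *m P' u = P' u *m P u) ->
  adm (fun u => P u *m P' u).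
move=> [[sP dP] P1 P2] [[sP' dP'] P1' P2'] PP'; split=> [|u Uu|u k Uu].
- split=> [|l u Uu]; first by smo.
  rewrite (dd_mulmx oU)// dP// dP'// mulmxBl mulmxBr !mulmxA.
  by rewrite addrA subrK.
- by rewrite -mulmxA P1'// mulmxA P1// PP'// trmx_mul mulmxA.
rewrite actM.
rewrite (eq_act (P u) k (fun s => P2' u s Uu)).
by rewrite act_mulmx P2// mulmxA PP'.
Qed.

Lemma admZ (a : R) P : adm P -> adm (fun u => a *: P u).
move=> [[sP dP] P1 P2]; split=> [|u Uu|u k Uu].
- split=> [|l u Uu]; first by apply: sm_scale => //; exact: sm_cst.
  by rewrite (dd_scalel oU)// dP// scalerBr -!scalemxAr -!scalemxAl.
- by rewrite -scalemxAl P1// [(_ *: _)^T]linearZ /= scalemxAr.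
rewrite -scalemxAl -P2// /act scaler_sumr; eqbig s.
by rewrite mxE scalerA.
Qed.

Lemma sm_trace (P : 'rV[R]_m -> 'M[R]_m) : Coo U P -> Coo U (fun u => \tr (P u)).
by move=> sP; apply: sm_sum => // i; exact: sm_coord. Qed.

Lemma dd_trace_adm P l u : adm P -> U u -> dd l (fun v => \tr (P v)) u = 0.
move=> [[sP dP] _ _] Uu; rewrite (dd_sum oU)//; last by move=> i; exact: sm_coord.
transitivity (\tr (dd l P u)); first by eqbig i; rewrite (dd_mxE l i i Uu sP).
by rewrite dP// raddfB /= mxtrace_mulC subrr.
Qed.

(** The sign makes the pairing with [Y] equal to the trace of [P]. *)
Definition htrace (P : 'rV[R]_m -> 'M[R]_m) u : 'rV[R]_(1 + n) :=
  - ctr (gi u *m P u) (hes^~ u).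

Lemma sm_htrace P : adm P -> Coo U (htrace P).
move=> [[sP _] _ _]; apply: smoothN => //; apply: sm_contract => //.
exact: sm_mulmx.
Qed.

Let tau u := \tr (S u).
Let D (P : 'rV[R]_m -> 'M[R]_m) u := P u *m (m%:R *: S u + (tau u)%:M).

Lemma dd_htrace P l u : adm P -> U u -> dd l (htrace P) u = row l (D P u *m J u).
move=> aP Uu; have [[sP dP] P1 P2] := aP.
rewrite (ddN l Uu); last by apply: sm_contract => //; exact: sm_mulmx.
rewrite (dd_parallel_trace E_sym oU sY gU l _ P1 P2)//.
(* The Laplacian is $-mN-\mathrm{tr}(S)Y$ with constant trace, so its differential is
   $-(mS+\tau)dY$; this is the origin of the factor in [D]. *)
have dl s : dd s lap u = - row s ((m%:R *: S u + (tau u)%:M) *m J u).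
  have sN' := sN; have st := sm_trace sS.
  rewrite (dd_ext oU s Uu lap_conj_pos) (ddB oU)//; last by apply: sm_scale.
    rewrite (ddN s Uu); last by apply: sm_scale => //; exact: sm_cst.
    rewrite (dd_scalel oU)// (dd_scale oU)// (dd_trace_adm _ adm_shape Uu) scale0r add0r.
    rewrite -(row_jac N s u) form0// -(row_jac Y s u) -opprD; congr (- _).
    by rewrite mulmxDl mul_scalar_mx -scalemxAl linearD /= ![row s (_ *: _)]linearZ.
  by apply: smoothN => //; apply: sm_scale => //; exact: sm_cst.
rewrite /D -mulmxA [RHS]row_mul mulmx_sum_row -sumrN; eqbig s.
by rewrite dl scalerN opprK mxE.
Qed.

Let trE (X : 'M[R]_m) (P : 'rV[R]_m -> 'M[R]_m) u : P u *m g u = g u *m (P u)^T ->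
  U u -> \sum_k (row k (gi u *m P u) *m col k X) 0 0 = \tr (P u *m X *m gi u).
move=> P1 Uu; rewrite mxtrace_mulC mulmxA; eqbig k; rewrite mxE [RHS]mxE.
by eqbig j; rewrite !mxE.
Qed.

Lemma htrace_position P u : adm P -> U u -> htrace P u *m E *m (Y u)^T = (\tr (P u))%:M.
move=> [_ P1 _] Uu; apply: mx11_eq; rewrite /htrace !mulNmx -!contract_mulmxr.
rewrite (eq_contract _ (fun k => hes_position k Uu)) /ctr [LHS]mxE summxE -sumrN mxE mulr1n.
transitivity (\sum_k (row k (gi u *m P u) *m col k (g u)) 0 0).
  by eqbig k; rewrite mulmxN mxE opprK.
by rewrite (trE _ (P1 u Uu) Uu) mulmxK ?gU.
Qed.

Lemma htrace_J P u : U u -> htrace P u *m E *m (J u)^T = 0.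
move=> Uu; rewrite /htrace !mulNmx -!contract_mulmxr.
by rewrite (eq_contract _ (fun k => hes_jac gU k Uu)) /ctr big1 ?oppr0// => k _; rewrite mulmx0.
Qed.

Lemma htrace_conj_pos P u : adm P -> U u -> htrace P u *m E *m (N u)^T = (\tr (P u *m S u))%:M.
move=> [_ P1 _] Uu; apply: mx11_eq; rewrite /htrace !mulNmx -!contract_mulmxr.
have hN k : hes k u *m E *m (N u)^T = - col k (A u).
  by rewrite -[LHS]mink_tr -[in RHS](btensor_sym Uu) -tr_row btensor_row// linearN opprK.
rewrite (eq_contract _ hN) /ctr [LHS]mxE summxE -sumrN mxE mulr1n.
transitivity (\sum_k (row k (gi u *m P u) *m col k (A u)) 0 0).
  by eqbig k; rewrite mulmxN mxE opprK.
by rewrite (trE _ (P1 u Uu) Uu) -mulmxA bshapeE.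
Qed.

(** Derivative of the orthogonality of [htrace P] to the tangent space, with [dd_htrace] for the
    first factor. *)
Lemma htrace_hes P l u : adm P -> U u ->
  htrace P u *m E *m (hes l u)^T = - row l (D P u *m g u).
move=> aP Uu; have : dd l (fun v => htrace P v *m E *m (J v)^T) u = 0.
  by rewrite (dd_ext oU l Uu (htrace_J P)) dd_cst.
have sv := sm_htrace aP.
rewrite (dd_mulmx oU)//; [|smo|smo].
rewrite (dd_mulmxl oU)// (dd_tr oU)// (dd_jac E Y l u) [(_ + _)^T]linearD /= mulmxDr.
rewrite [(cov l u *m _)^T]trmx_mul [_ *m (_ *m (cov l u)^T)]mulmxA htrace_J// mul0mx addr0.
rewrite dd_htrace// => /eqP; rewrite addrC addr_eq0 => /eqP ->; congr (- _).
by rewrite -!row_mul gmE !mulmxA.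
Qed.

(** The second factor is itself a contraction of the Hessian, so [htrace_hes] evaluates the product
    with no further derivative. *)
Lemma htrace_htrace P P' u : adm P -> adm P' -> U u ->
  htrace P u *m E *m (htrace P' u)^T = (\tr (D P u *m P' u))%:M.
move=> aP aP' Uu; have [_ P1 _] := aP'; apply: mx11_eq.
have -> : (htrace P' u)^T = - \sum_k (row k (gi u *m P' u) *m hes k u)^T.
  by rewrite /htrace /ctr linearN linear_sum.
rewrite mulmxN mulmx_sumr.
rewrite [LHS]mxE summxE mxE mulr1n -sumrN.
transitivity (\sum_k (row k (D P u *m g u) *m (row k (gi u *m P' u))^T) 0 0).
  eqbig k; rewrite trmx_mul mulmxA htrace_hes// mulNmx mxE opprK//.
transitivity (\tr (D P u *m g u *m (gi u *m P' u)^T)).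
  eqbig k; rewrite mxE [RHS]mxE; eqbig j; rewrite !mxE//.
rewrite trmx_mul (ginv_sym E_sym) mulmxA -(mulmxA _ (g u)) -P1//.
by rewrite -!mulmxA mulmxV ?gU// mulmx1.
Qed.

End MobiusFrame.

(** * Self-adjoint endomorphisms for a positive definite Gram matrix *)

Section SelfAdjoint.
Variables (R : realType) (m k : nat) (g : 'M[R]_m) (K : 'M[R]_(m, k)).
Hypotheses (gU : g \in unitmx) (gK : g = K *m K^T).

Lemma gram_pos_eq0 (v : 'rV[R]_m) : (v *m g *m v^T) 0 0 = 0 -> v = 0.
rewrite gK !mulmxA -mulmxA -trmx_mul => H.
have vK : v *m K = 0 by apply: dot_eq0; rewrite dotE mulmx1.
by rewrite -[v](mulmxK gU) gK mulmxA vK !mul0mx.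
Qed.

Lemma gram_pos_ge0 (v : 'rV[R]_m) : 0 <= (v *m g *m v^T) 0 0.
rewrite gK !mulmxA -mulmxA -trmx_mul; have := dot_ge0 (v *m K).
by rewrite dotE mulmx1.
Qed.

(** With $L=g^{-1}K$, the matrix $L^TBK$ has squared Frobenius norm $\mathrm{tr}(B^2)$ by
    self-adjointness; a square root of the metric is avoided. *)
Lemma selfadj_trace_sq_eq0 (B : 'M[R]_m) : B *m g = g *m B^T -> \tr (B *m B) = 0 -> B = 0.
move=> Bg trB; set L := invmx g *m K.
have gT : g^T = g by rewrite gK trmx_mul trmxK.
have LL : L *m L^T = invmx g.
  rewrite /L trmx_mul trmx_inv gT -!mulmxA [K *m (_ *m _)]mulmxA -gK mulmxV// mulmx1//.
have KL : K *m L^T = 1%:M.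
  by rewrite /L trmx_mul trmx_inv gT mulmxA -gK mulmxV.
clearbody L.
have H : L^T *m B *m K = 0.
  apply: frob_eq0; rewrite -[RHS]trB.
  have -> : L^T *m B *m K *m (L^T *m B *m K)^T = L^T *m (B *m g *m B^T *m L).
    by rewrite !trmx_mul trmxK gK !mulmxA.
  by rewrite mxtrace_mulC -(mulmxA (B *m g *m B^T)) LL -(mulmxA B g) -Bg mulmxA mulmxK.
have BK : B *m K = 0 by rewrite -[B]mul1mx -KL -!mulmxA (mulmxA L^T) H mulmx0.
have : B *m g = 0 by rewrite gK mulmxA BK mul0mx.
by move=> Bg0; rewrite -[B](mulmxK gU) Bg0 mul0mx.
Qed.

Variable S : 'M[R]_m.
Hypothesis Sg : S *m g = g *m S^T.

Let Re_sum (I : Type) (r : seq I) (F : I -> R[i]) : complex.Re (\sum_(i <- r) F i) = \sum_(i <- r) complex.Re (F i).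
by apply: (big_morph (@complex.Re R)) => // -[? ?] [? ?]. Qed.

Let Im_sum (I : Type) (r : seq I) (F : I -> R[i]) : complex.Im (\sum_(i <- r) F i) = \sum_(i <- r) complex.Im (F i).
by apply: (big_morph (@complex.Im R)) => // -[? ?] [? ?]. Qed.

(** Over the complex numbers an eigenvector of [T] exists. For its real and imaginary parts, carried
    over by [W], self-adjointness gives $b(|x|^2+|y|^2)=0$ with $b$ the imaginary part of the
    eigenvalue, so the eigenvalue is real and one of the two parts serves. *)
Lemma selfadj_invariant_eigen r (W : 'M[R]_(r, m)) (T : 'M[R]_r) : (0 < r)%N ->
  row_free W -> W *m S = T *m W ->
  exists (a : R) (x : 'rV[R]_r), x != 0 /\ x *m W *m S = a *: (x *m W).
move=> r0 fW WS; pose Tc := map_mx (real_complex R) T.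
have /closed_rootP[z] : size (char_poly Tc) != 1%N by rewrite size_char_poly; case: r r0 {W T fW WS Tc}.
rewrite -eigenvalue_root_char => /eigenvalueP[v vT v0].
pose x : 'rV[R]_r := \row_j complex.Re (v 0 j); pose y : 'rV[R]_r := \row_j complex.Im (v 0 j).
pose a := complex.Re z; pose b := complex.Im z.
have ReM (c : R[i]) (t : R) : complex.Re (c * real_complex R t) = complex.Re c * t.
  by case: c => c d /=; rewrite mulr0 subr0.
have ImM (c : R[i]) (t : R) : complex.Im (c * real_complex R t) = complex.Im c * t.
  by case: c => c d /=; rewrite mulr0 add0r.
have RM (c d : R[i]) : complex.Re (c * d) = complex.Re c * complex.Re d - complex.Im c * complex.Im d.
  by case: c d => ? ? [? ?].
have IM (c d : R[i]) : complex.Im (c * d) = complex.Re c * complex.Im d + complex.Im c * complex.Re d.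
  by case: c d => ? ? [? ?].
have xT : x *m T = a *: x - b *: y.
  apply/rowP => j; have := congr1 (fun M : 'rV[R[i]]_r => complex.Re (M 0 j)) vT.
  rewrite !mxE Re_sum => H; transitivity (complex.Re (z * v 0 j)).
    by rewrite -H; apply: eq_bigr => k' _; rewrite !mxE ReM.
  by rewrite RM.
have yT : y *m T = a *: y + b *: x.
  apply/rowP => j; have := congr1 (fun M : 'rV[R[i]]_r => complex.Im (M 0 j)) vT.
  rewrite !mxE Im_sum => H; transitivity (complex.Im (z * v 0 j)).
    by rewrite -H; apply: eq_bigr => k' _; rewrite !mxE ImM.
  by rewrite IM.
have fW0 (w : 'rV[R]_r) : w *m W = 0 -> w = 0.
  by move=> /(congr1 (mulmx^~ (pinvmx W))) /=; rewrite mul0mx -mulmxA mulmxVp// mulmx1.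
have xS : x *m W *m S = a *: (x *m W) - b *: (y *m W).
  by rewrite -mulmxA WS mulmxA xT mulmxBl -!scalemxAl.
have yS : y *m W *m S = a *: (y *m W) + b *: (x *m W).
  by rewrite -mulmxA WS mulmxA yT mulmxDl -!scalemxAl.
have xy0 : ~ (x = 0 /\ y = 0).
  move=> [x0 y0]; move/eqP: v0; apply; apply/rowP => j; rewrite mxE.
  move: x0 y0 => /rowP/(_ j) + /rowP/(_ j); rewrite !mxE.
  by case: (v 0 j) => c d /= -> ->.
have b0 : b = 0.
  apply/eqP/negP => /negP bn0; apply: xy0.
  have gT : g^T = g by rewrite gK trmx_mul trmxK.
  have H : (x *m W *m S *m g *m (y *m W)^T) 0 0 = (x *m W *m g *m (y *m W *m S)^T) 0 0.
    by rewrite -[x *m W *m S *m g]mulmxA Sg [in RHS]trmx_mul !mulmxA.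
  have C : (y *m W *m g *m (x *m W)^T) 0 0 = (x *m W *m g *m (y *m W)^T) 0 0.
    transitivity ((y *m W *m g *m (x *m W)^T)^T 0 0); first by rewrite [RHS]mxE.
    by rewrite trmx_mul trmxK [(y *m W *m g)^T]trmx_mul gT mulmxA.
  move: H; rewrite xS yS !mulmxBl [(_ + _)^T]linearD /= mulmxDr ![(_ *: _)^T]linearZ /= -!scalemxAr -!scalemxAl.
  have X := gram_pos_ge0 (x *m W); have Yp := gram_pos_ge0 (y *m W).
  have X0 := @gram_pos_eq0 (x *m W); have Y0 := @gram_pos_eq0 (y *m W).
  have XD (A B : 'M[R]_1) : (A + B) 0 0 = A 0 0 + B 0 0 by rewrite mxE.
  have XB (A B : 'M[R]_1) : (A - B) 0 0 = A 0 0 - B 0 0 by rewrite !mxE.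
  have XZ c (A : 'M[R]_1) : (c *: A) 0 0 = c * A 0 0 by rewrite mxE.
  rewrite XB XD !XZ.
  move: X Yp X0 Y0; move: ((x *m W *m g *m (x *m W)^T) 0 0) ((y *m W *m g *m (y *m W)^T) 0 0)
    ((x *m W *m g *m (y *m W)^T) 0 0) => p q s p0 q0 X0 Y0 H.
  have : b * (p + q) = 0 by lra.
  move=> /eqP; rewrite mulf_eq0 (negPf bn0) /= paddr_eq0// => /andP[/eqP p1 /eqP q1].
  by split; apply: fW0; [exact: X0|exact: Y0].
have [x0|xn0] := eqVneq x 0; last first.
  by exists a, x; split=> //; rewrite xS b0 scale0r subr0.
exists a, y; split; last by rewrite yS b0 scale0r addr0.
by apply/eqP => y0; apply: xy0.
Qed.

(** The row space of [B] is invariant under [S]; if it were nonzero it would contain an eigenvector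
    of the form $wB$. This one is killed by [B], and self-adjointness turns its square norm into a
    product containing $wBB=0$. *)
Lemma selfadj_annihilator (B : 'M[R]_m) : S *m B = B *m S -> B *m g = g *m B^T ->
  (forall a (v : 'rV[R]_m), v != 0 -> v *m S = a *: v -> v *m B = 0) -> B = 0.
move=> SB Bg ann; apply/eqP/negP => /negP Bn0.
have WB := eq_row_base B; set W := row_base B in WB *.
have fW : row_free W by rewrite row_base_free.
have sub : (W *m S <= W)%MS.
  have /submxP[D WD] : (W <= B)%MS by rewrite WB.
  rewrite {1}WD -mulmxA -SB mulmxA; apply: (submx_trans (submxMl _ _)).
  by rewrite WB.
have /submxP[T WS] := sub.
have r0 : (0 < \rank B)%N by rewrite lt0n mxrank_eq0.
have [a [x [x0 xS]]] := selfadj_invariant_eigen r0 fW WS.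
have xW0 : x *m W != 0.
  apply: contraNneq x0 => /(congr1 (mulmx^~ (pinvmx W))) /=.
  by rewrite mul0mx -mulmxA mulmxVp// mulmx1 => ->.
have /submxP[w xw] : (x *m W <= B)%MS by rewrite (submx_trans (submxMl _ _))// WB.
move: (ann _ _ xW0 xS); rewrite xw => wBB.
move: xW0; rewrite xw => /negP; apply; apply/eqP; apply: gram_pos_eq0.
by rewrite trmx_mul !mulmxA -(mulmxA (w *m B)) -Bg !mulmxA wBB !mul0mx mxE.
Qed.

End SelfAdjoint.

Lemma shift_mul (R : realType) (m : nat) (S : 'M[R]_m) (x y : R) :
  (S - x%:M) *m (S - y%:M) = S *m S - (x + y) *: S + (x * y)%:M.
rewrite mulmxBl mulmxBr mul_scalar_mx mul_mx_scalar scalerBr scale_scalar_mx.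
move: (S *m S) => a; apply/matrixP => i j; rewrite !mxE; move: (x * y *+ _) => u; ring.
Qed.

Lemma shift_comm (R : realType) (m : nat) (S : 'M[R]_m) (x y : R) :
  (S - x%:M) *m (S - y%:M) = (S - y%:M) *m (S - x%:M).
by rewrite !shift_mul addrC [y + x]addrC [y * x]mulrC addrC. Qed.

(** * Spectral projections for three eigenvalues *)

Section ThreeEigenvalues.
Variables (R : realType) (m : nat) (S : 'M[R]_m) (s : 'I_3 -> R).
Hypothesis s_inj : injective s.

(** Lagrange interpolation polynomials at the three eigenvalues. Addition of indices is modulo 3, so
    [a + 1] and [a + 2] are the two other indices whatever [a] is. *)
Definition lag_coef (a : 'I_3) : R := ((s a - s (a + 1)) * (s a - s (a + 2)))^-1.
Definition lag (a : 'I_3) : 'M[R]_m :=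
  lag_coef a *: ((S - (s (a + 1))%:M) *m (S - (s (a + 2))%:M)).
Definition annih : 'M[R]_m :=
  (S - (s 0)%:M) *m (S - (s 1)%:M) *m (S - (s 2)%:M).
Hypothesis S0 : annih = 0.

Let sD (a b : 'I_3) : a != b -> s a - s b != 0.
by move=> ab; rewrite subr_eq0; apply: contra_neq ab; exact: s_inj. Qed.

Let S0' (a : 'I_3) : (S - (s a)%:M) *m ((S - (s (a + 1))%:M) *m (S - (s (a + 2))%:M)) = 0.
rewrite -[RHS]S0 /annih mulmxA; case: a => [[|[|[|//]]] Ha].
- rewrite (_ : Ordinal Ha = 0); last exact/val_inj.
  by rewrite !add0r.
- rewrite (_ : Ordinal Ha = 1); last exact/val_inj.
  rewrite (_ : 1 + 1 = 2); last exact/val_inj.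
  rewrite (_ : 1 + 2 = 0); last exact/val_inj.
  by rewrite -mulmxA (shift_comm S (s 2) (s 0)) mulmxA (shift_comm S (s 1) (s 0)).
rewrite (_ : Ordinal Ha = 2); last exact/val_inj.
rewrite (_ : 2 + 1 = 0); last exact/val_inj.
rewrite (_ : 2 + 2 = 1); last exact/val_inj.
by rewrite (shift_comm S (s 2) (s 0)) -mulmxA (shift_comm S (s 2) (s 1)) mulmxA.
Qed.

Lemma lag_shape a : S *m lag a = s a *: lag a.
have := S0' a; rewrite mulmxBl mul_scalar_mx => /eqP; rewrite subr_eq0 => /eqP H.
by rewrite /lag -scalemxAr H scalerA mulrC -scalerA.
Qed.

Lemma lag_shapeC a : lag a *m S = S *m lag a.
rewrite /lag -scalemxAl -scalemxAr; congr (_ *: _).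
have c x : (S - x%:M) *m S = S *m (S - x%:M) by rewrite mulmxBl mulmxBr scalar_mxC.
by rewrite -mulmxA c mulmxA c mulmxA.
Qed.

Lemma lag_neq a b : a != b -> lag a *m lag b = 0.
move=> ab; have H : s a *: (lag a *m lag b) = s b *: (lag a *m lag b).
  by rewrite scalemxAl -lag_shape -lag_shapeC -mulmxA lag_shape scalemxAr.
move/eqP: H; rewrite -subr_eq0 -scalerBl scaler_eq0 (negPf (sD ab)) => /eqP//.
Qed.

Lemma lag_sum : lag 0 + lag 1 + lag 2 = 1%:M.
have d1 : s 0 - s 1 != 0 by exact: sD.
have d2 : s 0 - s 2 != 0 by exact: sD.
have d3 : s 1 - s 2 != 0 by exact: sD.
rewrite /lag /lag_coef !shift_mul !add0r.
rewrite (_ : 1 + 1 = 2 :> 'I_3); last exact/val_inj.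
rewrite (_ : 1 + 2 = 0 :> 'I_3); last exact/val_inj.
rewrite (_ : 2 + 1 = 0 :> 'I_3); last exact/val_inj.
rewrite (_ : 2 + 2 = 1 :> 'I_3); last exact/val_inj.
move: d1 d2 d3; move: (s 0) (s 1) (s 2) (S *m S) => x y z T d1 d2 d3.
apply/matrixP => i j; rewrite !mxE.
have [e He] : exists e : R, forall c, c *+ (i == j) = c * e.
  by exists (i == j)%:R => c; rewrite mulr_natr.
rewrite !He; move: (T i j) (S i j) => t w.
have d4 : y - x != 0 by rewrite -opprB oppr_eq0.
have d5 : z - x != 0 by rewrite -opprB oppr_eq0.
have d6 : z - y != 0 by rewrite -opprB oppr_eq0.
by field; rewrite d1 d2 d3 d4 d5 d6.
Qed.

Lemma lag_idem a : lag a *m lag a = lag a.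
rewrite -[RHS]mulmx1 -lag_sum !mulmxDr; case: a => [[|[|[|//]]] Ha].
- rewrite (_ : Ordinal Ha = 0); last exact/val_inj.
  by rewrite (@lag_neq 0 1)// (@lag_neq 0 2)// !addr0.
- rewrite (_ : Ordinal Ha = 1); last exact/val_inj.
  by rewrite (@lag_neq 1 0)// (@lag_neq 1 2)// addr0 add0r.
rewrite (_ : Ordinal Ha = 2); last exact/val_inj.
by rewrite (@lag_neq 2 0)// (@lag_neq 2 1)// !add0r.
Qed.

Lemma lag_neq0 a : eigenvalue S (s a) -> lag a != 0.
move=> /eigenvalueP[v vS v0]; apply: contraNneq v0 => /(congr1 (mulmx v)).
have H x : v *m (S - x%:M) = (s a - x) *: v by rewrite mulmxBr vS mul_mx_scalar scalerBl.
rewrite mulmx0 /lag -scalemxAr mulmxA H -scalemxAl H !scalerA => /eqP.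
rewrite scaler_eq0 => /orP[|/eqP -> //]; rewrite -mulrA mulVf ?oner_eq0//.
apply: mulf_neq0; apply: sD; case: a {vS H} => [[|[|[|//]]] Ha]//.
Qed.

End ThreeEigenvalues.

(** In a rank factorisation $P=CD$ idempotence forces $DC=1$, and the trace of an identity matrix is
    its size. *)
Lemma mxtrace_idem (R : realType) (m : nat) (P : 'M[R]_m) : P *m P = P -> \tr P = (\rank P)%:R.
move=> PP; move: (row_base_free P) (col_base_full P) (mulmx_base P).
move: (col_base P) (row_base P) => C D fD fC CD.
have H : C *m (D *m C *m D) = C *m D by rewrite !mulmxA CD -mulmxA CD PP.
have DC : D *m C = 1%:M by apply: (row_free_inj fD); rewrite (row_full_inj fC H) mul1mx.
transitivity (\tr (C *m D)); first by rewrite CD.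
by rewrite mxtrace_mulC DC mxtrace1.
Qed.

(** * Change of parametrisation *)

Section Reparametrization.
Variables (R : realType) (m N : nat) (E : 'M[R]_N).
Hypothesis E_sym : E^T = E.
Variables (U U' : set 'rV[R]_m) (Y Y' : 'rV[R]_m -> 'rV[R]_N) (phi : 'rV[R]_m -> 'rV[R]_m).
Hypotheses (oU : open U) (oU' : open U') (sY : Coo U Y) (sphi : Coo U' phi).
Hypothesis phiU : forall u, U' u -> U (phi u).
Hypothesis YY' : forall u, U' u -> Y' u = Y (phi u).

Notation D := (jac phi).

Lemma reparam_smooth : Coo U' Y'.
by apply: (sm_ext oU' _ (sm_comp oU oU' sphi phiU sY)) => v Uv; rewrite YY'.
Qed.
Let sY' := reparam_smooth.

Lemma dd_reparam p q (F : 'rV[R]_m -> 'M[R]_(p, q)) i u : U' u -> Coo U F ->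
  dd i (fun v => F (phi v)) u = act (D u) (fun j => dd j F (phi u)) i.
move=> U'u sF; rewrite (dd_comp i oU oU' sphi phiU U'u sF).
by eqbig j; rewrite jacE mxE.
Qed.

Lemma sm_reparam p q (F : 'rV[R]_m -> 'M[R]_(p, q)) :
  Coo U F -> Coo U' (fun v => F (phi v)).
exact: (sm_comp oU oU' sphi phiU). Qed.

Lemma reparam_jac u : U' u -> jac Y' u = D u *m jac Y (phi u).
move=> U'u; apply/row_matrixP => i; rewrite row_jac row_mul mulmx_sum_row.
rewrite (dd_ext oU' i U'u YY') (dd_reparam i U'u sY); eqbig j.
by rewrite (row_jac Y j) [row i _ _ _]mxE.
Qed.

Hypothesis gU : forall u, U u -> gm E Y u \in unitmx.
Hypothesis gU' : forall u, U' u -> gm E Y' u \in unitmx.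

Lemma reparam_gm u : U' u -> gm E Y' u = D u *m gm E Y (phi u) *m (D u)^T.
by move=> U'u; rewrite !gmE reparam_jac// trmx_mul !mulmxA. Qed.

Lemma jac_param_unit u : U' u -> D u \in unitmx.
move=> U'u; have := gU' U'u; rewrite reparam_gm// !unitmxE !det_mulmx.
by rewrite !unitrM => /andP[/andP[]].
Qed.

Lemma reparam_ginv u : U' u ->
  (D u)^T *m invmx (gm E Y' u) *m D u = invmx (gm E Y (phi u)).
move=> U'u; have Du := jac_param_unit U'u; have gu := gU (phiU U'u).
have -> : invmx (gm E Y' u) = invmx (D u)^T *m invmx (gm E Y (phi u)) *m invmx (D u).
  apply: (can_inj (mulKmx (gU' U'u))); rewrite mulmxV ?gU'// reparam_gm//.
  rewrite !mulmxA -(mulmxA (D u *m _)) mulmxV ?unitmx_tr// mulmx1.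
  by rewrite -(mulmxA (D u)) mulmxV// mulmx1 mulmxV.
by rewrite !mulmxA mulmxV ?unitmx_tr// mul1mx -mulmxA mulVmx// mulmx1.
Qed.

(** Obtained from [hes_unique]: the second derivatives of the change of parameters sit in the
    tangential coefficient, which needs no simplification. *)
Lemma reparam_hes k u : U' u ->
  hes E Y' k u = act (D u) (fun s => D u *m hes E Y s (phi u)) k.
move=> U'u; have sj := sm_jac oU sY; have sD := sm_jac oU' sphi.
apply: (proj1 (hes_unique gU' (c := (dd k D u + act (D u) (fun s => D u *m cov E Y s (phi u)) k) *m invmx (D u)) U'u _ _)).
  rewrite (dd_ext oU' k U'u reparam_jac) (dd_mulmx oU')//; last exact: sm_reparam.
  rewrite (dd_reparam k U'u sj) reparam_jac// mulmxA mulmxKV ?jac_param_unit// mulmxDl -act_mulmxr.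
  rewrite addrCA; congr (_ + _); rewrite -act_mulmx /act -big_split; apply: eq_bigr => s _ /=.
  by rewrite -scalerDr (dd_jac E) mulmxDr mulmxA.
rewrite reparam_jac// trmx_mul mulmxA -!act_mulmxr /act big1// => s _.
by rewrite -!mulmxA (mulmxA (hes _ _ _ _)) [_ *m (_ *m (D u)^T)]mulmxA (hes_jac gU s (phiU U'u)) mul0mx mulmx0 scaler0.
Qed.

Lemma reparam_contract (P P' : 'M[R]_m) u : U' u -> P' *m D u = D u *m P ->
  ctr (invmx (gm E Y' u) *m P') (hes E Y' ^~ u) =
  ctr (invmx (gm E Y (phi u)) *m P) (hes E Y ^~ (phi u)).
move=> U'u PP'; rewrite (eq_contract _ (fun k => reparam_hes k U'u)) -contract_trM -contractMr.
by rewrite -!mulmxA PP' !mulmxA reparam_ginv.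
Qed.

Lemma reparam_lap u : U' u -> lap E Y' u = lap E Y (phi u).
move=> U'u; rewrite !lapE -[invmx (gm E Y' u)]mulmx1 -[invmx (gm E Y (phi u))]mulmx1.
by apply: reparam_contract => //; rewrite mul1mx mulmx1.
Qed.

Lemma reparam_tless k u : U' u ->
  tless E Y' u k = act (D u) (fun s => D u *m tless E Y (phi u) s) k.
move=> U'u; rewrite tlessE reparam_hes// reparam_lap//.
rewrite (eq_act _ _ (fun s => congr1 (mulmx (D u)) (tlessE E Y (phi u) s))).
rewrite (eq_act _ _ (fun s => mulmxBr _ _ _)) act_fB; congr (_ - _).
rewrite reparam_gm//; set h := lap E Y _; set g := gm E Y _.
transitivity (m%:R^-1 *: (act (D u) (fun s => D u *m col s g) k *m h)).
  congr (_ *: (_ *m _)); rewrite act_mulmx colE -!mulmxA; congr (_ *m _).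
  apply/colP => i; rewrite /act summxE -colE [LHS]mxE; eqbig s.
  by rewrite !mxE mulrC.
rewrite -act_mulmxr /act scaler_sumr; eqbig s.
by rewrite scalerA mulrC -scalerA -scalemxAr mulmxA.
Qed.

Lemma reparam_tless_sqnorm u : U' u -> tless_sqnorm E Y' u = tless_sqnorm E Y (phi u).
move=> U'u; rewrite /tless_sqnorm -(reparam_ginv U'u).
set gi := invmx (gm E Y' u); set t := tless E Y (phi u).
have H i k : \tr (tless E Y' u k *m E *m (tless E Y' u i)^T *m gi) =
    \sum_r \sum_s D u i r * D u k s * \tr (t s *m E *m (t r)^T *m ((D u)^T *m gi *m D u)).
  rewrite !reparam_tless// /act [(\sum_s _)^T]linear_sum /= mulmx_sumr mulmx_suml raddf_sum /=.
  eqbig r; rewrite !mulmx_suml raddf_sum /=; eqbig s.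
  rewrite [(_ *: _)^T]linearZ /= -!scalemxAl -!scalemxAr -!scalemxAl !mxtraceZ mulrA; congr (_ * _); first exact: mulrC.
  by rewrite trmx_mul -!mulmxA mxtrace_mulC !mulmxA.
transitivity (\sum_i \sum_k \sum_r \sum_s (D u i r * gi i k * D u k s) *
   \tr (t s *m E *m (t r)^T *m ((D u)^T *m gi *m D u))).
  eqbig i; eqbig k; rewrite H mulr_sumr; eqbig r.
  by rewrite mulr_sumr; eqbig s; rewrite !mulrA [gi i k * _]mulrC.
transitivity (\sum_r \sum_s \sum_i \sum_k (D u i r * gi i k * D u k s) *
   \tr (t s *m E *m (t r)^T *m ((D u)^T *m gi *m D u))).
  transitivity (\sum_r \sum_i \sum_k \sum_s (D u i r * gi i k * D u k s) *
     \tr (t s *m E *m (t r)^T *m ((D u)^T *m gi *m D u))).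
    by rewrite [RHS]exchange_big; eqbig i; exact: exchange_big.
  eqbig r; rewrite [RHS]exchange_big; eqbig i; exact: exchange_big.
eqbig r; eqbig s.
under eq_bigr do rewrite -mulr_suml.
rewrite -mulr_suml; congr (_ * _); rewrite mxE exchange_big; eqbig k.
by rewrite mxE mulr_suml; eqbig i; rewrite !mxE.
Qed.

End Reparametrization.

(** * Constancy on connected manifolds, and passage from charts to the manifold *)

Section LocallyConstant.
Variables (R : realType) (m : nat).

Lemma sm_derive0 (U : set 'rV[R]_m) p q (F : 'rV[R]_m -> 'M[R]_(p, q)) u v :
  open U -> U u -> Coo U F -> (forall i, dd i F u = 0) ->
  derivable F u v /\ 'D_v F u = 0.
move=> oU Uu sF dF0; have dF := sm_is_diff oU Uu sF; split.
  by apply: diff_derivable; exact: ex_diff.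
rewrite deriveE; last exact: ex_diff.
rewrite diff_val /gradient big1// => i _.
by rewrite -ddE dF0 scaler0.
Qed.

Lemma dd0_near_const (U : set 'rV[R]_m) p q (F : 'rV[R]_m -> 'M[R]_(p, q)) u :
  open U -> U u -> Coo U F -> (forall i v, U v -> dd i F v = 0) ->
  \forall v \near u, F v = F u.
move=> oU Uu sF dF0.
have [e /= e0 eU] : exists2 e : R, 0 < e & ball u e `<=` U.
  by have /nbhs_ballP[e /= e0 eU] := open_nbhs_nbhs (conj oU Uu); exists e.
apply/nbhs_ballP; exists e => //= v uv; apply/matrixP => i j.
have inb t : t \in `[0, 1] -> U ((t * 1) *: (v - u) + u).
  rewrite in_itv /= => /andP[t0 t1]; apply: eU; rewrite mulr1 -ball_normE /= opprD addrC subrK normrN.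
  rewrite normrZ ger0_norm//; move: uv; rewrite -ball_normE /= distrC => uv.
  by apply: le_lt_trans uv; rewrite ler_piMl.
have H t : t \in `[0, 1] -> is_derive ((t * 1) *: (v - u) + u) (v - u) (fun w => F w i j) 0.
  move=> /inb Ut; have [d1 d2] := sm_derive0 (v - u) oU Ut sF (fun k => dF0 k _ Ut).
  split; first by have /derivable_mxP := d1; apply.
  by have := derive_mx d1; rewrite d2 => /matrixP/(_ i j); rewrite !mxE => <-.
have [t t01] := @MVT_line R _ (fun w => F w i j) (v - u) u 1 (fun t tt => @ex_derive _ _ _ _ _ _ _ (H t tt)).
rewrite (@derive_val _ _ _ _ _ _ _ (H t t01)) mulr0 scale1r subrK => /eqP.
by rewrite subr_eq0 => /eqP.
Qed.

Lemma manifold_const (M : topologicalType) (A : set (chart R M m)) p q (h : M -> 'M[R]_(p, q)) :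
  is_manifold A ->
  (forall c, A c -> Coo (cimg c) (h \o cinv c) /\
     forall i u, cimg c u -> dd i (h \o cinv c) u = 0) ->
  forall a b, h a = h b.
move=> [[_ _ conM _] [chA covA _]] hA.
have loc a : \forall b \near a, h b = h a.
  have [c Ac ca] := covA a; have [oD oI cK cC _] := chA c Ac; have [sh dh] := hA c Ac.
  have Iu : cimg c (cmap c a) by exists a.
  have N1 := dd0_near_const oI Iu sh dh.
  have N2 : \forall b \near a, cdom c b by exact: open_nbhs_nbhs.
  have N3 : \forall b \near a, (h \o cinv c) (cmap c b) = (h \o cinv c) (cmap c a) by exact: (cC a ca _ N1).
  near=> b; have Hb : (h \o cinv c) (cmap c b) = (h \o cinv c) (cmap c a) by near: b.
  by move: Hb; rewrite /= !cK//; near: b.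
have locconst a : open [set b | h b = h a].
  rewrite openE => b /= hb; rewrite /interior; have := loc b; rewrite /= hb.
  by apply: filterS => d /= ->.
move=> a b; suff : [set b | h b = h a] = setT by move=> /seteqP[_ /(_ b I)].
apply: conM.
- by exists a.
- by exists [set b | h b = h a] => //; rewrite setTI.
exists [set b | h b = h a]; last by rewrite setTI.
rewrite -openC openE => d /= hd; rewrite /interior.
by have := loc d; apply: filterS => d' /= hd'; rewrite hd'.
Unshelve. all: by end_near.
Qed.

End LocallyConstant.

Section ChartChange.
Variables (R : realType) (M : topologicalType) (m : nat) (A : set (chart R M m)).
Hypothesis mA : is_manifold A.

Lemma chart_open c : A c -> open (cimg c).
by case: mA => _ [cA _ _] /cA[]. Qed.

Lemma chart_cinv c u : A c -> cimg c u -> cdom c (cinv c u) /\ cmap c (cinv c u) = u.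
by case: mA => _ [cA _ _] /cA[_ _ cK _ _] [q qc <-]; rewrite cK. Qed.

Lemma chart_cmapK c q : A c -> cdom c q -> cinv c (cmap c q) = q.
by case: mA => _ [cA _ _] /cA[_ _ cK _ _]; apply: cK. Qed.

Lemma chart_cimg (c : chart R M m) q : cdom c q -> cimg c (cmap c q).
by exists q. Qed.

Definition overlap (c c' : chart R M m) := cmap c' @` (cdom c' `&` cdom c).
Definition transition (c c' : chart R M m) := cmap c \o cinv c'.

Lemma overlapP c c' u : A c' -> overlap c c' u <-> cimg c' u /\ cdom c (cinv c' u).
move=> Ac'; split=> [[q [qc' qc] <-]|[[q qc' <-]]].
  by rewrite chart_cmapK//; split=> //; exists q.
by rewrite chart_cmapK// => qc; exists q.
Qed.

Lemma overlap_open c c' : A c -> A c' -> open (overlap c c').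
move=> Ac Ac'; rewrite openE => u /(overlapP c u Ac')[u1 u2].
case: (mA) => _ [cA _ _]; have [oD oI _ _ cC] := cA c' Ac'; have [oDc _ _ _ _] := cA c Ac.
have N1 : nbhs u (cimg c') by exact: open_nbhs_nbhs.
have N2 : nbhs u ((cinv c') @^-1` (cdom c)).
  by apply: (cC u u1); exact: open_nbhs_nbhs.
rewrite /interior; apply: filterS (filterI N1 N2) => v [v1 v2].
by apply/(overlapP c v Ac').
Qed.

Lemma transition_smooth c c' : A c -> A c' -> Coo (overlap c c') (transition c c').
by case: mA => _ [_ _ tA] Ac Ac'; exact: tA. Qed.

Lemma transition_cimg c c' u : A c' -> overlap c c' u -> cimg c (transition c c' u).
by move=> Ac' /(overlapP c u Ac')[_ u2]; exists (cinv c' u). Qed.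

Lemma transitionK c c' u : A c -> A c' -> overlap c c' u ->
  cinv c (transition c c' u) = cinv c' u.
by move=> Ac Ac' /(overlapP c u Ac')[_ u2]; rewrite /transition /= chart_cmapK. Qed.

Definition chart_at (q : M) : chart R M m := sval (cid2 ((let: conj _ (And3 _ h _) := mA in h) q)).

Lemma chart_atP q : A (chart_at q) /\ cdom (chart_at q) q.
by rewrite /chart_at; case: cid2. Qed.

Variables (T : Type) (F : chart R M m -> 'rV[R]_m -> T).
(** A quantity given in every chart and compatible with transitions descends to the manifold; the
    chart chosen at each point is irrelevant by [globalizeE]. *)
Definition globalize q := F (chart_at q) (cmap (chart_at q) q).

Hypothesis F_invariant : forall c c' u, A c -> A c' -> overlap c c' u ->
  F c' u = F c (transition c c' u).

Lemma globalizeE c u : A c -> cimg c u -> globalize (cinv c u) = F c u.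
move=> Ac uc; have [uD uK] := chart_cinv Ac uc; rewrite /globalize.
have [A1 D1] := chart_atP (cinv c u); set c1 := chart_at _ in A1 D1 *.
have ov : overlap c1 c u by apply/(overlapP c1 u Ac).
by rewrite (F_invariant A1 Ac ov).
Qed.

End ChartChange.

Lemma three_distinct_dim (R : realType) (m : nat) (S : 'M[R]_m) :
  three_distinct_eigenvalues S -> (2 < m)%N.
move=> [s us sE]; have := @max_poly_roots _ (char_poly S) s.
rewrite size_char_poly size_tuple ltnS; apply => //.
  by rewrite -size_poly_eq0 size_char_poly.
by apply/allP => t ts; rewrite -eigenvalue_root_char sE.
Qed.

Lemma sqr_inj_pos (R : realType) (a b : R) : 0 < a -> 0 < b -> a ^+ 2 = b ^+ 2 -> a = b.
by move=> a0 b0; apply: pexpIrn; rewrite ?nnegrE ?ltW. Qed.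

(** * The hypotheses of the theorem in charts, and invariance under transitions *)

Section BlaschkeParallel.
Variables (R : realType) (m n : nat) (M : topologicalType).
Variables (A : set (chart R M m)) (x : M -> 'rV[R]_n.+1).
Hypotheses (mA : is_manifold A) (imm : immersion A (sphere n 1) x).
Hypotheses (umb : umbilic_free A (sphere n 1) x) (bp : blaschke_parallel A x).
Hypotheses (mf : mobius_form_vanishes A x) (three : three_blaschke_eigenvalues A x).
Notation E := (mink R n.+1).
Notation f c := (x \o cinv c).
Notation Y c := (mobius_position (f c)).
Notation g c := (gm E (Y c)).
Notation N c := (conj_pos (Y c)).

Lemma m_gt2 : (2 < m)%N.
case: (mA) => [[_ _ _ [q _]] [_ covA _]]; have [c Ac cq] := covA q.
by apply: three_distinct_dim (three Ac (chart_cimg cq)).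
Qed.
Let m_gt1 : (1 < m)%N. exact: ltnW m_gt2. Qed.
Let m_gt0 : (0 < m)%N. exact: ltnW m_gt1. Qed.

Section Chart.
Variables (c : chart R M m) (Ac : A c).
Notation U := (cimg c).

Let oU : open U. exact: chart_open mA _ Ac. Qed.
Let sf : Coo U (f c). by case: imm => _ + _; apply. Qed.
Let ff u : U u -> dot (f c u) (f c u) = 1.
by case: imm => H _ _ _; have := H (cinv c u); rewrite /= expr1n. Qed.
Let fr u : U u -> row_free (\matrix_(i < m) pd i (f c) u).
by case: imm => _ _; apply. Qed.
Let fu u : U u -> exists i j, sff (sphere n 1) (f c) i j u <>
  induced_metric (sf_form (sphere n 1)) (f c) u i j *: mean_curvature (sphere n 1) (f c) u.
exact: umb. Qed.

Lemma rhoc_gt0 u : U u -> 0 < rho (f c) u.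
exact: (rho_gt0 oU sf m_gt1 ff fr fu). Qed.

Lemma rhoc_sq u : U u ->
  rho (f c) u ^+ 2 = m%:R / (m%:R - 1) * tless_sqnorm 1%:M (f c) u.
exact: (rho_sq oU sf m_gt1 ff fr fu). Qed.

Lemma fc_gm_unit u : U u -> gm 1%:M (f c) u \in unitmx.
exact: (immersion_gm_unit fr). Qed.

Lemma sm_fc : Coo U (f c). exact: sf. Qed.

Lemma sm_Y : Coo U (Y c).
exact: (sm_mobius_position oU sf m_gt1 ff fr fu). Qed.
Let sY := sm_Y.

Lemma g_unit u : U u -> g c u \in unitmx.
exact: (mobius_gm_unit oU sf m_gt1 ff fr fu). Qed.
Let gU := g_unit.

(** Positive definiteness in the form used later: the metric is $BB^T$ for an explicit [B]. *)
Lemma g_gram u : U u -> g c u = (rho (f c) u *: jac (f c) u) *m (rho (f c) u *: jac (f c) u)^T.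
move=> Uu; rewrite (mobius_gmE oU sf m_gt1 ff fr fu Uu) gmE mulmx1.
by rewrite [(_ *: _)^T]linearZ /= -scalemxAr -scalemxAl scalerA expr2.
Qed.

Lemma Y_null u : U u -> Y c u *m E *m (Y c u)^T = 0.
exact: (mobius_position_null ff). Qed.

Lemma Y_pos u : U u -> 0 < Y c u 0 0.
move=> Uu; rewrite /mobius_position /light mxE.
rewrite (_ : row_mx (1%:M : 'M[R]_1) (f c u) 0 0 = 1) ?mulr1 ?rhoc_gt0//.
transitivity ((1%:M : 'M[R]_1) 0 0); last by rewrite mxE.
have -> : (0 : 'I_(1 + n.+1)) = lshift n.+1 0 by exact/val_inj.
by rewrite row_mxEl.
Qed.

Lemma Y_tless u : U u -> tless_sqnorm E (Y c) u = (m%:R - 1) / m%:R.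
exact: (mobius_tless_sqnorm oU sf m_gt1 ff fr fu). Qed.

Lemma mobius_NE u : U u -> mobius_N (f c) u = N c u.
move=> Uu; rewrite conj_posE /mobius_N /mobius_metric.
by rewrite (laplacianE (mink_sym R n.+1) (@lorentzE R n.+1) oU sY gU Uu).
Qed.

Lemma mobius_metricE u : mobius_metric (f c) u = g c u.
exact: (induced_metricE (@lorentzE R n.+1)). Qed.

Lemma sm_N : Coo U (N c).
exact: (sm_conj_pos oU sY gU). Qed.

Lemma blaschkeE u : U u -> blaschke_tensor (f c) u = btensor (Y c) u.
move=> Uu; apply/matrixP => i j; rewrite mxE.
have -> : pd i (mobius_N (f c)) u = dd i (N c) u.
  by rewrite -ddE; apply: (dd_ext oU i Uu) => v; exact: mobius_NE.
rewrite -ddE -!row_jac (form_rowE (@lorentzE R n.+1)) btensorE.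
by [].
Qed.

Lemma form0c u : U u -> jac (N c) u = bshape (Y c) u *m jac (Y c) u.
move=> Uu; apply/row_matrixP => i; rewrite row_jac.
have := mf Ac Uu i; rewrite /mobius_form => /eqP; rewrite subr_eq0 => /eqP.
have -> : pd i (mobius_N (f c)) u = dd i (N c) u.
  by rewrite -ddE; apply: (dd_ext oU i Uu) => v; exact: mobius_NE.
move=> ->; rewrite mobius_metricE blaschkeE// exchange_big /= row_mul mulmx_sum_row.
eqbig k; rewrite row_jac ddE -scaler_suml; congr (_ *: _).
by rewrite bshapeE [RHS]mxE mxE.
Qed.

Lemma sm_B : Coo U (btensor (Y c)).
exact: (sm_btensor oU sY gU). Qed.

Lemma B_parallel k u : U u -> dd k (btensor (Y c)) u =
  cov E (Y c) k u *m btensor (Y c) u + btensor (Y c) u *m (cov E (Y c) k u)^T.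
move=> Uu; have sB : Coo U (blaschke_tensor (f c)).
  by apply: (sm_ext oU _ sm_B) => v Uv; rewrite blaschkeE.
apply/eqP; rewrite -subr_eq0 opprD addrA; apply/eqP/matrixP => i j.
have := bp Ac Uu k i j.
rewrite (cov_derivE (mink_sym R n.+1) (@lorentzE R n.+1) oU sY gU k i j Uu sB).
by rewrite (dd_ext oU k Uu (fun v Uv => blaschkeE Uv)) blaschkeE// => ->; rewrite mxE.
Qed.

Lemma three_shape u : U u -> three_distinct_eigenvalues (bshape (Y c) u).
by move=> Uu; have := three Ac Uu; rewrite /endo mobius_metricE blaschkeE// bshapeE. Qed.

End Chart.

Section Transition.
Variables (c c' : chart R M m) (Ac : A c) (Ac' : A c').
Notation U := (cimg c).
Notation U' := (overlap c c').
Notation phi := (transition c c').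
Let oU : open U. exact: chart_open mA _ Ac. Qed.
Let oU' : open U'. exact: overlap_open Ac Ac'. Qed.
Let sphi : Coo U' phi. exact: (transition_smooth mA). Qed.
Let phiU u : U' u -> U (phi u). exact: (transition_cimg mA). Qed.
Let sub u : U' u -> cimg c' u. by move=> /(overlapP mA c u Ac')[]. Qed.

Lemma trans_f u : U' u -> f c' u = f c (phi u).
by move=> U'u; rewrite /= -[in LHS](transitionK mA Ac Ac' U'u). Qed.

Lemma trans_rho u : U' u -> rho (f c') u = rho (f c) (phi u).
move=> U'u; have r1 := rhoc_gt0 Ac' (sub U'u); have r2 := rhoc_gt0 Ac (phiU U'u).
have H : tless_sqnorm 1%:M (f c') u = tless_sqnorm 1%:M (f c) (phi u).
  apply: (reparam_tless_sqnorm oU oU' (sm_fc Ac) sphi phiU trans_f _ _ U'u).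
    exact: fc_gm_unit.
  by move=> v /sub; exact: fc_gm_unit.
have q1 := rhoc_sq Ac' (sub U'u); have q2 := rhoc_sq Ac (phiU U'u).
exact: (sqr_inj_pos r1 r2 (etrans q1 (etrans (congr1 ( *%R _) H) (esym q2)))).
Qed.

Lemma trans_Y u : U' u -> Y c' u = Y c (phi u).
by move=> U'u; rewrite /mobius_position trans_rho// trans_f. Qed.

Let gU := g_unit Ac.
Let gU' u (U'u : U' u) := g_unit Ac' (sub U'u).

Lemma trans_N u : U' u -> N c' u = N c (phi u).
move=> U'u; rewrite !conj_posE.
by rewrite (reparam_lap oU oU' (sm_Y Ac) sphi phiU trans_Y gU gU' U'u) trans_Y.
Qed.

Lemma trans_unit u : U' u -> jac phi u \in unitmx.
exact: (jac_param_unit oU oU' (sm_Y Ac) sphi phiU trans_Y gU'). Qed.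

Lemma trans_shape u : U' u -> bshape (Y c') u *m jac phi u = jac phi u *m bshape (Y c) (phi u).
move=> U'u; rewrite !bshapeE !btensorE.
rewrite (reparam_jac oU oU' (sm_N Ac) sphi phiU trans_N U'u).
rewrite (reparam_jac oU oU' (sm_Y Ac) sphi phiU trans_Y U'u) trmx_mul.
rewrite -(reparam_ginv oU oU' (sm_Y Ac) sphi phiU trans_Y gU gU' U'u).
by rewrite !mulmxA.
Qed.

Lemma trans_contract (P P' : 'M[R]_m) u : U' u -> P' *m jac phi u = jac phi u *m P ->
  ctr (invmx (g c' u) *m P') (hes E (Y c') ^~ u) =
  ctr (invmx (g c (phi u)) *m P) (hes E (Y c) ^~ (phi u)).
exact: (reparam_contract oU oU' (sm_Y Ac) sphi phiU trans_Y gU gU'). Qed.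

End Transition.

End BlaschkeParallel.

(** * Vectors orthogonal to a null vector *)

Section NullVectors.
Variables (R : realType) (n : nat).
Local Notation E := (mink R n).

Lemma lorentz_split (u v : 'rV[R]_(1 + n)) :
  lorentz u v = - (u 0 0 * v 0 0) + dot (rsubmx u) (rsubmx v).
by []. Qed.

Lemma dotC k (u v : 'rV[R]_k) : dot u v = dot v u.
by eqbig i; rewrite mulrC. Qed.

Lemma dot_comb k (a b : R) (u v : 'rV[R]_k) : dot (a *: u - b *: v) (a *: u - b *: v) =
  a ^+ 2 * dot u u - 2 * a * b * dot u v + b ^+ 2 * dot v v.
rewrite /dot !mulr_sumr -sumrB -big_split; apply: eq_bigr => i _ /=.
by rewrite !mxE; ring.
Qed.

Lemma rowS_eq (u v : 'rV[R]_(1 + n)) : u 0 0 = v 0 0 -> rsubmx u = rsubmx v -> u = v.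
move=> h0 hr; rewrite -[u]hsubmxK -[v]hsubmxK hr; congr row_mx.
apply: mx11_eq; rewrite !mxE; have -> : lshift n 0 = 0 :> 'I_(1 + n) by exact/val_inj.
exact: h0.
Qed.

(* With [y] null, [y_0^2 <w, w>] is the square of the Euclidean norm of the
   spatial part of [y_0 w - w_0 y] as soon as [<w, y> = 0]. *)
Lemma null_orth (w y : 'rV[R]_(1 + n)) : lorentz y y = 0 -> lorentz w y = 0 ->
  y 0 0 ^+ 2 * lorentz w w =
  dot (y 0 0 *: rsubmx w - w 0 0 *: rsubmx y) (y 0 0 *: rsubmx w - w 0 0 *: rsubmx y).
rewrite dot_comb !lorentz_split; move: (dot _ _) (dot _ _) (dot _ _) (y 0 0) (w 0 0).
move=> a b d y0 w0 h1 h2.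
have -> : d = y0 * y0 by lra.
have -> : b = w0 * y0 by lra.
by ring.
Qed.

Lemma null_orth_ge0 (w y : 'rV[R]_(1 + n)) : lorentz y y = 0 -> lorentz w y = 0 ->
  0 < y 0 0 -> 0 <= lorentz w w.
move=> h1 h2 y0; have := dot_ge0 (y 0 0 *: rsubmx w - w 0 0 *: rsubmx y).
by rewrite -null_orth// pmulr_rge0// exprn_gt0.
Qed.

Lemma null_orth_eq0 (w y : 'rV[R]_(1 + n)) : lorentz y y = 0 -> lorentz w y = 0 ->
  0 < y 0 0 -> lorentz w w = 0 -> w = (w 0 0 / y 0 0) *: y.
move=> h1 h2 y0 h3; have := null_orth h1 h2; rewrite h3 mulr0 => /esym/dot_eq0/eqP.
rewrite subr_eq0 => /eqP H; have yn0 : y 0 0 != 0 by rewrite gt_eqF.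
apply: rowS_eq; first by rewrite mxE divfK.
rewrite linearZ /= mulrC -scalerA -H scalerA mulVf// scale1r//.
Qed.

End NullVectors.

Local Notation hes0 := hes.
Local Notation cov0 := cov.
Local Notation lap0 := lap.

(** * The image of the position vector under a projection along a constant vector *)

Section SpaceFormImage.
Variables (R : realType) (m n N' : nat) (U : set 'rV[R]_m) (Y : 'rV[R]_m -> 'rV[R]_(1 + n)).
Local Notation E := (mink R n).
Hypotheses (oU : open U) (sY : Coo U Y) (m_gt1 : (1 < m)%N).
Local Notation J := (jac Y).
Local Notation g := (gm E Y).
Local Notation gi u := (invmx (g u)).
Local Notation cov := (cov E Y).
Local Notation hes := (hes E Y).
Local Notation lap := (lap E Y).
Local Notation N := (conj_pos Y).
Local Notation A := (btensor Y).
Local Notation S := (bshape Y).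
Hypothesis gU : forall u, U u -> g u \in unitmx.
Hypothesis Ynull : forall u, U u -> Y u *m E *m (Y u)^T = 0.
Hypothesis Ypos : forall u, U u -> 0 < Y u 0 0.
Hypothesis form0 : forall u, U u -> jac N u = S u *m J u.
Hypothesis A_parallel : forall k u, U u -> dd k A u = cov k u *m A u + A u *m (cov k u)^T.
Hypothesis Ytless : forall u, U u -> tless_sqnorm E Y u = (m%:R - 1) / m%:R.
Hypothesis S3 : forall u, U u -> three_distinct_eigenvalues (S u).

Variables (c : 'rV[R]_(1 + n)) (Q : space_form R N') (E' : 'M[R]_N') (L : 'M[R]_(1 + n, N')) (t : R).
Hypothesis cY : forall u, U u -> Y u *m E *m c^T = 1%:M.
Hypothesis E'_sym : E'^T = E'.
Hypothesis QE : forall u v, sf_form Q u v = (u *m E' *m v^T) 0 0.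
Hypothesis t_gt0 : 0 < t.
Hypothesis cL : c *m L = 0.
Hypothesis LE : forall v w : 'rV_(1 + n), v *m E *m c^T = 0 -> w *m E *m c^T = 0 ->
  sf_form Q (v *m L) (w *m L) = t ^+ 2 * lorentz v w.
Local Notation gamma := (lorentz c c).
Hypothesis Qt : sf_curv Q * t ^+ 2 = - gamma.

Let E_sym := mink_sym R n.
Let m_gt0 : (0 < m)%N. exact: ltnW. Qed.
Let mn0 : m%:R != 0 :> R. by rewrite pnatr_eq0 -lt0n. Qed.
Let tn0 : t != 0. by rewrite gt_eqF. Qed.
Let sJ := sm_jac oU sY.
Let sg := sm_gm E oU sY.
Let sh k := sm_hes oU sY gU k.
Let sl := sm_lap oU sY gU.
Let lE := @lorentzE R n.

Variable f : 'rV[R]_m -> 'rV[R]_N'.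
Hypothesis fE : forall u, U u -> f u = Y u *m L.
Lemma image_smooth : Coo U f.
by apply: (sm_ext oU (f := fun u => Y u *m L)) => [u Uu|]; [rewrite fE|smo].
Qed.
Let sf := image_smooth.

Let LEm p q (X : 'M[R]_(p, 1 + n)) (Z : 'M[R]_(q, 1 + n)) :
  X *m E *m c^T = 0 -> Z *m E *m c^T = 0 ->
  X *m L *m E' *m (Z *m L)^T = t ^+ 2 *: (X *m E *m Z^T).
move=> X0 Z0; apply/matrixP => i j.
have r0 r (W : 'M[R]_(r, 1 + n)) k : W *m E *m c^T = 0 -> row k W *m E *m c^T = 0.
  by move=> W0; rewrite -!row_mul W0 row0.
rewrite -(form_rowE QE) !row_mul LE ?r0// (form_rowE lE).
by rewrite [RHS]mxE.
Qed.

Let Jc u : U u -> J u *m E *m c^T = 0.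
move=> Uu; apply/row_matrixP => i; rewrite row0 !row_mul row_jac.
have : dd i (fun v => Y v *m E *m c^T) u = 0 by rewrite (dd_ext oU i Uu cY) dd_cst.
by rewrite !(dd_mulmxl oU)//; smo.
Qed.

Let hc k u : U u -> hes k u *m E *m c^T = 0.
move=> Uu; have : dd k (fun v => J v *m E *m c^T) u = 0 by rewrite (dd_ext oU k Uu Jc) dd_cst.
rewrite !(dd_mulmxl oU)//; [|smo].
by rewrite (dd_jac E Y k u) !mulmxDl -(mulmxA (cov k u)) -(mulmxA (cov k u)) Jc// mulmx0 addr0.
Qed.

Let lc u : U u -> lap u *m E *m c^T = 0.
move=> Uu; rewrite lapE -!contract_mulmxr (eq_contract _ (fun k => hc k Uu)).
by rewrite /ctr big1// => k _; rewrite mulmx0.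
Qed.

(** Unlike [Y], this vector is orthogonal to [c], where [L] is a similarity; its image is a multiple
    of the position vector [f], which is how the terms along [f] are lifted to the Lorentz space. *)
Let z := locked_with dd_key (fun u => c - gamma *: Y u).
Let zE : z = fun u => c - gamma *: Y u. exact: unlock. Qed.
Let zc u : U u -> z u *m E *m c^T = 0.
move=> Uu; rewrite zE !mulmxBl -!scalemxAl cY//; apply: mx11_eq.
by rewrite lE !mxE mulr1n mulr1 subrr.
Qed.
Let zL u : U u -> z u *m L = - gamma *: f u.
by move=> Uu; rewrite fE// zE mulmxBl cL sub0r -scalemxAl scaleNr. Qed.

Let jf u : U u -> jac f u = J u *m L.
move=> Uu; apply/row_matrixP => i; rewrite row_mul !row_jac.
by rewrite (dd_ext oU i Uu fE) (dd_mulmxl oU).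
Qed.

Lemma image_gm u : U u -> gm E' f u = t ^+ 2 *: g u.
by move=> Uu; rewrite !gmE jf// LEm// Jc. Qed.

Lemma image_gm_unit u : U u -> gm E' f u \in unitmx.
by move=> Uu; rewrite image_gm// unitmxZ ?gU// unitfE expf_neq0. Qed.

Let gU' := image_gm_unit.

Let hf_cf k u : U u -> (hes0 E' f k u) = hes k u *m L /\ (cov0 E' f k u) = cov k u.
move=> Uu; apply: (hes_unique gU' Uu).
  rewrite (dd_ext oU k Uu jf) (dd_mulmxl oU)// (dd_jac E Y k u) mulmxDl jf// !mulmxA.
  by [].
by rewrite jf// LEm// ?hc ?Jc// (hes_jac gU)// scaler0.
Qed.

Lemma image_hes k u : U u -> (hes0 E' f k u) = hes k u *m L. by case/(hf_cf k). Qed.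
Lemma image_cov k u : U u -> (cov0 E' f k u) = cov k u. by case/(hf_cf k). Qed.

Let gi' u : U u -> invmx (gm E' f u) = t ^- 2 *: gi u.
by move=> Uu; rewrite image_gm// invmxZ// unitmxZ ?gU// unitfE expf_neq0. Qed.

Lemma image_lap u : U u -> lap0 E' f u = t ^- 2 *: (lap u *m L).
move=> Uu; rewrite !lapE gi'// (eq_contract _ (fun k => image_hes k Uu)) contractZ.
by rewrite contract_mulmxr.
Qed.

Let Yz u : U u -> Y u *m E *m (z u)^T = 1%:M.
move=> Uu; rewrite zE [(_ - _)^T]linearB /= [(_ *: _)^T]linearZ /= mulmxBr -scalemxAr Ynull//.
by rewrite scaler0 subr0 cY.
Qed.

Lemma image_curv u : U u -> sf_curv Q * (sf_curv Q * sf_form Q (f u) (f u)) = sf_curv Q.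
move=> Uu; have [->|qn0] := eqVneq (sf_curv Q) 0; first by rewrite !mul0r.
have gn0 : gamma != 0 by rewrite -[gamma]opprK -Qt oppr_eq0 mulf_neq0// expf_neq0.
have H : sf_form Q (z u *m L) (z u *m L) = t ^+ 2 * lorentz (z u) (z u).
  by apply: LE; exact: zc.
move: H; rewrite zL// (bformZl QE) (bformZr E'_sym QE).
have -> : lorentz (z u) (z u) = - gamma.
  have c0 := zc Uu; have y0 := Yz Uu.
  rewrite lE {2}zE [(_ - _)^T]linearB /= [(_ *: _)^T]linearZ /= mulmxBr -scalemxAr c0.
  have -> : z u *m E *m (Y u)^T = 1%:M by rewrite -mink_tr y0 trmx1.
  by rewrite sub0r !mxE mulr1.
move: (sf_form _ _ _) (sf_curv Q) Qt gn0 qn0 tn0 => F q; move: (gamma) => G qt gn0 qn0 tn0' H.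
have FE : G * F = - t ^+ 2.
  apply: (mulfI (x := - G)); first by rewrite oppr_eq0.
  have -> : - G * (G * F) = - (- G * (- G * F)) by ring.
  by rewrite H; ring.
have -> : q * (q * F) = q * (- (q * t ^+ 2) * F) / - t ^+ 2.
  by field.
by rewrite qt opprK FE; field.
Qed.
Let cff := image_curv.

Lemma image_sff i j u : U u -> sff Q f i j u = (row j (hes i u) + g u i j *: z u) *m L.
move=> Uu; rewrite (sffE E'_sym QE oU sf gU' cff i j Uu) image_hes// row_mul mulmxDl -scalemxAl zL//.
congr (_ + _); rewrite image_gm// mxE scalerA; congr (_ *: _).
by rewrite mulrA Qt mulrC.
Qed.

Let X := locked_with dd_key (fun u => m%:R^-1 *: lap u + z u).
Let XE : X = fun u => m%:R^-1 *: lap u + z u. exact: unlock. Qed.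

Lemma image_mean u : U u -> mean_curvature Q f u = t ^- 2 *: (X u *m L).
move=> Uu; rewrite (mean_curvatureE E'_sym QE oU sf gU' cff m_gt0 Uu) image_lap//.
rewrite XE mulmxDl zL// scalerDr -scalemxAl !scalerA [m%:R^-1 * _]mulrC; congr (_ + _ *: _).
by rewrite -Qt mulrC mulfK// expf_neq0.
Qed.

Let Xc u : U u -> X u *m E *m c^T = 0.
by move=> Uu; rewrite XE !mulmxDl -!scalemxAl lc// zc// scaler0 addr0. Qed.

Let beta u := \tr (S u) / m%:R + gamma.

Let hz u i : U u -> hes i u *m E *m (z u)^T = gamma *: col i (g u).
move=> Uu; rewrite zE [(_ - _)^T]linearB /= [(_ *: _)^T]linearZ /= mulmxBr -scalemxAr hc//.
by rewrite (hes_position oU sY Ynull)// scalerN opprK add0r.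
Qed.

Let zz u : U u -> z u *m E *m (z u)^T = (- gamma)%:M.
move=> Uu; have c0 := zc Uu; have y0 := Yz Uu.
rewrite {2}zE [(_ - _)^T]linearB /= [(_ *: _)^T]linearZ /= mulmxBr -scalemxAr c0.
have -> : z u *m E *m (Y u)^T = 1%:M by rewrite -mink_tr y0 trmx1.
by rewrite sub0r scale_scalar_mx mulr1 raddfN.
Qed.

Let lz u : U u -> lap u *m E *m (z u)^T = (m%:R * gamma)%:M.
move=> Uu; rewrite zE [(_ - _)^T]linearB /= [(_ *: _)^T]linearZ /= mulmxBr -scalemxAr lc//.
by rewrite (lap_position oU sY gU Ynull)// scalerN opprK add0r scale_scalar_mx mulrC.
Qed.

Let hl u i : U u -> hes i u *m E *m (lap u)^T = m%:R *: col i (A u) + \tr (S u) *: col i (g u).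
move=> Uu; rewrite (lap_conj_pos oU sY m_gt0 gU Ynull Uu).
rewrite [(_ - _)^T]linearB /= [(- _)^T]linearN /= ![(_ *: _)^T]linearZ /= mulmxBr mulmxN -!scalemxAr.
rewrite (hes_position oU sY Ynull)// scalerN opprK; congr (_ + _).
rewrite -[hes i u *m E *m _]mink_tr -scalerN; congr (_ *: _).
rewrite -[N u *m _ *m _]opprK -(btensor_row oU sY gU Ynull i Uu) linearN opprK.
by rewrite /= tr_row (btensor_sym oU sY gU Ynull Uu).
Qed.

(** Pairing with the mean curvature vector turns the second fundamental form into the Blaschke
    tensor plus a constant multiple of the metric, because the Laplacian is a combination of [N] and
    [Y]. Pseudo-parallelism and the three principal curvatures both follow from this. *)
Lemma image_sff_along u : U u ->
  sff_along Q f (mean_curvature Q f u) u = A u + beta u *: g u.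
move=> Uu; apply/matrixP => i j; rewrite mxE image_sff// image_mean//.
rewrite (bformZr E'_sym QE) LE; last exact: Xc.
  rewrite mulKf ?expf_neq0// lE XE [(_ + _)^T]linearD /= [(_ *: _)^T]linearZ /= !mulmxDl !mulmxDr.
  rewrite -!scalemxAl -!scalemxAr -!row_mul hz// zz// hl//.
  have -> : z u *m E *m (lap u)^T = (m%:R * gamma)%:M by rewrite -mink_tr lz// tr_scalar_mx.
  have gs : g u j i = g u i j by rewrite -{1}(gm_sym E_sym Y u) mxE.
  have As : A u j i = A u i j by rewrite -{1}(btensor_sym oU sY gU Ynull Uu) mxE.
  rewrite !mxE gs As !mulr1n /beta.
  move: (A u i j) (g u i j) (\tr (S u)) (gamma) => a b d e; field; by [].
rewrite !mulmxDl -!row_mul -!scalemxAl hc// zc// row0 scaler0 addr0//.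
Qed.

Let Xsq u : U u -> X u *m E *m (X u)^T = (2 * \tr (S u) / m%:R + gamma)%:M.
move=> Uu; rewrite {2}XE [(_ + _)^T]linearD /= [(_ *: _)^T]linearZ /= mulmxDr -scalemxAr XE !mulmxDl -!scalemxAl.
rewrite zz// lz//.
have -> : z u *m E *m (lap u)^T = (m%:R * gamma)%:M by rewrite -mink_tr lz// tr_scalar_mx.
have -> : lap u *m E *m (lap u)^T = (2 * m%:R * \tr (S u))%:M.
  have H : lap u *m E *m (lap u)^T = - (m%:R *: (N u *m E *m (lap u)^T)) - \tr (S u) *: (Y u *m E *m (lap u)^T).
    by rewrite {1}(lap_conj_pos oU sY m_gt0 gU Ynull Uu) !mulmxBl !mulNmx -!scalemxAl.
  rewrite H.
  have -> : Y u *m E *m (lap u)^T = - (m%:R)%:M.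
    by rewrite -mink_tr (lap_position oU sY gU Ynull Uu) linearN /= tr_scalar_mx.
  have -> : N u *m E *m (lap u)^T = (- \tr (S u))%:M.
    rewrite (lap_conj_pos oU sY m_gt0 gU Ynull Uu) [(_ - _)^T]linearB /= [(- _)^T]linearN /= ![(_ *: _)^T]linearZ /=.
    rewrite mulmxBr mulmxN -!scalemxAr (conj_pos_null oU sY m_gt0 gU Ynull Uu).
    by rewrite (conj_pos_position oU sY m_gt0 gU Ynull Uu) scaler0 oppr0 sub0r scale_scalar_mx mulr1 raddfN.
  rewrite scalerN opprK !scale_scalar_mx -raddfN -raddfD /=; congr (_%:M); ring.
rewrite !scale_scalar_mx -!raddfD /= ?scale_scalar_mx -?raddfD /=; congr (_%:M).
by move: (\tr (S u)) (gamma) => a b; field.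
Qed.

Let XJ u : U u -> X u *m E *m (J u)^T = 0.
move=> Uu; rewrite XE zE !mulmxDl !mulNmx -!scalemxAl (lap_jac gU)//.
have -> : c *m E *m (J u)^T = 0 by exact: mink_tr0 (Jc Uu).
by rewrite (mink_tr0 (J_pos oU sY Ynull Uu)) !scaler0 oppr0 !addr0.
Qed.

Let XY u : U u -> X u *m E *m (Y u)^T = 0.
move=> Uu; rewrite XE !mulmxDl -!scalemxAl (lap_position oU sY gU Ynull Uu).
have -> : z u *m E *m (Y u)^T = 1%:M by rewrite -mink_tr Yz// trmx1.
by rewrite scalerN scale_scalar_mx mulVf// addNr.
Qed.

Let Snotscalar u a : U u -> S u = a%:M -> False.
move=> Uu Sa; have [s us sE] := S3 Uu.
have sa i : i \in s -> i = a.
  rewrite -sE Sa => /eigenvalueP[v]; rewrite mul_mx_scalar => /eqP.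
  rewrite -subr_eq0 -scalerBl scaler_eq0 => /orP[|/eqP -> /eqP//].
  by rewrite subr_eq0 => /eqP ->.
have s0 := sa _ (mem_tnth 0 s); have s1 := sa _ (mem_tnth 1 s).
by have /tuple_uniqP/(_ 0 1) := us; rewrite s0 s1 => /(_ erefl).
Qed.

(** Being orthogonal to the null vector [Y], [X] is spacelike or a multiple of [Y]; in the latter
    case orthogonality to [c] gives [X = 0], and then [image_sff_along] makes the Blaschke tensor a
    multiple of the metric, against three eigenvalues. *)
Lemma image_mean_pos u : U u -> 0 < lorentz (X u) (X u).
move=> Uu; have y0 := Ypos Uu.
have nY : lorentz (Y u) (Y u) = 0 by rewrite lE Ynull// mxE.
have nX : lorentz (X u) (Y u) = 0 by rewrite lE XY// mxE.
rewrite lt_neqAle (null_orth_ge0 nY nX y0) andbT eq_sym; apply/eqP => X0.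
have XeY := null_orth_eq0 nY nX y0 X0.
have Xz : X u = 0.
  have := Xc Uu; rewrite XeY -!scalemxAl cY// => /matrixP/(_ 0 0); rewrite [LHS]mxE [X in _ * X]mxE [RHS]mxE mulr1 => H.
  by rewrite H scale0r.
have := image_sff_along Uu; rewrite image_mean// Xz mul0mx scaler0 => H.
apply: (Snotscalar (a := - beta u) Uu); rewrite bshapeE.
have -> : A u = - (beta u *: g u).
  apply/eqP; rewrite -addr_eq0 -H; apply/eqP/matrixP => i j.
  by rewrite !mxE QE trmx0 mulmx0 mxE.
by rewrite mulNmx -scalemxAl mulmxV ?gU// scalemx1 raddfN.
Qed.

Let bH u : U u -> sf_form Q (mean_curvature Q f u) (mean_curvature Q f u) = t ^- 2 * lorentz (X u) (X u).
move=> Uu; rewrite image_mean// (bformZl QE) (bformZr E'_sym QE) LE ?Xc//.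
by rewrite mulKf// expf_neq0.
Qed.

Lemma image_row_free u : U u -> row_free (\matrix_(i < m) pd i f u).
move=> Uu; have -> : \matrix_(i < m) pd i f u = jac f u by rewrite jacE ddE.
apply: inj_row_free => v vJ; rewrite -[v](mulmxK (gU' Uu)) gmE !mulmxA vJ !mul0mx //.
Qed.

Lemma image_not_minimal u : U u -> mean_curvature Q f u <> 0.
move=> Uu H0; have := bH Uu; rewrite H0 (bform0l QE) => /esym/eqP.
by rewrite mulf_eq0 invr_eq0 expf_eq0 (negPf tn0) andbF /= gt_eqF// image_mean_pos.
Qed.

(** At an umbilic point the image of the traceless Hessian would vanish, and with it the norm that
    equals (m-1)/m. *)
Lemma image_umbilic_free u : U u -> exists i j,
  sff Q f i j u <> induced_metric (sf_form Q) f u i j *: mean_curvature Q f u.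
move=> Uu; apply: contrapT => H; have H' i j : row j (tless E Y u i) *m L = 0.
  have /eqP : sff Q f i j u = induced_metric (sf_form Q) f u i j *: mean_curvature Q f u.
    by apply: contrapT => H2; apply: H; exists i, j.
  rewrite image_sff// (induced_metricE QE) image_gm// image_mean// mxE scalerA mulrAC mulfV ?expf_neq0// mul1r.
  rewrite -subr_eq0 scalemxAl -mulmxBl => /eqP <-; congr (_ *m _).
  rewrite tlessE raddfB /= linearZ /= row_mul XE scalerDr opprD addrACA subrr addr0; congr (_ - _).
  have -> : row j (col i (g u)) = (g u i j)%:M.
    by apply: mx11_eq; rewrite -[in RHS](gm_sym E_sym Y u) !mxE mulr1n.
  by rewrite mul_scalar_mx !scalerA mulrC.
have tL i : tless E Y u i *m L = 0 by apply/row_matrixP => j; rewrite row_mul H' row0.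
have tc i : tless E Y u i *m E *m c^T = 0.
  by rewrite tlessE !mulmxBl -!scalemxAl hc// -!mulmxA (mulmxA (lap u)) lc// mulmx0 scaler0 subrr.
have : tless_sqnorm E Y u = 0.
  rewrite /tless_sqnorm big1// => i _; rewrite big1// => k _.
  have := LEm (tc k) (tc i); rewrite !tL !mul0mx => /esym/eqP.
  by rewrite scaler_eq0 expf_eq0 (negPf tn0) andbF /= => /eqP ->; rewrite mul0mx mxtrace0 mulr0.
rewrite Ytless// => /eqP; rewrite mulf_eq0 invr_eq0 (negPf mn0) orbF subr_eq0 -[1]/(1%:R) eqr_nat.
by move=> /eqP m1; move: m_gt1; rewrite m1.
Qed.

Let sA := sm_btensor oU sY gU.
Let sS := sm_shape oU sY gU.
Let aS := adm_shape oU sY gU Ynull form0 A_parallel.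

Lemma image_pseudo_parallel k i j u : U u -> cov_deriv (induced_metric (sf_form Q) f)
  (fun v => sff_along Q f (mean_curvature Q f v) v) k i j u = 0.
move=> Uu; have sb : Coo U beta.
  apply: smoothD => //; last exact: sm_cst.
  apply: smoothM => //; last exact: sm_cst.
  exact: (sm_trace oU sS).
have db : dd k beta u = 0.
  rewrite (ddD _ Uu); [|apply: smoothM => //|exact: sm_cst]; last exact: sm_cst.
    rewrite (ddM _ Uu); [|exact: (sm_trace oU sS)|exact: sm_cst].
    by rewrite (dd_trace_adm oU k aS Uu) !dd_cst mul0r mulr0 !addr0.
  exact: (sm_trace oU sS).
have sP : Coo U (fun v => A v + beta v *: g v) by smo.
rewrite (cov_derivE E'_sym QE oU sf gU' k i j Uu); last first.
  by apply: (sm_ext oU _ sP) => v Uv; rewrite image_sff_along.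
rewrite (dd_ext oU k Uu image_sff_along) image_sff_along// image_cov//.
rewrite (ddD _ Uu); [|smo|smo].
rewrite (dd_scale oU)// db scale0r add0r A_parallel// (dd_gm E_sym oU sY gU k Uu).
rewrite mulmxDr mulmxDl -!scalemxAr -!scalemxAl scalerDr.
move: (cov k u *m A u) (A u *m _) (_ *: (cov k u *m _)) (_ *: (g u *m _)) => a1 a2 a3 a4.
by rewrite !mxE; ring.
Qed.

(** Up to scale the mean curvature vector is the image of [X], which equals $c-\gamma
    Y-N-(\mathrm{tr}(S)/m)Y$; the differential of this vector is tangential because that of [N]
    is. *)
Lemma image_parallel_mean k u : U u -> normal_proj Q f u (pd k (mean_curvature Q f) u) = 0.
move=> Uu; have sN := sm_conj_pos oU sY gU.
have sX : Coo U (fun v => t ^- 2 *: (X v *m L)).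
  by rewrite XE zE; smo.
have [r dH] : exists r : 'rV_m, pd k (mean_curvature Q f) u = r *m jac f u.
  rewrite -ddE (dd_ext oU k Uu image_mean) (dd_scalel oU)//; last by rewrite XE zE; smo.
  rewrite (dd_mulmxl oU)//; last by rewrite XE zE; smo.
  have -> : dd k X u = row k (- (S u + (\tr (S u) / m%:R + gamma)%:M) *m J u).
    have sx2 : Coo U (fun v => \tr (S v) / m%:R *: Y v).
      apply: sm_scale => //; apply: smoothM => //; first exact: (sm_trace oU sS).
      exact: sm_cst.
    rewrite (dd_ext oU k Uu (g := fun v => c - gamma *: Y v - N v - (\tr (S v) / m%:R) *: Y v)); last first.
      move=> v Uv; rewrite XE (lap_conj_pos oU sY m_gt0 gU Ynull Uv) scalerBr scalerN !scalerA mulVf// scale1r.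
      by rewrite zE [m%:R^-1 * _]mulrC addrC addrA.
    rewrite (ddB oU)//; [|smo].
    rewrite (ddB oU)//; [|smo].
    rewrite (ddB oU)//; [|smo|smo].
    rewrite dd_cst sub0r (dd_scalel oU)// (dd_scale oU)//; last first.
      by apply: smoothM => //; [exact: (sm_trace oU sS)|exact: sm_cst].
    rewrite (ddM _ Uu); [|exact: (sm_trace oU sS)|exact: sm_cst].
    rewrite (dd_trace_adm oU k aS Uu) dd_cst mul0r mulr0 addr0 scale0r add0r.
    rewrite -(row_jac N k u) form0// -(row_jac Y k u) mulNmx raddfN /= mulmxDl mul_scalar_mx ?raddfN /= ?raddfD /= [row k (_ *: J u)]linearZ /=.
    move: (row k (S u *m _)) (row k (J u)) => a1 a2; apply/rowP => j; rewrite !mxE; ring.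
  exists (t ^- 2 *: row k (- (S u + (\tr (S u) / m%:R + gamma)%:M))).
  by rewrite jf// row_mul -scalemxAl !mulmxA.
rewrite dH /normal_proj /space_proj (induced_metricE QE).
have -> : sf_curv Q * sf_form Q (r *m jac f u) (f u) = 0.
  rewrite QE -!mulmxA (mulmxA (jac f u)).
  have /matrixP/(_ 0 0) : r *m (sf_curv Q *: (jac f u *m E' *m (f u)^T)) = 0.
    by rewrite (curv_jac_pos E'_sym QE oU sf cff Uu) mulmx0.
  by rewrite -scalemxAr !mxE.
rewrite scale0r subr0; apply/eqP; rewrite subr_eq0; apply/eqP.
rewrite mulmx_sum_row exchange_big /=; eqbig l.
rewrite -scaler_suml row_jac ddE; congr (_ *: _).
transitivity ((r *m gm E' f u *m invmx (gm E' f u)) 0 l); first by rewrite mulmxK ?gU'.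
rewrite mxE; eqbig a; rewrite mulrC; congr (_ * _).
have -> : pd a f u = row a (jac f u) by rewrite row_jac ddE.
rewrite -mulmx_sum_row -[r *m jac f u](row_id 0) (form_rowE QE) gmE !mulmxA//.
Qed.

(** Gauss equation, with $|\Delta Y|^2=2m\,\mathrm{tr}(S)$; the squared norm of the Hessian exceeds
    that of its traceless part, (m-1)/m, by $|\Delta Y|^2/m$. *)
Lemma image_scalar_curvature u : U u -> scalar_curvature (induced_metric (sf_form Q) f) u =
  t ^- 2 * (2 * \tr (S u) * (m%:R - 1) - (m%:R - 1) / m%:R).
move=> Uu; rewrite (gauss_scalar E'_sym QE oU sf gU' Uu) image_lap//.
have ll : lorentz (lap u) (lap u) = 2 * m%:R * \tr (S u).
  rewrite (trace_shape oU sY m_gt0 gU Ynull Uu).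
  by move: (lorentz _ _) => a; field.
rewrite (bformZl QE) (bformZr E'_sym QE) LE ?lc// ll.
have -> : hes_sqnorm E' f u = t ^- 2 * hes_sqnorm E Y u.
  rewrite /hes_sqnorm mulr_sumr; eqbig i; rewrite mulr_sumr; eqbig k.
  rewrite gi'// !image_hes// LEm ?hc// mxE -scalemxAr -scalemxAl scalerA mxtraceZ.
  by rewrite mulVf ?expf_neq0// mul1r mulrA.
have := Ytless Uu; rewrite (tless_sqnormE E_sym (gU Uu) m_gt0) -lE ll => H.
have -> : hes_sqnorm E Y u = (m%:R - 1) / m%:R + m%:R^-1 * (2 * m%:R * \tr (S u)).
  by rewrite -H subrK.
by move: (\tr (S u)) => a; have := tn0; have := mn0; move: (m%:R : R) => b b0 t0; field; rewrite b0 t0.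
Qed.

Lemma image_three u : U u -> three_distinct_eigenvalues
  (endo (induced_metric (sf_form Q) f u) (sff_along Q f (unit_mean_curvature Q f u) u)).
move=> Uu; have Hp : 0 < sf_form Q (mean_curvature Q f u) (mean_curvature Q f u).
  by rewrite bH// mulr_gt0 ?image_mean_pos// invr_gt0 exprn_gt0.
set d := (Num.sqrt (sf_form Q (mean_curvature Q f u) (mean_curvature Q f u)))^-1.
have d0 : d != 0 by rewrite invr_eq0 gt_eqF// sqrtr_gt0.
have -> : sff_along Q f (unit_mean_curvature Q f u) u = d *: (A u + beta u *: g u).
  rewrite -image_sff_along//; apply/matrixP => i j; rewrite !mxE /unit_mean_curvature.
  by rewrite (bformZr E'_sym QE).
rewrite /endo (induced_metricE QE) gi'// -scalemxAr -scalemxAl mulmxDl -scalemxAl mulmxV ?gU// scalerA.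
have -> : A u *m gi u = S u by rewrite bshapeE.
set e := _ * d; have en0 : e != 0 by rewrite mulf_neq0// invr_eq0 expf_neq0.
have [s us sE] := S3 Uu; pose h a := e * (a + beta u).
have hI : injective h by move=> a b /(mulfI en0)/addIr.
exists (map_tuple h s); first by rewrite map_inj_uniq.
move=> a; have -> : a = h (e^-1 * a - beta u) by rewrite /h subrK mulVKf.
rewrite (mem_map hI) -sE; apply/eigenvalueP/eigenvalueP => -[v vS v0]; exists v => //.
  apply: (scalerI en0); rewrite -scalemxAr mulmxDr -scalemxAr mulmx1 in vS.
  rewrite scalerBl scalerBr scalerA mulVKf// -[LHS](addrK (e *: (beta u *: v))) -scalerDr vS.
  by rewrite /h !scalerA -!scalerBl; congr (_ *: _); field.
by rewrite -scalemxAr mulmxDr vS -scalemxAr mulmx1 -scalerDl scalerA.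
Qed.

End SpaceFormImage.

Lemma ord3_cases (a : 'I_3) : [\/ a = 0, a = 1 | a = 2].
by case: a => [[|[|[|//]]] Ha]; [constructor 1|constructor 2|constructor 3]; exact/val_inj.
Qed.

(** * Lorentz reflections and normal forms of vectors *)

Section Reflections.
Variables (R : realType) (n : nat).
Notation E := (mink R n).
Implicit Types (c d u v : 'rV[R]_(1 + n)) (T : 'M[R]_(1 + n)).

Lemma lorentzDl u v w : lorentz (u + v) w = lorentz u w + lorentz v w.
exact: (bformDl (@lorentzE R n)). Qed.
Lemma lorentzDr u v w : lorentz w (u + v) = lorentz w u + lorentz w v.
exact: (bformDr (mink_sym R n) (@lorentzE R n)). Qed.
Lemma lorentzZl a u v : lorentz (a *: u) v = a * lorentz u v.
exact: (bformZl (@lorentzE R n)). Qed.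
Lemma lorentzZr a u v : lorentz v (a *: u) = a * lorentz v u.
exact: (bformZr (mink_sym R n) (@lorentzE R n)). Qed.
Lemma lorentzBl u v w : lorentz (u - v) w = lorentz u w - lorentz v w.
exact: (bformBl (@lorentzE R n)). Qed.
Lemma lorentzBr u v w : lorentz w (u - v) = lorentz w u - lorentz w v.
exact: (bformBr (mink_sym R n) (@lorentzE R n)). Qed.
Lemma lorentzC u v : lorentz u v = lorentz v u.
exact: (bformC (mink_sym R n) (@lorentzE R n)). Qed.

Lemma lorentz_transformation1 : lorentz_transformation (1%:M : 'M[R]_(1 + n)).
by split=> [u v|u _]; rewrite !mulmx1. Qed.

Lemma lorentz_transformationM T T' : lorentz_transformation T ->
  lorentz_transformation T' -> lorentz_transformation (T *m T').
move=> [T1 T2] [T3 T4]; split=> [u v|u u0 up]; rewrite !mulmxA; first by rewrite T3 T1.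
by apply: T4; [rewrite T1|exact: T2].
Qed.

Definition reflection d : 'M[R]_(1 + n) := 1%:M - (2 / lorentz d d) *: (E *m d^T *m d).

Lemma reflectionE d u : u *m reflection d = u - (2 * lorentz u d / lorentz d d) *: d.
rewrite mulmxBr mulmx1 -scalemxAr !mulmxA; congr (_ - _).
have -> : u *m E *m d^T = (lorentz u d)%:M by apply: mx11_eq; rewrite -lorentzE mxE mulr1n.
by rewrite mul_scalar_mx scalerA; congr (_ *: _); rewrite mulrAC.
Qed.

(** For the time orientation: multiplied by $u_0\langle d,d\rangle$, the time coordinate of the
    image of a null vector [u] is a squared Euclidean norm. It vanishes only if [d] is a multiple of
    [u], which a spacelike [d] is not. *)
Lemma reflection_lorentz d : 0 < lorentz d d -> lorentz_transformation (reflection d).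
move=> d0; have dn0 : lorentz d d != 0 by rewrite gt_eqF.
split=> [u v|u u0 up]; rewrite !reflectionE.
  rewrite !lorentzBl !lorentzBr !lorentzZl !lorentzZr (lorentzC d v).
  by move: (lorentz u v) (lorentz u d) (lorentz v d) (lorentz d d) dn0 => a b e f f0; field.
rewrite -(pmulr_rgt0 _ d0) -(pmulr_rgt0 _ up) !mxE.
have dq := dot_comb (u 0 0) (d 0 0) (rsubmx d) (rsubmx u).
have -> : u 0 0 * (lorentz d d * (u 0 0 - 2 * lorentz u d / lorentz d d * d 0 0)) =
    dot (u 0 0 *: rsubmx d - d 0 0 *: rsubmx u) (u 0 0 *: rsubmx d - d 0 0 *: rsubmx u).
  have -> : lorentz d d * (u 0 0 - 2 * lorentz u d / lorentz d d * d 0 0) =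
      lorentz d d * u 0 0 - 2 * lorentz u d * d 0 0.
    by move: (lorentz d d) (lorentz u d) dn0 => a b a0; field.
  rewrite dq; move: u0; rewrite !lorentz_split (dotC (rsubmx d) (rsubmx u)).
  move: (dot _ _) (dot _ _) (dot _ _) (u 0 0) (d 0 0) => a b e f h /eqP.
  by rewrite addrC subr_eq0 => /eqP ->; ring.
rewrite lt_neqAle dot_ge0 andbT eq_sym; apply/eqP => /dot_eq0/eqP.
rewrite subr_eq0 => /eqP H; have un0 : u 0 0 != 0 by rewrite gt_eqF.
have dE : d = (d 0 0 / u 0 0) *: u.
  apply: rowS_eq; first by rewrite mxE divfK.
  by rewrite linearZ /= mulrC -scalerA -H scalerA mulVf// scale1r.
by move: d0; rewrite dE lorentzZl lorentzC lorentzZl u0 !mulr0 ltxx.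
Qed.

Lemma reflection_swap c c' : lorentz c' c' = lorentz c c ->
  lorentz (c - c') (c - c') != 0 -> c *m reflection (c - c') = c'.
move=> cc H; rewrite reflectionE.
have -> : 2 * lorentz c (c - c') = lorentz (c - c') (c - c').
  rewrite !lorentzBl !lorentzBr (lorentzC c' c) cc.
  by ring.
by rewrite mulfV// scale1r opprB addrC subrK.
Qed.

(* Pairing with a vector of a future light ray determines the time orientation. *)
Lemma nonspacelike_past c y : lorentz y y = 0 -> 0 < y 0 0 -> lorentz y c = 1 ->
  lorentz c c <= 0 -> c 0 0 < 0.
move=> y0 yp yc cc; have dq := dot_comb (c 0 0) (y 0 0) (rsubmx y) (rsubmx c).
have q0 := dot_ge0 (c 0 0 *: rsubmx y - y 0 0 *: rsubmx c).
rewrite le_eqVlt in cc; have c2 : 2 * c 0 0 <= y 0 0 * lorentz c c.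
  rewrite -(ler_pM2l yp); move: dq q0 y0 yc; rewrite !lorentz_split; move: (dot (_ - _) _).
  move: (dot _ _) (dot _ _) (dot _ _) (c 0 0) (y 0 0) => a b e f h w -> q h1 h2.
  have ea : e = h * h by lra.
  have eb : b = 1 + h * f by lra.
  by move: q; rewrite ea eb; nra.
case/orP: cc => [/eqP c0|cn]; last first.
  have := mulr_gt0 yp (_ : 0 < - lorentz c c); rewrite oppr_gt0 => /(_ cn); lra.
have := c2; rewrite c0 mulr0 => c3; rewrite lt_neqAle; apply/andP; split; last by lra.
apply/eqP => c00; move: c0; rewrite lorentz_split c00 mul0r oppr0 add0r => /dot_eq0 r0.
have cz : c = 0 by apply: rowS_eq; rewrite ?c00 ?r0 ?mxE// linear0.
by move: yc; rewrite cz (bform0r (mink_sym R n) (@lorentzE R n)) => /esym/eqP; rewrite oner_eq0.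
Qed.

(** The difference of [c] and its normal form has square $-2t(t+c_0)$, which is positive for past
    [c] unless [c] is already normal, so one reflection does. *)
Lemma normal_timelike c : lorentz c c < 0 -> c 0 0 < 0 ->
  exists2 T, lorentz_transformation T &
    c *m T = row_mx (- Num.sqrt (- lorentz c c))%:M 0.
move=> cc c0; set t := Num.sqrt _; have t0 : 0 < t by rewrite sqrtr_gt0 oppr_gt0.
have t2 : t ^+ 2 = - lorentz c c by rewrite sqr_sqrtr// oppr_ge0 ltW.
set c' := row_mx _ _; have c'0 : c' 0 0 = - t.
  have -> : (0 : 'I_(1 + n)) = lshift n 0 by exact/val_inj.
  by rewrite row_mxEl mxE mulr1n.
have c'r : rsubmx c' = 0 by rewrite row_mxKr.
have cc' : lorentz c' c' = lorentz c c.
  rewrite lorentz_split c'0 c'r dotE mul0mx mul0mx mxE addr0 mulrNN -expr2 t2 opprK//.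
have H : lorentz (c - c') (c - c') = - (2 * t) * (t + c 0 0).
  rewrite !lorentzBl !lorentzBr (lorentzC c' c) cc'.
  rewrite [lorentz c c']lorentz_split c'0 c'r dotE trmx0 mulmx0 mxE addr0.
  have -> : lorentz c c = - t ^+ 2 by rewrite t2 opprK.
  by ring.
have cs : c 0 0 ^+ 2 = t ^+ 2 + dot (rsubmx c) (rsubmx c).
  by rewrite t2 lorentz_split; ring.
have [r0|rn0] := eqVneq (rsubmx c) 0.
  exists 1%:M; first exact: lorentz_transformation1.
  rewrite mulmx1; apply: rowS_eq; last by rewrite r0 c'r.
  rewrite c'0; move: cs; rewrite r0 dotE mul0mx mul0mx mxE addr0 => cs.
  by apply: oppr_inj; rewrite opprK; apply: sqr_inj_pos; rewrite ?oppr_gt0// sqrrN.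
have ct : t < - c 0 0.
  have r0 : 0 < dot (rsubmx c) (rsubmx c).
    by rewrite lt_neqAle dot_ge0 andbT eq_sym; apply: contraNneq rn0 => /dot_eq0 ->.
  by nra.
have Hp : 0 < lorentz (c - c') (c - c') by rewrite H; nra.
exists (reflection (c - c')); first exact: reflection_lorentz.
by apply: reflection_swap => //; rewrite gt_eqF.
Qed.

End Reflections.

Section NormalForms.
Variables (R : realType) (n : nat).
Implicit Types (c : 'rV[R]_(1 + (1 + n))) (T : 'M[R]_(1 + (1 + n))).

Lemma row_mx3_coord (a b : R) (w : 'rV[R]_n) (v := row_mx a%:M (row_mx b%:M w) : 'rV_(1 + (1 + n))) :
  [/\ v 0 0 = a, rsubmx v 0 0 = b & rsubmx (rsubmx v) = w].
split; last by rewrite !row_mxKr.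
  have -> : (0 : 'I_(1 + (1 + n))) = lshift (1 + n) 0 by exact/val_inj.
  by rewrite row_mxEl mxE mulr1n.
rewrite row_mxKr; have -> : (0 : 'I_(1 + n)) = lshift n 0 by exact/val_inj.
by rewrite row_mxEl mxE mulr1n.
Qed.

Lemma dot_split (u v : 'rV[R]_(1 + n)) :
  dot u v = u 0 0 * v 0 0 + dot (rsubmx u) (rsubmx v).
rewrite /dot big_ord_recl; congr (_ + _); eqbig i.
by rewrite !mxE; congr (u 0 _ * v 0 _); exact/val_inj.
Qed.

Lemma normal_null c : lorentz c c = 0 -> exists2 T, lorentz_transformation T &
  c *m T = row_mx (c 0 0)%:M (row_mx (- c 0 0)%:M 0).
move=> cc; set c' := row_mx _ _; have [c'0 c'1 c'2] := row_mx3_coord (c 0 0) (- c 0 0) (0 : 'rV_n).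
have cc' : lorentz c' c' = lorentz c c.
  rewrite cc lorentz_split dot_split c'0 c'1 c'2 [dot 0 _]dotE mul0mx mul0mx mxE.
  by ring.
have H : lorentz (c - c') (c - c') = dot (rsubmx (c - c')) (rsubmx (c - c')).
  by rewrite lorentz_split mxE [(- c') 0 0]mxE c'0 subrr mul0r oppr0 add0r.
have [e|e] := eqVneq (rsubmx (c - c')) 0.
  exists 1%:M; first exact: lorentz_transformation1.
  rewrite mulmx1; apply: rowS_eq; first by rewrite c'0.
  by move/eqP: e; rewrite raddfB subr_eq0 => /eqP.
have Hp : 0 < lorentz (c - c') (c - c').
  by rewrite H lt_neqAle dot_ge0 andbT eq_sym; apply: contraNneq e => /dot_eq0 ->.
exists (reflection (c - c')); first exact: reflection_lorentz.
by apply: reflection_swap => //; rewrite gt_eqF.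
Qed.

Lemma normal_spacelike c : 0 < lorentz c c -> exists2 T, lorentz_transformation T &
  c *m T = row_mx 0 (row_mx (Num.sqrt (lorentz c c))%:M 0).
move=> cc; set t := Num.sqrt _; have t0 : 0 < t by rewrite sqrtr_gt0.
have t2 : t ^+ 2 = lorentz c c by rewrite sqr_sqrtr// ltW.
have [c'0 c'1 c'2] := row_mx3_coord 0 t (0 : 'rV_n).
rewrite (_ : (0 : 'M[R]_1) = 0%:M); last by rewrite raddf0.
set c' : 'rV_(1 + (1 + n)) := row_mx _ _ in c'0 c'1 c'2 *.
have cl (v : 'rV_(1 + (1 + n))) : lorentz v c' = rsubmx v 0 0 * t.
  have d0 : dot (rsubmx (rsubmx v)) (0 : 'rV_n) = 0 by rewrite dotE trmx0 mulmx0 mxE.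
  by rewrite lorentz_split dot_split c'0 c'1 c'2 d0 mulr0 oppr0 add0r addr0.
have cc' : lorentz c' c' = lorentz c c by rewrite cl c'1 -expr2.
have [h|h] := ltP (rsubmx c 0 0) t.
  have Hp : 0 < lorentz (c - c') (c - c').
    by rewrite lorentzBl !lorentzBr (lorentzC c' c) cc' cl -t2; nra.
  exists (reflection (c - c')); first exact: reflection_lorentz.
  by apply: reflection_swap => //; rewrite gt_eqF.
(* Here the difference with [c'] need not be spacelike, but the sum is: [c] is reflected to the
   opposite of [c'], which the reflection in [c'] itself then reverses. *)
have N1 : lorentz (-1 *: c') (-1 *: c') = lorentz c c by rewrite lorentzZl lorentzZr cc' !mulN1r opprK.
have Hp : 0 < lorentz (c - -1 *: c') (c - -1 *: c').
  rewrite lorentzBl !lorentzBr [lorentz (-1 *: c') c]lorentzC N1 lorentzZr cl -t2.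
  have : 0 <= (rsubmx c 0 0 - t) * t by rewrite mulr_ge0 ?subr_ge0// ltW.
  by have := mulr_gt0 t0 t0; nra.
have Hc : 0 < lorentz c' c' by rewrite cc'.
exists (reflection (c - -1 *: c') *m reflection c').
  by apply: lorentz_transformationM; exact: reflection_lorentz.
have Hn : lorentz (c - -1 *: c') (c - -1 *: c') != 0 by rewrite gt_eqF.
rewrite mulmxA (reflection_swap N1 Hn) reflectionE lorentzZl mulN1r mulrN mulNr mulfK ?gt_eqF// -scalerBl.
by rewrite (_ : -1 - - 2 = 1) ?scale1r//; ring.
Qed.

End NormalForms.

(** * The inverse function theorem with smooth inverse *)

Section InverseFunction.
Variables (R : realType) (m : nat).

Definition rV_complete : completeNormedModType R :=
  HB.pack 'rV[R]_m (Complete.on 'rV[R]_m).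

Lemma norm_mulmx_le n (v : 'rV[R]_m) (X : 'M[R]_(m, n)) :
  `|v *m X| <= (\sum_j `|row j X|) * `|v|.
rewrite mulmx_sum_row (le_trans (ler_norm_sum _ _ _))// mulr_suml ler_sum// => j _.
by rewrite normrZ mulrC ler_wpM2l// mx_norm_ge.
Qed.

Lemma mulmx_continuous n (X : 'M[R]_(m, n)) : continuous (fun v : 'rV[R]_m => v *m X).
move=> v; apply: (@sm_cont _ _ setT) => //.
have oT : open [set: 'rV[R]_m] by exact: openT.
have sid := @sm_id R m setT.
by have := sm_mulmx oT (sid oT) (sm_cst oT X).
Qed.

Lemma gradient_jac n (F : 'rV[R]_m -> 'rV[R]_n) u h : gradient F u h = h *m jac F u.
by rewrite /gradient mulmx_sum_row; eqbig j; rewrite row_jac ddE. Qed.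

Variables (U : set 'rV[R]_m) (f : 'rV[R]_m -> 'rV[R]_m) (u0 : 'rV[R]_m).
Hypotheses (oU : open U) (Uu0 : U u0) (sf : Coo U f).
Hypothesis fU : jac f u0 \in unitmx.

Let A := jac f u0.
Let h u := f u *m invmx A.

Let jac_unit_ball : exists2 d, 0 < d & ball u0 d `<=` U /\ forall u, ball u0 d u -> jac f u \in unitmx.
have sD : Coo U (fun u => \det (jac f u)) by apply: sm_det => //; exact: sm_jac.
have cD := sm_cont sD Uu0.
have dn0 : \det (jac f u0) != 0 by move: fU; rewrite unitmxE unitfE.
have N1 : \forall u \near u0, \det (jac f u) != 0.
  by apply: (cD [set y : R | y != 0]); apply: open_nbhs_nbhs; split=> //; exact: open_neq.
have N2 : nbhs u0 U by exact: open_nbhs_nbhs.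
have /nbhs_ballP[d /= d0 dP] : \forall u \near u0, U u /\ jac f u \in unitmx.
  by apply: filterS2 N1 N2 => u D Uu; split; rewrite // unitmxE unitfE.
by exists d => //; split=> u /dP[].
Qed.

Theorem inverse_function : exists (V : set 'rV[R]_m) (e : R) (psi : 'rV[R]_m -> 'rV[R]_m),
  [/\ open V, V u0, V `<=` U & 0 < e] /\
  [/\ forall w, ball (f u0) e w -> V (psi w) /\ f (psi w) = w,
      forall u, V u -> ball (f u0) e (f u) /\ psi (f u) = u,
      forall u, V u -> jac f u \in unitmx & Coo (ball (f u0) e) psi].
have [d1 d10 [B1 B2]] := jac_unit_ball.
have oB : open (ball u0 d1) by exact: ball_open.
have sfB : Coo (ball u0 d1) f by exact: sm_sub sf.
have shB : Coo (ball u0 d1) h by rewrite /h; smo.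
have AU : A \in unitmx by [].
have jh : jac h u0 = 1%:M.
  rewrite -(mulmxV AU); apply/row_matrixP => i; rewrite row_mul !row_jac.
  by rewrite (dd_mulmxl oB)//; exact: ballxx.
have h2 : 0 < 2^-1 :> R by rewrite invr_gt0.
have [d d0 [dB dP]] := C1_strict_mx oB (ballxx u0 d10) shB h2.
have {}dP x y : ball u0 d x -> ball u0 d y -> `|h y - h x - (y - x)| <= 2^-1 * `|y - x|.
  by move=> Bx By; have := dP x y Bx By; rewrite gradient_jac jh mulmx1.
have inj x y : ball u0 d x -> ball u0 d y -> `|y - x| <= 2 * `|h y - h x|.
  move=> Bx By; have := dP x y Bx By; have := ler_normB (h y - h x) (h y - h x - (y - x)).
  by rewrite opprB addrC subrK; lra.
pose r := d / 2; have r0 : 0 < r by rewrite divr_gt0.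
have [e e0 eP] : exists2 e, 0 < e & forall w, ball (f u0) e w -> `|w *m invmx A - h u0| <= r / 2.
  have r2 : 0 < r / 2 by rewrite divr_gt0.
  have /nbhs_ballP[e /= e0 eP] := @mulmx_continuous _ (invmx A) (f u0) _ (nbhsx_ballx (f u0 *m invmx A) _ r2).
  by exists e => // w /eP; rewrite -ball_normE /= distrC => /ltW.
pose K := [set u : 'rV[R]_m | `|u - u0| <= r].
have KB u : K u -> ball u0 d u.
  by rewrite /K /= -ball_normE /= distrC => /le_lt_trans; apply; rewrite /r; lra.
have Kc : closed K.
  rewrite (_ : K = closed_ball u0 r); first exact: closed_ball_closed.
  by rewrite closed_ballE//; apply/seteqP; split=> u; rewrite /K /closed_ball_ /= distrC.
have fix_ w : ball (f u0) e w -> exists2 u, K u & f u = w.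
  (* The fixed points of [T] are the solutions of [f u = w]. The map [h] has derivative 1 at [u0],
     so [T] contracts by the factor 1/2 of the strict estimate. *)
  move=> Bw; pose T u := u - h u + w *m invmx A.
  have TK : {homo T : u / K u >-> K u}.
    move=> u Ku; have := dP u0 u (ballxx u0 d0) (KB u Ku); have := eP w Bw.
    have := ler_normB (w *m invmx A - h u0) (h u - h u0 - (u - u0)); rewrite /K /= in Ku *.
    have -> : w *m invmx A - h u0 - (h u - h u0 - (u - u0)) = T u - u0.
      by rewrite /T; move: (w *m _) (h u) (h u0) => a b c; apply/matrixP => i j; rewrite !mxE; ring.
    by lra.
  have ctr : is_contraction (mkfun_fun TK).
    exists (2^-1)%:nng; split=> /=; first by lra.
    move=> [x y] [/= Kx Ky]; have := dP y x (KB y Ky) (KB x Kx).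
    rewrite -normrN; congr (_ <= _); congr (`| _ |).
    by rewrite /T /mkfun; move: (w *m _) (h x) (h y) => a b c; apply/matrixP => i j; rewrite !mxE; ring.
  have K0 : K !=set0 by exists u0; rewrite /K /= subrr normr0 ltW.
  have [u Ku uE] := banach_fixed_point (X := rV_complete) ctr Kc K0; exists u => //.
  have hE : h u = w *m invmx A.
    have uE' : u = u - h u + w *m invmx A :> 'rV[R]_m := uE.
    have := congr1 (fun z : 'rV[R]_m => z - u + h u) uE'; rewrite subrr add0r => ->.
    by move: (h u) (w *m _) (u : 'rV[R]_m) => a b c; apply/matrixP => i j; rewrite !mxE; ring.
  by move: hE => /(congr1 (mulmx^~ A)); rewrite /h -!mulmxA mulVmx// !mulmx1.
pose V := [set u | ball u0 d u /\ ball (f u0) e (f u)].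
have [psi psiP] : exists psi, forall w, ball (f u0) e w -> V (psi w) /\ f (psi w) = w.
  have /choice[psi psiP] : forall w, exists u, ball (f u0) e w -> V u /\ f u = w.
    move=> w; have [Bw|nB] := pselect (ball (f u0) e w); last by exists 0.
    by have [u Ku fu] := fix_ w Bw; exists u => _; split=> //; split; [exact: KB|rewrite fu].
  by exists psi.
have VU u : V u -> U u by case=> /dB/B1.
have VJ u : V u -> jac f u \in unitmx by case=> /dB/B2.
have Vpsi u : V u -> psi (f u) = u.
  move=> [Bu Bf]; have [[Bp _] fp] := psiP _ Bf.
  have := inj u (psi (f u)) Bu Bp; rewrite /h fp subrr normr0 mulr0 normr_le0 subr_eq0.
  by move=> /eqP.
exists V, e, psi; split; split=> //; last 2 first.
- by move=> u Vu; split; [case: Vu|exact: Vpsi].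
- have oE : open (ball (f u0) e) by exact: ball_open.
  pose C := \sum_j `|row j (invmx A)|.
  have C0 : 0 <= C by rewrite sumr_ge0.
  have lip w w' : ball (f u0) e w -> ball (f u0) e w' -> `|psi w' - psi w| <= 2 * C * `|w' - w|.
    move=> Bw Bw'; have [[P1 _] f1] := psiP w Bw; have [[P2 _] f2] := psiP w' Bw'.
    have := inj _ _ P1 P2; rewrite /h f1 f2 -mulmxBl => /le_trans; apply.
    by rewrite -mulrA ler_wpM2l//; exact: norm_mulmx_le.
  have pd1 w : ball (f u0) e w -> is_diff w psi (mulmxr (invmx (jac f (psi w))) : {linear 'rV[R]_m -> 'rV[R]_m}).
    move=> Bw; apply: is_diff_approx; first exact: mulmx_continuous.
    move=> k k0; have [Vw fw] := psiP w Bw; set W := invmx _; set CW := \sum_j `|row j W|.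
    have CW0 : 0 <= CW by rewrite sumr_ge0.
    (* The error of [f] is multiplied by [CW] for the inverse derivative and by [2 * C] for the
       Lipschitz constant of [psi]; the added ones keep the denominator positive. *)
    pose k' := k / ((CW + 1) * (2 * C + 1)).
    have k'0 : 0 < k' by rewrite divr_gt0// mulr_gt0//; nra.
    have [dl dl0 [_ dlP]] := C1_strict_mx oU (VU _ Vw) sf k'0.
    have Lw : 0 < e - `|f u0 - w| by move: Bw; rewrite -ball_normE /= subr_gt0.
    have Ld : 0 < dl / (2 * C + 1) by rewrite divr_gt0//; nra.
    apply/nbhs_ballP; exists (Num.min (e - `|f u0 - w|) (dl / (2 * C + 1))).
      by rewrite /= lt_min Lw Ld.
    move=> v; rewrite -ball_normE /= sub0r normrN lt_min => /andP[Lv Lv2].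
    have Bv : ball (f u0) e (v + w).
      rewrite -ball_normE /= opprD addrCA addrC; apply: le_lt_trans (ler_normB _ _) _.
      by rewrite -ltrBrDl.
    have [Vv fv] := psiP _ Bv; have L := lip _ _ Bw Bv; rewrite addrK in L.
    have Bd : ball (psi w) dl (psi (v + w)).
      rewrite -ball_normE /= distrC; apply: le_lt_trans L _.
      by move: Lv2; rewrite ltr_pdivlMr; [have := normr_ge0 v; nra|nra].
    have := dlP _ _ (ballxx _ dl0) Bd; rewrite gradient_jac fv fw addrK => H.
    rewrite /= -normrN opprB -/W.
    have -> : v *m W - (psi (v + w) - psi w) = (v - (psi (v + w) - psi w) *m jac f (psi w)) *m W.
      by rewrite mulmxBl mulmxK//; exact: VJ.
    apply: le_trans (norm_mulmx_le _ _) _; rewrite -/CW.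
    apply: (@le_trans _ _ (CW * (k' * (2 * C * `|v|)))).
      by rewrite ler_wpM2l//; apply: le_trans H _; rewrite ler_wpM2l// ltW.
    have -> : k = k' * ((CW + 1) * (2 * C + 1)) by rewrite /k' divfK// gt_eqF// mulr_gt0//; nra.
    have := normr_ge0 v; move: (`|v|) => nv nv0.
    have -> : CW * (k' * (2 * C * nv)) = k' * nv * (CW * (2 * C)) by ring.
    have -> : k' * ((CW + 1) * (2 * C + 1)) * nv = k' * nv * ((CW + 1) * (2 * C + 1)) by ring.
    by apply: ler_wpM2l; [apply: mulr_ge0 => //; exact: ltW|lra].
  have oV : open V.
    rewrite openE => u [Bu Bf]; rewrite /interior; apply: filterI.
      by apply: open_nbhs_nbhs; split=> //; exact: ball_open.
    apply: (sm_cont sf (B1 _ (dB _ Bu))).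
    by apply: open_nbhs_nbhs; split.
  have sW : Coo V (fun u => invmx (jac f u)).
    apply: sm_invmx => //; apply: (sm_sub VU); exact: sm_jac.
  have dcomp p q (G : 'rV[R]_m -> 'M[R]_(p, q)) w : Coo V G -> ball (f u0) e w ->
      differentiable (G \o psi) w /\ forall i, pd i (G \o psi) w =
        \sum_j (invmx (jac f (psi w))) i j *: pd j G (psi w).
    move=> sG Bw; have [Vw _] := psiP w Bw.
    have dd1 := pd1 w Bw; have dd2 := sm_is_diff oV Vw sG.
    have dd3 := is_diff_comp dd1 dd2.
    have ex : differentiable (G \o psi) w by case: dd3.
    split=> // i; transitivity ('D_(delta_mx 0 i) (G \o psi) w); first by [].
    rewrite deriveE// (diff_val (is_diff_def := dd3)) /= /gradient; eqbig j.
    by rewrite -rowE mxE.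
  (* Stated for every composite with [psi], since a partial derivative of such a composite is again
     one, with a new [G]. *)
  have sm k p q (G : 'rV[R]_m -> 'M[R]_(p, q)) : Coo V G -> Ck k (ball (f u0) e) (G \o psi).
    have cG p' q' (G' : 'rV[R]_m -> 'M[R]_(p', q')) w : Coo V G' -> ball (f u0) e w ->
        {for w, continuous (G' \o psi)}.
      by move=> sG Bw; apply: differentiable_continuous; case: (dcomp _ _ _ _ sG Bw).
    elim: k p q G => [|k IH] p q G sG.
      by split=> [w Bw|]; [exact: cG|exact: I].
    split=> [w Bw|]; first exact: cG.
    split=> [w i Bw|i]; first by apply: diff_derivable; case: (dcomp _ _ _ _ sG Bw).
    have sG2 : Coo V (fun u => \sum_j (invmx (jac f u)) i j *: pd j G u).
      apply: sm_sum => // j; apply: sm_scale => //; last exact: sm_pd.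
      by have := sm_coord oV i j sW.
    apply: (Ck_ext oE _ (IH _ _ _ sG2)) => w Bw.
    by case: (dcomp _ _ _ _ sG Bw) => _ ->.
  by move=> k; exact: (sm k _ _ id (@sm_id R m V oV)).
- rewrite openE => u [Bu Bf]; rewrite /interior; apply: filterI.
    by apply: open_nbhs_nbhs; split=> //; exact: ball_open.
  apply: (sm_cont sf (B1 _ (dB _ Bu))).
  by apply: open_nbhs_nbhs; split=> //; exact: ball_open.
- by split; [exact: ballxx|exact: ballxx].
Qed.

End InverseFunction.

(** * Norms of Hessians restricted to a block *)

Section BlockNorm.
Variables (R : realType) (m N : nat) (E : 'M[R]_N).

(** For [Q] the inverse metric and [X] the Hessian this is [hes_sqnorm]; for [Q] the inverse metric
    times a projection it is the norm of the Hessian on the range of that projection. *)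
Definition block_sqnorm (Q : 'M[R]_m) (X : 'I_m -> 'M[R]_(m, N)) : R :=
  \sum_i \sum_k Q i k * \tr (X k *m E *m (X i)^T *m Q).

End BlockNorm.

Lemma block_sqnorm_change (R : realType) (m N p : nat) (E : 'M[R]_N) (D : 'M[R]_(p, m)) (K : 'M[R]_p)
    (X : 'I_m -> 'M[R]_(m, N)) (X' : 'I_p -> 'M[R]_(p, N)) :
  (forall k, X' k = \sum_l D k l *: (D *m X l)) ->
  block_sqnorm E K X' = block_sqnorm E (D^T *m K *m D) X.
move=> X'E; rewrite /block_sqnorm.
transitivity (\sum_i \sum_k \sum_a \sum_b (K i k * (D k b * D i a)) *
    \tr (X b *m E *m (X a)^T *m (D^T *m K *m D))).
  eqbig i; eqbig k; rewrite !X'E linear_sum /= mulmx_sumr.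
  rewrite mulmx_suml raddf_sum mulr_sumr; apply: eq_bigr => a _ /=.
  rewrite !mulmx_suml raddf_sum mulr_sumr; apply: eq_bigr => b _ /=.
  rewrite linearZ /= -scalemxAr -!scalemxAl scalerA mxtraceZ mulrA.
  congr (_ * _); first by congr (_ * _); rewrite mulrC.
  by rewrite trmx_mul -!mulmxA [LHS]mxtrace_mulC !mulmxA.
transitivity (\sum_i \sum_a \sum_k \sum_b (K i k * (D k b * D i a)) *
    \tr (X b *m E *m (X a)^T *m (D^T *m K *m D))).
  by eqbig i; exact: exchange_big.
rewrite exchange_big; apply: eq_bigr => a _ /=.
transitivity (\sum_i \sum_b \sum_k (K i k * (D k b * D i a)) *
    \tr (X b *m E *m (X a)^T *m (D^T *m K *m D))).
  by eqbig i; exact: exchange_big.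
rewrite exchange_big; apply: eq_bigr => b _ /=.
under eq_bigr do rewrite -mulr_suml; rewrite -mulr_suml; congr (_ * _).
rewrite -mulmxA mxE; eqbig i; rewrite !mxE mulr_sumr; eqbig k.
by rewrite [LHS]mulrA [LHS]mulrC.
Qed.

(** * Slices tangent to a parallel distribution *)

Section Submanifold.
Variables (R : realType) (m p N : nat) (E : 'M[R]_N).
Hypothesis E_sym : E^T = E.
Variables (U : set 'rV[R]_m) (Y y : 'rV[R]_m -> 'rV[R]_N) (P : 'rV[R]_m -> 'M[R]_m).
Hypotheses (oU : open U) (sY : Coo U Y) (sy : Coo U y).
Hypothesis gU : forall u, U u -> gm E Y u \in unitmx.
Hypothesis gB : forall u, U u -> exists k (B : 'M[R]_(m, k)), gm E Y u = B *m B^T.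
Hypothesis pP : parallel E U Y P.
Hypothesis Pg : forall u, U u -> P u *m gm E Y u = gm E Y u *m (P u)^T.
Hypothesis Prank : forall u, U u -> \rank (P u) = p.
Hypothesis yP : forall u, U u -> jac y u = P u *m jac Y u.

Variables (U' : set 'rV[R]_p) (phi : 'rV[R]_p -> 'rV[R]_m) (z : 'rV[R]_p -> 'rV[R]_N).
Hypotheses (oU' : open U') (sphi : Coo U' phi).
Hypothesis phiU : forall w, U' w -> U (phi w).
Notation D := (jac phi).
Hypothesis DP : forall w, U' w -> D w *m P (phi w) = D w.
Hypothesis Dfree : forall w, U' w -> row_free (D w).
Hypothesis zE : forall w, U' w -> z w = y (phi w).

Lemma sub_smooth : Coo U' z.
by apply: (sm_ext oU' _ (sm_comp oU oU' sphi phiU sy)) => v Uv; rewrite zE.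
Qed.

Let sJ := sm_jac oU sY.
Let ddphi q r (F : 'rV[R]_m -> 'M[R]_(q, r)) k w : U' w -> Coo U F ->
  dd k (fun v => F (phi v)) w = \sum_l D w k l *: dd l F (phi w).
move=> Uw sF; rewrite (dd_comp k oU oU' sphi phiU Uw sF).
by eqbig l; rewrite jacE mxE.
Qed.

Let scomp q r (F : 'rV[R]_m -> 'M[R]_(q, r)) : Coo U F -> Coo U' (fun w => F (phi w)).
exact: (sm_comp oU oU' sphi phiU). Qed.

Lemma sub_jac w : U' w -> jac z w = D w *m jac Y (phi w).
move=> Uw; rewrite -{1}(DP Uw) -mulmxA -yP; last exact: phiU.
apply/row_matrixP => k; rewrite row_jac row_mul mulmx_sum_row (dd_ext oU' k Uw zE) ddphi//.
by eqbig l; rewrite (row_jac y l) [row k (D w) 0 l]mxE.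
Qed.

Lemma sub_gm w : U' w -> gm E z w = D w *m gm E Y (phi w) *m (D w)^T.
by move=> Uw; rewrite !gmE sub_jac// trmx_mul !mulmxA. Qed.

Lemma sub_gm_unit w : U' w -> gm E z w \in unitmx.
move=> Uw; have [k [B gE]] := gB (phiU Uw); apply: definite_unitmx => v.
have fB : row_free B.
  apply: inj_row_free => x xB; have := gU (phiU Uw); rewrite gE => gu.
  by rewrite -[x](mulmxK gu) mulmxA xB !mul0mx.
have fDB : row_free (D w *m B).
  apply: inj_row_free => x /eqP; rewrite mulmxA mulmx_free_eq0// mulmx_free_eq0 ?Dfree// => /eqP.
  by [].
rewrite sub_gm// gE => H; apply: (gram_definite fDB); rewrite -[RHS]H trmx_mul !mulmxA.
by [].
Qed.

Let spY : Coo U P. by case: pP. Qed.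
Let dP l u : U u -> dd l P u = cov E Y l u *m P u - P u *m cov E Y l u.
by case: pP => _; apply. Qed.

Let h k w := \sum_l D w k l *: (D w *m hes E Y l (phi w)).
Let sD := sm_jac oU' sphi.

Let ddz k w : U' w -> dd k (jac z) w =
  h k w + (dd k D w + \sum_l D w k l *: (D w *m cov E Y l (phi w))) *m jac Y (phi w).
move=> Uw; rewrite (dd_ext oU' k Uw sub_jac) (dd_mulmx oU')//; last exact: scomp.
rewrite ddphi// mulmxDl addrCA; congr (_ + _).
rewrite mulmx_sumr mulmx_suml -big_split; apply: eq_bigr => l _ /=.
by rewrite -scalemxAr -scalemxAl -scalerDr (dd_jac E Y l) mulmxDr mulmxA.
Qed.

(** The same derivative as in [ddz], computed with the projection inserted. Comparison shows that
    the tangential coefficient is unchanged by the projection: the slices are totally geodesic, and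
    their Hessian is the restriction of that of [Y]. *)
Let ddz' k w : U' w -> dd k (jac z) w =
  h k w + (dd k D w + \sum_l D w k l *: (D w *m cov E Y l (phi w))) *m P (phi w) *m jac Y (phi w).
move=> Uw; have sPJ : Coo U (fun u => P u *m jac Y u) by exact: sm_mulmx.
have jz v : U' v -> jac z v = D v *m (P (phi v) *m jac Y (phi v)).
  by move=> Uv; rewrite mulmxA DP// sub_jac.
rewrite (dd_ext oU' k Uw jz) (dd_mulmx oU')//; last exact: (scomp sPJ).
rewrite (ddphi k Uw sPJ) !mulmxDl !mulmxA addrCA; congr (_ + _).
rewrite mulmx_sumr !mulmx_suml -big_split; apply: eq_bigr => l _ /=.
rewrite -scalemxAr -!scalemxAl -scalerDr; congr (_ *: _).
have Up := phiU Uw; rewrite (dd_mulmx oU)// dP// (dd_jac E Y l) mulmxBl mulmxDr [in LHS]mulmxDr.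
rewrite mulmxN !mulmxDr !mulmxA DP//.
by rewrite [X in _ + X]addrC addrA subrK addrC.
Qed.

Let grankP w : U' w -> exists G, [/\ P (phi w) = G *m D w, D w *m G = 1%:M & P (phi w) *m P (phi w) = P (phi w)].
move=> Uw; have Up := phiU Uw; have sub : (D w <= P (phi w))%MS by rewrite -{1}(DP Uw) submxMl.
have rk : (P (phi w) <= D w)%MS.
  have rD : \rank (D w) = p by exact/eqP/Dfree.
  by rewrite -(mxrank_leqif_sup sub).2 Prank// rD.
have PE : P (phi w) = P (phi w) *m pinvmx (D w) *m D w by rewrite mulmxKpV.
exists (P (phi w) *m pinvmx (D w)); split=> //; last first.
  by rewrite {1}PE -mulmxA DP.
apply: (row_free_inj (Dfree Uw)); rewrite mul1mx -mulmxA -PE; exact: DP.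
Qed.

Lemma sub_hes k w : U' w -> hes E z k w = \sum_l D w k l *: (D w *m hes E Y l (phi w)).
move=> Uw; have Up := phiU Uw; have [G [PE DG _]] := grankP Uw.
set Q := dd k D w + \sum_l D w k l *: (D w *m cov E Y l (phi w)).
have QP : Q = Q *m P (phi w).
  apply/eqP; rewrite -subr_eq0; apply/eqP; apply: (tangent_eq0 gU Up).
  have := ddz' k Uw; rewrite (ddz k Uw) => /addrI; rewrite -/Q => QJ.
  by rewrite mulmxBl -QJ subrr !mul0mx.
have [] // := hes_unique (k := k) (h := h k w) (c := Q *m G) sub_gm_unit Uw.
  by rewrite ddz// -/Q QP PE -!mulmxA (mulmxA G) sub_jac// !mulmxA -[Q *m G *m D w *m G]mulmxA DG mulmx1.
rewrite sub_jac// trmx_mul mulmxA /h mulmx_suml mulmx_suml mulmx_suml big1// => l _.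
by rewrite -!scalemxAl -!mulmxA (mulmxA (hes E Y l _)) (mulmxA _ (jac Y _)^T) (hes_jac gU)// mul0mx mulmx0 scaler0.
Qed.

Lemma sub_ginv w : U' w ->
  (D w)^T *m invmx (gm E z w) *m D w = invmx (gm E Y (phi w)) *m P (phi w).
move=> Uw; have Up := phiU Uw; have [G [PE DG PP]] := grankP Uw; have gz := sub_gm_unit Uw.
set Z := gm E Y (phi w) *m (D w)^T *m invmx (gm E z w).
have DZ : D w *m Z = 1%:M by rewrite /Z !mulmxA -sub_gm// mulmxV.
have PZ : P (phi w) *m Z = Z.
  by rewrite /Z !mulmxA Pg// -[_ *m (P _)^T *m _]mulmxA -trmx_mul DP.
have ZG : Z = G by rewrite -PZ PE -mulmxA DZ mulmx1.
apply: (can_inj (mulKmx (gU Up))); rewrite !mulmxA mulmxV ?gU// mul1mx -/Z ZG -PE.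
by [].
Qed.

Lemma sub_lap w : U' w ->
  lap E z w = ctr (invmx (gm E Y (phi w)) *m P (phi w)) (hes E Y ^~ (phi w)).
move=> Uw; rewrite lapE -sub_ginv// (eq_contract _ (fun k => sub_hes k Uw)) /ctr.
transitivity (\sum_k \sum_l D w k l *: (row k (invmx (gm E z w)) *m D w *m hes E Y l (phi w))).
  by eqbig k; rewrite mulmx_sumr; eqbig l; rewrite -scalemxAr mulmxA.
rewrite exchange_big; apply: eq_bigr => l _ /=.
under eq_bigr do rewrite scalemxAl; rewrite -mulmx_suml; congr (_ *m _).
under eq_bigr do rewrite scalemxAl; rewrite -mulmx_suml -mulmxA !row_mul mulmxA; congr (_ *m _).
by rewrite [RHS]mulmx_sum_row; eqbig k; rewrite !mxE.
Qed.

Lemma sub_hes_sqnorm w : U' w -> hes_sqnorm E z w =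
  block_sqnorm E (invmx (gm E Y (phi w)) *m P (phi w)) (hes E Y ^~ (phi w)).
move=> Uw; rewrite -sub_ginv// -(block_sqnorm_change E _ (X' := hes E z ^~ w))//.
by move=> k; exact: sub_hes.
Qed.

End Submanifold.

Section LineConstant.
Variables (R : realType) (m : nat).

Lemma ball_segment n (c w v : 'rV[R]_n) (e t : R) : 0 <= t <= 1 ->
  ball c e w -> ball c e (w + v) -> ball c e (t *: v + w).
move=> /andP[t0 t1]; rewrite -ball_normE /= => B1 B2.
have -> : c - (t *: v + w) = (1 - t) *: (c - w) + t *: (c - (w + v)).
  by apply/matrixP => i j; rewrite !mxE; ring.
apply: le_lt_trans (ler_normD _ _) _; rewrite !normrZ (ger0_norm t0) ger0_norm ?subr_ge0//.
have [->|tn0] := eqVneq t 0; first by rewrite subr0 mul1r mul0r addr0.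
have tp : 0 < t by rewrite lt_neqAle eq_sym tn0.
by nra.
Qed.

Lemma line_const (U : set 'rV[R]_m) n (F : 'rV[R]_m -> 'rV[R]_n) w v :
  open U -> Coo U F -> (forall t, 0 <= t <= 1 -> U (t *: v + w)) ->
  (forall t, 0 <= t <= 1 -> v *m jac F (t *: v + w) = 0) -> F (v + w) = F w.
move=> oU sF inU vJ; apply/matrixP => i j; rewrite !ord1.
have H t : t \in `[0, 1] -> is_derive ((t * 1) *: v + w) v (fun u => F u 0 j) 0.
  rewrite in_itv /= mulr1 => t01; have Ut := inU t t01.
  have dF := sm_is_diff oU Ut sF.
  have exF : differentiable F (t *: v + w) by case: dF.
  have d1 : derivable F (t *: v + w) v by exact: diff_derivable.
  have d2 : 'D_v F (t *: v + w) = 0.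
    by rewrite deriveE// diff_val gradient_jac vJ.
  split; first by have /derivable_mxP := d1; apply.
  by have := derive_mx d1; rewrite d2 => /matrixP/(_ 0 j); rewrite !mxE => <-.
have [t t01] := @MVT_line R _ (fun u => F u 0 j) v w 1 (fun t tt => @ex_derive _ _ _ _ _ _ _ (H t tt)).
rewrite (@derive_val _ _ _ _ _ _ _ (H t t01)) mulr0 scale1r => /eqP.
by rewrite subr_eq0 => /eqP.
Qed.

End LineConstant.

Lemma rank_factor (F : fieldType) (p q r : nat) (A : 'M[F]_(p, q)) :
  \rank A = r -> exists (X : 'M[F]_(p, r)) (W : 'M[F]_(r, q)), A = X *m W.
by move=> <-; exists (col_base A), (row_base A); rewrite mulmx_base. Qed.

(** * Coordinates adapted to complementary projections *)

Section LocalProduct.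
Variables (R : realType) (m N : nat) (E : 'M[R]_N) (mu : 'I_3 -> nat).
Variables (U : set 'rV[R]_m) (Y : 'rV[R]_m -> 'rV[R]_N) (y : 'I_3 -> 'rV[R]_m -> 'rV[R]_N).
Variables (P : 'I_3 -> 'rV[R]_m -> 'M[R]_m) (u0 : 'rV[R]_m).
Hypotheses (openU : open U) (Uu0 : U u0) (sY : Coo U Y) (sy : forall a, Coo U (y a)).
Hypothesis gU : forall u, U u -> gm E Y u \in unitmx.
Hypothesis yP : forall a u, U u -> jac (y a) u = P a u *m jac Y u.
Hypothesis Psum : forall u, U u -> \sum_a P a u = 1%:M.
Hypothesis Pneq : forall a b u, U u -> a != b -> P a u *m P b u = 0.
Hypothesis Prank : forall a u, U u -> \rank (P a u) = mu a.
Variable I_ : forall a, 'M[R]_(mu a, m).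
Hypothesis II : forall a, I_ a *m (I_ a)^T = 1%:M.
Hypothesis I_neq : forall a b, a != b -> I_ a *m (I_ b)^T = 0.
Hypothesis Isum : \sum_a (I_ a)^T *m I_ a = 1%:M.

Let Pid a u : U u -> P a u *m P a u = P a u.
move=> Uu; rewrite -[RHS]mulmx1 -(Psum Uu) mulmx_sumr (bigD1 a)//= big1 ?addr0// => b ba.
by rewrite Pneq// eq_sym.
Qed.

Definition adapted (V : set 'rV[R]_m) (w0 : 'rV[R]_m) (e : R) (zeta psi : 'rV[R]_m -> 'rV[R]_m) :=
  [/\ open V, V u0, V `<=` U & 0 < e] /\
  [/\ forall w, ball w0 e w -> V (psi w) /\ zeta (psi w) = w,
      forall u, V u -> ball w0 e (zeta u) /\ psi (zeta u) = u,
      Coo U zeta & Coo (ball w0 e) psi] /\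
  [/\ forall a w, ball w0 e w -> I_ a *m jac psi w *m P a (psi w) = I_ a *m jac psi w,
      forall a w, ball w0 e w -> row_free (I_ a *m jac psi w) &
      forall a w w', ball w0 e w -> ball w0 e w' -> w *m (I_ a)^T = w' *m (I_ a)^T ->
        y a (psi w) = y a (psi w')].

(** The integrals [y a] are at hand, so no integrability theorem is called for. The differential of
    [y a] has rank [mu a]; as many linear functions of it, taken from a rank factorisation at [u0],
    form the a-th block of coordinates, and the inverse function theorem does the rest. *)
Lemma adapted_coordinates : exists V w0 e zeta psi, adapted V w0 e zeta psi.
have fact a : exists XW : 'M[R]_(m, mu a) * 'M[R]_(mu a, m), P a u0 = XW.1 *m XW.2.
  by have [X [W PE]] := rank_factor (Prank a Uu0); exists (X, W).
pose X a := (sval (cid (fact a))).1; pose W a := (sval (cid (fact a))).2.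
have PE a : P a u0 = X a *m W a by rewrite /X /W; case: cid.
have Xfree a (v : 'M[R]_(mu a)) : X a *m v = 0 -> v = 0.
  move=> Xv; have rX : \rank (X a)^T = mu a.
    apply/eqP; rewrite mxrank_tr eqn_leq rank_leq_col /= -{1}(Prank a Uu0) PE.
    exact: mxrankM_maxl.
  have fX : row_free (X a)^T by rewrite /row_free rX.
  apply: trmx_inj; rewrite trmx0; apply: (row_free_inj fX).
  by rewrite mul0mx -trmx_mul Xv trmx0.
have PX a : P a u0 *m X a = X a.
  have wfree (v : 'M[R]_(m, mu a)) : v *m W a = 0 -> v = 0.
    have fW : row_free (W a).
      by rewrite /row_free eqn_leq rank_leq_row /= -{1}(Prank a Uu0) PE mxrankM_maxr.
    by move=> vW; apply: (row_free_inj fW); rewrite mul0mx.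
  apply/eqP; rewrite -subr_eq0; apply/eqP/wfree.
  by rewrite mulmxBl -mulmxA -PE Pid// subrr.
have [K0 JK] : exists K0, jac Y u0 *m K0 = 1%:M.
  exists (E *m (jac Y u0)^T *m invmx (gm E Y u0)).
  have gE : gm E Y u0 = jac Y u0 *m E *m (jac Y u0)^T by rewrite gmE.
  by rewrite !mulmxA -gE mulmxV ?gU.
pose zeta u := \sum_a y a u *m (K0 *m X a *m I_ a).
have sz : Coo U zeta by apply: sm_sum => // a; smo.
have jz u : U u -> jac zeta u = \sum_a P a u *m jac Y u *m (K0 *m X a *m I_ a).
  move=> Uu; apply/row_matrixP => i; rewrite row_jac /zeta (dd_sum openU)//; last by move=> a; smo.
  rewrite raddf_sum; apply: eq_bigr => a _ /=.
  by rewrite (dd_mulmxl openU)// -yP// row_mul row_jac.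
have jz0 : jac zeta u0 \in unitmx.
  suff /mulmx1_unit[] : jac zeta u0 *m (\sum_b (I_ b)^T *m W b) = 1%:M by [].
  rewrite jz// mulmx_suml -(Psum Uu0); eqbig a.
  rewrite mulmx_sumr (bigD1 a)//= big1 ?addr0 => [|b ba].
    by rewrite !mulmxA -(mulmxA (P a u0)) JK mulmx1 PX -(mulmxA (X a)) II mulmx1 PE.
  by rewrite !mulmxA -(mulmxA _ (I_ a)) I_neq ?mulmx0 ?mul0mx// eq_sym.
have [V [e [psi [[oV Vu VU e0] [psiV Vpsi jV spsi]]]]] := inverse_function openU Uu0 sz jz0.
have oB : open (ball (zeta u0) e) by exact: ball_open.
have psiU w : ball (zeta u0) e w -> U (psi w) by move=> /psiV[/VU].
have chain n (F : 'rV[R]_m -> 'rV[R]_n) w : ball (zeta u0) e w -> Coo U F ->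
    jac (F \o psi) w = jac psi w *m jac F (psi w).
  move=> Bw sF; apply/row_matrixP => i; rewrite row_jac row_mul mulmx_sum_row.
  rewrite (dd_comp i openU oB spsi psiU Bw sF); eqbig j.
  by rewrite (row_jac F j) (row_jac psi i).
have DZ w : ball (zeta u0) e w -> jac psi w *m jac zeta (psi w) = 1%:M.
  move=> Bw; rewrite -chain//; apply/row_matrixP => i; rewrite row_jac.
  rewrite (dd_ext oB i Bw (g := id)); last by move=> v Bv /=; case: (psiV v Bv).
  by rewrite ddE pd_id row1.
have key a b w : ball (zeta u0) e w ->
    I_ b *m jac psi w *m P a (psi w) *m (jac Y (psi w) *m K0 *m X a) = I_ b *m (I_ a)^T.
  move=> Bw; rewrite -[RHS]mulmx1 -[in RHS]mulmxA; transitivity (I_ b *m (jac psi w *m jac zeta (psi w)) *m (I_ a)^T).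
    rewrite jz; last exact: psiU.
    rewrite -!mulmxA !mulmx_suml !mulmx_sumr (bigD1 a)//= big1 ?addr0 => [|c ca].
      by rewrite -!mulmxA II mulmx1.
    by rewrite -!mulmxA I_neq// !mulmx0.
  by rewrite DZ// !mulmx1.
have D0 a b w : ball (zeta u0) e w -> a != b -> I_ b *m jac psi w *m P a (psi w) = 0.
  move=> Bw ab; have [X' [W' PE']] := rank_factor (Prank a (psiU _ Bw)).
  have := key a a w Bw; have := key a b w Bw; rewrite II I_neq ?(eq_sym b a)// PE'.
  (* In a factorisation of [P a] through dimension [mu a], the diagonal case of [key] makes the
     square matrix [W' *m M] invertible, and the off-diagonal case then annihilates the remaining
     factor. *)
  move: (jac Y (psi w) *m K0 *m X a) => M; rewrite !mulmxA -!(mulmxA _ W' M) => H0 /mulmx1_unit[_ Tu].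
  suff -> : I_ b *m jac psi w *m X' = 0 by rewrite mul0mx.
  by rewrite -[LHS](mulmxK Tu) H0 mul0mx.
have DP a w : ball (zeta u0) e w -> I_ a *m jac psi w *m P a (psi w) = I_ a *m jac psi w.
  move=> Bw; rewrite -[RHS]mulmx1 -(Psum (psiU _ Bw)) mulmx_sumr (bigD1 a)//= big1 ?addr0// => b ba.
  exact: D0.
exists V, (zeta u0), e, zeta, psi; split=> //; split; first by split=> //; exact: sm_sub sz.
split=> // [a w Bw|a w w' Bw Bw' ww'].
  apply: inj_row_free => v vD; have := key a a w Bw; rewrite II DP// => H.
  by rewrite -[v]mulmx1 -H !mulmxA -(mulmxA v) vD !mul0mx.
rewrite -[w](subrK w'); have -> : w - w' + w' = w by rewrite subrK.
have sya : Coo (ball (zeta u0) e) (y a \o psi) by exact: (sm_comp openU oB spsi psiU).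
have := line_const (F := y a \o psi) (w := w') (v := w - w') oB sya; rewrite subrK; apply.
  by move=> t t01; apply: ball_segment => //; rewrite addrC subrK.
move=> t t01; have Bt : ball (zeta u0) e (t *: (w - w') + w').
  by apply: ball_segment => //; rewrite addrC subrK.
rewrite chain// yP ?mulmxA; last exact: psiU.
suff -> : (w - w') *m jac psi (t *: (w - w') + w') *m P a (psi (t *: (w - w') + w')) = 0.
  by rewrite mul0mx.
have : (w - w') *m (I_ a)^T = 0 by rewrite mulmxBl ww' subrr.
move: (w - w') (_ *: _ + w') Bt => d x Bx d0.
rewrite -[d]mulmx1 -Isum mulmx_sumr !mulmx_suml big1// => b _; rewrite !mulmxA.
have [->|ba] := eqVneq b a; first by rewrite d0 !mul0mx.
by rewrite -(mulmxA _ (I_ b)) -(mulmxA _ (I_ b *m _)) D0 ?mulmx0// eq_sym.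
Qed.

End LocalProduct.

(** * Splitting coordinates into three blocks *)

Section BlockInclusion.
Variables (R : realType) (mu : 'I_3 -> nat) (m : nat).
Hypothesis mu_sum : (mu 0%R + mu 1%R + mu 2%R)%N = m.

Definition boff (a : 'I_3) : nat :=
  if a == 0 then 0%N else if a == 1 then mu 0 else (mu 0%R + mu 1%R)%N.

Lemma boff_lt a (i : 'I_(mu a)) : (boff a + i < m)%N.
have := ltn_ord i; rewrite -mu_sum /boff; by have [ea|ea|ea] := ord3_cases a; subst a => /= ?; lia.
Qed.

Definition bord a (i : 'I_(mu a)) : 'I_m := Ordinal (boff_lt i).

Lemma bord_inj a b (i : 'I_(mu a)) (k : 'I_(mu b)) : bord i = bord k -> a = b /\ i = k :> nat.
move=> /(congr1 val) /=; have := ltn_ord i; have := ltn_ord k; rewrite /boff.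
by have [ea|ea|ea] := ord3_cases a; have [eb|eb|eb] := ord3_cases b; subst a b => /= ? ? ?;
  (split; [|lia]) => //; exfalso; lia.
Qed.

Lemma bord_cover (j : 'I_m) : exists a (i : 'I_(mu a)), j = bord i.
have jm : (j < mu 0%R + mu 1%R + mu 2%R)%N by rewrite mu_sum.
have [h0|h0] := ltnP j (mu 0).
  by exists 0, (Ordinal h0); apply/val_inj.
have [h1|h1] := ltnP j (mu 0%R + mu 1%R)%N.
  have h : (j - mu 0%R < mu 1%R)%N by lia.
  by exists 1, (Ordinal h); apply/val_inj => /=; rewrite /boff /=; lia.
have h : (j - (mu 0%R + mu 1%R) < mu 2%R)%N by lia.
by exists 2, (Ordinal h); apply/val_inj => /=; rewrite /boff /=; lia.
Qed.

Definition binc a : 'M[R]_(mu a, m) := \matrix_(i, j) (j == bord i)%:R.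

Lemma mul_binc_tr n (v : 'M[R]_(n, m)) a k (i : 'I_(mu a)) : (v *m (binc a)^T) k i = v k (bord i).
rewrite mxE (bigD1 (bord i))//= !mxE eqxx mulr1 big1 ?addr0// => j ji.
by rewrite !mxE (negPf ji) mulr0.
Qed.

Lemma bincK a : binc a *m (binc a)^T = 1%:M.
apply/matrixP => i k; rewrite mul_binc_tr !mxE; congr (_%:R).
by congr nat_of_bool; apply/eqP/eqP => [/bord_inj[_ h]|->//]; exact/esym/val_inj.
Qed.

Lemma binc_neq a b : a != b -> binc a *m (binc b)^T = 0.
move=> ab; apply/matrixP => i k; rewrite mul_binc_tr !mxE.
by case: eqP => // /bord_inj[e _]; rewrite e eqxx in ab.
Qed.

Lemma binc_ext n (v w : 'M[R]_(n, m)) :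
  (forall a, v *m (binc a)^T = w *m (binc a)^T) -> v = w.
move=> vw; apply/matrixP => k j; have [a [i ->]] := bord_cover j.
by rewrite -!mul_binc_tr vw.
Qed.

Lemma binc_sum : \sum_a (binc a)^T *m binc a = 1%:M.
apply: binc_ext => b; rewrite mulmx_suml mul1mx (bigD1 b)//= -mulmxA bincK mulmx1.
by rewrite big1 ?addr0// => a ab; rewrite -mulmxA binc_neq ?mulmx0.
Qed.

Lemma ball_binc (c v : 'rV[R]_m) e : 0 < e ->
  ball c e v <-> forall a, ball (c *m (binc a)^T) e (v *m (binc a)^T).
move=> e0; rewrite -ball_normE /=; split=> [H a|H].
  rewrite -ball_normE /= -mulmxBl; apply/mx_norm_lt => // i j.
  by rewrite mul_binc_tr; apply: le_lt_trans H; exact: mx_norm_ge.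
apply/mx_norm_lt => // i j; have [a [k ->]] := bord_cover j.
have := H a; rewrite -ball_normE /= -mulmxBl; apply: le_lt_trans.
by rewrite -mul_binc_tr; exact: mx_norm_ge.
Qed.

Definition assemble (w : forall a, 'rV[R]_(mu a)) : 'rV[R]_m := \sum_a w a *m binc a.

Lemma assembleK w a : assemble w *m (binc a)^T = w a.
rewrite mulmx_suml (bigD1 a)//= -mulmxA bincK mulmx1 big1 ?addr0// => b ba.
by rewrite -mulmxA binc_neq// mulmx0.
Qed.

End BlockInclusion.

Lemma big3 (V : nmodType) (F : 'I_3 -> V) : \sum_a F a = F 0 + F 1 + F 2.
rewrite !big_ord_recl big_ord0 addr0 addrA.
have -> : lift ord0 ord0 = 1 :> 'I_3 by exact/val_inj.
by have -> : lift ord0 (lift ord0 ord0) = 2 :> 'I_3 by exact/val_inj.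
Qed.

Lemma dot_CauchySchwarz (R : realType) n (u v : 'rV[R]_n) : dot u v ^+ 2 <= dot u u * dot v v.
have [v0|vn0] := eqVneq v 0.
  by rewrite v0 !dotE !trmx0 !mulmx0 !mxE expr0n /= mulr0.
have vp : 0 < dot v v.
  by rewrite lt_neqAle dot_ge0 andbT eq_sym; apply: contraNneq vn0 => /dot_eq0 ->.
have := dot_ge0 (dot v v *: u - dot u v *: v); rewrite dot_comb => H.
rewrite -(ler_pM2l vp); move: H; move: (dot u u) (dot v v) (dot u v) => a b c; nra.
Qed.

(** * Orthonormal bases of row spaces *)

Section OrthonormalRows.
Variable R : realType.

Lemma orthonormal_rows r k n (A : 'M[R]_(k, n)) : \rank A = r ->
  exists Q : 'M[R]_(r, n), Q *m Q^T = 1%:M /\ (Q :=: A)%MS.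
elim: r k A => [|r IH] k A rA.
  exists 0; split; first by rewrite mul0mx; apply/matrixP => -[].
  have -> : A = 0 by apply/eqP; rewrite -mxrank_eq0 rA.
  by apply/eqmxP; rewrite !sub0mx.
have [i vn0] : exists i, row i A != 0.
  apply: contrapT => H; have A0 : A = 0.
    apply/row_matrixP => i; rewrite row0; apply/eqP; apply: contrapT => /negP h.
    by apply: H; exists i.
  by move: rA; rewrite A0 mxrank0.
set v := row i A in vn0; have d0 : 0 < dot v v.
  by rewrite lt_neqAle dot_ge0 andbT eq_sym; apply: contraNneq vn0 => /dot_eq0 ->.
have [u [uu uA]] : exists u : 'rV_n, u *m u^T = 1%:M /\ (u <= A)%MS.
  exists ((Num.sqrt (dot v v))^-1 *: v); split; last by rewrite scalemx_sub// row_sub.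
  rewrite -scalemxAl linearZ /= -scalemxAr scalerA.
  have -> : v *m v^T = (dot v v)%:M by rewrite [LHS]mx11_scalar dotE mulmx1.
  by rewrite scale_scalar_mx -expr2 exprVn sqr_sqrtr ?ltW// mulVf ?gt_eqF.
have [A' A'E] : exists X, X = A - A *m u^T *m u by eexists.
have A'u : A' *m u^T = 0 by rewrite A'E mulmxBl -(mulmxA (A *m u^T)) uu mulmx1 subrr.
have A'A : (A' <= A)%MS by rewrite A'E addmx_sub// eqmx_opp mulmx_sub.
have AE : A = A' + A *m u^T *m u by rewrite A'E subrK.
have rA' : \rank A' = r.
  apply/eqP; rewrite eqn_leq; apply/andP; split.
    rewrite -ltnS -rA; apply: rank_ltmx; rewrite ltmxE A'A /=; apply/negP => AA'.
    have /submxP[x ux] := submx_trans uA AA'; have : u *m u^T = 0 by rewrite {1}ux -mulmxA A'u mulmx0.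
    by rewrite uu => /matrixP/(_ 0 0); rewrite !mxE => /eqP; rewrite oner_eq0.
  rewrite -ltnS -rA [A in (\rank A <= _)%N]AE; apply: leq_trans (mxrank_add _ _) _.
  by rewrite -[(\rank A').+1]addn1 leq_add2l (leq_trans (mxrankM_maxr _ _))// rank_leq_row.
have [Q [QQ QA']] := IH _ _ rA'.
have Qu : Q *m u^T = 0.
  have /submxP[x ->] : (Q <= A')%MS by rewrite QA'.
  by rewrite -mulmxA A'u mulmx0.
have uQ : u *m Q^T = 0 by rewrite -[LHS]trmxK trmx_mul trmxK Qu trmx0.
change (exists X : 'M[R]_(1 + r, n), X *m X^T = 1%:M /\ (X :=: A)%MS); exists (col_mx u Q); split.
  by rewrite tr_col_mx mul_col_row uu uQ Qu QQ -scalar_mx_block.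
apply/eqmxP/andP; split.
  by rewrite col_mx_sub uA QA' A'A.
rewrite [A in (A <= _)%MS]AE addmx_sub//.
  have : (Q <= col_mx u Q)%MS by apply/submxP; exists (row_mx 0 1%:M); rewrite mul_row_col mul0mx add0r mul1mx.
  by rewrite QA'.
by rewrite mulmx_sub//; apply/submxP; exists (row_mx 1%:M 0); rewrite mul_row_col mul0mx mul1mx addr0.
Qed.

Lemma orthonormal_splitting N k1 k2 (B1 : 'M[R]_(k1, N)) (B2 : 'M[R]_(k2, N)) :
  B1 *m B2^T = 0 ->
  exists r0 r1 r2 (Q0 : 'M[R]_(r0, N)) (Q1 : 'M[R]_(r1, N)) (Q2 : 'M[R]_(r2, N)),
  [/\ (r0 + r1 + r2)%N = N, (Q1 :=: B1)%MS, (Q2 :=: B2)%MS &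
     Q0^T *m Q0 + Q1^T *m Q1 + Q2^T *m Q2 = 1%:M] /\
  [/\ Q0 *m Q0^T = 1%:M, Q1 *m Q1^T = 1%:M & Q2 *m Q2^T = 1%:M] /\
  [/\ Q0 *m Q1^T = 0, Q0 *m Q2^T = 0 & Q1 *m Q2^T = 0].
move=> BB; have [Q1 [QQ1 QB1]] := orthonormal_rows (erefl (\rank B1)).
have [Q2 [QQ2 QB2]] := orthonormal_rows (erefl (\rank B2)).
have Q12 : Q1 *m Q2^T = 0.
  have /submxP[x ->] : (Q1 <= B1)%MS by rewrite QB1.
  have /submxP[y ->] : (Q2 <= B2)%MS by rewrite QB2.
  by rewrite trmx_mul mulmxA -(mulmxA x) BB mulmx0 mul0mx.
have Q21 : Q2 *m Q1^T = 0 by rewrite -[LHS]trmxK trmx_mul trmxK Q12 trmx0.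
move: Q1 Q2 QQ1 QB1 QQ2 QB2 Q12 Q21; move: (\rank B1) (\rank B2) => r1 r2 Q1 Q2 QQ1 QB1 QQ2 QB2 Q12 Q21.
pose C := col_mx Q1 Q2; have CC : C *m C^T = 1%:M.
  by rewrite tr_col_mx mul_col_row QQ1 QQ2 Q12 Q21 -scalar_mx_block.
have rC : \rank C^T = (r1 + r2)%N.
  apply/eqP; rewrite mxrank_tr eqn_leq rank_leq_row /=.
  by rewrite -{1}(@mxrank1 R (r1 + r2)) -CC mxrankM_maxl.
have [Q0 [QQ0 QK]] := orthonormal_rows (erefl (\rank (kermx C^T))).
have Q0C : Q0 *m C^T = 0 by apply/sub_kermxP; rewrite QK.
have r0E : (\rank (kermx C^T) + r1 + r2)%N = N.
  rewrite mxrank_ker rC -addnA subnK// -rC mxrank_tr; exact: rank_leq_col.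
move: Q0 QQ0 QK Q0C r0E; move: (\rank _) => r0 Q0 QQ0 _ Q0C r0E.
have [Q01 Q02] : Q0 *m Q1^T = 0 /\ Q0 *m Q2^T = 0.
  by move: Q0C; rewrite /C tr_col_mx mul_mx_row -row_mx0 => /eq_row_mx.
have Q10 : Q1 *m Q0^T = 0 by rewrite -[LHS]trmxK trmx_mul trmxK Q01 trmx0.
have Q20 : Q2 *m Q0^T = 0 by rewrite -[LHS]trmxK trmx_mul trmxK Q02 trmx0.
exists r0, r1, r2, Q0, Q1, Q2; split=> //; split=> //.
move: Q1 Q2 Q0 QQ1 QQ2 QQ0 Q12 Q21 Q01 Q02 Q10 Q20 {QB1 QB2 Q0C CC rC C BB B1 B2}.
move: r0E; case: N / => Q1 Q2 Q0 QQ1 QQ2 QQ0 Q12 Q21 Q01 Q02 Q10 Q20.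
pose O := col_mx (col_mx Q0 Q1) Q2.
have OO : O *m O^T = 1%:M.
  rewrite /O !tr_col_mx !mul_col_row mul_col_mx mul_mx_row QQ0 QQ1 QQ2 Q12 Q01 Q02 Q10 Q20 Q21.
  by rewrite -scalar_mx_block col_mx0 row_mx0 -scalar_mx_block.
by rewrite -(mulmx1C OO) !tr_col_mx !mul_row_col.
Qed.

(** Among the matrices whose rows are orthogonal to everything orthogonal to the family, one of
    maximal rank contains every member, for otherwise adding a row would increase the rank. *)
Lemma span_family (T : Type) N (f : T -> 'rV[R]_N) : exists k (B : 'M[R]_(k, N)),
  (forall q, (f q <= B)%MS) /\
  forall w : 'rV_N, (forall q, f q *m w^T = 0) -> B *m w^T = 0.
pose P r := exists k (B : 'M[R]_(k, N)), \rank B = r /\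
  forall w : 'rV_N, (forall q, f q *m w^T = 0) -> B *m w^T = 0.
have P0 : exists r, `[< P r >].
  by exists 0%N; apply/asboolP; exists 0%N, 0; split=> [|w _]; [rewrite mxrank0|rewrite mul0mx].
have PN r : `[< P r >] -> (r <= N)%N.
  by move=> /asboolP[k [B [<- _]]]; exact: rank_leq_col.
case: (ex_maxnP P0 PN) => r /asboolP[k [B [rB Bw]]] rmax.
exists k, B; split=> // q.
have : (\rank (col_mx B (f q)) <= \rank B)%N.
  rewrite rB; apply: rmax; apply/asboolP; exists (k + 1)%N, (col_mx B (f q)); split=> // w fw.
  by rewrite mul_col_mx Bw// fw// col_mx0.
have sB : (B <= col_mx B (f q))%MS by apply/submxP; exists (row_mx 1%:M 0); rewrite mul_row_col mul1mx mul0mx addr0.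
move=> le; have : (col_mx B (f q) <= B)%MS by rewrite -(geq_leqif (mxrank_leqif_sup sB)).
by rewrite col_mx_sub => /andP[].
Qed.

End OrthonormalRows.

(** * A factor as a minimal immersion into a quadric of its own span *)

Section FactorImmersion.
Variables (R : realType) (p N N' : nat) (E : 'M[R]_N) (E' : 'M[R]_N') (Q : space_form R N').
Variables (U : set 'rV[R]_p) (z : 'rV[R]_p -> 'rV[R]_N) (f : 'rV[R]_p -> 'rV[R]_N') (L : 'M[R]_(N', N)).
Hypotheses (oU : open U) (E_sym : E^T = E) (E'_sym : E'^T = E') (E'U : E' \in unitmx).
Hypothesis QE : forall u v, sf_form Q u v = (u *m E' *m v^T) 0 0.
Hypotheses (LE : L *m E *m L^T = E') (p_gt0 : (0 < p)%N).
Hypotheses (sz : Coo U z) (sf : Coo U f).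
Hypothesis zf : forall t, U t -> z t = f t *m L.
Hypothesis gU : forall t, U t -> gm E z t \in unitmx.
Variable k : R.
Hypotheses (kn0 : k != 0) (Qk : sf_curv Q = k).
Hypothesis lapz : forall t, U t -> lap E z t = - (p%:R * k) *: z t.
Hypothesis zz : forall t, U t -> z t *m E *m (z t)^T = (k^-1)%:M.

Let jz t : U t -> jac z t = jac f t *m L.
move=> Ut; apply/row_matrixP => i; rewrite row_mul !row_jac (dd_ext oU i Ut zf).
by rewrite (dd_mulmxl oU).
Qed.

Lemma lift_gm t : U t -> gm E' f t = gm E z t.
by move=> Ut; rewrite !gmE jz// trmx_mul -LE !mulmxA. Qed.

Let gU' t : U t -> gm E' f t \in unitmx. by move=> Ut; rewrite lift_gm// gU. Qed.

Let hz i t : U t -> hes E z i t = hes E' f i t *m L.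
move=> Ut; apply: (proj1 (hes_unique gU (c := cov E' f i t) Ut _ _)).
  rewrite (dd_ext oU i Ut jz) (dd_mulmxl oU)//; last exact: sm_jac.
  by rewrite (dd_jac E') mulmxDl jz// mulmxA.
by rewrite jz// trmx_mul -!mulmxA (mulmxA L) (mulmxA (L *m E)) LE !mulmxA (hes_jac gU').
Qed.

Lemma lift_lap t : U t -> lap E' f t = - (p%:R * k) *: f t.
move=> Ut; have := lapz Ut; rewrite lapE (eq_contract _ (fun i => hz i Ut)) contract_mulmxr -lift_gm//.
have -> : ctr (invmx (gm E' f t)) ((hes E' f)^~ t) = lap E' f t by rewrite lapE.
rewrite zf// scalemxAl => /(congr1 (fun X => X *m E *m L^T)); rewrite -!(mulmxA _ L) -!mulmxA (mulmxA L) LE.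
by move=> /(congr1 (mulmx^~ (invmx E'))); rewrite !mulmxK.
Qed.

Let ff t : U t -> sf_form Q (f t) (f t) = k^-1.
move=> Ut; have := zz Ut; rewrite zf// trmx_mul -!mulmxA (mulmxA L) (mulmxA (L *m E)) LE => /matrixP/(_ 0 0).
by rewrite QE mulmxA => ->; rewrite mxE mulr1n.
Qed.

Let cff t : U t -> sf_curv Q * (sf_curv Q * sf_form Q (f t) (f t)) = sf_curv Q.
by move=> Ut; rewrite ff// Qk mulfV// mulr1. Qed.

Lemma lift_row_free t : U t -> row_free (\matrix_(i < p) pd i f t).
move=> Ut; have -> : \matrix_(i < p) pd i f t = jac f t by rewrite jacE ddE.
apply: inj_row_free => v vJ; rewrite -[v](mulmxK (gU' Ut)) gmE !mulmxA vJ !mul0mx //.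
Qed.

(** Takahashi's criterion: on a quadric of curvature $k$ the coordinates satisfy $\Delta f=-pkf$
    exactly when the mean curvature vector vanishes. *)
Lemma lift_minimal t : U t -> mean_curvature Q f t = 0.
move=> Ut; rewrite (mean_curvatureE E'_sym QE oU sf gU' cff p_gt0 Ut) lift_lap// Qk.
rewrite scalerA -scalerDl mulrN mulrA mulVf ?pnatr_eq0 -?lt0n// mul1r addNr scale0r //.
Qed.

Lemma lift_scalar_curvature t : U t -> scalar_curvature (induced_metric (sf_form Q) f) t =
  p%:R ^+ 2 * k - hes_sqnorm E z t.
move=> Ut; rewrite (gauss_scalar E'_sym QE oU sf gU' Ut) lift_lap//.
rewrite (bformZl QE) (bformZr E'_sym QE) ff//; congr (_ - _); first by field.
rewrite /hes_sqnorm lift_gm//; eqbig i; eqbig j; rewrite !hz// trmx_mul.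
by rewrite -LE !mulmxA.
Qed.

(* The vectors [f] and [pd i f] are linearly independent. *)
Lemma lift_dim t : U t -> (p < N')%N.
move=> Ut; have fj : jac f t *m E' *m (f t)^T = 0.
  have := curv_jac_pos E'_sym QE oU sf cff Ut; rewrite Qk => /eqP.
  by rewrite scaler_eq0 (negPf kn0) => /eqP.
have fr : row_free (col_mx (jac f t) (f t)).
  apply: inj_row_free => v; rewrite -[v]hsubmxK mul_row_col => H.
  have jf : f t *m E' *m (jac f t)^T = 0 by apply: (can_inj (@trmxK _ _ _)); rewrite !trmx_mul trmxK E'_sym trmx0 mulmxA fj.
  have l0 : lsubmx v = 0.
    have := congr1 (fun X => X *m E' *m (jac f t)^T) H; rewrite /= !mul0mx !mulmxDl -!mulmxA (mulmxA (jac f t)).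
    rewrite (mulmxA (f t)) jf mulmx0 addr0 => H1; have gE : gm E' f t = jac f t *m E' *m (jac f t)^T by rewrite gmE.
    by rewrite -[lsubmx v](mulmxK (gU' Ut)) gE H1 mul0mx.
  have r0 : rsubmx v = 0.
    move: H; rewrite l0 mul0mx add0r => /(congr1 (fun X => X *m E' *m (f t)^T)); rewrite /= !mul0mx -!mulmxA (mulmxA (f t)).
    have -> : f t *m E' *m (f t)^T = (k^-1)%:M.
      by apply: mx11_eq; rewrite -QE ff// mxE mulr1n.
    by rewrite mul_mx_scalar => /eqP; rewrite scaler_eq0 invr_eq0 (negPf kn0) => /eqP.
  by rewrite l0 r0 row_mx0.
by have := rank_leq_col (col_mx (jac f t) (f t)); rewrite (eqP fr) addn1.
Qed.

End FactorImmersion.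

(** * A ball as a manifold with one chart *)

Section BallManifold.
Variables (R : realType) (p : nat).

Lemma rV_second_countable : @second_countable 'rV[R]_p.
pose B (i : 'rV[rat]_p * rat) : set 'rV[R]_p := @ball R 'rV[R]_p (map_mx ratr i.1) (ratr i.2).
exists (range B).
  by apply: (sub_countable (card_image_le B setT)); exact: countableP.
split=> [A [i _ <-]|x A /nbhs_ballP[e /= e0 eA]]; first exact: ball_open.
have e42 : e / 4 < e / 2 by lra.
have [r] := rat_in_itvoo e42; rewrite in_itv /= => /andP[r4 r2].
have rp : 0 < ratr r :> R by apply: lt_trans r4; rewrite divr_gt0.
have /choice[q qP] : forall j, exists q : rat, `|x 0 j - ratr q| < ratr r.
  move=> j; have h : x 0 j - ratr r < x 0 j + ratr r by lra.
  have [q] := rat_in_itvoo h; rewrite in_itv /= => /andP[q1 q2]; exists q.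
  by rewrite ltr_norml; apply/andP; split; lra.
exists (B (\row_j q j, r)).
  split; first by exists (\row_j q j, r).
  rewrite /B -ball_normE /=; apply: mx_norm_lt => // i j.
  by rewrite !ord1 !mxE distrC.
move=> y; rewrite /B /= => By; apply: eA; rewrite -ball_normE /=; apply: mx_norm_lt => // i j.
move: By; rewrite -ball_normE /= => By; have := le_lt_trans (mx_norm_ge _ 0 j) By.
have := qP j; rewrite !ord1 !mxE => h1 h2.
have -> : x 0 j - y 0 j = (x 0 j - ratr (q j)) + (ratr (q j) - y 0 j) by ring.
by apply: le_lt_trans (ler_normD _ _) _; lra.
Qed.

Lemma rV_connected : connected [set: 'rV[R]_p].
have -> : [set: 'rV[R]_p] = \bigcup_(v in setT) ((fun t : R => t *: v) @` setT).
  by apply/seteqP; split=> // v _; exists v => //; exists 1 => //; rewrite scale1r.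
apply: bigcup_connected; first by exists 0 => v _; exists 0 => //; rewrite scale0r.
move=> v _; apply: connected_continuous_connected.
  by apply/connected_intervalP => x y _ _ z _.
by apply: continuous_subspaceT => t; apply: cvgZr_tmp; exact: cvg_id.
Qed.

Variables (c : 'rV[R]_p) (e : R).
Hypothesis e0 : 0 < e.

(* Coordinatewise [t |-> c + e t / (1 + |t|)] and its inverse. *)
Definition bsquash (v : 'rV[R]_p) : 'rV[R]_p :=
  \row_j (c 0 j + e * (v 0 j / (1 + `|v 0 j|))).
Definition bunsquash (w : 'rV[R]_p) : 'rV[R]_p :=
  \row_j (let r := (w 0 j - c 0 j) / e in r / (1 - `|r|)).
(** The carrier is all of R^p and only its chart takes values in the ball. With a single chart the
    transition is the identity of the ball, so the squashing map need only be a homeomorphism. *)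
Definition ball_chart : chart R 'rV[R]_p p := Chart setT bsquash bunsquash.

Let n0 (t : R) : 0 < 1 + `|t|. by rewrite ltr_pwDl. Qed.
Let en0 : e != 0. by rewrite gt_eqF. Qed.

Lemma bsquashK v : bunsquash (bsquash v) = v.
apply/rowP => j; rewrite !mxE; move: (v 0 j) => t; have t0 := n0 t.
have -> : (c 0 j + e * (t / (1 + `|t|)) - c 0 j) / e = t / (1 + `|t|).
  by rewrite addrC addKr mulrC mulKf.
rewrite /= normrM normfV (gtr0_norm t0); move: (`|t|) t0 => b b0.
by field; rewrite gt_eqF//= (_ : 1 + b - b = 1) ?oner_eq0//; ring.
Qed.

Lemma squash_ball v : ball c e (bsquash v).
rewrite -ball_normE /=; apply: mx_norm_lt => // i j; rewrite !ord1 !mxE.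
rewrite opprD addrA subrr add0r normrN normrM (gtr0_norm e0) normrM normfV (gtr0_norm (n0 _)).
by rewrite -[ltRHS]mulr1 ltr_pM2l// ltr_pdivrMr ?n0// mul1r ltrDr.
Qed.

Lemma bunsquashK w : ball c e w -> bsquash (bunsquash w) = w.
rewrite -ball_normE /= => Bw; apply/rowP => j; rewrite !mxE /=.
have : `|(w 0 j - c 0 j) / e| < 1.
  rewrite normrM normfV (gtr0_norm e0) ltr_pdivrMr// mul1r.
  by have := le_lt_trans (mx_norm_ge _ 0 j) Bw; rewrite !mxE distrC.
have wE : w 0 j = c 0 j + e * ((w 0 j - c 0 j) / e) by rewrite [e * _]mulrC divfK// addrC subrK.
rewrite [RHS]wE; move: ((w 0 j - c 0 j) / e) => r r1; congr (_ + e * _).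
have d0 : 0 < 1 - `|r| by rewrite subr_gt0.
rewrite normrM normfV (gtr0_norm d0); move: (`|r|) d0 => b d0.
by field; rewrite gt_eqF//= (_ : 1 - b + b = 1) ?oner_eq0//; ring.
Qed.

Lemma ball_chart_cimg : cimg ball_chart = ball c e.
apply/seteqP; split=> [w [v _ <-]|w Bw]; first exact: squash_ball.
by exists (bunsquash w) => //; exact: bunsquashK.
Qed.

Lemma squash_coord_continuous (a b t : R) : {for t, continuous (fun t : R => a + b * (t / (1 + `|t|)))}.
have cd : (1 + `|u|) @[u --> t] --> 1 + `|t|.
  by apply: cvgD; [exact: cvg_cst|exact: cvg_norm].
have cq : (u / (1 + `|u|)) @[u --> t] --> t / (1 + `|t|).
  by apply: cvgM => //; apply: cvgV cd; rewrite gt_eqF// ltr_pwDl.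
by apply: cvgD; [exact: cvg_cst|apply: cvgM cq; exact: cvg_cst].
Qed.
Lemma unsquash_coord_continuous (a b t : R) : 1 - `|(t - a) / b| != 0 -> {for t, continuous (fun t : R => (t - a) / b / (1 - `|(t - a) / b|))}.
move=> d0.
have cr : ((u - a) / b) @[u --> t] --> (t - a) / b.
  by apply: cvgM; [apply: cvgB; [exact: cvg_id|exact: cvg_cst]|exact: cvg_cst].
have cd : (1 - `|(u - a) / b|) @[u --> t] --> 1 - `|(t - a) / b|.
  by apply: cvgB; [exact: cvg_cst|exact: cvg_norm].
by apply: cvgM => //; apply: cvgV cd.
Qed.

Lemma squash_continuous : continuous bsquash.
move=> v; apply/mx_continuousP => i j.
have -> : (fun w => bsquash w i j) = (fun t => c 0 j + e * (t / (1 + `|t|))) \o (fun w : 'rV[R]_p => w 0 j).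
  by apply/funext => w; rewrite !ord1 /= mxE.
by apply: continuous_comp; [exact: coord_continuous|exact: squash_coord_continuous].
Qed.

Lemma unsquash_continuous w : ball c e w -> {for w, continuous bunsquash}.
move=> Bw; apply/mx_continuousP => i j.
have -> : (fun u => bunsquash u i j) = (fun t => (t - c 0 j) / e / (1 - `|(t - c 0 j) / e|)) \o (fun u : 'rV[R]_p => u 0 j).
  by apply/funext => u; rewrite !ord1 /= mxE.
apply: continuous_comp; first exact: coord_continuous.
apply: unsquash_coord_continuous; move: Bw; rewrite -ball_normE /= => Bw.
rewrite gt_eqF// subr_gt0 normrM normfV (gtr0_norm e0) ltr_pdivrMr// mul1r.
by have := le_lt_trans (mx_norm_ge _ 0 j) Bw; rewrite !mxE distrC.
Qed.

Lemma ball_chart_manifold : is_manifold [set ball_chart].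
have oB : open (ball c e) by exact: ball_open.
split; first split.
- exact: norm_hausdorff.
- exact: rV_second_countable.
- exact: rV_connected.
- by exists 0.
split.
- move=> _ ->; split; [exact: openT|by rewrite ball_chart_cimg| | |].
  + by move=> v _; exact: bsquashK.
  + by move=> v _; exact: squash_continuous.
  + by rewrite ball_chart_cimg => w; exact: unsquash_continuous.
- by move=> v; exists ball_chart.
move=> _ _ -> ->; rewrite setIid -/(cimg ball_chart) ball_chart_cimg.
apply: (sm_ext oB _ (sm_id oB)) => w Bw /=.
by rewrite bunsquashK.
Qed.

End BallManifold.

(** * Splitting the Lorentz space along three mutually orthogonal families *)

Section SplitFrame.
Variable R : realType.

Lemma lorentz_transformation_mink n (T : 'M[R]_(1 + n)) : lorentz_transformation T ->
  T *m mink R n *m T^T = mink R n.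
move=> [TT _]; apply/matrixP => i j; have := TT (row i 1%:M) (row j 1%:M).
rewrite -!row_mul !mul1mx !(@lorentzE R n).
have gen (A B : 'M[R]_(1 + n)) : (row i A *m col j B) 0 0 = (A *m B) i j.
  by rewrite !mxE; eqbig k; rewrite !mxE.
have H (X : 'M[R]_(1 + n)) : (row i X *m mink R n *m (row j X)^T) 0 0 = (X *m mink R n *m X^T) i j.
  by rewrite -row_mul tr_row gen.
by rewrite !H mul1mx trmx1 mulmx1.
Qed.

Lemma mink_unit n : mink R n \in unitmx.
have H : mink R n *m mink R n = 1%:M.
  rewrite /mink mulmx_block !mulmx0 !mul0mx !addr0 add0r mulmx1 -scalar_mxM mulrNN mulr1.
  by rewrite -scalar_mx_block.
by case: (mulmx1_unit H).
Qed.

Lemma lorentz_transformation_unit n (T : 'M[R]_(1 + n)) : lorentz_transformation T -> T \in unitmx.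
move=> /lorentz_transformation_mink H; have := mink_unit n; rewrite -H !unitmx_mul.
by case/andP => /andP[].
Qed.

Lemma lorentz_transformation_inv_mink n (T : 'M[R]_(1 + n)) : lorentz_transformation T ->
  invmx T *m mink R n *m (invmx T)^T = mink R n.
move=> lT; have Tu := lorentz_transformation_unit lT.
rewrite -[in LHS](lorentz_transformation_mink lT) !mulmxA mulVmx// mul1mx -mulmxA -trmx_mul mulVmx// trmx1.
by rewrite mulmx1.
Qed.

Lemma block_row n r (v : 'rV[R]_(1 + n)) (Q : 'M[R]_(n, r)) :
  v *m block_mx 1%:M 0 0 Q = row_mx (lsubmx v) (rsubmx v *m Q).
by rewrite -{1}[v]hsubmxK mul_row_block !mulmx0 mulmx1 addr0 add0r. Qed.

Lemma row_mx00 n (a : 'M[R]_1) (b : 'rV[R]_n) : row_mx a b 0 0 = a 0 0.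
by rewrite (_ : (0 : 'I_(1 + n)) = lshift n 0) ?row_mxEl//; exact/val_inj. Qed.

Lemma lsubmx00 n (v : 'rV[R]_(1 + n)) : lsubmx v 0 0 = v 0 0.
by rewrite -{2}[v]hsubmxK row_mx00. Qed.

Lemma castmx_orth n k l (e : k = l) (X : 'M[R]_(n, k)) :
  castmx (erefl n, e) X *m (castmx (erefl n, e) X)^T = X *m X^T.
by case: _ / e; rewrite castmx_id. Qed.

Lemma mulmx_castr n p k l (e : k = l) (v : 'M[R]_(p, n)) (X : 'M[R]_(n, k)) :
  v *m castmx (erefl n, e) X = castmx (erefl p, e) (v *m X).
by case: _ / e; rewrite !castmx_id. Qed.

Lemma orthogonal_lorentz n (O : 'M[R]_n) : O *m O^T = 1%:M ->
  lorentz_transformation (block_mx 1%:M 0 0 O : 'M[R]_(1 + n)).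
move=> OO; split=> [u v|u _ up]; rewrite !block_row; last by rewrite row_mx00 lsubmx00.
rewrite /lorentz !row_mx00 !lsubmx00 !row_mxKr !dotE !mulmx1 trmx_mul !mulmxA -(mulmxA _ O) OO mulmx1.
by [].
Qed.

Variables (M : Type) (N : nat) (y : 'I_3 -> M -> 'rV[R]_(1 + N)) (q0 : M).
Hypothesis yy : forall a b p q, a != b -> lorentz (y a p) (y b q) = 0.
Hypotheses (yn : lorentz (y 0 q0) (y 0 q0) < 0) (yp : 0 < y 0 q0 0 0).

(** Family 0 contains a timelike vector, which is moved onto the time axis; the two other families
    then have zero time coordinate and are split off by Euclidean orthonormal bases. The matrices
    [L0], [L1], [L2] read coordinates in the three parts and [K0], [K1], [K2] embed the parts back
    isometrically. *)
Lemma split_frame : exists (r0 r1 r2 : nat) (e : (r0 + r1 + r2)%N = N) (T : 'M[R]_(1 + N))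
    (L0 : 'M[R]_(1 + N, 1 + r0)) (L1 : 'M[R]_(1 + N, r1)) (L2 : 'M[R]_(1 + N, r2))
    (K0 : 'M[R]_(1 + r0, 1 + N)) (K1 : 'M[R]_(r1, 1 + N)) (K2 : 'M[R]_(r2, 1 + N)),
  [/\ lorentz_transformation T,
     forall u : 'rV[R]_(1 + N), (u *m T) 0 0 = (u *m L0) 0 0 &
     forall u : 'rV[R]_(1 + N), rsubmx (u *m T) =
       castmx (erefl 1%N, e) (row_mx (row_mx (rsubmx (u *m L0)) (u *m L1)) (u *m L2))] /\
  [/\ forall q, y 0 q = y 0 q *m L0 *m K0, forall q, y 1 q = y 1 q *m L1 *m K1 &
      forall q, y 2 q = y 2 q *m L2 *m K2] /\
  [/\ K0 *m mink R N *m K0^T = mink R r0, K1 *m mink R N *m K1^T = 1%:M &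
      K2 *m mink R N *m K2^T = 1%:M] /\
  [/\ forall q, y 1 q *m L0 = 0 /\ y 2 q *m L0 = 0,
      forall q, y 0 q *m L1 = 0 /\ y 2 q *m L1 = 0 &
      forall q, y 0 q *m L2 = 0 /\ y 1 q *m L2 = 0].
have [T0 lT0 T0E] : exists2 T0, lorentz_transformation T0 &
    exists2 d : R, d != 0 & y 0 q0 *m T0 = row_mx d%:M 0.
  (* The normal form is available for past vectors, hence the sign. *)
  have [||T lT TE] := @normal_timelike R N (- y 0 q0).
  - by rewrite -scaleN1r lorentzZl lorentzZr mulN1r mulN1r opprK.
  - by rewrite mxE oppr_lt0.
  move: TE; set h := Num.sqrt _ => TE; exists T => //; exists h.
    rewrite gt_eqF// sqrtr_gt0 oppr_gt0 -[- y 0 q0]scaleN1r lorentzZl lorentzZr mulN1r mulN1r opprK //.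
  rewrite -[LHS]opprK -mulNmx TE opp_row_mx oppr0; congr row_mx; apply: mx11_eq.
  by rewrite !mxE !mulr1n opprK.
case: T0E => d d0 T0E; have [TT _] := lT0.
pose f a q := rsubmx (y a q *m T0).
have w0 a q : a != 0 -> y a q *m T0 = row_mx 0 (f a q).
  move=> a0; rewrite -[LHS]hsubmxK; congr row_mx; apply: mx11_eq; rewrite lsubmx00 [RHS]mxE.
  have := yy q0 q (a := 0) (b := a); rewrite eq_sym a0 => /(_ isT).
  rewrite -TT T0E /lorentz row_mx00 row_mxKr [dot 0 _]dotE !mul0mx [(0 : 'M[R]_1) _ _]mxE addr0 [_%:M _ _]mxE mulr1n.
  by move=> /eqP; rewrite oppr_eq0 mulf_eq0 (negPf d0) => /eqP.
have ff a b p q : a != b -> b != 0 -> f a p *m (f b q)^T = 0.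
  move=> ab b0; have := yy p q ab; rewrite -TT (w0 b)// -[y a p *m T0]hsubmxK (@lorentzE R N) row_mx_mink.
  by rewrite trmx0 mulmx0 oppr0 add0r => H; apply: mx11_eq; rewrite H mxE.
have [k1 [B1 [fB1 B1f]]] := span_family (f 1); have [k2 [B2 [fB2 B2f]]] := span_family (f 2).
have tr0 k l h (X : 'M[R]_(k, h)) (Y : 'M[R]_(l, h)) : X *m Y^T = 0 -> Y *m X^T = 0.
  by move=> XY; rewrite -[LHS]trmxK trmx_mul trmxK XY trmx0.
have BB : B1 *m B2^T = 0.
  apply/matrixP => k i; have : B1 *m (row i B2)^T = 0.
    apply: B1f => p; have H : f 1 p *m B2^T = 0 by apply: tr0; apply: B2f => q; exact: ff.
    by rewrite tr_row colE mulmxA H mul0mx.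
  by rewrite tr_row colE mulmxA -colE => /matrixP/(_ k 0); rewrite [LHS]mxE => ->; rewrite !mxE.
have [r0 [r1 [r2 [Q0 [Q1 [Q2 [[e QB1 QB2 QQ] [[QQ0 QQ1 QQ2] [Q01 Q02 Q12]]]]]]]]] := orthonormal_splitting BB.
have f1Q q : f 1 q = f 1 q *m Q1^T *m Q1.
  have /submxP[z ->] : (f 1 q <= Q1)%MS by rewrite QB1.
  by rewrite -(mulmxA z) QQ1 mulmx1.
have f2Q q : f 2 q = f 2 q *m Q2^T *m Q2.
  have /submxP[z ->] : (f 2 q <= Q2)%MS by rewrite QB2.
  by rewrite -(mulmxA z) QQ2 mulmx1.
have Q1f (w : 'rV_N) : B1 *m w^T = 0 -> w *m Q1^T = 0.
  move=> Bw; apply: tr0; have /submxP[z ->] : (Q1 <= B1)%MS by rewrite QB1.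
  by rewrite -mulmxA Bw mulmx0.
have Q2f (w : 'rV_N) : B2 *m w^T = 0 -> w *m Q2^T = 0.
  move=> Bw; apply: tr0; have /submxP[z ->] : (Q2 <= B2)%MS by rewrite QB2.
  by rewrite -mulmxA Bw mulmx0.
have f0Q1 q : f 0 q *m Q1^T = 0 by apply: Q1f; apply: B1f => p; apply: tr0; apply: ff.
have f0Q2 q : f 0 q *m Q2^T = 0 by apply: Q2f; apply: B2f => p; apply: tr0; apply: ff.
have f2Q1 q : f 2 q *m Q1^T = 0 by apply: Q1f; apply: B1f => p; apply: tr0; apply: ff.
have f1Q2 q : f 1 q *m Q2^T = 0 by apply: Q2f; apply: B2f => p; apply: tr0; apply: ff.
have f0Q q : f 0 q = f 0 q *m Q0^T *m Q0.
  by rewrite -[LHS]mulmx1 -QQ !mulmxDr !mulmxA f0Q1 f0Q2 !mul0mx !addr0.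
have f1Q0 q : f 1 q *m Q0^T = 0 by rewrite f1Q -mulmxA (tr0 _ _ _ _ _ Q01) mulmx0.
have f2Q0 q : f 2 q *m Q0^T = 0 by rewrite f2Q -mulmxA (tr0 _ _ _ _ _ Q02) mulmx0.
have Tu := lorentz_transformation_unit lT0; have Ti := lorentz_transformation_inv_mink lT0.
pose O := castmx (erefl N, e) (row_mx (row_mx Q0^T Q1^T) Q2^T).
have OO : O *m O^T = 1%:M.
  by rewrite /O castmx_orth !tr_row_mx !mul_row_col !trmxK.
have K0E : block_mx 1%:M 0 0 Q0 *m mink R N *m (block_mx 1%:M 0 0 Q0)^T = mink R r0.
  rewrite /mink tr_block_mx !trmx0 trmx1 !mulmx_block !mulmx0 !mul0mx !mulmx1 !mul1mx !addr0 !add0r QQ0.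
  by rewrite mul0mx.
have K1E k (Q : 'M[R]_(k, N)) : Q *m Q^T = 1%:M -> row_mx 0 Q *m mink R N *m (row_mx 0 Q)^T = 1%:M.
  by move=> H; rewrite row_mx_mink mul0mx oppr0 add0r.
have KT k (X : 'M[R]_(k, 1 + N)) Z : X *m mink R N *m X^T = Z ->
    X *m invmx T0 *m mink R N *m (X *m invmx T0)^T = Z.
  by move=> <-; rewrite trmx_mul !mulmxA -(mulmxA X) -(mulmxA X) Ti.
exists r0, r1, r2, e, (T0 *m block_mx 1%:M 0 0 O), (T0 *m block_mx 1%:M 0 0 Q0^T).
exists (T0 *m col_mx 0 Q1^T), (T0 *m col_mx 0 Q2^T).
exists (block_mx 1%:M 0 0 Q0 *m invmx T0), (row_mx 0 Q1 *m invmx T0), (row_mx 0 Q2 *m invmx T0).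
have c0 k (v : 'rV[R]_(1 + N)) (Q : 'M[R]_(N, k)) : v *m col_mx 0 Q = rsubmx v *m Q.
  by rewrite -{1}[v]hsubmxK mul_row_col mulmx0 add0r.
have wE q : y 0 q *m T0 = row_mx (lsubmx (y 0 q *m T0)) (f 0 q) by rewrite hsubmxK.
split; [split|split; [split|split; [split|split]]].
- by apply: lorentz_transformationM => //; exact: orthogonal_lorentz.
- by move=> u; rewrite !mulmxA !block_row !row_mx00.
- move=> u; rewrite !mulmxA !block_row !row_mxKr !c0.
  by rewrite /O mulmx_castr !mul_mx_row.
- move=> q; rewrite !mulmxA block_row; move: (wE q); set w := y 0 q *m T0 => wE'.
  rewrite block_row row_mxKl row_mxKr -/(f 0 q) -f0Q -wE' /w mulmxK//.
- by move=> q; rewrite !mulmxA c0 -/(f 1 q) mul_mx_row mulmx0 -f1Q -w0// mulmxK.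
- by move=> q; rewrite !mulmxA c0 -/(f 2 q) mul_mx_row mulmx0 -f2Q -w0// mulmxK.
- exact: KT.
- by apply: KT; exact: K1E.
- by apply: KT; exact: K1E.
- by move=> q; split; rewrite mulmxA w0// block_row row_mxKl row_mxKr ?f1Q0 ?f2Q0 row_mx0.
- by move=> q; split; rewrite mulmxA c0; [exact: f0Q1|exact: f2Q1].
- by move=> q; split; rewrite mulmxA c0; [exact: f0Q2|exact: f1Q2].
Qed.

End SplitFrame.

Lemma open_setI_preimage (T T' : topologicalType) (B : set T) (O : set T') (f : T -> T') :
  open B -> open O -> (forall u, B u -> {for u, continuous f}) ->
  open [set u | B u /\ O (f u)].
move=> oB oO cf; rewrite openE => u [Bu Ou]; rewrite /interior.
have N1 : nbhs u B by exact: open_nbhs_nbhs.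
have N2 : nbhs u (f @^-1` O) by apply: (cf u Bu); exact: open_nbhs_nbhs.
by apply: filterS (filterI N1 N2) => v [].
Qed.

(** * Adapted coordinates as an open embedding of a product of three balls *)

Section ProductEmbedding.
Variables (R : realType) (m : nat) (M : topologicalType) (A : set (chart R M m)).
Hypothesis mA : is_manifold A.
Variables (mu : 'I_3 -> nat).
Hypothesis mu_sum : (mu 0%R + mu 1%R + mu 2%R)%N = m.
Notation I_ a := (binc R mu_sum a).
Variables (c : chart R M m) (Ac : A c) (V : set 'rV[R]_m) (w0 : 'rV[R]_m) (e : R).
Variables (zeta psi : 'rV[R]_m -> 'rV[R]_m).
Hypotheses (oV : open V) (VU : V `<=` cimg c) (e0 : 0 < e).
Hypotheses (psiV : forall w, ball w0 e w -> V (psi w) /\ zeta (psi w) = w).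
Hypotheses (Vpsi : forall u, V u -> ball w0 e (zeta u) /\ psi (zeta u) = u).
Hypotheses (sz : Coo (cimg c) zeta) (sp : Coo (ball w0 e) psi).

Notation X3 := ('rV[R]_(mu 0) * 'rV[R]_(mu 1) * 'rV[R]_(mu 2))%type.
Definition ball_charts a : set (chart R 'rV[R]_(mu a) (mu a)) :=
  [set ball_chart (w0 *m (I_ a)^T) e].
Notation bc a := (@ball_charts a).
Definition block_squash a := bsquash (w0 *m (I_ a)^T) e.
Definition block_unsquash a := bunsquash (w0 *m (I_ a)^T) e.
Notation sq a := (@block_squash a).
Notation us a := (@block_unsquash a).
Definition blocks : 'M[R]_(mu 0 + mu 1 + mu 2, m) := col_mx (col_mx (I_ 0) (I_ 1)) (I_ 2).
Definition squash3 (z : X3) : 'rV[R]_(mu 0 + mu 1 + mu 2) :=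
  row_mx (row_mx (sq 0 z.1.1) (sq 1 z.1.2)) (sq 2 z.2).
Definition unsquash3 (u : 'rV[R]_(mu 0 + mu 1 + mu 2)) : X3 :=
  ((us 0 (lsubmx (lsubmx u)), us 1 (rsubmx (lsubmx u))), us 2 (rsubmx u)).
Definition product_param (z : X3) : M := cinv c (psi (squash3 z *m blocks)).
Definition product_coord (q : M) : X3 := unsquash3 (zeta (cmap c q) *m blocks^T).
Notation F := product_param.
Notation G := product_coord.

Let n01 : (0 : 'I_3) != 1. by []. Qed.
Let n02 : (0 : 'I_3) != 2. by []. Qed.
Let n12 : (1 : 'I_3) != 2. by []. Qed.

Lemma blocks_row v0 v1 v2 : row_mx (row_mx v0 v1) v2 *m blocks = v0 *m I_ 0 + v1 *m I_ 1 + v2 *m I_ 2 :> 'rV_m.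
by rewrite /blocks !mul_row_col. Qed.

Lemma squash3_blocks z : squash3 z *m blocks = sq 0 z.1.1 *m I_ 0 + sq 1 z.1.2 *m I_ 1 + sq 2 z.2 *m I_ 2.
exact: blocks_row. Qed.

Lemma mul_blocks_tr (w : 'rV[R]_m) : w *m blocks^T = row_mx (row_mx (w *m (I_ 0)^T) (w *m (I_ 1)^T)) (w *m (I_ 2)^T).
by rewrite /blocks !tr_col_mx !mul_mx_row. Qed.

Lemma blocksK : blocks^T *m blocks = 1%:M.
by rewrite /blocks !tr_col_mx !mul_row_col -(binc_sum R mu_sum) big3. Qed.

Lemma blocksTK : blocks *m blocks^T = 1%:M.
rewrite /blocks !tr_col_mx !mul_col_row mul_col_mx mul_mx_row !bincK.
rewrite (binc_neq R mu_sum n01) (binc_neq R mu_sum n02) (binc_neq R mu_sum n12).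
rewrite (@binc_neq R _ _ mu_sum 1 0)// (@binc_neq R _ _ mu_sum 2 0)// (@binc_neq R _ _ mu_sum 2 1)//.
by rewrite -scalar_mx_block col_mx0 row_mx0 -scalar_mx_block.
Qed.

Lemma squash3_block z :
  [/\ squash3 z *m blocks *m (I_ 0)^T = sq 0 z.1.1, squash3 z *m blocks *m (I_ 1)^T = sq 1 z.1.2 &
      squash3 z *m blocks *m (I_ 2)^T = sq 2 z.2].
rewrite squash3_blocks !mulmxDl -!mulmxA !bincK !mulmx1.
rewrite (binc_neq R mu_sum n01) (binc_neq R mu_sum n02) (binc_neq R mu_sum n12).
rewrite (@binc_neq R _ _ mu_sum 1 0)// (@binc_neq R _ _ mu_sum 2 0)// (@binc_neq R _ _ mu_sum 2 1)//.
by rewrite !mulmx0 !addr0 !add0r.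
Qed.

Lemma squash3_ball z : ball w0 e (squash3 z *m blocks).
apply/(ball_binc mu_sum _ _ e0) => a; have [h0 h1 h2] := squash3_block z.
by case: (ord3_cases a) => ->; rewrite ?h0 ?h1 ?h2; exact: squash_ball.
Qed.

Lemma squash3K : cancel squash3 unsquash3.
move=> [[z0 z1] z2]; rewrite /unsquash3 /squash3 !row_mxKl !row_mxKr.
by rewrite /block_unsquash /block_squash /= !bsquashK.
Qed.

Lemma unsquash3K w : ball w0 e w -> squash3 (unsquash3 (w *m blocks^T)) = w *m blocks^T.
move=> /(ball_binc mu_sum _ _ e0) Bw; rewrite mul_blocks_tr /unsquash3 /squash3 /= !row_mxKl !row_mxKr.
by rewrite /block_unsquash /block_squash !bunsquashK.
Qed.

Lemma product_param_cimg z : V (psi (squash3 z *m blocks)) /\ cimg c (psi (squash3 z *m blocks)).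
by have [h _] := psiV (squash3_ball z); split=> //; exact: VU. Qed.

Lemma product_coordK : cancel F G.
move=> z; have [h1 h2] := product_param_cimg z.
rewrite /product_coord /product_param.
have [_ ->] := chart_cinv mA Ac h2; have [_ ->] := psiV (squash3_ball z).
have -> : squash3 z *m blocks *m blocks^T = squash3 z; last exact: squash3K.
by rewrite mul_blocks_tr; have [-> -> ->] := squash3_block z.
Qed.

Lemma product_paramK q : cdom c q -> V (cmap c q) -> F (G q) = q.
move=> cq Vq; have [h1 h2] := Vpsi Vq; rewrite /product_param /product_coord unsquash3K//.
by rewrite -mulmxA blocksK mulmx1 h2 (chart_cmapK mA).
Qed.

Lemma range_product_param : range F = [set q | cdom c q /\ V (cmap c q)].
apply/seteqP; split=> [_ [z _ <-]|q [cq Vq]].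
  by have [h1 h2] := product_param_cimg z; have [h3 h4] := chart_cinv mA Ac h2; rewrite /= h4.
by exists (G q) => //; exact: product_paramK.
Qed.

Let chc : is_chart c. by case: mA => _ [H _ _]; exact: H. Qed.
Let oB : open (ball w0 e). exact: ball_open. Qed.

Lemma product_param_continuous : continuous F.
move=> z; have [h1 h2] := product_param_cimg z; have [_ _ _ _ cc] := chc.
have cs : {for z, continuous (fun z => squash3 z *m blocks)}.
  have cb a (p : X3 -> 'rV[R]_(mu a)) : {for z, continuous p} -> {for z, continuous (fun z => sq a (p z) *m I_ a)}.
    move=> cp; apply: (continuous_comp (f := fun z => sq a (p z)) (g := mulmx^~ (I_ a))).
      by apply: (continuous_comp cp); exact: squash_continuous.
    exact: mulmx_continuous.
  have f1 : {for z, continuous (fst : X3 -> _)} by exact: cvg_fst.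
  have f2 (t : 'rV[R]_(mu 0) * 'rV[R]_(mu 1)) : {for t, continuous fst} by exact: cvg_fst.
  have f3 (t : 'rV[R]_(mu 0) * 'rV[R]_(mu 1)) : {for t, continuous snd} by exact: cvg_snd.
  have c0 : {for z, continuous (fun z : X3 => sq 0 z.1.1 *m I_ 0)} by apply: cb; exact: (continuous_comp f1 (f2 _)).
  have c1 : {for z, continuous (fun z : X3 => sq 1 z.1.2 *m I_ 1)} by apply: cb; exact: (continuous_comp f1 (f3 _)).
  have c2 : {for z, continuous (fun z : X3 => sq 2 z.2 *m I_ 2)} by apply: cb; exact: cvg_snd.
  have -> : (fun z => squash3 z *m blocks) = (fun z => sq 0 z.1.1 *m I_ 0 + sq 1 z.1.2 *m I_ 1 + sq 2 z.2 *m I_ 2).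
    by apply/funext => t; exact: squash3_blocks.
  exact: (cvgD (cvgD c0 c1) c2).
have cp : {for squash3 z *m blocks, continuous psi} by exact: (sm_cont sp (squash3_ball z)).
exact: (continuous_comp (continuous_comp cs cp) (cc _ h2)).
Qed.

Lemma product_coord_continuous q : range F q -> {for q, continuous G}.
rewrite range_product_param => -[cq Vq]; have [Bq _] := Vpsi Vq; have [_ _ _ cm _] := chc.
have cw : {for q, continuous (fun q => zeta (cmap c q))}.
  by apply: (continuous_comp (cm q cq)); exact: (sm_cont sz (chart_cimg cq)).
have cu a : {for q, continuous (fun q => us a (zeta (cmap c q) *m (I_ a)^T))}.
  apply: (continuous_comp (f := fun q => zeta (cmap c q) *m (I_ a)^T)).
    have cI := @mulmx_continuous R _ _ (I_ a)^T (zeta (cmap c q)).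
    exact: (continuous_comp cw cI).
  by apply: unsquash_continuous => //; move/(ball_binc mu_sum _ _ e0): Bq.
have -> : G = fun q => ((us 0 (zeta (cmap c q) *m (I_ 0)^T), us 1 (zeta (cmap c q) *m (I_ 1)^T)),
    us 2 (zeta (cmap c q) *m (I_ 2)^T)).
  by apply/funext => t; rewrite /product_coord mul_blocks_tr /unsquash3 !row_mxKl !row_mxKr.
exact: (cvg_pair (cvg_pair (cu 0) (cu 1)) (cu 2)).
Qed.

Let prodP c1 : prod_atlas (prod_atlas (bc 0) (bc 1)) (bc 2) c1 ->
  [/\ cdom c1 = setT, cmap c1 = squash3 & cinv c1 = unsquash3].
move=> [c12 [c3 [[d1 [d2 [-> -> ->]]] -> ->]]]; split; [|exact: erefl|exact: erefl].
by apply/seteqP; split.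
Qed.

Lemma product_param_open_embedding :
  open_embedding (prod_atlas (prod_atlas (bc 0) (bc 1)) (bc 2)) A F.
split.
  rewrite range_product_param; have [oD _ _ cm _] := chc.
  by apply: open_setI_preimage => // q cq; exact: cm.
exists G; split; first exact: product_coordK.
  split=> [z _|c1 c' /prodP[dE mE iE] Ac']; first exact: product_param_continuous.
  pose W := [set u : 'rV[R]_(mu 0 + mu 1 + mu 2) | ball w0 e (u *m blocks) /\ overlap c' c (psi (u *m blocks))].
  have oL : open [set u : 'rV[R]_(mu 0 + mu 1 + mu 2) | ball w0 e (u *m blocks)].
    have H := open_setI_preimage openT oB (fun u _ => @mulmx_continuous R _ _ blocks u).
    have E : [set u | setT u /\ ball w0 e (u *m blocks)] = [set u | ball w0 e (u *m blocks)].
      by apply/seteqP; split=> u //= [].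
    by rewrite -E.
  have oov := overlap_open mA Ac' Ac.
  have sl (O : set 'rV[R]_(mu 0 + mu 1 + mu 2)) : open O -> Coo O (fun u => u *m blocks).
    by move=> oO; apply: (sm_const_mulmxl oO); exact: sm_id.
  have spl : Coo [set u : 'rV[R]_(mu 0 + mu 1 + mu 2) | ball w0 e (u *m blocks)] (psi \o (fun u => u *m blocks)).
    by apply: (sm_comp oB oL _ _ sp) => //; exact: sl.
  have oW : open W.
    have := open_setI_preimage oL oov (fun u Lu => sm_cont spl Lu).
    by [].
  have WL : W `<=` [set u : 'rV[R]_(mu 0 + mu 1 + mu 2) | ball w0 e (u *m blocks)] by move=> u [].
  apply: (sm_sub (U := W)).
    move=> _ [z [_ Fz] <-]; rewrite mE; split; first exact: squash3_ball.
    by have [h1 h2] := product_param_cimg z; apply/(overlapP mA c' _ Ac).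
  apply: (sm_ext oW (f := transition c' c \o (psi \o (fun u => u *m blocks)))).
    move=> u [Bu _] /=; rewrite /transition /= iE /product_param; congr (cmap c' (cinv c (psi _))).
    have uE : u = (u *m blocks) *m blocks^T.
      by rewrite -mulmxA blocksTK mulmx1.
    by rewrite {2}uE unsquash3K// -uE.
  apply: (sm_comp oov oW (sm_sub WL spl)); last exact: (transition_smooth mA Ac' Ac).
  by move=> u [].
split=> [q Fq|c' c1 Ac' /prodP[dE mE iE]]; first exact: product_coord_continuous.
have oov := overlap_open mA Ac Ac'.
have st := transition_smooth mA Ac Ac'.
pose W := [set u | overlap c c' u /\ V (transition c c' u)].
have oW : open W by apply: (open_setI_preimage oov oV) => u ou; exact: (sm_cont st ou).
apply: (sm_sub (U := W)).
  move=> _ [q [[cq' Fq] _] <-]; move: Fq; rewrite range_product_param => -[cq Vq].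
  split; last by rewrite /transition /= (chart_cmapK mA).
  by exists q.
apply: (sm_ext oW (f := (fun w => w *m blocks^T) \o (zeta \o transition c c'))).
  move=> u [ou Vu] /=; rewrite mE /product_coord -[cmap c (cinv c' u)]/(transition c c' u).
  by rewrite unsquash3K//; have [] := Vpsi Vu.
have oU : open (cimg c) by exact: (chart_open mA).
apply: (sm_const_mulmxl oW); apply: (sm_comp oU oW _ _ sz).
  by apply: sm_sub st => u [].
by move=> u [ou _]; exact: (transition_cimg mA Ac' ou).
Qed.

End ProductEmbedding.

(** * The algebra of the constants of the fourth family *)

Section LSConstants.
Variable R : realType.

(** The solution of the linear system is the triple of Blaschke eigenvalues itself, the curvatures
    of the factors being $-1/r_1^2$, $1/r_2^2$, $1/r_3^2$. The hypotheses on the sums over $a$ give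
    the moments of the weights $1/k_a$ at the $l_a$, from which the numbers $B_a$ are recovered. *)
Lemma LS_constants (m0 m1 m2 : nat) (l0 l1 l2 k0 k1 k2 e0 e1 e2 : R) :
  let M : R := (m0 + m1 + m2)%:R in
  let t := m0%:R * l0 + m1%:R * l1 + m2%:R * l2 in
  [/\ (0 < m0)%N, (0 < m1)%N & (0 < m2)%N] -> [/\ l0 != l1, l0 != l2 & l1 != l2] ->
  [/\ k0 < 0, 0 < k1 & 0 < k2] ->
  [/\ M * l0 + t = m0%:R * k0, M * l1 + t = m1%:R * k1 & M * l2 + t = m2%:R * k2] ->
  k0^-1 + k1^-1 + k2^-1 = 0 -> l0 / k0 + l1 / k1 + l2 / k2 = 1 ->
  [/\ m0%:R * k0 <= e0, m1%:R * k1 <= e1 & m2%:R * k2 <= e2] ->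
  e0 + e1 + e2 = (M - 1) / M + 2 * t ->
  exists r1 r2 r3 n1 n2 n3 K : R,
    [/\ r1 ^+ 2 = - k0^-1, r2 ^+ 2 = k1^-1 & r3 ^+ 2 = k2^-1] /\
    [/\ LS_parameters m0 m1 m2 r1 r2 r3 n1 n2 n3,
        m2%:R * r2 ^+ 2 <> m1%:R * r3 ^+ 2, LS_constant m0 m1 m2 r1 r2 r3 K &
        [/\ n1 * K = m0%:R * k0 - e0, n2 * K = m1%:R * k1 - e1 & n3 * K = m2%:R * k2 - e2]].
move=> M t [m0p m1p m2p] [l01 l02 l12] [k0n k1p k2p] [E0 E1 E2] sk sl [le0 le1 le2] se.
have Mp : 0 < M by rewrite ltr0n addn_gt0 m2p orbT.
have [k0' k1' k2'] : [/\ k0 != 0, k1 != 0 & k2 != 0] by rewrite lt_eqF// !gt_eqF.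
(* Substitute $m_a=(Ml_a+t)/k_a$ into $t=\sum m_al_a$; the terms in [t] cancel because the first
   moment is 1. *)
have sl2 : l0 ^+ 2 / k0 + l1 ^+ 2 / k1 + l2 ^+ 2 / k2 = 0.
  have a0 : m0%:R = (M * l0 + t) / k0 by rewrite E0 mulfK.
  have a1 : m1%:R = (M * l1 + t) / k1 by rewrite E1 mulfK.
  have a2 : m2%:R = (M * l2 + t) / k2 by rewrite E2 mulfK.
  have : t = M * (l0 ^+ 2 / k0 + l1 ^+ 2 / k1 + l2 ^+ 2 / k2) + t * (l0 / k0 + l1 / k1 + l2 / k2).
    rewrite {1}/t; transitivity ((M * l0 + t) / k0 * l0 + (M * l1 + t) / k1 * l1 + (M * l2 + t) / k2 * l2).
      by rewrite -a0 -a1 -a2.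
    by move: (t) (k0^-1) (k1^-1) (k2^-1) => ? ? ? ?; ring.
  rewrite sl mulr1 => /eqP; rewrite eq_sym -subr_eq0 addrK mulf_eq0 gt_eqF//= => /eqP; exact.
move: sk sl sl2; set b0 := k0^-1; set b1 := k1^-1; set b2 := k2^-1 => sk sl sl2.
(* The moments of order 0, 1, 2 are 0, 1, 0. In the sum of $(l_a-l_1)(l_a-l_2)/k_a$ over $a$ only
   the index 0 survives, and expansion gives $-(l_1+l_2)$; the next two are alike. *)
have F0 : (l0 - l1) * (l0 - l2) * b0 = - (l1 + l2).
  transitivity ((l0 ^+ 2 * b0 + l1 ^+ 2 * b1 + l2 ^+ 2 * b2) - (l1 + l2) * (l0 * b0 + l1 * b1 + l2 * b2) + l1 * l2 * (b0 + b1 + b2)); first by ring.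
  by rewrite sk sl sl2; ring.
have F1 : (l1 - l0) * (l1 - l2) * b1 = - (l0 + l2).
  transitivity ((l0 ^+ 2 * b0 + l1 ^+ 2 * b1 + l2 ^+ 2 * b2) - (l0 + l2) * (l0 * b0 + l1 * b1 + l2 * b2) + l0 * l2 * (b0 + b1 + b2)); first by ring.
  by rewrite sk sl sl2; ring.
have F2 : (l2 - l0) * (l2 - l1) * b2 = - (l0 + l1).
  transitivity ((l0 ^+ 2 * b0 + l1 ^+ 2 * b1 + l2 ^+ 2 * b2) - (l0 + l1) * (l0 * b0 + l1 * b1 + l2 * b2) + l0 * l1 * (b0 + b1 + b2)); first by ring.
  by rewrite sk sl sl2; ring.
have b0n : b0 < 0 by rewrite invr_lt0.
have b1p : 0 < b1 by rewrite invr_gt0.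
have b2p : 0 < b2 by rewrite invr_gt0.
have [d01 d02 d12] : [/\ l0 - l1 != 0, l0 - l2 != 0 & l1 - l2 != 0] by rewrite !subr_eq0.
have [d10 d20 d21] : [/\ l1 - l0 != 0, l2 - l0 != 0 & l2 - l1 != 0] by rewrite -[l1 - l0]opprB -[l2 - l0]opprB -[l2 - l1]opprB !oppr_eq0.
have s12 : l1 + l2 != 0 by rewrite -oppr_eq0 -F0 !mulf_neq0// lt_eqF.
have s02 : l0 + l2 != 0 by rewrite -oppr_eq0 -F1 !mulf_neq0// gt_eqF.
have s01 : l0 + l1 != 0 by rewrite -oppr_eq0 -F2 !mulf_neq0// gt_eqF.
have K0 : k0 = - ((l0 - l1) * (l0 - l2)) / (l1 + l2).
  apply: (mulIf s12); rewrite divfK// -[l1 + l2]opprK -F0 mulrN [_ * b0]mulrC mulrA mulfV// mul1r //.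
have K1 : k1 = - ((l1 - l0) * (l1 - l2)) / (l0 + l2).
  apply: (mulIf s02); rewrite divfK// -[l0 + l2]opprK -F1 mulrN [_ * b1]mulrC mulrA mulfV// mul1r //.
have K2 : k2 = - ((l2 - l0) * (l2 - l1)) / (l0 + l1).
  apply: (mulIf s01); rewrite divfK// -[l0 + l1]opprK -F2 mulrN [_ * b2]mulrC mulrA mulfV// mul1r //.
(* The prescribed products $B_aB_b$ have product $-P$, which must be a square. The sign of [P] is
   that of $k_0k_1k_2$, and exactly one curvature is negative. *)
pose P := (l0 + l1) * (l0 + l2) * (l1 + l2).
have Pn : P < 0.
  have : P * k0 ^+ 2 * k1 ^+ 2 * k2 ^+ 2 = ((l0 - l1) * (l0 - l2) * (l1 - l2)) ^+ 2 * k0 * k1 * k2.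
    by rewrite K0 K1 K2 /P; field; rewrite s01 s02 s12.
  have V0 : 0 < ((l0 - l1) * (l0 - l2) * (l1 - l2)) ^+ 2 by rewrite exprn_even_gt0//= !mulf_neq0.
  move=> H; have : P * (k0 ^+ 2 * k1 ^+ 2 * k2 ^+ 2) < 0.
    rewrite mulrA mulrA H; move: V0; set v := (_ * _ * _) ^+ 2; move: v => v V0.
    by rewrite pmulr_llt0// pmulr_llt0// pmulr_rlt0.
  rewrite pmulr_llt0//; apply: mulr_gt0; [apply: mulr_gt0|]; by rewrite exprn_even_gt0.
(* Up to sign [q] is the product of the three $B_a$; dividing by the product of two of them gives
   the third. *)
pose q := Num.sqrt (- P).
have qq : q ^+ 2 = - P by rewrite sqr_sqrtr// oppr_ge0 ltW.
pose B0 := q / (l1 + l2); pose B1 := q / (l0 + l2); pose B2 := q / (l0 + l1).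
have BB01 : B0 * B1 = - (l0 + l1).
  transitivity (q ^+ 2 / ((l1 + l2) * (l0 + l2))); first by rewrite /B0 /B1; field; rewrite s12 s02.
  by rewrite qq /P; field; rewrite s12 s02.
have BB02 : B0 * B2 = - (l0 + l2).
  transitivity (q ^+ 2 / ((l1 + l2) * (l0 + l1))); first by rewrite /B0 /B2; field; rewrite s12 s01.
  by rewrite qq /P; field; rewrite s12 s01.
have BB12 : B1 * B2 = - (l1 + l2).
  transitivity (q ^+ 2 / ((l0 + l2) * (l0 + l1))); first by rewrite /B1 /B2; field; rewrite s02 s01.
  by rewrite qq /P; field; rewrite s02 s01.
have Bk0 : B0 ^+ 2 = k0 - 2 * l0 by rewrite /B0 expr_div_n qq K0 /P; field.
have Bk1 : B1 ^+ 2 = k1 - 2 * l1 by rewrite /B1 expr_div_n qq K1 /P; field.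
have Bk2 : B2 ^+ 2 = k2 - 2 * l2 by rewrite /B2 expr_div_n qq K2 /P; field.
have sB : m0%:R * B0 + m1%:R * B1 + m2%:R * B2 = 0.
  have a0 : m0%:R = (M * l0 + t) / k0 by rewrite E0 mulfK.
  have a1 : m1%:R = (M * l1 + t) / k1 by rewrite E1 mulfK.
  have a2 : m2%:R = (M * l2 + t) / k2 by rewrite E2 mulfK.
  rewrite a0 a1 a2 /B0 /B1 /B2 K0 K1 K2; move: (t) => tt.
  by field; rewrite d01 d02 d12 d10 d20 d21 s01 s02 s12.
pose K := m0%:R * B0 ^+ 2 + m1%:R * B1 ^+ 2 + m2%:R * B2 ^+ 2 - (M - 1) / M.
(* Each $B_a^2$ equals $k_a-2l_a$, so the constant [K] is the sum of three nonpositive deficits, and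
   the weights are their shares in it. *)
have KE : K = (m0%:R * k0 - e0) + (m1%:R * k1 - e1) + (m2%:R * k2 - e2).
  rewrite /K Bk0 Bk1 Bk2; have -> : (M - 1) / M = e0 + e1 + e2 - 2 * t by rewrite se addrK.
  by rewrite /t; ring.
pose r1 := Num.sqrt (- b0); pose r2 := Num.sqrt b1; pose r3 := Num.sqrt b2.
have R1 : r1 ^+ 2 = - b0 by rewrite sqr_sqrtr// oppr_ge0 ltW.
have R2 : r2 ^+ 2 = b1 by rewrite sqr_sqrtr// ltW.
have R3 : r3 ^+ 2 = b2 by rewrite sqr_sqrtr// ltW.
have LC : LS_constant m0 m1 m2 r1 r2 r3 K.
  exists l0, l1, l2, B0, B1, B2; split; last by split.
  rewrite R1 R2 R3 invrN mulrN opprK /b0 /b1 /b2 !invrK -E0 -E1 -E2 /t /M.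
  by split; ring.
have nE : exists n1 n2 n3 : R, [/\ 0 <= n1, 0 <= n2, 0 <= n3 & n1 + n2 + n3 = 1] /\
    [/\ n1 * K = m0%:R * k0 - e0, n2 * K = m1%:R * k1 - e1 & n3 * K = m2%:R * k2 - e2].
  have x0 : m0%:R * k0 - e0 <= 0 by rewrite subr_le0.
  have x1 : m1%:R * k1 - e1 <= 0 by rewrite subr_le0.
  have x2 : m2%:R * k2 - e2 <= 0 by rewrite subr_le0.
  clear LC; move: x2 x1 x0 KE; clearbody K.
  clear; move: (m0%:R * k0 - e0) (m1%:R * k1 - e1) (m2%:R * k2 - e2) => x0 x1 x2 x2n x1n x0n KE.
  (* If [K] vanishes then so do all three deficits, and any weights of sum 1 are correct. *)
  have [Kz|Kn] := eqVneq K 0.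
    exists 1, 0, 0; split; first by split; rewrite ?ler01// !addr0.
    by rewrite Kz !mulr0; split; lra.
  have Kneg : K < 0 by rewrite lt_neqAle Kn KE; lra.
  exists (x0 / K), (x1 / K), (x2 / K); split; last by rewrite !divfK.
  split; rewrite ?nmulr_lge0 ?invr_lt0//.
  by rewrite -!mulrDl -KE mulfV.
have [n1 [n2 [n3 [nn nK]]]] := nE.
exists r1, r2, r3, n1, n2, n3, K; split=> //; split=> //.
  split=> //; split=> //; split; first by rewrite sqrtr_gt0 oppr_gt0.
  - by rewrite sqrtr_gt0.
  - by rewrite sqrtr_gt0.
  by rewrite R1 R2 R3; apply/eqP; rewrite -subr_eq0 -opprD oppr_eq0 addrA sk.
(* Multiplied by $k_1k_2$, the equality becomes $m_2k_2=m_1k_1$, which by the linear system means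
   that two eigenvalues coincide. *)
rewrite R2 R3 => H; move/eqP: l12; apply; have Mn : M != 0 by [rewrite gt_eqF]; apply: (mulfI Mn); apply: (addIr t).
rewrite E1 E2; have : m2%:R * b1 * (k1 * k2) = m1%:R * b2 * (k1 * k2) by rewrite H.
have -> : m2%:R * b1 * (k1 * k2) = m2%:R * k2 * (b1 * k1) by ring.
have -> : m1%:R * b2 * (k1 * k2) = m1%:R * k1 * (b2 * k2) by ring.
by rewrite /b1 /b2 !mulVf// !mulr1 => ->.
Qed.

End LSConstants.

(** * Constancy of the Blaschke spectrum and the block vectors *)

Section GlobalEigenvalues.
Variables (R : realType) (m n : nat) (M : topologicalType).
Variables (A : set (chart R M m)) (x : M -> 'rV[R]_n.+1).
Hypotheses (mA : is_manifold A) (imm : immersion A (sphere n 1) x).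
Hypotheses (umb : umbilic_free A (sphere n 1) x) (bp : blaschke_parallel A x).
Hypotheses (mf : mobius_form_vanishes A x) (three : three_blaschke_eigenvalues A x).
Notation E := (mink R n.+1).
Notation Y c := (mobius_position (x \o cinv c)).
Notation S c := (bshape (Y c)).
Notation g c := (gm E (Y c)).

Definition adm_at (c : chart R M m) := adm (cimg c) (Y c).

Lemma adm_chart_shape c : A c -> adm_at c (S c).
move=> Ac.
exact: (adm_shape (chart_open mA Ac) (sm_Y mA imm umb three Ac)
  (g_unit mA imm umb three Ac) (@Y_null _ _ _ _ _ _ imm c) (form0c mA imm umb mf three Ac)
  (B_parallel mA imm umb bp three Ac)).
Qed.

Lemma manifold_const_scalar (h : M -> R) :
  (forall c, A c -> Coo (cimg c) (h \o cinv c) /\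
     forall i u, cimg c u -> dd i (h \o cinv c) u = 0) ->
  forall a b, h a = h b.
move=> hA a b; suff : (h a)%:M = (h b)%:M :> 'M[R]_1.
  by move=> /matrixP/(_ 0 0); rewrite !mxE !mulr1n.
apply: (manifold_const (h := fun q => (h q)%:M) mA) => c Ac; have [sh dh] := hA c Ac.
have oU := chart_open mA Ac.
have sM : Coo (cimg c) ((fun q => (h q)%:M : 'M[R]_1) \o cinv c).
  apply/(sm_mxP oU) => i j; apply: (sm_ext oU _ sh) => v _.
  by rewrite !ord1 /= mxE mulr1n.
split=> // i u Uu; apply/matrixP => k l; rewrite !ord1 -(dd_mxE i 0 0 Uu sM) [RHS]mxE.
rewrite -[RHS](dh i u Uu); apply: (dd_ext oU i Uu) => v _.
by rewrite /= mxE mulr1n.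
Qed.

(** The trace of a parallel endomorphism has zero differential, and chart transitions act by
    similarity. *)
Lemma const_trace (P : chart R M m -> 'rV[R]_m -> 'M[R]_m) :
  (forall c, A c -> adm_at c (P c)) ->
  (forall c c' u, A c -> A c' -> overlap c c' u ->
     P c' u *m jac (transition c c') u = jac (transition c c') u *m P c (transition c c' u)) ->
  exists t, forall c u, A c -> cimg c u -> \tr (P c u) = t.
move=> aP tP; pose F c u := \tr (P c u).
have Finv c c' u : A c -> A c' -> overlap c c' u -> F c' u = F c (transition c c' u).
  move=> Ac Ac' ov; have H := tP c c' u Ac Ac' ov.
  have Du := trans_unit mA imm umb three Ac Ac' ov.
  rewrite /F -[P c' u](mulmxK Du) H mxtrace_mulC mulmxA mulVmx// mul1mx//.
have gE c u : A c -> cimg c u -> globalize mA F (cinv c u) = F c u by move=> Ac Uu; exact: globalizeE.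
have cst : forall a b, globalize mA F a = globalize mA F b.
  apply: manifold_const_scalar => c Ac; have oU := chart_open mA Ac.
  have [[sP _] _ _] := aP c Ac; have sF : Coo (cimg c) (F c) by exact: (sm_trace oU sP).
  split; first by apply: (sm_ext oU _ sF) => v Uv /=; rewrite gE.
  move=> i u Uu; transitivity (dd i (F c) u); first by apply: (dd_ext oU i Uu) => v Uv /=; rewrite gE.
  exact: (dd_trace_adm oU i (aP c Ac) Uu).
case: (mA) => [[_ _ _ [q _]] _]; exists (globalize mA F q) => c u Ac Uu.
by rewrite -[LHS]gE.
Qed.

Lemma adm_poly2 c (a b : R) : A c -> adm_at c (fun u => (S c u - a%:M) *m (S c u - b%:M)).
move=> Ac; have oU := chart_open mA Ac; have aS := adm_chart_shape Ac.
apply: (admM oU); [exact: (admB_scalar oU)|exact: (admB_scalar oU)|].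
by move=> u _; exact: shift_comm.
Qed.

Lemma adm_annih c s : A c -> adm_at c (fun u => annih (S c u) s).
move=> Ac; have oU := chart_open mA Ac; have aS := adm_chart_shape Ac.
apply: (admM oU); [exact: adm_poly2|exact: (admB_scalar oU)|].
by move=> u _; rewrite -mulmxA (shift_comm _ (s 1) (s 2)) !mulmxA (shift_comm _ (s 0) (s 2)).
Qed.

Lemma adm_lag c s a : A c -> adm_at c (fun u => lag (S c u) s a).
by move=> Ac; have oU := chart_open mA Ac; apply: (admZ oU); exact: adm_poly2. Qed.

Let tS c c' u : A c -> A c' -> overlap c c' u ->
  S c' u *m jac (transition c c') u = jac (transition c c') u *m S c (transition c c' u).
by move=> Ac Ac' ov; exact: (trans_shape mA imm umb three Ac Ac' ov). Qed.

Let tB (D P P' : 'M[R]_m) (a : R) : P' *m D = D *m P -> (P' - a%:M) *m D = D *m (P - a%:M).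
by move=> H; rewrite mulmxBl mulmxBr H scalar_mxC. Qed.

Let tM (D P P' Q Q' : 'M[R]_m) : P' *m D = D *m P -> Q' *m D = D *m Q ->
  (P' *m Q') *m D = D *m (P *m Q).
by move=> H1 H2; rewrite -mulmxA H2 !mulmxA H1. Qed.

Lemma trans_lag c c' s a u : A c -> A c' -> overlap c c' u ->
  lag (S c' u) s a *m jac (transition c c') u =
  jac (transition c c') u *m lag (S c (transition c c' u)) s a.
move=> Ac Ac' ov; rewrite -scalemxAl -scalemxAr; congr (_ *: _).
by apply: tM; apply: tB; exact: tS.
Qed.

Lemma trans_annih c c' s u : A c -> A c' -> overlap c c' u ->
  annih (S c' u) s *m jac (transition c c') u =
  jac (transition c c') u *m annih (S c (transition c c' u)) s.
by move=> Ac Ac' ov; apply: tM; [apply: tM|]; apply: tB; exact: tS.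
Qed.

Lemma annih_gm c s u : A c -> cimg c u -> annih (S c u) s *m g c u = g c u *m (annih (S c u) s)^T.
by move=> Ac Uu; have [_ H _] := adm_annih s Ac; exact: H. Qed.

(** The eigenvalues are taken at one point, where their cubic annihilates the Blaschke endomorphism.
    The trace of the square of this cubic is constant on the manifold, hence zero, and a
    self-adjoint endomorphism with that property vanishes; eigenvalues never have to be followed as
    functions. Constant traces of the projections give the multiplicities. *)
Lemma blaschke_spectrum : exists (s : 'I_3 -> R) (mu : 'I_3 -> nat),
  [/\ injective s, forall a, (0 < mu a)%N, (mu 0%R + mu 1%R + mu 2%R)%N = m &
    forall c u, A c -> cimg c u -> annih (S c u) s = 0 /\
      forall a, \tr (lag (S c u) s a) = (mu a)%:R /\ \rank (lag (S c u) s a) = mu a].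
case: (mA) => [[_ _ _ [q _]] [_ covA _]]; have [c0 Ac0 c0q] := covA q.
set u0 := cmap c0 q; have U0 : cimg c0 u0 by exact: chart_cimg.
have [t ut tE] := three_shape mA imm umb three Ac0 U0.
pose s := tnth t; have sI : injective s by apply/tuple_uniqP.
have eig a : eigenvalue (S c0 u0) (s a) by rewrite tE mem_tnth.
have gram c u (Ac : A c) (Uu : cimg c u) := g_gram mA imm umb three Ac Uu.
have gun c u (Ac : A c) (Uu : cimg c u) := g_unit mA imm umb three Ac Uu.
have an0 : annih (S c0 u0) s = 0.
  have [_ Sg _] := adm_chart_shape Ac0.
  apply: (selfadj_annihilator (gun _ _ Ac0 U0) (gram _ _ Ac0 U0) (Sg u0 U0)); last first.
  - move=> a v v0 vS; have aE : a \in t by rewrite -tE; apply/eigenvalueP; exists v.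
    have H (w : 'rV[R]_m) b : w *m S c0 u0 = a *: w -> w *m (S c0 u0 - b%:M) = (a - b) *: w.
      by move=> wS; rewrite mulmxBr wS mul_mx_scalar scalerBl.
    have /tnthP[i ai] := aE.
    have -> : v *m annih (S c0 u0) s = ((a - s 0) * ((a - s 1) * (a - s 2))) *: v.
      rewrite /annih mulmxA mulmxA (H _ _ vS) -!scalemxAl (H _ _ vS) -scalemxAl (H _ _ vS) !scalerA.
      by rewrite mulrA.
    suff -> : (a - s 0) * ((a - s 1) * (a - s 2)) = 0 by rewrite scale0r.
    rewrite ai -/(s i); case: i {ai} => [[|[|[|//]]] Hi].
    + by rewrite (_ : Ordinal Hi = 0) ?subrr ?mul0r//; exact/val_inj.
    + by rewrite (_ : Ordinal Hi = 1) ?subrr ?mul0r ?mulr0//; exact/val_inj.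
    + by rewrite (_ : Ordinal Hi = 2) ?subrr ?mulr0//; exact/val_inj.
  - exact: annih_gm.
  have c1 b : S c0 u0 *m (S c0 u0 - b%:M) = (S c0 u0 - b%:M) *m S c0 u0.
    by rewrite mulmxBl mulmxBr scalar_mxC.
  by rewrite /annih !mulmxA c1 -[_ *m S c0 u0 *m _]mulmxA c1 mulmxA -[_ *m S c0 u0 *m _]mulmxA c1 mulmxA.
have [r rE] : exists r, forall c u, A c -> cimg c u -> \tr (annih (S c u) s *m annih (S c u) s) = r.
  apply: (const_trace (P := fun c u => annih (S c u) s *m annih (S c u) s)).
    move=> c Ac; apply: (admM (chart_open mA Ac)) => //; exact: adm_annih.
  by move=> c c' u Ac Ac' ov; apply: tM; exact: trans_annih.
have an c u : A c -> cimg c u -> annih (S c u) s = 0.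
  move=> Ac Uu; apply: (selfadj_trace_sq_eq0 (gun _ _ Ac Uu) (gram _ _ Ac Uu)); first exact: annih_gm.
  by rewrite rE// -(rE _ _ Ac0 U0) an0 mulmx0 mxtrace0.
have tr c u a (Ac : A c) (Uu : cimg c u) : \tr (lag (S c u) s a) = (\rank (lag (S c0 u0) s a))%:R.
  have [ra raE] : exists r, forall c u, A c -> cimg c u -> \tr (lag (S c u) s a) = r.
    apply: (const_trace (P := fun c u => lag (S c u) s a)); first by move=> ? ?; exact: adm_lag.
    by move=> ? ? ? ? ? ?; exact: trans_lag.
  by rewrite raE// -(raE _ _ Ac0 U0) mxtrace_idem// lag_idem// an.
exists s; exists (fun a => \rank (lag (S c0 u0) s a)); split=> //.
- by move=> a; rewrite lt0n mxrank_eq0 lag_neq0.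
- have := congr1 (@mxtrace _ _) (lag_sum (S c0 u0) sI); rewrite !raddfD /= !tr// mxtrace1.
  by rewrite -!natrD => /eqP; rewrite eqr_nat => /eqP.
move=> c u Ac Uu; split; first exact: an.
move=> a; split; first exact: tr.
have := tr c u a Ac Uu; rewrite mxtrace_idem ?lag_idem// ?an// => /eqP.
by rewrite eqr_nat => /eqP.
Qed.

Variables (s : 'I_3 -> R) (mu : 'I_3 -> nat).
Hypotheses (s_inj : injective s) (mu_gt0 : forall a, (0 < mu a)%N).
Hypothesis mu_sum : (mu 0%R + mu 1%R + mu 2%R)%N = m.
Hypothesis spec : forall c u, A c -> cimg c u -> annih (S c u) s = 0 /\
  forall a, \tr (lag (S c u) s a) = (mu a)%:R /\ \rank (lag (S c u) s a) = mu a.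

(** The constant value of the trace of the Blaschke endomorphism; see [tr_bshape]. *)
Definition ptau : R := (mu 0)%:R * s 0 + (mu 1)%:R * s 1 + (mu 2)%:R * s 2.
Definition pk a : R := (m%:R * s a + ptau) / (mu a)%:R.
Definition eproj := locked_with dd_key
  (fun c a u => lag (S c u) s a : 'M[R]_m).
Lemma projE c a : eproj c a = fun u => lag (S c u) s a.
by rewrite /eproj unlock. Qed.
Definition pvec c a := locked_with dd_key
  (fun u => (mu a)%:R^-1 *: htrace (Y c) (eproj c a) u).
Lemma pvecE c a : pvec c a = fun u => (mu a)%:R^-1 *: htrace (Y c) (eproj c a) u.
exact: unlock. Qed.

Let mun0 a : (mu a)%:R != 0 :> R. by rewrite pnatr_eq0 -lt0n. Qed.
Let m0 : (0 < m)%N. by apply: ltnW; apply: ltnW; exact: (m_gt2 mA three). Qed.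

Lemma trans_pvec c c' a u : A c -> A c' -> overlap c c' u ->
  pvec c' a u = pvec c a (transition c c' u).
move=> Ac Ac' ov; rewrite !pvecE /htrace; congr (_ *: - _).
by apply: (trans_contract mA imm umb three Ac Ac' ov); rewrite !projE; exact: trans_lag.
Qed.

Section Chart.
Variables (c : chart R M m) (Ac : A c).
Notation U := (cimg c).
Notation J := (jac (Y c)).
Notation N := (conj_pos (Y c)).
Notation P a u := (eproj c a u).
Notation v := (pvec c).
Let oU : open U. exact: chart_open mA _ Ac. Qed.
Let sY := sm_Y mA imm umb three Ac.
Let gU := g_unit mA imm umb three Ac.
Let Yn := @Y_null _ _ _ _ _ _ imm c.
Let f0 := form0c mA imm umb mf three Ac.
Let Bp := B_parallel mA imm umb bp three Ac.
Let aP a : adm_at c (eproj c a). by rewrite projE; exact: adm_lag. Qed.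
Let sp0 u (Uu : U u) : annih (S c u) s = 0. by have [] := spec Ac Uu. Qed.

Lemma proj_tr a u : U u -> \tr (P a u) = (mu a)%:R.
by move=> Uu; rewrite projE; have [_ /(_ a)[]] := spec Ac Uu. Qed.
Lemma proj_rank a u : U u -> \rank (P a u) = mu a.
by move=> Uu; rewrite projE; have [_ /(_ a)[]] := spec Ac Uu. Qed.
Lemma proj_idem a u : U u -> P a u *m P a u = P a u.
by move=> Uu; rewrite !projE; exact: (lag_idem s_inj (sp0 Uu)). Qed.
Lemma proj_neq a b u : U u -> a != b -> P a u *m P b u = 0.
by move=> Uu; rewrite !projE; exact: (lag_neq s_inj (sp0 Uu)). Qed.
Lemma proj_sum u : U u -> P 0 u + P 1 u + P 2 u = 1%:M.
by move=> Uu; rewrite !projE; exact: (lag_sum _ s_inj). Qed.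
Lemma proj_shape a u : U u -> S c u *m P a u = s a *: P a u.
by move=> Uu; rewrite !projE; exact: (lag_shape (sp0 Uu)). Qed.
Lemma proj_shapeC a u : P a u *m S c u = S c u *m P a u.
by rewrite projE; exact: lag_shapeC. Qed.
Lemma proj_adm a : adm_at c (eproj c a). exact: aP. Qed.

Lemma tr_bshape u : U u -> \tr (S c u) = ptau.
move=> Uu; rewrite -[S c u]mulmx1 -(proj_sum Uu) !mulmxDr !proj_shape// !raddfD /= !mxtraceZ.
by rewrite !proj_tr// /ptau; congr (_ + _ + _); rewrite mulrC.
Qed.

Lemma proj_D a u : U u ->
  P a u *m (m%:R *: S c u + (\tr (S c u))%:M) = ((mu a)%:R * pk a) *: P a u.
move=> Uu; rewrite tr_bshape// mulmxDr mul_mx_scalar -scalemxAr.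
rewrite proj_shapeC proj_shape// scalerA -scalerDl.
by congr (_ *: _); rewrite /pk [RHS]mulrC divfK.
Qed.

Lemma sm_pvec a : Coo U (v a).
rewrite pvecE; apply: sm_scale => //; first exact: sm_cst.
exact: (sm_htrace oU sY gU (aP a)).
Qed.

Lemma dd_pvec a l u : U u -> dd l (v a) u = pk a *: row l (P a u *m J u).
move=> Uu; rewrite pvecE (dd_scalel oU)//; last exact: (sm_htrace oU sY gU (aP a)).
rewrite (dd_htrace oU sY m0 gU Yn f0 Bp l (aP a) Uu) proj_D// -scalemxAl linearZ /= scalerA.
by rewrite mulKf.
Qed.

Lemma pvec_position a u : U u -> v a u *m E *m (Y c u)^T = 1%:M.
move=> Uu; rewrite pvecE -!scalemxAl (htrace_position oU sY gU Yn (aP a) Uu) proj_tr//.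
by rewrite scale_scalar_mx mulVf.
Qed.

Lemma pvec_conj_pos a u : U u -> v a u *m E *m (N u)^T = (s a)%:M.
move=> Uu; rewrite pvecE -!scalemxAl (htrace_conj_pos oU sY gU Yn (aP a) Uu).
rewrite proj_shapeC proj_shape// mxtraceZ proj_tr//.
by rewrite scale_scalar_mx mulrC mulfK.
Qed.

Lemma pvec_hes a l u : U u ->
  v a u *m E *m (hes E (Y c) l u)^T = - (pk a *: row l (P a u *m g c u)).
move=> Uu; rewrite pvecE -!scalemxAl (htrace_hes oU sY m0 gU Yn f0 Bp l (aP a) Uu) proj_D//.
by rewrite -scalemxAl linearZ /= scalerN scalerA mulKf.
Qed.

Lemma pvec_pvec a b u : U u -> v a u *m E *m (v b u)^T = (pk a * (a == b)%:R)%:M.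
move=> Uu; rewrite pvecE [X in _ *m X](_ : _ = (mu b)%:R^-1 *: (htrace (Y c) (eproj c b) u)^T); last first.
  by rewrite pvecE linearZ.
rewrite -!scalemxAl -scalemxAr (htrace_htrace oU sY m0 gU Yn f0 Bp (aP a) (aP b) Uu) proj_D//.
rewrite -scalemxAl mxtraceZ; case: eqVneq => [->|ab].
  rewrite proj_idem// proj_tr// !scale_scalar_mx mulr1; congr (_%:M).
  by have := mun0 b; move: (mu b)%:R (pk b) => t q t0; field.
by rewrite proj_neq// mxtrace0 mulr0 !scale_scalar_mx !mulr0.
Qed.

End Chart.

(** * Global vectors and the dichotomy *)

Definition gpos := locked_with dd_key (globalize mA (fun c => Y c)).
Definition gconj := locked_with dd_key (globalize mA (fun c => conj_pos (Y c))).
Definition gpvec a := locked_with dd_key (globalize mA (fun c => pvec c a)).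

Lemma gposE c u : A c -> cimg c u -> gpos (cinv c u) = Y c u.
move=> Ac Uu; rewrite /gpos unlock; apply: (globalizeE mA (F := fun c => Y c) _ Ac Uu) => ? ? ? *.
exact: (trans_Y mA imm umb three).
Qed.
Lemma gconjE c u : A c -> cimg c u -> gconj (cinv c u) = conj_pos (Y c) u.
move=> Ac Uu; rewrite /gconj unlock; apply: (globalizeE mA (F := fun c => conj_pos (Y c)) _ Ac Uu) => ? ? ? *.
exact: (trans_N mA imm umb three).
Qed.
Lemma gpvecE a c u : A c -> cimg c u -> gpvec a (cinv c u) = pvec c a u.
move=> Ac Uu; rewrite /gpvec unlock; apply: (globalizeE mA (F := fun c => pvec c a) _ Ac Uu) => ? ? ? *.
exact: (trans_pvec).
Qed.

Lemma point_chart q : exists c u, [/\ A c, cimg c u & q = cinv c u].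
case: (mA) => [_ [_ covA _]]; have [c Ac cq] := covA q.
by exists c, (cmap c q); split=> //; [exact: chart_cimg|rewrite (chart_cmapK mA)].
Qed.

Lemma gpos_light q : exists2 r, 0 < r & gpos q = r *: light (x q).
have [c [u [Ac Uu ->]]] := point_chart q; rewrite gposE//.
by exists (rho (x \o cinv c) u) => //; exact: (rhoc_gt0 mA imm umb three Ac Uu).
Qed.

Lemma gpos_null q : lorentz (gpos q) (gpos q) = 0.
have [c [u [Ac Uu ->]]] := point_chart q.
by rewrite gposE// (@lorentzE R n.+1) (@Y_null _ _ _ _ _ _ imm c)// mxE.
Qed.

Lemma gpos_pos q : 0 < gpos q 0 0.
have [c [u [Ac Uu ->]]] := point_chart q; rewrite gposE//.
exact: (Y_pos mA imm umb three Ac Uu).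
Qed.

Lemma gpos_mobius T q : mobius T (x q) = ((gpos q *m T) 0 0)^-1 *: rsubmx (gpos q *m T).
have [r r0 ->] := gpos_light q; rewrite /mobius -scalemxAl linearZ /= scalerA.
have -> : (r *: (light (x q) *m T)) 0 0 = r * (light (x q) *m T) 0 0 by rewrite mxE.
by rewrite invfM mulrAC mulVf ?gt_eqF// mul1r.
Qed.

Lemma gpvec_gpos a q : lorentz (gpvec a q) (gpos q) = 1.
have [c [u [Ac Uu ->]]] := point_chart q; rewrite gposE// gpvecE// (@lorentzE R n.+1).
by rewrite (pvec_position Ac a Uu) mxE.
Qed.

Lemma gpvec_gconj a q : lorentz (gpvec a q) (gconj q) = s a.
have [c [u [Ac Uu ->]]] := point_chart q; rewrite gconjE// gpvecE// (@lorentzE R n.+1).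
by rewrite (pvec_conj_pos Ac a Uu) mxE mulr1n.
Qed.

Lemma gpos_gconj q : lorentz (gpos q) (gconj q) = 1.
have [c [u [Ac Uu ->]]] := point_chart q; rewrite gconjE// gposE// lorentzC (@lorentzE R n.+1).
rewrite (conj_pos_position (chart_open mA Ac) (sm_Y mA imm umb three Ac) m0
  (g_unit mA imm umb three Ac) (@Y_null _ _ _ _ _ _ imm c) Uu).
by rewrite mxE.
Qed.

Lemma gpvec_gpvec a b q : lorentz (gpvec a q) (gpvec b q) = pk a * (a == b)%:R.
have [c [u [Ac Uu ->]]] := point_chart q; rewrite !gpvecE// (@lorentzE R n.+1).
by rewrite (pvec_pvec Ac a b Uu) mxE mulr1n.
Qed.

Lemma gpvec_const a : pk a = 0 -> forall p q, gpvec a p = gpvec a q.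
move=> k0; apply: (manifold_const mA) => c Ac; have oU := chart_open mA Ac.
have sp := sm_pvec Ac a.
split; first by apply: (sm_ext oU _ sp) => u Uu; rewrite /= gpvecE.
move=> i u Uu; rewrite (dd_ext oU i Uu (g := pvec c a)); last by move=> v Uv; rewrite /= gpvecE.
by rewrite (dd_pvec Ac a i Uu) k0 scale0r.
Qed.

Notation sum3 F := (F 0 + F 1 + F 2).

Definition gres q := gpos q -
  ((pk 0)^-1 *: gpvec 0 q + (pk 1)^-1 *: gpvec 1 q + (pk 2)^-1 *: gpvec 2 q).

Lemma gres_const : (forall a, pk a != 0) -> forall p q, gres p = gres q.
move=> kn0; apply: (manifold_const mA) => c Ac.
have oU := chart_open mA Ac; have sp a := sm_pvec Ac a.
have sY := sm_Y mA imm umb three Ac.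
pose h u := Y c u - ((pk 0)^-1 *: pvec c 0 u + (pk 1)^-1 *: pvec c 1 u + (pk 2)^-1 *: pvec c 2 u).
have hE u : cimg c u -> gres (cinv c u) = h u.
  by move=> Uu; rewrite /gres gposE// !gpvecE.
split; first by apply: (sm_ext oU (f := h)) => [u Uu|]; [rewrite /= hE|rewrite /h; smo].
move=> i u Uu; rewrite (dd_ext oU i Uu (g := h)); last by move=> v Uv; rewrite /= hE.
rewrite /h (ddB oU)//; last by smo.
rewrite !(ddD _ Uu); try smo.
rewrite !(dd_scalel oU)// !(dd_pvec Ac _ i Uu) !scalerA !mulVf// !scale1r.
rewrite -!raddfD -!mulmxDl /= (proj_sum Uu) mul1mx row_jac.
by rewrite subrr.
Qed.

Definition ksum : R := (pk 0)^-1 + (pk 1)^-1 + (pk 2)^-1.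

Lemma gpvec_gres a q : pk a != 0 -> lorentz (gpvec a q) (gres q) = 0.
move=> ka; rewrite /gres lorentzBr !lorentzDr !lorentzZr gpvec_gpos !gpvec_gpvec.
by have [e|e|e] := ord3_cases a; rewrite e in ka *; rewrite /= !(mulr1, mulr0, addr0, add0r) mulVf ?subrr.
Qed.

Lemma gpos_gres q : lorentz (gpos q) (gres q) = - ksum.
rewrite /gres lorentzBr !lorentzDr !lorentzZr gpos_null ![lorentz (gpos q) _]lorentzC.
by rewrite !gpvec_gpos !mulr1 sub0r.
Qed.

Lemma gres_gres q : (forall a, pk a != 0) -> lorentz (gres q) (gres q) = - ksum.
move=> kn0; rewrite {1}/gres lorentzBl !lorentzDl !lorentzZl !gpvec_gres//.
by rewrite gpos_gres !mulr0 !addr0 subr0.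
Qed.

Lemma gconj_gres q : lorentz (gconj q) (gres q) = 1 - (s 0 / pk 0 + s 1 / pk 1 + s 2 / pk 2).
rewrite /gres lorentzBr !lorentzDr !lorentzZr ![lorentz (gconj q) _]lorentzC.
by rewrite gpos_gconj !gpvec_gconj ![_^-1 * _]mulrC.
Qed.

Lemma gpos_not_const : ~ (forall p q, gpos p = gpos q).
move=> H; case: (mA) => [[_ _ _ [q _]] _]; have [c [u [Ac Uu _]]] := point_chart q.
have oU := chart_open mA Ac; have gU := g_unit mA imm umb three Ac Uu.
have J0 : jac (Y c) u = 0.
  apply/row_matrixP => i; rewrite row_jac row0 (dd_ext oU i Uu (g := fun=> gpos q)) ?dd_cst//.
  by move=> v Uv; rewrite -gposE//.
have g0 : gm E (Y c) u = 0 by rewrite gmE J0 !mul0mx.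
have := mulmxV gU; rewrite g0 mul0mx => /esym/(congr1 (@mxtrace _ _))/eqP.
by rewrite mxtrace0 mxtrace1 pnatr_eq0 -leqn0 leqNgt m0.
Qed.

(** In the remaining case the residue [gres] is null and orthogonal to the null vector [gpos], hence
    a multiple of it, and pairing with [gconj] shows the factor to be $1-\sum l_a/k_a$, the same
    everywhere. As [gres] is constant and [gpos] is not, the factor is zero, which yields both the
    decomposition and the second relation. *)
Lemma dichotomy : (exists c, forall q, lorentz (gpos q) c = 1) \/
  [/\ forall a, pk a != 0, ksum = 0, s 0 / pk 0 + s 1 / pk 1 + s 2 / pk 2 = 1 &
      forall q, gres q = 0].
case: (mA) => [[_ _ _ [q0 _]] _].
have [[a /eqP ka]|kn0] := pselect (exists a, pk a == 0).
  left; exists (gpvec a q0) => q; rewrite lorentzC (gpvec_const ka q0 q).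
  exact: gpvec_gpos.
have {}kn0 a : pk a != 0 by apply/negP => ka; apply: kn0; exists a.
have cst := gres_const kn0.
have [k0|k0] := eqVneq ksum 0; last first.
  left; exists (- ksum^-1 *: gres q0) => q; rewrite lorentzZr (cst q0 q).
  by rewrite gpos_gres mulrNN mulVf.
have gn q : lorentz (gres q) (gres q) = 0 by rewrite gres_gres// k0 oppr0.
have gy q : lorentz (gres q) (gpos q) = 0 by rewrite lorentzC gpos_gres k0 oppr0.
have gE q := null_orth_eq0 (gpos_null q) (gy q) (gpos_pos q) (gn q).
have al q : gres q = (1 - (s 0 / pk 0 + s 1 / pk 1 + s 2 / pk 2)) *: gpos q.
  by rewrite -(gconj_gres q) {2}gE lorentzZr lorentzC gpos_gconj mulr1 -gE.
have [e0|e0] := eqVneq (1 - (s 0 / pk 0 + s 1 / pk 1 + s 2 / pk 2)) 0; last first.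
  case: gpos_not_const => p q; apply: (scalerI e0); rewrite -!al; exact: cst.
right; split=> //; last by move=> q; rewrite al e0 scale0r.
by apply/eqP; rewrite eq_sym -subr_eq0 e0.
Qed.

(** * The three space forms *)

Lemma image_special N' (Q : space_form R N') (E' : 'M[R]_N') (L : 'M[R]_(1 + n.+1, N'))
    (t : R) (c : 'rV[R]_(1 + n.+1)) (xt : M -> 'rV[R]_N') :
  (forall q, lorentz (gpos q) c = 1) -> E'^T = E' ->
  (forall u v, sf_form Q u v = (u *m E' *m v^T) 0 0) -> 0 < t -> c *m L = 0 ->
  (forall v w : 'rV_(1 + n.+1), lorentz v c = 0 -> lorentz w c = 0 ->
    sf_form Q (v *m L) (w *m L) = t ^+ 2 * lorentz v w) ->
  sf_curv Q * t ^+ 2 = - lorentz c c ->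
  (forall q, xt q = gpos q *m L) -> (forall q, sf_pts Q (xt q)) ->
  special_pseudo_parallel A Q xt.
move=> cY E'_sym QE t0 cL LE Qt xtE xtQ.
have m1 : (1 < m)%N by apply: ltnW; exact: (m_gt2 mA three).
have LE' (v w : 'rV_(1 + n.+1)) : v *m E *m c^T = 0 -> w *m E *m c^T = 0 ->
    sf_form Q (v *m L) (w *m L) = t ^+ 2 * lorentz v w.
  by move=> v0 w0; apply: LE; rewrite (@lorentzE R n.+1) ?v0 ?w0 mxE.
have cY' k (Ak : A k) u : cimg k u -> Y k u *m E *m c^T = 1%:M.
  move=> Uu; apply: mx11_eq; rewrite -(@lorentzE R n.+1) -(gposE Ak Uu) cY.
  by rewrite mxE.
have fE k (Ak : A k) u : cimg k u -> (xt \o cinv k) u = Y k u *m L.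
  by move=> Uu; rewrite /= xtE (gposE Ak Uu).
pose oU k (Ak : A k) := chart_open mA Ak.
pose sY k (Ak : A k) := sm_Y mA imm umb three Ak.
pose gU k (Ak : A k) := g_unit mA imm umb three Ak.
pose Yn k := @Y_null _ _ _ _ _ _ imm k.
pose Yp k (Ak : A k) := Y_pos mA imm umb three Ak.
pose f0 k (Ak : A k) := form0c mA imm umb mf three Ak.
pose Bp k (Ak : A k) := B_parallel mA imm umb bp three Ak.
pose Yt k (Ak : A k) := Y_tless mA imm umb three Ak.
pose S3 k (Ak : A k) := three_shape mA imm umb three Ak.
split; split.
- split=> // k Ak; first exact: (image_smooth (oU k Ak) (sY k Ak) (fE k Ak)).
  by move=> u Uu; exact: (image_row_free (oU k Ak) (sY k Ak) (gU k Ak) (cY' k Ak) QE t0 LE' (fE k Ak)).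
- move=> H; case: (mA) => [[_ _ _ [q _]] _]; have [k [u [Ak Uu _]]] := point_chart q.
  exact: (image_not_minimal (oU k Ak) (sY k Ak) m1 (gU k Ak) (Yn k) (Yp k Ak) (S3 k Ak)
    (cY' k Ak) E'_sym QE t0 cL LE' Qt (fE k Ak) Uu (H k Ak u Uu)).
- move=> k Ak u Uu.
  exact: (image_umbilic_free (oU k Ak) (sY k Ak) m1 (gU k Ak) (Yn k) (Yt k Ak)
    (cY' k Ak) E'_sym QE t0 cL LE' Qt (fE k Ak) Uu).
- move=> k Ak u Uu l i j.
  exact: (image_pseudo_parallel (oU k Ak) (sY k Ak) m1 (gU k Ak) (Yn k) (f0 k Ak) (Bp k Ak)
    (cY' k Ak) E'_sym QE t0 cL LE' Qt (fE k Ak) l i j Uu).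
- move=> k Ak u Uu l.
  exact: (image_parallel_mean (oU k Ak) (sY k Ak) m1 (gU k Ak) (Yn k) (f0 k Ak) (Bp k Ak)
    (cY' k Ak) E'_sym QE t0 cL LE' Qt (fE k Ak) l Uu).
- exists (t ^- 2 * (2 * ptau * (m%:R - 1) - (m%:R - 1) / m%:R)) => k Ak u Uu.
  rewrite -(tr_bshape Ak Uu).
  exact: (image_scalar_curvature (oU k Ak) (sY k Ak) m1 (gU k Ak) (Yn k) (Yt k Ak)
    (cY' k Ak) E'_sym QE t0 LE' (fE k Ak) Uu).
move=> k Ak u Uu.
exact: (image_three (oU k Ak) (sY k Ak) m1 (gU k Ak) (Yn k) (Yp k Ak) (S3 k Ak)
    (cY' k Ak) E'_sym QE t0 cL LE' Qt (fE k Ak) Uu).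
Qed.

Lemma lorentz_stationary (T : 'M[R]_(1 + n.+1)) (c d : 'rV[R]_(1 + n.+1)) :
  lorentz_transformation T -> c *m T = d -> (forall q, lorentz (gpos q) c = 1) ->
  forall q, lorentz (gpos q *m T) d = 1.
by move=> [T1 _] <- H q; rewrite T1. Qed.

Let lT (T : 'M[R]_(1 + n.+1)) (u v : 'rV[R]_(1 + n.+1)) : lorentz_transformation T ->
  lorentz (u *m T) (v *m T) = lorentz u v.
by case. Qed.

Lemma gposT (T : 'M[R]_(1 + n.+1)) q : lorentz_transformation T ->
  lorentz (gpos q *m T) (gpos q *m T) = 0 /\ 0 < (gpos q *m T) 0 0.
move=> hT; have Y0 := gpos_null q; split; first by rewrite lT.
by case: hT => _; apply=> //; exact: (gpos_pos).
Qed.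

(** In normal position [c] is $(-t,0)$, so the pairing with [c] says that the time coordinate of the
    transformed position is 1/t: projecting to the space part and scaling by [t] is the Moebius
    image itself. *)
Lemma timelike_case c : (forall q, lorentz (gpos q) c = 1) -> lorentz c c < 0 ->
  exists2 xt : M -> 'rV[R]_n.+1, special_pseudo_parallel A (sphere n 1) xt &
    mobius_equivalent x xt.
move=> cY cc; case: (mA) => [[_ _ _ [q0 _]] _].
have c0 : c 0 0 < 0.
  exact: (nonspacelike_past (gpos_null q0) (gpos_pos q0) (cY q0) (ltW cc)).
have [T hT cT] := normal_timelike cc c0; set t := Num.sqrt _ in cT.
have t0 : 0 < t by rewrite sqrtr_gt0 oppr_gt0.
have t2 : t ^+ 2 = - lorentz c c by rewrite sqr_sqrtr// oppr_ge0 ltW.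
pose D : 'M[R]_(1 + n.+1, n.+1) := t *: col_mx 0 1%:M.
have DE (v : 'rV_(1 + n.+1)) : v *m D = t *: rsubmx v.
  by rewrite -scalemxAr -{1}[v]hsubmxK mul_row_col mulmx0 add0r mulmx1.
have lc (v : 'rV_(1 + n.+1)) : lorentz v (row_mx (- t)%:M 0) = v 0 0 * t.
  rewrite lorentz_split row_mxKr.
  have -> : dot (rsubmx v) (0 : 'rV[R]_n.+1) = 0 by rewrite dotE trmx0 mulmx0 mxE.
  have -> : (row_mx (- t)%:M (0 : 'rV[R]_n.+1)) 0 0 = - t.
    have -> : (0 : 'I_(1 + n.+1)) = lshift n.+1 0 by exact/val_inj.
    by rewrite row_mxEl mxE mulr1n.
  by rewrite mulrN opprK addr0.
have Y1 q : (gpos q *m T) 0 0 * t = 1.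
  by rewrite -lc; exact: (lorentz_stationary hT cT cY).
exists (fun q => gpos q *m (T *m D)); last first.
  exists T => // q; rewrite (gpos_mobius) mulmxA DE; congr (_ *: _).
  by have [_ p] := gposT q hT; apply: (mulfI (lt0r_neq0 p)); rewrite Y1 mulfV// lt0r_neq0.
apply: (image_special (E' := 1%:M) (L := T *m D) (t := t) cY) => //.
- exact: trmx1.
- by move=> u v; exact: dotE.
- by rewrite mulmxA cT DE row_mxKr scaler0.
- move=> v w; rewrite -(lT v c hT) -(lT w c hT) -(lT v w hT) cT !lc.
  move=> /eqP; rewrite mulf_eq0 (gt_eqF t0) orbF => /eqP v0.
  move=> /eqP; rewrite mulf_eq0 (gt_eqF t0) orbF => /eqP w0.
  rewrite !mulmxA !DE lorentz_split v0 mul0r oppr0 add0r /=.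
  rewrite !dotE -!scalemxAl [(_ *: _)^T]linearZ /= -scalemxAr scalerA -expr2.
  by rewrite mxE.
- by rewrite /= expr1n invr1 mul1r.
move=> q; have [p1 p2] := gposT q hT; rewrite /= mulmxA DE expr1n.
rewrite !dotE -!scalemxAl [(_ *: _)^T]linearZ /= -scalemxAr scalerA -expr2 mxE -dotE.
have -> : dot (rsubmx (gpos q *m T)) (rsubmx (gpos q *m T)) = (gpos q *m T) 0 0 ^+ 2.
  by move: p1; rewrite lorentz_split addrC => /eqP; rewrite subr_eq0 expr2 => /eqP.
by rewrite mulrC -exprMn Y1 expr1n.
Qed.

Let row0_split k (v : 'rV[R]_(1 + k)) : v = row_mx (v 0 0)%:M (rsubmx v).
rewrite -{1}[v]hsubmxK; congr row_mx; apply: mx11_eq; rewrite !mxE mulr1n.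
by congr (v 0 _); exact/val_inj.
Qed.

Let coord3 (v : 'rV[R]_(1 + (1 + n))) :
  v = row_mx (v 0 0)%:M (row_mx (rsubmx v 0 0)%:M (rsubmx (rsubmx v))).
by rewrite -!row0_split.
Qed.

(** In normal position the pairing with [c] reads $t(y_0+y_1)=1$ with $t=-c_0$, so scaling the last
    [n] coordinates by [t] divides them by $y_0+y_1$: this is stereographic projection, the inverse
    of [sigma]. *)
Lemma null_case c : (forall q, lorentz (gpos q) c = 1) -> lorentz c c = 0 ->
  exists2 xb : M -> 'rV[R]_n, special_pseudo_parallel A (euclidean R n) xb &
    mobius_equivalent x (fun q => sigma (xb q)).
move=> cY cc; case: (mA) => [[_ _ _ [q0 _]] _].
have c0 : c 0 0 < 0.
  apply: (nonspacelike_past (gpos_null q0) (gpos_pos q0) (cY q0)).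
  by rewrite cc.
have [T hT cT] := normal_null cc; set t := - c 0 0.
have t0 : 0 < t by rewrite oppr_gt0.
pose D : 'M[R]_(1 + (1 + n), n) := t *: (col_mx 0 1%:M *m col_mx 0 1%:M).
have DE (v : 'rV_(1 + (1 + n))) : v *m D = t *: rsubmx (rsubmx v).
  rewrite -scalemxAr mulmxA; congr (_ *: _).
  rewrite -{1}[v]hsubmxK mul_row_col mulmx0 add0r mulmx1.
  by rewrite -{1}[rsubmx v]hsubmxK mul_row_col mulmx0 add0r mulmx1.
have [d0 d1 d2] := row_mx3_coord (c 0 0) (- c 0 0) (0 : 'rV[R]_n).
have lc (v : 'rV_(1 + (1 + n))) : lorentz v (row_mx (c 0 0)%:M (row_mx (- c 0 0)%:M 0)) =
    t * (v 0 0 + rsubmx v 0 0).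
  rewrite lorentz_split dot_split d0 d1 d2.
  have -> : dot (rsubmx (rsubmx v)) (0 : 'rV[R]_n) = 0 by rewrite dotE trmx0 mulmx0 mxE.
  by rewrite /t addr0; ring.
have Y1 q : t * ((gpos q *m T) 0 0 + rsubmx (gpos q *m T) 0 0) = 1.
  by rewrite -lc; exact: (lorentz_stationary hT cT cY).
exists (fun q => gpos q *m (T *m D)).
  apply: (image_special (E' := 1%:M) (L := T *m D) (t := t) cY) => //.
  - exact: trmx1.
  - by move=> u v; exact: dotE.
  - by rewrite mulmxA cT DE d2 scaler0.
  - move=> v w; rewrite -(lT v c hT) -(lT w c hT) -(lT v w hT) cT !lc.
    move=> /eqP; rewrite mulf_eq0 (gt_eqF t0) => /eqP v0.
    move=> /eqP; rewrite mulf_eq0 (gt_eqF t0) => /eqP w0.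
    rewrite !mulmxA !DE lorentz_split dot_split /=.
    have -> : dot (t *: rsubmx (rsubmx (v *m T))) (t *: rsubmx (rsubmx (w *m T))) =
        t ^+ 2 * dot (rsubmx (rsubmx (v *m T))) (rsubmx (rsubmx (w *m T))).
      by rewrite !dotE -!scalemxAl [(_ *: _)^T]linearZ /= -scalemxAr scalerA -expr2 mxE.
    move: v0 w0; move: (dot _ _) ((v *m T) 0 0) ((w *m T) 0 0) => a b e v0 w0.
    have -> : b = - rsubmx (v *m T) 0 0 by lra.
    have -> : e = - rsubmx (w *m T) 0 0 by lra.
    by ring.
  by rewrite /= mul0r cc oppr0.
exists T => // q; rewrite (gpos_mobius) mulmxA DE.
have [p1 p2] := gposT q hT; have y1 := Y1 q.
set y : 'rV[R]_(1 + (1 + n)) := gpos q *m T in p1 p2 y1 *.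
set w := rsubmx (rsubmx y); have w2 : dot (t *: w) (t *: w) = t * (y 0 0 - rsubmx y 0 0).
  have -> : dot (t *: w) (t *: w) = t ^+ 2 * dot w w.
    by rewrite !dotE -!scalemxAl [(_ *: _)^T]linearZ /= -scalemxAr scalerA -expr2 mxE.
  move: p1 y1; rewrite lorentz_split dot_split -/w.
  move: (dot w w) (y 0 0) (rsubmx y 0 0) => a b e p1 y1.
  have -> : a = (b - e) * (b + e) by lra.
  by transitivity (t * (b - e) * (t * (b + e))); [ring|rewrite y1 mulr1].
rewrite /sigma w2.
have -> : 1 + t * (y 0 0 - rsubmx y 0 0) = 2 * t * y 0 0 by lra.
have -> : 1 - t * (y 0 0 - rsubmx y 0 0) = 2 * t * rsubmx y 0 0 by lra.
rewrite -scale_scalar_mx scalerA -scale_row_mx scalerA invfM mulrAC mulVf ?mulf_neq0 ?gt_eqF// mul1r.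
by rewrite /w -(row0_split (rsubmx y)).
Qed.

(** In normal position the pairing with [c] reads $ty_1=1$; dropping $y_1$ and scaling by [t]
    inverts [tau], the condition of being null becoming the equation of the hyperboloid. *)
Lemma spacelike_case c : (forall q, lorentz (gpos q) c = 1) -> 0 < lorentz c c ->
  exists2 xb : M -> 'rV[R]_(1 + n), special_pseudo_parallel A (hyperbolic n (-1)) xb &
    mobius_equivalent x (fun q => tau (xb q)).
move=> cY cc.
have [T hT cT] := normal_spacelike cc; set t := Num.sqrt _ in cT.
have t0 : 0 < t by rewrite sqrtr_gt0.
have t2 : t ^+ 2 = lorentz c c by rewrite sqr_sqrtr// ltW.
pose D : 'M[R]_(1 + (1 + n), 1 + n) :=
  t *: col_mx (row_mx 1%:M 0) (col_mx 0 (row_mx 0 1%:M)).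
have DE (v : 'rV_(1 + (1 + n))) : v *m D = t *: row_mx (v 0 0)%:M (rsubmx (rsubmx v)).
  rewrite -scalemxAr; congr (_ *: _).
  rewrite {1}[v]coord3 mul_row_col mul_row_col mulmx0 add0r !mul_mx_row !mulmx1 !mulmx0.
  by rewrite add_row_mx addr0 add0r.
rewrite (_ : (0 : 'M[R]_1) = 0%:M) in cT; last by rewrite raddf0.
have [d0 d1 d2] := row_mx3_coord 0 t (0 : 'rV[R]_n).
have lc (v : 'rV_(1 + (1 + n))) : lorentz v (row_mx 0%:M (row_mx t%:M 0)) = t * rsubmx v 0 0.
  rewrite lorentz_split dot_split d0 d1 d2.
  have -> : dot (rsubmx (rsubmx v)) (0 : 'rV[R]_n) = 0 by rewrite dotE trmx0 mulmx0 mxE.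
  by ring.
have Y1 q : t * rsubmx (gpos q *m T) 0 0 = 1.
  by rewrite -lc; exact: (lorentz_stationary hT cT cY).
have e00 (a : R) (w : 'rV[R]_n) : row_mx a%:M w 0 0 = a.
  have -> : (0 : 'I_(1 + n)) = lshift n 0 by exact/val_inj.
  by rewrite row_mxEl mxE mulr1n.
have t00 (a : R) (w : 'rV[R]_n) : (t *: row_mx a%:M w) 0 0 = t * a.
  by rewrite mxE; congr (_ * _); exact: e00.
have lD (a b : R) (w w' : 'rV[R]_n) : lorentz (t *: row_mx a%:M w) (t *: row_mx b%:M w') =
    t ^+ 2 * (- (a * b) + dot w w').
  by rewrite lorentzZl lorentzZr mulrA -expr2 lorentz_split !row_mxKr !e00.
exists (fun q => gpos q *m (T *m D)).
  apply: (image_special (E' := mink R n) (L := T *m D) (t := t) cY) => //.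
  - exact: mink_sym.
  - exact: lorentzE.
  - by rewrite mulmxA cT DE d0 d2 raddf0 row_mx0 scaler0.
  - move=> v w; rewrite -(lT v c hT) -(lT w c hT) -(lT v w hT) cT !lc.
    move=> /eqP; rewrite mulf_eq0 (gt_eqF t0) => /eqP v0.
    move=> /eqP; rewrite mulf_eq0 (gt_eqF t0) => /eqP w0.
    rewrite !mulmxA !DE [lorentz (v *m T) _]lorentz_split dot_split v0 w0 mul0r add0r.
    exact: lD.
  - by rewrite /= mulN1r t2.
  move=> q; have [p1 p2] := gposT q hT; have y1 := Y1 q.
  rewrite /= mulmxA DE lD t00; split; last by rewrite mulr_gt0.
  move: p1 y1; rewrite lorentz_split dot_split.
  move: (dot _ _) ((gpos q *m T) 0 0) (rsubmx (gpos q *m T) 0 0) => a b e p1 y1.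
  have -> : a = b * b - e * e by lra.
  by rewrite invrN1; transitivity (- (t * e) ^+ 2); [ring|rewrite y1 expr1n].
exists T => // q; rewrite (gpos_mobius) mulmxA DE.
have [p1 p2] := gposT q hT; have y1 := Y1 q.
rewrite /tau t00 linearZ /= row_mxKr -y1 -scale_scalar_mx -scale_row_mx scalerA.
rewrite invfM mulrAC mulVf ?gt_eqF// mul1r.
by rewrite -(row0_split (rsubmx (gpos q *m T))).
Qed.

(** * The product case: factor vectors and their orthogonality at distant points *)

Hypothesis kn0 : forall a, pk a != 0.

Section Chart.
Variables (c : chart R M m) (Ac : A c).
Notation U := (cimg c).
Notation g := (gm E (Y c)).
Notation J := (jac (Y c)).
Let oU : open U. exact: chart_open mA _ Ac. Qed.
Let sY := sm_Y mA imm umb three Ac.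
Let gU := g_unit mA imm umb three Ac.
Let sp a := sm_pvec Ac a.

Definition facvec a u := (pk a)^-1 *: pvec c a u.

Lemma sm_facvec a : Coo U (facvec a).
by apply: sm_scale => //; exact: sm_cst. Qed.

Lemma jac_facvec a u : U u -> jac (facvec a) u = eproj c a u *m J u.
move=> Uu; apply/row_matrixP => i; rewrite row_jac (dd_scalel oU)//.
by rewrite (dd_pvec Ac a i Uu) scalerA mulVf// scale1r.
Qed.

Lemma facvec_adapted u0 : U u0 -> exists V w0 e zeta psi,
  adapted U facvec (eproj c) u0 (binc R mu_sum) V w0 e zeta psi.
move=> Uu0; apply: (adapted_coordinates (E := E) (Y := Y c)) => //.
- exact: sm_facvec.
- exact: jac_facvec.
- by move=> u Uu; rewrite big3; exact: (proj_sum Uu).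
- by move=> a b u Uu ab; exact: (proj_neq Ac Uu ab).
- by move=> a u Uu; exact: (proj_rank Ac a Uu).
- exact: bincK.
- exact: binc_neq.
- exact: binc_sum.
Qed.

(** The differential of the function already lies in block [a], so the partial trace of its Hessian
    equals the full one. It is therefore an eigenfunction of the elliptic Laplacian of the whole
    metric although it involves one block only. *)
Lemma unique_continuation_facvec a (c0 : 'rV[R]_(1 + n.+1)) z T0 T : 0 < T0 ->
  (forall u, sqdist z u <= T -> U u) ->
  (forall u, sqdist z u < T0 -> lorentz (pvec c a u) c0 = 0) ->
  forall u, sqdist z u < T -> lorentz (pvec c a u) c0 = 0.
move=> T00 TU phi0; pose gi u := invmx (g u).
have sgi : Coo U gi by exact: (sm_ginv oU sY gU).
have sg : Coo U g by exact: (sm_gm E oU sY).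
have scv k : Coo U (cov E (Y c) k) by exact: (sm_cov oU sY gU k).
have gb u : U u -> exists k (b : 'M[R]_(m, k)), gi u = b *m b^T.
  move=> Uu; have gE := g_gram mA imm umb three Ac Uu; set B := (_ *: _) in gE.
  exists _, (gi u *m B); rewrite trmx_mul !mulmxA -(mulmxA (gi u)) -gE /gi mulVmx ?gU// mul1mx.
  by rewrite (ginv_sym (mink_sym R n.+1)).
have quad u (xi : 'I_m -> R) : \sum_i (\sum_j gi u i j * xi j) * xi i =
    ((\row_j xi j) *m gi u *m (\row_j xi j)^T) 0 0.
  rewrite -mulmxA [RHS]mxE; eqbig i; rewrite !mxE mulrC; congr (_ * _).
  by eqbig j; rewrite !mxE.
have quad_dot k (b : 'M[R]_(m, k)) (v w : 'rV[R]_m) :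
    (v *m (b *m b^T) *m w^T) 0 0 = dot (v *m b) (w *m b).
  by rewrite dotE mulmx1 trmx_mul !mulmxA.
have gii u i : U u -> 0 <= g u i i.
  move=> Uu; have gE := g_gram mA imm umb three Ac Uu; set B := (_ *: _) in gE.
  have -> : g u i i = dot ((delta_mx 0 i : 'rV[R]_m) *m B) ((delta_mx 0 i : 'rV[R]_m) *m B).
    by rewrite -quad_dot -gE -rowE trmx_delta -colE !mxE.
  exact: dot_ge0.
pose phi u := lorentz (pvec c a u) c0.
have phiE u : phi u = (pvec c a u *m (E *m c0^T)) 0 0 by rewrite /phi (@lorentzE R n.+1) mulmxA.
have sphiM : Coo U (fun u => pvec c a u *m (E *m c0^T)) by smo.
have sphi : Coo U phi.
  by apply: (sm_ext oU _ (sm_coord oU 0 0 sphiM)) => u _; rewrite phiE.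
pose F u := pk a *: (eproj c a u *m J u *m (E *m c0^T)).
have dphi i u : U u -> dd i phi u = F u i 0.
  move=> Uu; transitivity (dd i (fun v => (pvec c a v *m (E *m c0^T)) 0 0) u).
    by apply: (dd_ext oU i Uu) => v _; exact: phiE.
  rewrite (dd_mxE i 0 0 Uu sphiM) (dd_mulmxl oU)//.
  rewrite (dd_pvec Ac a i Uu) /F -scalemxAl -row_mul.
  by rewrite [LHS]mxE [RHS]mxE [(row _ _) _ _]mxE.
have aP := proj_adm Ac a; have [[sP dP] _ _] := aP.
pose Q u := gi u *m eproj c a u.
have sQ : Coo U Q by exact: sm_mulmx.
have dQ i u : U u -> dd i Q u = - ((cov E (Y c) i u)^T *m Q u) - Q u *m cov E (Y c) i u.
  move=> Uu; rewrite (dd_mulmx oU)// dP// (dd_ginv (mink_sym R n.+1) oU sY gU i Uu) -/(gi u).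
  rewrite mulmxBl mulmxBr !mulNmx /Q !mulmxA.
  by rewrite addrA subrK.
have sJ : Coo U J by exact: (sm_jac oU sY).
have sF : Coo U F.
  apply: sm_scale => //; first exact: sm_cst.
  by apply: sm_mulmx => //; [exact: sm_mulmx|exact: sm_cst].
have dQJ i u : U u -> dd i (fun v => Q v *m J v) u =
    Q u *m hes E (Y c) i u - (cov E (Y c) i u)^T *m Q u *m J u.
  move=> Uu; rewrite (dd_mulmx oU)// dQ// (dd_jac E (Y c) i) mulmxBl mulmxDr !mulNmx !mulmxA.
  by rewrite /Q ?mulmxA addrCA subrK.
have fluxE i u : U u -> flux gi phi i u = (pk a *: (Q u *m J u *m (E *m c0^T))) i 0.
  move=> Uu; transitivity ((gi u *m F u) i 0); last by rewrite /F -scalemxAr /Q !mulmxA.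
  by rewrite /flux mxE; eqbig j; rewrite -ddE dphi.
have sQJ : Coo U (fun v => Q v *m J v) by exact: sm_mulmx.
have sFl : Coo U (fun v => pk a *: (Q v *m J v *m (E *m c0^T))).
  apply: sm_scale => //; first exact: sm_cst.
  by apply: sm_mulmx => //; exact: sm_cst.
(* Contracted connection coefficients: the first-order discrepancy between the Lebesgue divergence
   form and the Laplacian. *)
pose beta j u := - \sum_i ((cov E (Y c) i u)^T *m gi u) i j.
have divE u : U u -> divop gi phi u =
    \sum_j beta j u * pd j phi u + (- (pk a * (mu a)%:R)) * phi u.
  move=> Uu; transitivity (\sum_i (pk a *: ((Q u *m hes E (Y c) i u -
      (cov E (Y c) i u)^T *m Q u *m J u) *m (E *m c0^T))) i 0).
    eqbig i; rewrite -ddE (dd_ext oU i Uu (fluxE i)) (dd_mxE i i 0 Uu sFl).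
    by rewrite (dd_scalel oU) ?(dd_mulmxl oU) ?dQJ//; apply: sm_mulmx => //; exact: sm_cst.
  transitivity (\sum_i ((pk a *: (row i (Q u) *m hes E (Y c) i u *m (E *m c0^T))) 0 0 -
      ((cov E (Y c) i u)^T *m gi u *m F u) i 0)).
    have XB (X Z : 'cV[R]_m) i : (X - Z) i 0 = X i 0 - Z i 0 by rewrite !mxE.
    eqbig i; rewrite mulmxBl scalerBr XB; congr (_ - _).
      by rewrite -!row_mul !mxE.
    by rewrite /F -scalemxAr /Q !mulmxA.
  rewrite sumrB addrC; congr (_ + _).
    rewrite -sumrN; transitivity (\sum_i \sum_j - (((cov E (Y c) i u)^T *m gi u) i j * F u j 0)).
      by eqbig i; rewrite mxE -sumrN.
    rewrite exchange_big; apply: eq_bigr => j _ /=; rewrite /beta -ddE dphi// mulNr mulr_suml.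
    by rewrite sumrN.
  have -> : \sum_i (pk a *: (row i (Q u) *m hes E (Y c) i u *m (E *m c0^T))) 0 0 =
      (pk a *: (ctr (Q u) (hes E (Y c) ^~ u) *m (E *m c0^T))) 0 0.
    by rewrite /ctr mulmx_suml scaler_sumr summxE.
  have -> : ctr (Q u) (hes E (Y c) ^~ u) = - ((mu a)%:R *: pvec c a u).
    by rewrite pvecE scalerA mulfV ?pnatr_eq0 -?lt0n// scale1r /htrace opprK.
  by rewrite phiE mulNmx -scalemxAl scalerN scalerA mxE mulNr; congr (- _); rewrite mxE.
(* By Cauchy-Schwarz $\xi_j^2\le g_{jj}\,g^{-1}(\xi,\xi)$; adding 1 to the trace gives a smooth
   positive bound for all diagonal entries. *)
pose B u := 1 + \tr (g u).
have ell u (xi : 'I_m -> R) j : U u ->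
    xi j ^+ 2 <= B u * \sum_i (\sum_j0 gi u i j0 * xi j0) * xi i.
  move=> Uu; rewrite quad; set v := \row_j xi j.
  have [k [b gib]] := gb u Uu.
  have v0 : 0 <= (v *m gi u *m v^T) 0 0 by rewrite gib quad_dot dot_ge0.
  have -> : xi j = (v *m gi u *m ((delta_mx 0 j : 'rV[R]_m) *m g u)^T) 0 0.
    rewrite trmx_mul (gm_sym (mink_sym R n.+1)) mulmxA mulmxKV ?gU// trmx_delta -colE !mxE.
    by [].
  have e2 : (((delta_mx 0 j : 'rV[R]_m) *m g u) *m gi u *m ((delta_mx 0 j : 'rV[R]_m) *m g u)^T) 0 0 = g u j j.
    rewrite trmx_mul (gm_sym (mink_sym R n.+1)) mulmxK ?gU// mulmxA trmx_delta -colE -rowE !mxE.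
    by [].
  have cs := dot_CauchySchwarz (v *m b) ((delta_mx 0 j : 'rV[R]_m) *m g u *m b).
  rewrite -!quad_dot -gib e2 in cs; apply: le_trans cs _; rewrite mulrC ler_wpM2r//.
  rewrite /B /mxtrace (bigD1 j)//= addrCA lerDl addr_ge0// sumr_ge0// => i _; exact: gii.
apply: (unique_continuation_ball (a := gi) (B := B) oU sgi _ _ ell _ _ sphi _ _ divE T00 TU phi0).
- by move=> u Uu; exact: (ginv_sym (mink_sym R n.+1)).
- move=> u xi Uu; rewrite quad; have [k [b gib]] := gb u Uu; rewrite gib quad_dot; exact: dot_ge0.
- by move=> u Uu; rewrite /B ltr_pwDl// sumr_ge0// => i _; exact: gii.
- by apply: smoothD => //; [exact: sm_cst|exact: (sm_trace oU sg)].
- exact: sm_cst.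
move=> j; apply: smoothN => //; apply: sm_sum => // i.
by apply: sm_coord => //; apply: sm_mulmx => //; exact: sm_tr.
Qed.

End Chart.

Lemma sqdist_coord k (z u : 'rV[R]_k) j : (u 0 j - z 0 j) ^+ 2 <= sqdist z u.
by rewrite /sqdist (bigD1 j)//= lerDl sumr_ge0// => i _; exact: sqr_ge0. Qed.

Lemma sqdist_ball k (z u : 'rV[R]_k) (e : R) : 0 < e -> sqdist z u < e ^+ 2 -> ball z e u.
move=> e0 zu; rewrite -ball_normE /=; apply: mx_norm_lt => // i j; rewrite ord1.
have := le_lt_trans (sqdist_coord z u j) zu; rewrite !mxE -[_ - u 0 j]opprB normrN => H.
by rewrite -(@ltr_pXn2r _ 2)// ?nnegrE ?ltW// real_normK// num_real.
Qed.

Lemma sqdist_triangle k (z u v : 'rV[R]_k) : sqdist z v <= 2 * (sqdist z u + sqdist u v).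
rewrite /sqdist -big_split mulr_sumr ler_sum// => j _ /=.
have := sqr_ge0 ((u 0 j - z 0 j) - (v 0 j - u 0 j)); lra.
Qed.

Lemma sqdistC k (z u : 'rV[R]_k) : sqdist z u = sqdist u z.
by eqbig j; rewrite -sqrrN opprB. Qed.

Lemma sqdist_near k (z : 'rV[R]_k) (r : R) : 0 < r -> \forall u \near z, sqdist z u < r.
move=> r0; have oT : open [set: 'rV[R]_k] by exact: openT.
have cz := sm_cont (@sm_sqdist R k z setT oT) (I : [set: 'rV[R]_k] z).
have z0 : sqdist z z = 0 by rewrite /sqdist big1// => j _; rewrite subrr expr0n.
have := cz [set y : R | y < r]; rewrite /= z0 => H.
by apply: H; apply: open_nbhs_nbhs; split=> //; exact: open_lt.
Qed.

Lemma gpvec_continuation a (c0 : 'rV[R]_(1 + n.+1)) (q0 : M) :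
  (\forall q \near q0, lorentz (gpvec a q) c0 = 0) -> forall q, lorentz (gpvec a q) c0 = 0.
move=> near0; pose Z := [set q : M | \forall p \near q, lorentz (gpvec a p) c0 = 0].
suff ZT : Z = setT.
  by move=> q; have : Z q by [rewrite ZT]; move/nbhs_singleton.
case: (mA) => [[_ _ conM _] [chA covA _]].
have chnear c u : A c -> cimg c u -> Z (cinv c u) <->
    \forall v \near u, lorentz (pvec c a v) c0 = 0.
  move=> Ac Uu; have [oD oI cK cC cI] := chA c Ac; have [Du Ku] := chart_cinv mA Ac Uu.
  have NU : nbhs u (cimg c) by exact: open_nbhs_nbhs.
  split=> H.
    have H1 := cI u Uu _ H; apply: filterS2 NU H1 => v Uv /=.
    by rewrite (gpvecE a Ac Uv).
  have ND : nbhs (cinv c u) (cdom c) by exact: open_nbhs_nbhs.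
  have H1 : \forall p \near cinv c u, lorentz (pvec c a (cmap c p)) c0 = 0.
    have H2 : \forall v \near cmap c (cinv c u), lorentz (pvec c a v) c0 = 0 by rewrite Ku.
    exact: (cC _ Du _ H2).
  apply: filterS2 ND H1 => p Dp /=; rewrite -(gpvecE a Ac) ?cK//.
  exact: chart_cimg.
apply: conM; first by exists q0.
- exists Z; last by rewrite setTI.
  by rewrite openE => q Zq; exact: nbhs_interior Zq.
exists Z; last by rewrite setTI.
move=> q qZ; have [c Ac cq] := covA q; set u := cmap c q.
have [oD oI cK cC cI] := chA c Ac; have Uu : cimg c u by exact: chart_cimg.
rewrite -(cK q cq); apply/(chnear c u Ac Uu).
have /nbhs_ballP[e /= e0 eU] : nbhs u (cimg c) by exact: open_nbhs_nbhs.
(* The continuation ball is centred at a point [z] near [u] and must contain a neighbourhood of [u]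
   while staying in the chart. The triangle inequality for squared distances loses a factor 2,
   whence the fractions 16 and 4. *)
pose r := e ^+ 2; have r0 : 0 < r by exact: exprn_gt0.
have N1 : \forall p \near q, sqdist u (cmap c p) < r / 16.
  have r16 : 0 < r / 16 by rewrite divr_gt0.
  exact: (cC q cq _ (sqdist_near u r16)).
have N2 : nbhs q (cdom c) by exact: open_nbhs_nbhs.
have [p [Zp [Dp up]]] := qZ _ (filterI N2 N1).
have Uz := chart_cimg Dp; set z := cmap c p in Uz up.
have /nbhs_ballP[e1 /= e10 e1P] : \forall v \near z, lorentz (pvec c a v) c0 = 0.
  by apply/(chnear c z Ac Uz); rewrite cK.
have H := unique_continuation_facvec (a := a) (c0 := c0) (z := z) (T0 := e1 ^+ 2) (T := r / 4) Ac.
have zu : \forall v \near u, sqdist z v < r / 4.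
  have : \forall v \near u, sqdist u v < r / 16 by apply: sqdist_near; rewrite divr_gt0.
  apply: filterS => v uv; apply: le_lt_trans (sqdist_triangle z u v) _.
  by rewrite (sqdistC z u); lra.
apply: filterS zu => v; apply: H; first exact: exprn_gt0.
  move=> w zw; apply: eU; apply: sqdist_ball => //; apply: le_lt_trans (sqdist_triangle u z w) _.
  by rewrite -/r; lra.
by move=> w zw; apply: e1P; exact: sqdist_ball.
Qed.

(** For points close together a third point is found at which both vectors take the same values, and
    there they are orthogonal; [gpvec_continuation] then moves [p] away from [q]. *)
Lemma gpvec_orthogonal a b p q : a != b -> lorentz (gpvec a p) (gpvec b q) = 0.
move=> ab; move: p; apply: (gpvec_continuation (q0 := q)).
have [_ [chA covA _]] := mA; have [c Ac cq] := covA q; have [oD oI cK cC cI] := chA c Ac.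
set u := cmap c q; have Uu : cimg c u by exact: chart_cimg.
have [V [w0 [e [zeta [psi [[oV Vu VU e0] [[psiV Vpsi _ _] [_ _ yy]]]]]]]] := facvec_adapted Ac Uu.
have NV : \forall p \near q, V (cmap c p) by exact: (cC q cq _ (open_nbhs_nbhs (conj oV Vu))).
have ND : nbhs q (cdom c) by exact: open_nbhs_nbhs.
apply: filterS2 ND NV => p Dp Vp; have Up := chart_cimg Dp.
rewrite -(cK q cq) -(cK p Dp) !(gpvecE _ Ac)//.
have [Bp pE] := Vpsi _ Vp; have [Bq qE] := Vpsi _ Vu.
(* Block [b] is that of [q] and the other blocks are those of [p]; each factor vector depends on its
   own block only. *)
pose w := assemble mu_sum (fun d => (if d == b then zeta u else zeta (cmap c p)) *m (binc R mu_sum d)^T).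
have Bw : ball w0 e w.
  apply/(ball_binc mu_sum _ _ e0) => d; rewrite assembleK; case: eqP => _.
    by move/(ball_binc mu_sum _ _ e0): Bq.
  by move/(ball_binc mu_sum _ _ e0): Bp.
have ya : facvec c a (cmap c p) = facvec c a (psi w).
  by rewrite -{1}pE; apply: yy => //; rewrite assembleK (negPf ab).
have yb : facvec c b u = facvec c b (psi w).
  by rewrite -{1}qE; apply: yy => //; rewrite assembleK eqxx.
have Uw : cimg c (psi w) by apply: VU; case: (psiV w Bw).
have fE d v : pvec c d v = pk d *: facvec c d v by rewrite scalerA mulfV// scale1r.
rewrite !fE ya yb lorentzZl lorentzZr [lorentz _ _](_ : _ = 0) ?mulr0//.
rewrite /facvec lorentzZl lorentzZr (@lorentzE R n.+1).
rewrite (pvec_pvec Ac a b Uw) (negPf ab) mulr0.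
by rewrite mxE mul0rn !mulr0.
Qed.

(** * Partial norms of the Hessian *)

Notation fac := facvec.
Notation I_ a := (binc R mu_sum a).

Definition bnorm a (c : chart R M m) (u : 'rV[R]_m) : R :=
  block_sqnorm E (invmx (gm E (Y c) u) *m eproj c a u) (hes E (Y c) ^~ u).

Section Chart.
Variables (c : chart R M m) (Ac : A c).
Notation U := (cimg c).
Notation g := (gm E (Y c)).
Notation J := (jac (Y c)).
Let oU : open U. exact: chart_open mA _ Ac. Qed.
Let sY := sm_Y mA imm umb three Ac.
Let gU := g_unit mA imm umb three Ac.
Let aP a := proj_adm Ac a.
Let gB u : U u -> exists k (B : 'M[R]_(m, k)), g u = B *m B^T.
by move=> Uu; have gE := g_gram mA imm umb three Ac Uu; do 2 eexists; exact: gE. Qed.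

(** The projection is idempotent and may act on either index of the Hessian, so projecting one index
    is enough; in this form the three partial norms add up. *)
Lemma bnormE a u : U u -> bnorm a c u =
  \sum_i \tr (act (invmx (g u)) (hes E (Y c) ^~ u) i *m E *m (hes E (Y c) i u)^T *m
    (invmx (g u) *m eproj c a u)).
move=> Uu; have [_ _ actP] := aP a; eqbig i.
have PP := proj_idem Ac a Uu.
transitivity (\tr (act (invmx (g u) *m eproj c a u) (hes E (Y c) ^~ u) i *m E *m
    (hes E (Y c) i u)^T *m (invmx (g u) *m eproj c a u))).
  by rewrite /act !mulmx_suml raddf_sum; apply: eq_bigr => k _ /=; rewrite -!scalemxAl mxtraceZ.
rewrite actM (eq_act _ _ (fun k => actP u k Uu)) act_mulmx -!mulmxA mxtrace_mulC !mulmxA.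
by rewrite -(mulmxA _ (eproj c a u)) PP.
Qed.

Lemma bnorm_sum u : U u ->
  bnorm 0 c u + bnorm 1 c u + bnorm 2 c u = (m%:R - 1) / m%:R + 2 * ptau.
move=> Uu.
have mn0 : m%:R != 0 :> R by rewrite pnatr_eq0 -lt0n.
have := Y_tless mA imm umb three Ac Uu.
rewrite (tless_sqnormE (mink_sym R n.+1) (gU Uu) m0) => /eqP; rewrite subr_eq => /eqP hsq.
have ll : (lap E (Y c) u *m E *m (lap E (Y c) u)^T) 0 0 = 2 * m%:R * ptau.
  rewrite -(tr_bshape Ac Uu) (trace_shape oU sY m0 gU (@Y_null _ _ _ _ _ _ imm c) Uu).
  by rewrite (@lorentzE R n.+1); move: ((_ *m _ *m _) 0 0) => a; field.
have -> : (m%:R - 1) / m%:R + 2 * ptau = hes_sqnorm E (Y c) u.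
  by rewrite hsq ll; field.
rewrite !bnormE// -!big_split /=; eqbig i.
rewrite -!mxtraceD -!mulmxDr (proj_sum Uu) mulmx1.
rewrite /act !mulmx_suml raddf_sum /=; eqbig k.
by rewrite -!scalemxAl mxtraceZ.
Qed.

(** A factorisation of the inverse metric reduces the norm to a sum of squares of vectors orthogonal
    to the null vector [Y], none of which is timelike. *)
Lemma block_sqnorm_ge0 u (X : 'I_m -> 'M[R]_(m, 1 + n.+1)) : U u ->
  (forall k, X k *m E *m (Y c u)^T = 0) -> 0 <= block_sqnorm E (invmx (g u)) X.
move=> Uu XY; have [k [b gE]] := gB Uu; have gu := gU Uu.
have -> : invmx (g u) = ((invmx (g u) *m b)^T)^T *m 1%:M *m (invmx (g u) *m b)^T.
  by rewrite trmxK mulmx1 trmx_mul (ginv_sym (mink_sym R n.+1)) mulmxA -(mulmxA _ b) -gE mulVmx// mul1mx.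
set D := (invmx (g u) *m b)^T; pose X' a := \sum_l D a l *: (D *m X l).
have -> : block_sqnorm E (D^T *m 1%:M *m D) X = block_sqnorm E 1%:M X'.
  by apply/esym/block_sqnorm_change.
rewrite /block_sqnorm sumr_ge0// => i _; rewrite (bigD1 i)//= big1 ?addr0 => [|a ai]; last first.
  by rewrite mxE eq_sym (negPf ai) mul0r.
rewrite mxE eqxx mul1r mulmx1 /mxtrace sumr_ge0// => r _.
have -> : (X' i *m E *m (X' i)^T) r r = lorentz (row r (X' i)) (row r (X' i)).
  by rewrite (form_rowE (@lorentzE R n.+1)).
apply: (null_orth_ge0 (y := Y c u)).
- by rewrite (@lorentzE R n.+1) (@Y_null _ _ _ _ _ _ imm c)// mxE.
- rewrite (@lorentzE R n.+1) -!row_mul /X' !mulmx_suml big1 ?row0 ?mxE// => l _.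
  by rewrite -!scalemxAl -!mulmxA (mulmxA (X l)) XY mulmx0 scaler0.
exact: (Y_pos mA imm umb three Ac Uu).
Qed.

(** The projected Hessian is corrected by a multiple of the block vector so as to become orthogonal
    to [Y]. The norm of the corrected family is the partial norm minus $m_ak_a$, and it is
    nonnegative. *)
Lemma bnorm_ge a u : U u -> (mu a)%:R * pk a <= bnorm a c u.
move=> Uu; have gu := gU Uu; have E_sym := mink_sym R n.+1.
set P := eproj c a u; set v := pvec c a u.
have PP : P *m P = P by exact: (proj_idem Ac a Uu).
have [_ Pg actP] := aP a; have {}Pg : P *m g u = g u *m P^T by exact: Pg.
have Pgi : P^T *m invmx (g u) = invmx (g u) *m P.
  by apply: (can_inj (mulKmx gu)); rewrite !mulmxA -Pg mulmxK// mulmxV// mul1mx.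
pose X k := P *m hes E (Y c) k u + col k (P *m g u) *m v.
have XY k : X k *m E *m (Y c u)^T = 0.
  rewrite !mulmxDl -!mulmxA (mulmxA (hes _ _ _ _)) (mulmxA v).
  rewrite (hes_position oU sY (@Y_null _ _ _ _ _ _ imm c))//.
  rewrite (pvec_position Ac a Uu) mulmx1 mulmxN !colE mulmxA.
  by rewrite addNr.
have := block_sqnorm_ge0 Uu XY.
pose G i k := invmx (g u) i k.
have hv k : hes E (Y c) k u *m E *m v^T = - (pk a *: col k (P *m g u)).
  rewrite -mink_tr (pvec_hes Ac a k Uu) linearN linearZ /= tr_row trmx_mul.
  by rewrite (gm_sym E_sym) Pg.
have vh k : v *m E *m (hes E (Y c) k u)^T = - (pk a *: (col k (P *m g u))^T).
  by rewrite -mink_tr hv linearN linearZ.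
have vv : v *m E *m v^T = (pk a)%:M.
  by rewrite (pvec_pvec Ac a a Uu) eqxx mulr1.
have XX k i : X k *m E *m (X i)^T *m invmx (g u) =
    P *m (hes E (Y c) k u *m E *m (hes E (Y c) i u)^T) *m (invmx (g u) *m P) -
    pk a *: (col k (P *m g u) *m (col i (P *m g u))^T *m invmx (g u)).
  have Pc j : P *m col j (P *m g u) = col j (P *m g u) by rewrite !colE !mulmxA PP.
  have cP j : (col j (P *m g u))^T *m P^T = (col j (P *m g u))^T by rewrite -trmx_mul Pc.
  rewrite [(X i)^T]linearD /= !trmx_mul !(mulmxDr, mulmxDl).
  have -> : P *m hes E (Y c) k u *m E *m ((hes E (Y c) i u)^T *m P^T) *m invmx (g u) =
      P *m (hes E (Y c) k u *m E *m (hes E (Y c) i u)^T) *m (invmx (g u) *m P).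
    by rewrite -Pgi !mulmxA.
  have -> : col k (P *m g u) *m v *m E *m ((hes E (Y c) i u)^T *m P^T) *m invmx (g u) =
      - (pk a *: (col k (P *m g u) *m (col i (P *m g u))^T *m invmx (g u))).
    rewrite !mulmxA -(mulmxA _ v) -(mulmxA _ (v *m E)) vh mulmxN -scalemxAr !mulNmx -!scalemxAl.
    by rewrite -(mulmxA _ _ P^T) cP.
  have -> : P *m hes E (Y c) k u *m E *m (v^T *m (col i (P *m g u))^T) *m invmx (g u) =
      - (pk a *: (col k (P *m g u) *m (col i (P *m g u))^T *m invmx (g u))).
    rewrite !mulmxA -(mulmxA P) -(mulmxA P (_ *m _)) hv mulmxN -scalemxAr Pc !mulNmx -!scalemxAl.
    by [].
  have -> : col k (P *m g u) *m v *m E *m (v^T *m (col i (P *m g u))^T) *m invmx (g u) =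
      pk a *: (col k (P *m g u) *m (col i (P *m g u))^T *m invmx (g u)).
    rewrite !mulmxA -(mulmxA _ v) -(mulmxA _ (v *m E)) vv mul_mx_scalar -!scalemxAl.
    by [].
  by rewrite addNr addr0.
rewrite /block_sqnorm; under eq_bigr => i _ do under eq_bigr => k _ do rewrite XX raddfB /= mxtraceZ mulrBr.
under eq_bigr => i _ do rewrite sumrB; rewrite sumrB.
have -> : \sum_i \sum_k invmx (g u) i k * (pk a * \tr (col k (P *m g u) *m (col i (P *m g u))^T *m invmx (g u))) =
    (mu a)%:R * pk a.
  have colsum (C D : 'M[R]_m) : \sum_i col i C *m (col i D)^T = C *m D^T.
    apply/matrixP => r t; rewrite summxE !mxE; eqbig i.
    by rewrite !mxE big_ord1 !mxE.
  set H := P *m g u.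
  transitivity (pk a * \tr (\sum_i col i P *m (col i H)^T *m invmx (g u))).
    rewrite raddf_sum mulr_sumr; apply: eq_bigr => i _ /=.
    have -> : col i P = \sum_k invmx (g u) i k *: col k H.
      rewrite -[P in LHS](mulmxK gu) -/H colE -mulmxA -colE.
      have -> : col i (invmx (g u)) = (row i (invmx (g u)))^T by rewrite tr_row (ginv_sym E_sym).
      apply/colP => r; rewrite summxE mxE; eqbig k.
      by rewrite !mxE mulrC.
    rewrite !mulmx_suml raddf_sum mulr_sumr; apply: eq_bigr => k _ /=.
    by rewrite -!scalemxAl mxtraceZ mulrCA.
  rewrite -mulmx_suml colsum mulrC; congr (_ * _); rewrite -(proj_tr Ac a Uu) -/P.
  by rewrite /H trmx_mul (gm_sym E_sym) -Pg !mulmxA PP mulmxK.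
rewrite subr_ge0; congr (_ <= _); rewrite bnormE//; eqbig i.
transitivity (\tr (P *m (act (invmx (g u)) (hes E (Y c) ^~ u) i *m E *m (hes E (Y c) i u)^T) *m (invmx (g u) *m P))).
  rewrite /act !mulmx_suml mulmx_sumr mulmx_suml raddf_sum; apply: eq_bigr => k _ /=.
  by rewrite -!scalemxAl -scalemxAr -scalemxAl mxtraceZ.
by rewrite -mulmxA mxtrace_mulC -!mulmxA PP.
Qed.

End Chart.

Section Transition.
Variables (c c' : chart R M m) (Ac : A c) (Ac' : A c').

Lemma trans_bnorm a u : overlap c c' u -> bnorm a c' u = bnorm a c (transition c c' u).
move=> ov; have Uu : cimg c' u by case/(overlapP mA c u Ac'): ov.
have oU := chart_open mA Ac; have oU' := overlap_open mA Ac Ac'.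
have gU := g_unit mA imm umb three Ac.
have gU' v : overlap c c' v -> gm E (Y c') v \in unitmx.
  by move=> /(overlapP mA c v Ac')[Uv _]; exact: (g_unit mA imm umb three Ac').
have ph v : overlap c c' v -> cimg c (transition c c' v) by exact: (transition_cimg mA).
have sph := transition_smooth mA Ac Ac'.
have tY v := @trans_Y _ _ _ _ _ _ mA imm umb three _ _ Ac Ac' v.
rewrite /bnorm (block_sqnorm_change E _ (X' := hes E (Y c') ^~ u) (D := jac (transition c c') u)
  (X := hes E (Y c) ^~ (transition c c' u))); last first.
  by move=> k; exact: (reparam_hes oU oU' (sm_Y mA imm umb three Ac) sph ph tY gU gU' k ov).
rewrite -(reparam_ginv oU oU' (sm_Y mA imm umb three Ac) sph ph tY gU gU' ov) !projE.
by rewrite -!mulmxA (trans_lag s a Ac Ac' ov).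
Qed.

End Transition.

(** * Slices through adapted coordinates and constancy of the partial norms *)

Section Slice.
Variables (c : chart R M m) (Ac : A c) (u0 : 'rV[R]_m) (Uu0 : cimg c u0).
Notation U := (cimg c).
Variables (V : set 'rV[R]_m) (w0 : 'rV[R]_m) (e : R) (zeta psi : 'rV[R]_m -> 'rV[R]_m).
Hypothesis ad : adapted U (fac c) (eproj c) u0 (binc R mu_sum) V w0 e zeta psi.
Variable a : 'I_3.

Let e0 : 0 < e. by case: ad => [[]]. Qed.
Let psiV w : ball w0 e w -> V (psi w) /\ zeta (psi w) = w.
by case: ad => _ [[+ _ _ _] _]; apply. Qed.
Let VU : V `<=` U. by case: ad => [[]]. Qed.

Definition slice (w : 'rV[R]_m) (t : 'rV[R]_(mu a)) := psi (w + (t - w *m (I_ a)^T) *m I_ a).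
Notation U' := (ball (w0 *m (I_ a)^T) e).

Lemma slice_arg w t : ball w0 e w -> U' t -> ball w0 e (w + (t - w *m (I_ a)^T) *m I_ a).
move=> Bw Bt; apply/(ball_binc mu_sum _ _ e0) => b; rewrite mulmxDl -mulmxA.
have [<-|ab] := eqVneq a b; first by rewrite bincK mulmx1 addrC subrK.
by rewrite (binc_neq R mu_sum ab) mulmx0 addr0; move/(ball_binc mu_sum _ _ e0): Bw.
Qed.

Lemma slice_smooth w : ball w0 e w -> Coo U' (slice w).
move=> Bw; have oB : open (ball w0 e) by exact: ball_open.
have oU' : open U' by exact: ball_open.
case: ad => _ [[_ _ _ sp] _].
apply: (sm_comp (phi := fun t => w + (t - w *m (I_ a)^T) *m I_ a) oB oU' _ _ sp).
  have sid := @sm_id R (mu a) U' oU'; smo.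
by move=> t; exact: slice_arg.
Qed.

Lemma slice_jac w t : ball w0 e w -> U' t ->
  jac (slice w) t = I_ a *m jac psi (w + (t - w *m (I_ a)^T) *m I_ a).
move=> Bw Bt; have oB : open (ball w0 e) by exact: ball_open.
have oU' : open U' by exact: ball_open.
case: ad => _ [[_ _ _ sp] _]; set phi := fun t => w + (t - w *m (I_ a)^T) *m I_ a.
have sid := @sm_id R (mu a) U' oU'.
have sphi : Coo U' phi by rewrite /phi; smo.
apply/row_matrixP => i; rewrite row_jac row_mul mulmx_sum_row.
rewrite (dd_comp i oB oU' sphi (fun t => @slice_arg w t Bw) Bt sp); eqbig j.
rewrite (row_jac psi j); congr (_ *: _); rewrite /phi (ddD _ Bt); [|exact: sm_cst|smo].
rewrite dd_cst add0r (dd_mulmxl oU')//; last by smo.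
rewrite (ddB oU')//; last by smo.
by rewrite dd_cst subr0 ddE pd_id -rowE.
Qed.

Lemma slice_fac w t : ball w0 e w -> U' t -> fac c a (slice w0 t) = fac c a (slice w t).
move=> Bw Bt; case: ad => _ [_ [_ _ yy]]; apply: yy; try exact: slice_arg.
  by apply: slice_arg => //; exact: ballxx.
by rewrite !mulmxDl -!mulmxA bincK !mulmx1 [LHS]addrC [RHS]addrC !subrK.
Qed.

Let oB : open (ball w0 e). exact: ball_open. Qed.
Let oU' : open U'. exact: ball_open. Qed.
Let oU := chart_open mA Ac.
Let sY := sm_Y mA imm umb three Ac.
Let gU := g_unit mA imm umb three Ac.
Let aP := proj_adm Ac a.
Let gB u : U u -> exists k (B : 'M[R]_(m, k)), gm E (Y c) u = B *m B^T.
by move=> Uu; have gE := g_gram mA imm umb three Ac Uu; do 2 eexists; exact: gE. Qed.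
Let sfa := sm_facvec Ac a.
Let pP : parallel E U (Y c) (eproj c a). by case: aP. Qed.
Let Pg u : U u -> eproj c a u *m gm E (Y c) u = gm E (Y c) u *m (eproj c a u)^T.
by case: aP => _ + _; apply. Qed.
Let Prank u : U u -> \rank (eproj c a u) = mu a.
by move=> Uu; exact: (proj_rank Ac a Uu). Qed.
Let yP u : U u -> jac (fac c a) u = eproj c a u *m jac (Y c) u.
exact: (jac_facvec Ac a). Qed.

Section Fixed.
Variables (w : 'rV[R]_m) (Bw : ball w0 e w).
Let phiU t : U' t -> U (slice w t).
by move=> Bt; apply: VU; case: (psiV (slice_arg Bw Bt)). Qed.
Let DP t : U' t -> jac (slice w) t *m eproj c a (slice w t) = jac (slice w) t.
move=> Bt; rewrite slice_jac//; case: ad => _ [_ [+ _ _]]; apply; exact: slice_arg.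
Qed.
Let Dfree t : U' t -> row_free (jac (slice w) t).
move=> Bt; rewrite slice_jac//; case: ad => _ [_ [_ + _]]; apply; exact: slice_arg.
Qed.
Let z t := fac c a (slice w0 t).
Let zE t : U' t -> z t = fac c a (slice w t). exact: slice_fac. Qed.
Let ss := slice_smooth Bw.

Lemma slice_z_smooth : Coo U' z.
exact: (sub_smooth oU sfa oU' ss phiU zE). Qed.

Lemma slice_gm_unit t : U' t -> gm E z t \in unitmx.
exact: (sub_gm_unit oU sfa gU gB yP oU' ss phiU DP Dfree zE). Qed.

Lemma slice_lap t : U' t -> lap E z t = - ((mu a)%:R * pk a) *: z t.
move=> Bt; rewrite (sub_lap oU sY sfa gU gB pP Pg Prank yP oU' ss phiU DP Dfree zE Bt) zE//.
have -> : ctr (invmx (gm E (Y c) (slice w t)) *m eproj c a (slice w t)) ((hes E (Y c))^~ (slice w t)) =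
    - ((mu a)%:R *: pvec c a (slice w t)).
  by rewrite pvecE scalerA mulfV ?pnatr_eq0 -?lt0n// scale1r /htrace opprK.
by rewrite scaleNr scalerA -mulrA mulfV// mulr1.
Qed.

(** The left side involves only the slice through the centre [w0], so the partial norm at [psi w]
    depends on block [a] of [w] alone. *)
Lemma slice_hes_sqnorm : hes_sqnorm E z (w *m (I_ a)^T) = bnorm a c (psi w).
have Bt : U' (w *m (I_ a)^T) by move/(ball_binc mu_sum _ _ e0): Bw.
rewrite (sub_hes_sqnorm oU sY sfa gU gB pP Pg Prank yP oU' ss phiU DP Dfree zE Bt).
by rewrite /bnorm /slice subrr mul0mx addr0.
Qed.

End Fixed.

End Slice.

(** Of three functions of separate blocks with constant sum each is constant: changing one block
    changes only one summand. *)
Lemma bnorm_locally_const c u0 V w0 e zeta psi a w w' : A c -> cimg c u0 ->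
  adapted (cimg c) (fac c) (eproj c) u0 (binc R mu_sum) V w0 e zeta psi ->
  ball w0 e w -> ball w0 e w' -> bnorm a c (psi w) = bnorm a c (psi w').
move=> Ac Uu0 ad Bw Bw'; have [[oV Vu VU e0] [[psiV _ _ _] _]] := ad.
(* Block [a] is taken from [w], the others from [w']. *)
pose v := assemble mu_sum (fun d => (if d == a then w else w') *m (I_ d)^T).
have Bv : ball w0 e v.
  apply/(ball_binc mu_sum _ _ e0) => d; rewrite assembleK; case: eqP => _.
    by move/(ball_binc mu_sum _ _ e0): Bw.
  by move/(ball_binc mu_sum _ _ e0): Bw'.
have inU r : ball w0 e r -> cimg c (psi r) by move=> /psiV[/VU].
have S r : ball w0 e r -> \sum_d bnorm d c (psi r) = (m%:R - 1) / m%:R + 2 * ptau.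
  by move=> Br; rewrite big3 bnorm_sum//; exact: inU.
have := S v Bv; rewrite -(S w' Bw') (bigD1 a)//= [RHS](bigD1 a)//=.
have -> : bnorm a c (psi v) = bnorm a c (psi w).
  by rewrite -!(slice_hes_sqnorm Ac ad)// assembleK eqxx.
rewrite (eq_bigr (fun d => bnorm d c (psi w'))); first by move/addIr.
move=> d da; rewrite -!(slice_hes_sqnorm Ac ad)// assembleK.
by rewrite (negPf da).
Qed.

Lemma bnorm_const : exists ka : 'I_3 -> R, forall a c u, A c -> cimg c u -> bnorm a c u = ka a.
case: (mA) => [[_ _ conM [q0 _]] [chA covA _]].
pose h a := globalize mA (fun c u => bnorm a c u).
have hE a c u : A c -> cimg c u -> h a (cinv c u) = bnorm a c u.
  move=> Ac Uu; apply: (globalizeE mA (F := fun c u => bnorm a c u) _ Ac Uu) => ? ? ? ? ? ?.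
  exact: trans_bnorm.
exists (fun a => h a q0) => a c u Ac Uu; rewrite -hE//.
have loc p : \forall q \near p, h a q = h a p.
  have [c1 Ac1 c1p] := covA p; have [oD oI cK cC cI] := chA c1 Ac1.
  have Up := chart_cimg c1p.
  have [V [w0 [e [zeta [psi ad]]]]] := facvec_adapted Ac1 Up.
  have [[oV Vu VU e0] [[psiV Vpsi _ _] _]] := ad.
  have NV : \forall q \near p, V (cmap c1 q) by exact: (cC p c1p _ (open_nbhs_nbhs (conj oV Vu))).
  have ND : nbhs p (cdom c1) by exact: open_nbhs_nbhs.
  apply: filterS2 ND NV => q Dq Vq; have Uq := chart_cimg Dq.
  rewrite -(cK q Dq) -(cK p c1p) !hE//.
  have [Bp pE] := Vpsi _ Vu; have [Bq qE] := Vpsi _ Vq.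
  by rewrite -pE -qE; exact: (bnorm_locally_const _ Ac1 Up ad).
have opn p : open [set q | h a q = h a p].
  rewrite openE => q /= hq; rewrite /interior; have := loc q; rewrite /= hq.
  by apply: filterS => r /= ->.
suff : [set q | h a q = h a q0] = setT by move=> /seteqP[_ /(_ (cinv c u) I)].
apply: conM.
- by exists q0.
- by exists [set q | h a q = h a q0] => //; rewrite setTI.
exists [set q | h a q = h a q0]; last by rewrite setTI.
rewrite -openC openE => q /= hq; rewrite /interior.
by have := loc q; apply: filterS => r /= hr; rewrite hr.
Qed.

Notation gfac a q := ((pk a)^-1 *: gpvec a q).

Lemma gfac_gfac a b p q : a != b -> lorentz (gfac a p) (gfac b q) = 0.
move=> ab; rewrite lorentzZl lorentzZr.
by rewrite (gpvec_orthogonal p q ab) !mulr0.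
Qed.

Lemma gfac_sqnorm a q : lorentz (gfac a q) (gfac a q) = (pk a)^-1.
rewrite lorentzZl lorentzZr (gpvec_gpvec) eqxx mulr1.
by rewrite mulVf// mulr1.
Qed.

Lemma gfacE a c u : A c -> cimg c u -> gfac a (cinv c u) = fac c a u.
by move=> Ac Uu; rewrite (gpvecE a Ac Uu). Qed.

(** * The factors of the fourth family and the final assembly *)

Section Factor.
Variables (c : chart R M m) (Ac : A c) (u0 : 'rV[R]_m) (V : set 'rV[R]_m) (w0 : 'rV[R]_m) (e : R).
Variables (zeta psi : 'rV[R]_m -> 'rV[R]_m).
Hypothesis ad : adapted (cimg c) (fac c) (eproj c) u0 (binc R mu_sum) V w0 e zeta psi.
Variable a : 'I_3.
Notation ca := (w0 *m (I_ a)^T).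
Notation z := (fun t : 'rV[R]_(mu a) => fac c a (slice psi w0 t)).
Let e0 : 0 < e. by case: ad => [[]]. Qed.
Let B0 : ball w0 e w0. exact: ballxx. Qed.

Lemma slice_cimg t : ball ca e t -> cimg c (slice psi w0 t).
move=> Bt; have [[oV Vu VU _] [[psiV _ _ _] _]] := ad.
by apply: VU; apply: (proj1 (psiV _ _)); exact: (slice_arg ad).
Qed.

Variables (N' : nat) (Q : space_form R N') (E' : 'M[R]_N').
Variables (L : 'M[R]_(1 + n.+1, N')) (K : 'M[R]_(N', 1 + n.+1)) (ka : R).
Hypotheses (E'_sym : E'^T = E') (E'U : E' \in unitmx).
Hypothesis QE : forall u v, sf_form Q u v = (u *m E' *m v^T) 0 0.
Hypotheses (KE : K *m E *m K^T = E') (Qk : sf_curv Q = pk a).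
Hypothesis yLK : forall q, gfac a q = gfac a q *m L *m K.
Hypothesis yQ : forall q, sf_pts Q (gfac a q *m L).
Hypothesis bE : forall u, cimg c u -> bnorm a c u = ka.

(** The squashing chart makes the factor a function on a whole vector space; the other blocks are
    frozen at the centre [w0], and [L] passes to coordinates in the span of the factor. *)
Definition ls_factor (v : 'rV[R]_(mu a)) : 'rV[R]_N' := z (bsquash ca e v) *m L.

Let oB : open (ball ca e). exact: ball_open. Qed.
Let f := ls_factor \o cinv (ball_chart ca e).
Let fE t : ball ca e t -> f t = z t *m L.
by move=> Bt; rewrite /f /ls_factor /= bunsquashK. Qed.
Let sz : Coo (ball ca e) z := slice_z_smooth Ac ad a B0.
Let sf : Coo (ball ca e) f.
apply: (sm_ext oB (f := fun t => z t *m L)); first by move=> t Bt; rewrite fE.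
exact: (sm_const_mulmxl oB).
Qed.
Let zf t : ball ca e t -> z t = f t *m K.
by move=> Bt; rewrite fE// -!(gfacE a Ac (slice_cimg Bt)). Qed.
Let gU t : ball ca e t -> gm E z t \in unitmx.
exact: (slice_gm_unit Ac ad B0). Qed.
Let zz t : ball ca e t -> z t *m E *m (z t)^T = ((pk a)^-1)%:M.
move=> Bt; apply: mx11_eq; rewrite -(@lorentzE R n.+1) -(gfacE a Ac (slice_cimg Bt)) gfac_sqnorm.
by rewrite mxE mulr1n.
Qed.
Let lapz t : ball ca e t -> lap E z t = - ((mu a)%:R * pk a) *: z t.
exact: (slice_lap Ac ad B0). Qed.

(** Bounds the dimension of the span below, so that the codimensions exist as natural numbers. *)
Lemma ls_factor_dim : (mu a < N')%N.
exact: (lift_dim oB E'_sym QE KE sf zf gU (kn0 a) Qk zz (ballxx ca e0)).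
Qed.

Lemma ls_factor_minimal_csc :
  minimal_csc Q [set ball_chart ca e] ls_factor ((mu a)%:R ^+ 2 * pk a - ka).
split; first exact: ball_chart_manifold.
- split=> [v|_ ->|_ -> t]; rewrite ?ball_chart_cimg//.
    rewrite /ls_factor -(gfacE a Ac (slice_cimg (squash_ball ca e0 v))); exact: yQ.
  exact: (lift_row_free oB KE sf zf gU).
- move=> _ -> t; rewrite ball_chart_cimg//.
  exact: (lift_minimal oB E'_sym E'U QE KE (mu_gt0 a) sf zf gU (kn0 a) Qk lapz zz).
move=> _ -> t; rewrite ball_chart_cimg// => Bt.
rewrite (lift_scalar_curvature oB E'_sym E'U QE KE sf zf gU (kn0 a) lapz zz Bt); congr (_ - _).
pose w := w0 + (t - ca) *m I_ a; have Bw : ball w0 e w by exact: (slice_arg ad).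
have wE : w *m (I_ a)^T = t by rewrite mulmxDl -mulmxA bincK mulmx1 addrC subrK.
rewrite -[X in hes_sqnorm E z X]wE.
rewrite (slice_hes_sqnorm Ac ad a Bw) bE//.
by have [[oV Vu VU _] [[psiV _ _ _] _]] := ad; apply: VU; case: (psiV _ Bw).
Qed.

End Factor.
Arguments ls_factor : clear implicits.

Hypotheses (k0 : pk 0 < 0) (k1 : 0 < pk 1) (k2 : 0 < pk 2).
Hypothesis ks : (pk 0)^-1 + (pk 1)^-1 + (pk 2)^-1 = 0.
Hypothesis sk : s 0 / pk 0 + s 1 / pk 1 + s 2 / pk 2 = 1.
Hypothesis gposE : forall q, gpos q = gfac 0 q + gfac 1 q + gfac 2 q.

Lemma castmx_scale p k l (h : k = l) (b : R) (X : 'M[R]_(p, k)) :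
  castmx (erefl p, h) (b *: X) = b *: castmx (erefl p, h) X.
by case: _ / h; rewrite !castmx_id. Qed.

(** The block vector is timelike with pairing 1 with [gpos], hence past directed; division by the
    negative [pk 0] turns it to the future. *)
Lemma gfac0_future q : 0 < gfac 0 q 0 0.
rewrite mxE nmulr_rgt0 ?invr_lt0//.
apply: (nonspacelike_past (gpos_null q) (gpos_pos q)).
  by rewrite lorentzC (gpvec_gpos).
by rewrite (gpvec_gpvec) eqxx mulr1 ltW.
Qed.

Lemma ls_constants : exists (ka : 'I_3 -> R) (r1 r2 r3 n1 n2 n3 K : R),
  (forall a c u, A c -> cimg c u -> bnorm a c u = ka a) /\
  [/\ r1 ^+ 2 = - (pk 0)^-1, r2 ^+ 2 = (pk 1)^-1 & r3 ^+ 2 = (pk 2)^-1] /\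
  [/\ LS_parameters (mu 0) (mu 1) (mu 2) r1 r2 r3 n1 n2 n3,
      (mu 2)%:R * r2 ^+ 2 <> (mu 1)%:R * r3 ^+ 2, LS_constant (mu 0) (mu 1) (mu 2) r1 r2 r3 K &
      [/\ n1 * K = (mu 0)%:R * pk 0 - ka 0, n2 * K = (mu 1)%:R * pk 1 - ka 1 &
          n3 * K = (mu 2)%:R * pk 2 - ka 2]].
have [ka kaE] := bnorm_const; exists ka.
case: (mA) => [[_ _ _ [q _]] _]; have [c [u [Ac Uu _]]] := point_chart q.
have ge a : (mu a)%:R * pk a <= ka a.
  rewrite -(kaE a c u Ac Uu); exact: (bnorm_ge Ac a Uu).
have se : ka 0 + ka 1 + ka 2 = (m%:R - 1) / m%:R + 2 * ptau.
  rewrite -!(kaE _ c u Ac Uu); exact: (bnorm_sum Ac Uu).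
have Ek a : m%:R * s a + ptau = (mu a)%:R * pk a.
  by rewrite [RHS]mulrC /pk divfK// pnatr_eq0 -lt0n.
have sn a b : a != b -> s a != s b by apply: contra_neq; exact: s_inj.
have mE : (mu 0%R + mu 1%R + mu 2%R)%:R = m%:R :> R by rewrite mu_sum.
have := @LS_constants R (mu 0) (mu 1) (mu 2) (s 0) (s 1) (s 2) (pk 0) (pk 1) (pk 2) (ka 0) (ka 1) (ka 2).
rewrite /= mE -/(ptau) => H.
have [r1 [r2 [r3 [n1 [n2 [n3 [K [rr LC]]]]]]]] := H (And3 (mu_gt0 0) (mu_gt0 1) (mu_gt0 2))
  (And3 (sn 0 1 isT) (sn 0 2 isT) (sn 1 2 isT)) (And3 k0 k1 k2) (And3 (Ek 0) (Ek 1) (Ek 2)) ks sk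
  (And3 (ge 0) (ge 1) (ge 2)) se.
by exists r1, r2, r3, n1, n2, n3, K.
Qed.

Lemma ls_case : exists (p1 p2 p3 : nat) (r1 r2 r3 n1 n2 n3 : R),
  [/\ LS_parameters (mu 0) (mu 1) (mu 2) r1 r2 r3 n1 n2 n3,
      (mu 2)%:R * r2 ^+ 2 <> (mu 1)%:R * r3 ^+ 2 &
      mobius_equivalent_to_LS A x (mu 0) (mu 1) (mu 2) p1 p2 p3 r1 r2 r3 n1 n2 n3].
have [ka [r1 [r2 [r3 [n1 [n2 [n3 [K0 [kaE [[R1 R2 R3] [LP neq LC [N1 N2 N3]]]]]]]]]]]] := ls_constants.
case: (mA) => [[_ _ _ [q0 _]] _].
have y0n : lorentz (gfac 0 q0) (gfac 0 q0) < 0 by rewrite gfac_sqnorm invr_lt0.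
have [d0 [d1 [d2 [e [T [L0 [L1 [L2 [K_0 [K_1 [K_2 H]]]]]]]]]]] :=
  split_frame (fun a b p q => @gfac_gfac a b p q) y0n (gfac0_future q0).
case: H => [[hT T0 Tr] [[yK0 yK1 yK2] [[KE0 KE1 KE2] [yL0 yL1 yL2]]]].
have gL0 q : gpos q *m L0 = gfac 0 q *m L0.
  by have [h1 h2] := yL0 q; rewrite gposE; move: (gfac 0 q) (gfac 1 q) (gfac 2 q) h1 h2 => v0 v1 v2 h1 h2; rewrite !mulmxDl h1 h2 !addr0.
have gL1 q : gpos q *m L1 = gfac 1 q *m L1.
  by have [h1 h2] := yL1 q; rewrite gposE; move: (gfac 0 q) (gfac 1 q) (gfac 2 q) h1 h2 => v0 v1 v2 h1 h2; rewrite !mulmxDl h1 h2 add0r addr0.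
have gL2 q : gpos q *m L2 = gfac 2 q *m L2.
  by have [h1 h2] := yL2 q; rewrite gposE; move: (gfac 0 q) (gfac 1 q) (gfac 2 q) h1 h2 => v0 v1 v2 h1 h2; rewrite !mulmxDl h1 h2 !add0r.
have yp q : 0 < (gfac 0 q *m L0) 0 0.
  rewrite -gL0 -T0; have [_ Tp] := hT; apply: Tp; first exact: gpos_null.
  exact: gpos_pos.
have nE a N' (L : 'M[R]_(1 + n.+1, N')) (K : 'M[R]_(N', 1 + n.+1)) F q : K *m E *m K^T = F ->
    (forall q, gfac a q = gfac a q *m L *m K) ->
    (gfac a q *m L *m F *m (gfac a q *m L)^T) 0 0 = (pk a)^-1.
  move=> <- H; have := gfac_sqnorm a q; have := H q; rewrite (@lorentzE R n.+1).
  by move: (gfac a q) => v vE <-; rewrite [in RHS]vE [in RHS]trmx_mul !mulmxA.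
have h0 : sf_curv (hyperbolic d0 (- r1 ^- 2)) = pk 0 by rewrite /= R1 invrN opprK invrK.
have h1 : r2 ^- 2 = pk 1 by rewrite R2 invrK.
have h2 : r3 ^- 2 = pk 2 by rewrite R3 invrK.
have pt0 q : sf_pts (hyperbolic d0 (- r1 ^- 2)) (gfac 0 q *m L0).
  split; last exact: yp.
  by rewrite (@lorentzE R d0) (nE 0 _ L0 K_0)// -h0.
have pt1 q : dot (gfac 1 q *m L1) (gfac 1 q *m L1) = r2 ^+ 2.
  by rewrite dotE (nE 1 _ L1 K_1)// R2.
have pt2 q : dot (gfac 2 q *m L2) (gfac 2 q *m L2) = r3 ^+ 2.
  by rewrite dotE (nE 2 _ L2 K_2)// R3.
have [c [u [Ac Uu q0E]]] := point_chart q0.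
have [V [w0 [eps [zeta [psi ad]]]]] := facvec_adapted Ac Uu.
have D0 : (mu 0%R < 1 + d0)%N.
  apply: (ls_factor_dim Ac ad (Q := hyperbolic d0 (- r1 ^- 2)) (mink_sym R d0) _ KE0 h0 yK0).
  by move=> ? ?; exact: (@lorentzE R d0).
(* The dimension [d1] is not yet known to be a successor, as [sphere] demands, so the bound is taken
   in an auxiliary space form with the right product and curvature. *)
have D1 : (mu 1%R < d1)%N.
  exact: (ls_factor_dim Ac ad (Q := SpaceForm (@dot R d1) (pk 1) setT) (trmx1 R d1) (@dotE R d1) KE1 (erefl _) yK1).
have D2 : (mu 2%R < d2)%N.
  exact: (ls_factor_dim Ac ad (Q := SpaceForm (@dot R d2) (pk 2) setT) (trmx1 R d2) (@dotE R d2) KE2 (erefl _) yK2).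
clear c u Ac Uu q0E V w0 eps zeta psi ad.
have [p1 P1] : exists p1, d0 = (mu 0%R + p1)%N by exists (d0 - mu 0%R)%N; lia.
have [p2 P2] : exists p2, d1 = (mu 1%R + p2).+1 by exists (d1 - (mu 1%R).+1)%N; lia.
have [p3 P3] : exists p3, d2 = (mu 2%R + p3).+1 by exists (d2 - (mu 2%R).+1)%N; lia.
subst d0 d1 d2; exists p1, p2, p3, r1, r2, r3, n1, n2, n3; split=> //.
exists e; exists T => // q.
have [c [u [Ac Uu qE]]] := point_chart q.
have [V [w0 [eps [zeta [psi ad]]]]] := facvec_adapted Ac Uu.
have bka a v : cimg c v -> bnorm a c v = ka a by move=> Uv; exact: kaE.
have M0 := ls_factor_minimal_csc Ac ad (Q := hyperbolic (mu 0%R + p1) (- r1 ^- 2)) (mink_sym R _)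
  (mink_unit R _) (fun u v => @lorentzE R _ u v) KE0 h0 yK0 pt0 (@bka 0).
have M1 := ls_factor_minimal_csc Ac ad (Q := sphere (mu 1%R + p2) r2) (trmx1 R _)
  (unitmx1 R _) (@dotE R _) KE1 h1 yK1 pt1 (@bka 1).
have M2 := ls_factor_minimal_csc Ac ad (Q := sphere (mu 2%R + p3) r3) (trmx1 R _)
  (unitmx1 R _) (@dotE R _) KE2 h2 yK2 pt2 (@bka 2).
have [[oV Vu VU eps0] [[psiV Vpsi sz sp] [_ _ yy]]] := ad.
exists 'rV[R]_(mu 0), 'rV[R]_(mu 1), 'rV[R]_(mu 2).
exists [set ball_chart (w0 *m (I_ 0)^T) eps], [set ball_chart (w0 *m (I_ 1)^T) eps], [set ball_chart (w0 *m (I_ 2)^T) eps].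
exists (ls_factor c w0 eps psi 0 _ L0), (ls_factor c w0 eps psi 1 _ L1), (ls_factor c w0 eps psi 2 _ L2).
exists (product_param mu_sum c w0 eps psi); split.
- exists K0; [exact: LC|split].
  + have -> : - ((mu 0)%:R * ((mu 0)%:R - 1) / r1 ^+ 2) + n1 * K0 = (mu 0)%:R ^+ 2 * pk 0 - ka 0.
      by rewrite N1 R1 invrN invrK; ring.
    exact: M0.
  + have -> : (mu 1)%:R * ((mu 1)%:R - 1) / r2 ^+ 2 + n2 * K0 = (mu 1)%:R ^+ 2 * pk 1 - ka 1.
      by rewrite N2 R2 invrK; ring.
    exact: M1.
  + have -> : (mu 2)%:R * ((mu 2)%:R - 1) / r3 ^+ 2 + n3 * K0 = (mu 2)%:R ^+ 2 * pk 2 - ka 2.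
      by rewrite N3 R3 invrK; ring.
    exact: M2.
- exact: (product_param_open_embedding mA mu_sum Ac oV VU eps0 psiV Vpsi sz sp).
- rewrite (range_product_param mA mu_sum Ac VU eps0 psiV Vpsi) qE.
  by have [h3 h4] := chart_cinv mA Ac Uu; split=> //; rewrite h4.
move=> z; have Bz := squash3_ball mu_sum w0 eps0 z.
set w := squash3 mu_sum w0 eps z *m blocks R mu_sum in Bz.
have Uw : cimg c (psi w) by apply: VU; case: (psiV _ Bz).
have zE a t : w *m (I_ a)^T = t -> ball (w0 *m (I_ a)^T) eps t ->
    gfac a (cinv c (psi w)) = fac c a (slice psi w0 t).
  move=> wt Bt; rewrite (gfacE a Ac Uw); apply: yy => //.
    by apply: (slice_arg ad) => //; exact: ballxx.
  by rewrite wt mulmxDl -mulmxA bincK mulmx1 addrC subrK.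
have [w_0 w_1 w_2] := squash3_block mu_sum w0 eps z.
rewrite (gpos_mobius) T0 Tr gL0 gL1 gL2 /LS_map /product_param -/w.
rewrite (zE _ _ w_0) ?(zE _ _ w_1) ?(zE _ _ w_2); try exact: squash_ball.
by rewrite castmx_scale.
Qed.

End GlobalEigenvalues.

(** * Moving the timelike factor to the first place *)

Section Reordering.
Variable R : realType.

(** Orthogonality would make the product of the time coordinates equal to that of the space parts,
    but for timelike vectors it is strictly larger in absolute value than Cauchy-Schwarz allows for
    the latter. *)
Lemma timelike_not_orthogonal n (u v : 'rV[R]_(1 + n)) :
  lorentz u u < 0 -> lorentz v v < 0 -> lorentz u v != 0.
move=> uu vv; apply/negP => /eqP uv; have := dot_CauchySchwarz (rsubmx u) (rsubmx v).
have := dot_ge0 (rsubmx u); have := dot_ge0 (rsubmx v); move: uu vv uv; rewrite /lorentz.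
move: (dot (rsubmx u) (rsubmx u)) (dot (rsubmx v) (rsubmx v)) (dot (rsubmx u) (rsubmx v)) => a b c.
move: (u 0 0) (v 0 0) => p q h1 h2 h3 b0 a0 cs.
have cE : c = p * q by lra.
have ap : a < p * p by lra.
have bq : b < q * q by lra.
have : a * b < (p * p) * (q * q).
  by apply: le_lt_trans (ler_wpM2r b0 (ltW ap)) _; rewrite ltr_pM2l// (le_lt_trans a0).
by move: cs; rewrite cE leNgt (_ : (p * q) ^+ 2 = p * p * (q * q)) ?expr2; [move=> /negP h /h|ring].
Qed.

(** Cyclic shifts are enough, since only one factor has to reach a given place, and they are
    compatible with the cyclic indices of [lag]. *)
Definition rotate (T : Type) (t : 'I_3) (f : 'I_3 -> T) (a : 'I_3) := f (a + t).

Let I11 : 1 + 1 = 2 :> 'I_3. exact/val_inj. Qed.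
Let I12 : 1 + 2 = 0 :> 'I_3. exact/val_inj. Qed.
Let I21 : 2 + 1 = 0 :> 'I_3. exact/val_inj. Qed.
Let I22 : 2 + 2 = 1 :> 'I_3. exact/val_inj. Qed.
Definition ord3E := (I11, I12, I21, I22).

Lemma annih_rotate m (S : 'M[R]_m) s t : annih S s = 0 -> annih S (rotate t s) = 0.
rewrite /annih /rotate !add0r => S0; case: (ord3_cases t) => ->; rewrite ?addr0 ?ord3E//.
  by rewrite -mulmxA (shift_comm S (s 2) (s 0)) mulmxA (shift_comm S (s 1) (s 0)).
by rewrite (shift_comm S (s 2) (s 0)) -mulmxA (shift_comm S (s 2) (s 1)) mulmxA.
Qed.

Lemma lag_rotate m (S : 'M[R]_m) s t a : lag S (rotate t s) a = lag S s (a + t).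
by rewrite /lag /lag_coef /rotate !(addrAC a _ t).
Qed.

Lemma ptau_rotate (s : 'I_3 -> R) mu t : ptau (rotate t s) (rotate t mu) = ptau s mu.
by rewrite /ptau /rotate !add0r; case: (ord3_cases t) => ->; rewrite ?addr0 ?ord3E//; ring.
Qed.

Lemma pk_rotate m (s : 'I_3 -> R) mu t a : pk m (rotate t s) (rotate t mu) a = pk m s mu (a + t).
by rewrite /pk ptau_rotate. Qed.

Lemma rotate_sum (mu : 'I_3 -> nat) t :
  (rotate t mu 0%R + rotate t mu 1%R + rotate t mu 2%R)%N = (mu 0%R + mu 1%R + mu 2%R)%N.
by rewrite /rotate !add0r; case: (ord3_cases t) => ->; rewrite ?addr0 ?ord3E//; lia.
Qed.

Lemma rotate_inj (s : 'I_3 -> R) t : injective s -> injective (rotate t s).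
by move=> si a b /si /addIr. Qed.

Lemma rotate_sum3 (V : nmodType) (F : 'I_3 -> V) t :
  F (0 + t) + F (1 + t) + F (2 + t) = F 0 + F 1 + F 2.
case: (ord3_cases t) => ->; rewrite ?addr0 ?add0r ?ord3E//; last by rewrite -addrA addrC.
by rewrite addrC addrA.
Qed.

End Reordering.

Section Rotation.
Variables (R : realType) (m n : nat) (M : topologicalType).
Variables (A : set (chart R M m)) (x : M -> 'rV[R]_n.+1).
Hypotheses (mA : is_manifold A) (imm : immersion A (sphere n 1) x).
Hypotheses (umb : umbilic_free A (sphere n 1) x) (three : three_blaschke_eigenvalues A x).

Lemma gpvec_rotate (s : 'I_3 -> R) mu t a q :
  gpvec x mA (rotate t s) (rotate t mu) a q = gpvec x mA s mu (a + t) q.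
have [c [u [Ac Uu ->]]] := point_chart mA q.
rewrite !(gpvecE mA imm umb three _ _ _ Ac Uu) !pvecE.
have -> : eproj x (rotate t s) c a = eproj x s c (a + t).
  by rewrite !projE; apply/funext => v; rewrite lag_rotate.
by [].
Qed.

End Rotation.

Theorem theorem1p3 (R : realType) (m p : nat) (M : topologicalType)
    (A : set (chart R M m)) (x : M -> 'rV[R]_(m + p).+1) :
  is_manifold A ->
  immersion A (sphere (m + p) 1) x ->
  umbilic_free A (sphere (m + p) 1) x ->
  blaschke_parallel A x ->
  mobius_form_vanishes A x ->
  three_blaschke_eigenvalues A x ->
  [\/ exists2 xt : M -> 'rV[R]_(m + p).+1,
        special_pseudo_parallel A (sphere (m + p) 1) xt &
        mobius_equivalent x xt,
      exists2 xb : M -> 'rV[R]_(m + p),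
        special_pseudo_parallel A (euclidean R (m + p)) xb &
        mobius_equivalent x (fun q => sigma (xb q)),
      exists2 xb : M -> 'rV[R]_(1 + (m + p)),
        special_pseudo_parallel A (hyperbolic (m + p) (-1)) xb &
        mobius_equivalent x (fun q => tau (xb q)) |
      exists (m1 m2 m3 p1 p2 p3 : nat) (r1 r2 r3 mu1 mu2 mu3 : R),
        [/\ m = (m1 + m2 + m3)%N, p = (p1 + p2 + p3 + 1)%N,
            LS_parameters m1 m2 m3 r1 r2 r3 mu1 mu2 mu3,
            m3%:R * r2 ^+ 2 <> m2%:R * r3 ^+ 2 &
            mobius_equivalent_to_LS A x m1 m2 m3 p1 p2 p3
              r1 r2 r3 mu1 mu2 mu3]].
Proof.
move=> mA imm umb bp mf three.
have [s [mu [s_inj mu_gt0 mu_sum spec]]] := blaschke_spectrum mA imm umb bp mf three.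
have [[c cY]|[kn0 ks sk g0]] := dichotomy mA imm umb bp mf three s_inj mu_gt0 spec.
  have [cc|cc|cc] := ltgtP (lorentz c c) 0.
  - apply: Or41; exact: (timelike_case imm umb bp mf three s_inj spec cY cc).
  - apply: Or43; exact: (spacelike_case imm umb bp mf three s_inj spec cY cc).
  - apply: Or42; exact: (null_case imm umb bp mf three s_inj spec cY cc).
apply: Or44; case: (mA) => [[_ _ _ [q0 _]] _].
(* If all the [pk] were positive their inverses could not add up to zero. *)
have [t kt] : exists t, pk m s mu t < 0.
  apply: contrapT => H; have kp a : 0 < (pk m s mu a)^-1.
    by rewrite invr_gt0 lt_neqAle eq_sym kn0 /= leNgt; apply/negP => h; apply: H; exists a.
  by move: ks; rewrite /ksum => /eqP; rewrite gt_eqF// !addr_gt0.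
(* A second negative one would give two orthogonal timelike vectors at [q0]. *)
have kp a : a != t -> 0 < pk m s mu a.
  move=> at_; rewrite lt_neqAle eq_sym kn0 /= leNgt; apply/negP => ka.
  have nn b : pk m s mu b < 0 -> lorentz (gpvec x mA s mu b q0) (gpvec x mA s mu b q0) < 0.
    by move=> kb; rewrite (gpvec_gpvec mA imm umb bp mf three s_inj mu_gt0 spec) eqxx mulr1.
  have := timelike_not_orthogonal (nn a ka) (nn t kt).
  by rewrite (gpvec_orthogonal mA imm umb bp mf three s_inj mu_gt0 mu_sum spec kn0 q0 q0 at_) eqxx.
have spec' c u : A c -> cimg c u ->
    annih (bshape (mobius_position (x \o cinv c)) u) (rotate t s) = 0 /\
    forall a, \tr (lag (bshape (mobius_position (x \o cinv c)) u) (rotate t s) a) = (rotate t mu a)%:R /\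
      \rank (lag (bshape (mobius_position (x \o cinv c)) u) (rotate t s) a) = rotate t mu a.
  move=> Ac Uu; have [h1 h2] := spec c u Ac Uu; split; first exact: annih_rotate.
  by move=> a; rewrite lag_rotate; exact: h2.
have kr a : pk m (rotate t s) (rotate t mu) a = pk m s mu (a + t) by exact: pk_rotate.
have sum' : (rotate t mu 0%R + rotate t mu 1%R + rotate t mu 2%R)%N = m by rewrite rotate_sum.
have at_ a : a != 0 -> a + t != t by move=> a0; rewrite -[X in _ != X]add0r (inj_eq (addIr t)).
have [|||||||p1 [p2 [p3 [r1 [r2 [r3 [n1 [n2 [n3 [LP neq eqv]]]]]]]]]] :=
  @ls_case R m (m + p) M A x mA imm umb bp mf three (rotate t s) (rotate t mu)
    (rotate_inj s_inj) (fun a => mu_gt0 (a + t)) sum' spec'.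
- by move=> a; rewrite kr.
- by rewrite kr add0r.
- by rewrite kr kp// at_.
- by rewrite kr kp// at_.
- by rewrite !kr (rotate_sum3 (fun a => (pk m s mu a)^-1)); exact: ks.
- by rewrite !kr (rotate_sum3 (fun a => s a / pk m s mu a)); exact: sk.
- move=> q; rewrite !kr !(gpvec_rotate mA imm umb three).
  rewrite (rotate_sum3 (fun a => (pk m s mu a)^-1 *: gpvec x mA s mu a q)).
  by apply/eqP; rewrite -subr_eq0; apply/eqP; exact: (g0 q).
exists (rotate t mu 0), (rotate t mu 1), (rotate t mu 2), p1, p2, p3, r1, r2, r3, n1, n2, n3.
(* The codimension formula is the count of ambient dimensions recorded in [e], each of the two
   spherical factors contributing one extra dimension. *)
split=> //; case: eqv => e _; move: e sum'; clear; lia.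
Qed.
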